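(* Let $m,n\ge0$ be integers. The function $$\prod_{0\le r<s\le2m+2n+3}(t_rt_s;p,q)_\infty\ I^{(m)}_{BC_n}(t_0,\dots,t_{2m+2n+3};p,q)$$ extends to a holomorphic function on the domain $\prod_{0\le r\le2m+2n+3}t_r=(pq)^{m+1}$, $0<|p|,|q|<1$.
   Context: $(x;p,q)_\infty=\prod_{i,j\ge0}(1-p^iq^jx)$, $(p;p)=\prod_{k\ge1}(1-p^k)$, $\Gamma(x;p,q)=\prod_{j,k\ge0}(1-p^{j+1}q^{k+1}/x)(1-p^jq^kx)^{-1}$; signs $\pm$ in an argument denote a product over all choices of signs. For nonnegative integers $m,n$ and parameters with $\prod_{0\le r\le2m+2n+3}t_r=(pq)^{m+1}$ and $|p|,|q|,|t_r|<1$, $$I^{(m)}_{BC_n}(t_0,t_1,\dots;p,q)=\frac{(p;p)^n(q;q)^n}{2^nn!}\int_{T^n}\frac{\prod_{1\le i\le n}\prod_{0\le r\le2m+2n+3}\Gamma(t_rz_i^{\pm1};p,q)}{\prod_{1\le i<j\le n}\Gamma(z_i^{\pm1}z_j^{\pm1};p,q)\prod_{1\le i\le n}\Gamma(z_i^{\pm2};p,q)}\prod_{1\le i\le n}\frac{dz_i}{2\pi\sqrt{-1}z_i},$$ $T^n$ the unit torus. It is extended meromorphically to the full set $\prod_rt_r=(pq)^{m+1}$, $0<|p|,|q|<1$, by replacing $T^n$ by $C^n$ with $C$ a contour containing all points $p^iq^jt_r$, $i,j\ge0$, and excluding their reciprocals. *)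

(* Defs.v *)
From HB Require Import structures.
From mathcomp Require Import all_boot all_order all_algebra.
From mathcomp Require Import all_classical all_reals all_analysis.
From mathcomp Require Import complex.

Set Implicit Arguments.
Unset Strict Implicit.
Unset Printing Implicit Defensive.
Import Order.TTheory GRing.Theory Num.Theory.
Import numFieldNormedType.Exports.
Local Open Scope classical_set_scope.
Local Open Scope ring_scope.
Local Open Scope complex_scope.

(* R[i] carries no canonical topology of its own; seen as an abstract
   numFieldType it receives the topology and the normed module structure
   given by its modulus. *)
Definition CC (R : realType) : numFieldType := R[i].

Section EllipticHypergeometric.
Variable R : realType.
Local Notation C := (CC R).
Local Notation mu := (@lebesgue_measure R).

(* For D open this is holomorphy in the usual sense.  For D a closed complex
   submanifold of an open set, as in BC_domain below, it is holomorphy on the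
   manifold D: locally, f is the restriction of an ambient holomorphic
   function.  Differentiability is over C. *)
Definition holomorphic_on (V : normedModType C) (D : set V) (f : V -> C) :=
  forall x, D x -> exists g : V -> C,
    (\forall y \near x, differentiable g y) /\
    (\forall y \near x, D y -> f y = g y).

(* The double products converge absolutely for |p|, |q| < 1, so the limit
   over square partial products is their value. *)
Definition qpoch2 (x p q : C) : C :=
  limn (fun N => \prod_(i < N) \prod_(j < N) (1 - p ^+ i * q ^+ j * x)).

Definition qpoch (p : C) : C :=
  limn (fun N => \prod_(1 <= k < N) (1 - p ^+ k)).

Definition egamma (x p q : C) : C :=
  limn (fun N => \prod_(j < N) \prod_(k < N)
    ((1 - p ^+ j.+1 * q ^+ k.+1 / x) * (1 - p ^+ j * q ^+ k * x)^-1)).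

Definition piecewise_C1 (f : R -> R) :=
  {within `[0, 1], continuous f} /\
  exists B : seq R,
    [/\ forall s, s \in `]0, 1[ -> s \notin B ->
          derivable f s 1 /\ {for s, continuous (derive1 f)},
        forall s, s \in `[0, 1[ -> cvg (derive1 f u @[u --> s^'+]) &
        forall s, s \in `]0, 1] -> cvg (derive1 f u @[u --> s^'-])].

(* Curves are parametrised by [0, 1]; their values elsewhere are irrelevant. *)
Definition closed_contour (g : R -> C) :=
  [/\ piecewise_C1 (fun s => complex.Re (g s)),
      piecewise_C1 (fun s => complex.Im (g s)),
      g 0 = g 1 &
      forall s u, s \in `[0, 1[ -> u \in `[0, 1[ -> g s = g u -> s = u].

Definition curve_deriv (g : R -> C) (s : R) : C :=
  derive1 (fun u => complex.Re (g u)) s +i* derive1 (fun u => complex.Im (g u)) s.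

Definition contour_integral (g : R -> C) (f : C -> C) : C :=
  let h s : C := f (g s) * curve_deriv g s in
  (\int[mu]_(s in `[0, 1]) complex.Re (h s)) +i*
  (\int[mu]_(s in `[0, 1]) complex.Im (h s)).

Definition two_pi_i : C := 0 +i* (2 * pi).

Definition winding_number (g : R -> C) (a : C) : C :=
  two_pi_i^-1 * contour_integral g (fun z => (z - a)^-1).

Definition avoids (g : R -> C) (a : C) := forall s, s \in `[0, 1] -> g s != a.

(* The point a lies inside g, which is then positively oriented. *)
Definition encloses (g : R -> C) (a : C) :=
  avoids g a /\ winding_number g a = 1.

Definition excludes (g : R -> C) (a : C) :=
  avoids g a /\ winding_number g a = 0.

(* The n-fold integral of f(z_1, ..., z_n) \prod_i dz_i / (2 pi i z_i)
   over g x ... x g, as an iterated integral. *)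
Fixpoint power_contour_integral (g : R -> C) (n : nat) :
    (n.-tuple C -> C) -> C :=
  match n with
  | 0 => fun f => f [tuple]
  | n'.+1 => fun f => contour_integral g (fun z =>
      power_contour_integral g (fun w : n'.-tuple C => f [tuple of z :: w])
      / (two_pi_i * z))
  end.

(* The quotient takes the junk value of x / 0 only where some z_i z_j^{+-1} or
   z_i ^ 2 is of the form p^a q^b with a, b integers, a null set for the
   integrals below. *)
Definition BC_integrand (N n : nat) (t : 'rV[C]_N) (p q : C)
    (z : n.-tuple C) : C :=
  let Gamma x := egamma x p q in
  let Z i := tnth z i in
  (\prod_(i < n) \prod_(r < N) (Gamma (t 0 r * Z i) * Gamma (t 0 r * (Z i)^-1)))
  / ((\prod_(i < n) \prod_(j < n | (i < j)%N)
        (Gamma (Z i * Z j) * Gamma (Z i * (Z j)^-1) *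
         Gamma ((Z i)^-1 * Z j) * Gamma ((Z i)^-1 * (Z j)^-1)))
     * \prod_(i < n) (Gamma (Z i ^+ 2) * Gamma (Z i ^- 2))).

Definition I_BC (N n : nat) (g : R -> C) (t : 'rV[C]_N) (p q : C) : C :=
  qpoch p ^+ n * qpoch q ^+ n / (2 ^ n * n`!)%:R
  * power_contour_integral g (@BC_integrand N n t p q).

Definition unit_circle (s : R) : C := cos (2 * pi * s) +i* sin (2 * pi * s).

(* A contour through 0 is ruled out explicitly: 0 is only a limit of the
   points p^i q^j t_r, and the integration form dz/z is singular there. *)
Definition admissible_contour (N : nat) (t : 'rV[C]_N) (p q : C)
    (g : R -> C) :=
  [/\ closed_contour g, avoids g 0 &
      forall (i j : nat) (r : 'I_N),
        encloses g (p ^+ i * q ^+ j * t 0 r) /\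
        excludes g (p ^+ i * q ^+ j * t 0 r)^-1].

Definition BC_domain (m n : nat) :
    set ('rV[C]_(2 * m + 2 * n + 4) * (C * C)) :=
  [set x | let t : 'rV[C]_(2 * m + 2 * n + 4) := x.1 in
     let p : C := x.2.1 in let q : C := x.2.2 in
     [/\ \prod_r t 0 r = (p * q) ^+ m.+1,
         0 < `|p| < 1 & 0 < `|q| < 1]].

Definition BC_prefactor (N : nat) (t : 'rV[C]_N) (p q : C) : C :=
  \prod_(r < N) \prod_(s < N | (r < s)%N) qpoch2 (t 0 r * t 0 s) p q.

End EllipticHypergeometric.

Arguments two_pi_i {R}.
Arguments unit_circle {R} s.
Arguments BC_domain R m n : clear implicits.
Arguments I_BC {R N} n g t p q.

(* Main.v *)
(* By the addition formula for theta functions, the cross terms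
   prod_(i < j) 1 / Gamma(z_i^(+-1) z_j^(+-1)) form, up to a constant in p and q, a product
   of two determinants det(f_i(z_k)) det(g_i(z_k)), with f_i theta functions of base p
   and g_i of base q. Expanding the determinants turns the n-fold integral into a
   constant times det(L_ik), where the L_ik are one-dimensional integrals. An L_ik is a
   rational combination of Laurent coefficients, which continues it to all parameters
   off the divisors l = 1 - p^i q^j t_r t_s = 0; so, near any point, the product F of the
   prefactor and the integral is a holomorphic function divided by finitely many l.

   These l are divided out one at a time. This is possible if l F tends to 0 along
   some path ending at the generic points of l = 0. There l L_ik extends
   holomorphically, with a value that is a sum of residues over the pairs of colliding
   poles p^a q^b t_r and p^(i-a) q^(j-b) t_s. The quasi-periodicity of the residues in a
   and b gives this value the form u_i v_k, and makes it vanish if r = s. Hence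
   l det(L_ik) = det(l L_ik) / l^(n-1) is bounded, and tends to 0 if r = s; if r <> s the
   prefactor vanishes on l = 0. *)
Require Import Defs.
From HB Require Import structures.
From mathcomp Require Import all_boot all_order all_algebra.
From mathcomp Require Import all_classical all_reals all_analysis.
From mathcomp Require Import measurable_realfun.
From mathcomp Require Import perm complex ring lra zify.
Set Implicit Arguments.
Unset Strict Implicit.
Unset Printing Implicit Defensive.
Import Order.TTheory GRing.Theory Num.Theory.
Import numFieldNormedType.Exports.
Local Open Scope classical_set_scope.
Local Open Scope ring_scope.
Local Open Scope complex_scope.

(** * Complex sequences and uniform closure *)

Section Modulus.
Variable R : realType.
Local Notation C := (CC R).

(** An admissible contour is known only through winding numbers, and the poles accumulate at 0. All
    but finitely many poles are moved into a kernel holomorphic on an annulus containing the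
    contour; the remaining integral is evaluated by primitives and winding numbers. The outcome is a
    formula in constant terms on two circles, one inside all remaining inverse poles and one outside
    all remaining poles, and it keeps its meaning where no contour exists. The domain is a
    hypersurface, whereas germs are divided in the ambient space: a germ is first pulled back along
    the retraction that solves the balancing condition for a parameter absent from l. The numerator
    being continuous, its vanishing on l = 0 is checked at a dense set of points, so one path at
    each generic point is enough; the path must itself respect the balancing condition. The
    balancing condition also gives the residues a multiplier (p q)^(2n+2), which is exactly what the
    multipliers of the theta functions of base p and q compensate: this is the source of the form
    u_i v_k. *)

Definition cmod (z : C) : R := ComplexField.Normc.normc z.

Lemma cmodE (z : C) : `|z| = (cmod z)%:C. Proof. by []. Qed.
Lemma cmod_ge0 z : 0 <= cmod z.
Proof. by rewrite /cmod; case: z => a b; exact: sqrtr_ge0. Qed.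
Lemma cmod0 : cmod 0 = 0. Proof. exact: ComplexField.Normc.normc0. Qed.
Lemma cmod1 : cmod 1 = 1. Proof. exact: ComplexField.Normc.normc1. Qed.
Lemma cmodM x y : cmod (x * y) = cmod x * cmod y.
Proof. exact: ComplexField.Normc.normcM. Qed.
Lemma cmodV x : cmod x^-1 = (cmod x)^-1.
Proof. exact: ComplexField.Normc.normcV. Qed.
Lemma cmodN x : cmod (- x) = cmod x.
Proof. exact: normcN. Qed.
Lemma cmodD x y : cmod (x + y) <= cmod x + cmod y.
Proof. exact: le_normcD. Qed.
Lemma cmodB x y : cmod (x - y) <= cmod x + cmod y.
Proof. by rewrite -(cmodN y); exact: cmodD. Qed.
Lemma cmodBC x y : cmod (x - y) = cmod (y - x).
Proof. by rewrite -cmodN opprB. Qed.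
Lemma cmod_eq0 x : (cmod x == 0) = (x == 0).
Proof.
apply/eqP/eqP => [/ComplexField.Normc.eq0_normc//|->]; exact: cmod0.
Qed.
Lemma cmod_gt0 x : (0 < cmod x) = (x != 0).
Proof. by rewrite lt0r cmod_ge0 andbT cmod_eq0. Qed.
Lemma cmodX x n : cmod (x ^+ n) = cmod x ^+ n.
Proof. by elim: n => [|n IH]; rewrite ?expr0 ?cmod1// !exprS cmodM IH. Qed.
Lemma cmod_prod I (s : seq I) (P : pred I) (F : I -> C) :
  cmod (\prod_(i <- s | P i) F i) = \prod_(i <- s | P i) cmod (F i).
Proof. by apply: (big_morph cmod cmodM cmod1). Qed.
Lemma cmod_sum I (s : seq I) (P : pred I) (F : I -> C) :
  cmod (\sum_(i <- s | P i) F i) <= \sum_(i <- s | P i) cmod (F i).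
Proof.
elim/big_rec2: _ => [|i a b _ h]; first by rewrite cmod0.
by apply: le_trans (cmodD _ _) _; rewrite lerD2l.
Qed.
Lemma cmodBl x y : cmod x - cmod y <= cmod (x - y).
Proof. by rewrite lerBlDr; apply: le_trans (cmodD _ _); rewrite subrK. Qed.
Lemma cmodBr x y : cmod y - cmod x <= cmod (x - y).
Proof. by rewrite cmodBC cmodBl. Qed.
Lemma cmodC (x : R) : cmod x%:C = `|x|.
Proof. by rewrite /cmod /= expr0n /= addr0 sqrtr_sqr. Qed.
Lemma cmod_nat n : cmod n%:R = n%:R.
Proof.
have -> : (n%:R : C) = (n%:R : R)%:C by rewrite (rmorph_nat (@real_complex_def R (Phant R))).
by rewrite cmodC ger0_norm.
Qed.
Lemma cmod_Re (z : C) : `|complex.Re z| <= cmod z.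
Proof.
case: z => a b; rewrite /cmod /= -(sqrtr_sqr a).
by rewrite ler_sqrt ?addr_ge0 ?sqr_ge0// lerDl sqr_ge0.
Qed.
Lemma cmod_Im (z : C) : `|complex.Im z| <= cmod z.
Proof.
case: z => a b; rewrite /cmod /= -(sqrtr_sqr b).
by rewrite ler_sqrt ?addr_ge0 ?sqr_ge0// lerDr sqr_ge0.
Qed.
Lemma cmod_ReIm (z : C) : cmod z <= `|complex.Re z| + `|complex.Im z|.
Proof.
case: z => a b /=; rewrite /cmod /=.
rewrite -(ger0_norm (addr_ge0 (normr_ge0 a) (normr_ge0 b))) -sqrtr_sqr.
rewrite ler_sqrt ?sqr_ge0//; have := mulr_ge0 (normr_ge0 a) (normr_ge0 b).
rewrite sqrrD !real_normK ?num_real//; lra.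
Qed.

(** Real epsilons keep the estimates in the ordered field [R]; [ccvg_lim] translates to the [limn]
    of the definitions. *)
Definition ccvg (u : nat -> C) (l : C) :=
  forall e : R, 0 < e -> exists N, forall n, (N <= n)%N -> cmod (u n - l) < e.

Lemma ccvg_lim u l : ccvg u l -> limn u = l.
Proof.
move=> h; apply: cvg_lim => //; apply/cvgrPdist_lt => e e0.
have er : e = (complex.Re e)%:C.
  by move: e0; rewrite ltcE => /andP[/eqP + _]; case: (e) => a b /= ->.
have e0' : 0 < complex.Re e by move: e0; rewrite ltcE => /andP[].
have [N hN] := h _ e0'; exists N => // n /= Nn.
by rewrite cmodE cmodBC er ltcR; exact: hN.
Qed.

Lemma ccvg_unique u l l' : ccvg u l -> ccvg u l' -> l = l'.
Proof. by move=> /ccvg_lim <- /ccvg_lim <-. Qed.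

Lemma ccvg_cst l : ccvg (fun=> l) l.
Proof. by move=> e e0; exists 0%N => n _; rewrite subrr cmod0. Qed.

Lemma ccvg_eq u v l : (exists N, forall n, (N <= n)%N -> u n = v n) -> ccvg u l -> ccvg v l.
Proof.
move=> [M hM] h e e0; have [N hN] := h e e0; exists (maxn M N) => n.
by rewrite geq_max => /andP[h1 h2]; rewrite -hM// hN.
Qed.

Lemma ccvg_bdd u l : ccvg u l -> exists2 B : R, 0 < B & forall n, cmod (u n) <= B.
Proof.
move=> h; have [N hN] := h 1 ltr01.
pose B := cmod l + 1 + \sum_(i < N) cmod (u i).
have s0 : 0 <= \sum_(i < N) cmod (u i) by apply: sumr_ge0 => i _; exact: cmod_ge0.
exists B => [|n]; first by rewrite /B; have := cmod_ge0 l; lra.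
have [nN|Nn] := ltnP n N.
  rewrite /B (bigD1 (Ordinal nN))//=.
  have : 0 <= \sum_(i < N | i != Ordinal nN) cmod (u i).
    by apply: sumr_ge0 => i _; exact: cmod_ge0.
  by have := cmod_ge0 l; lra.
have := hN n Nn; have := cmodBl (u n) l; rewrite /B; lra.
Qed.

Lemma ccvgD u v l k : ccvg u l -> ccvg v k -> ccvg (fun n => u n + v n) (l + k).
Proof.
move=> h1 h2 e e0; have e2 : 0 < e / 2 by rewrite divr_gt0.
have [N hN] := h1 _ e2; have [M hM] := h2 _ e2.
exists (maxn N M) => n; rewrite geq_max => /andP[a b].
rewrite opprD addrACA; apply: le_lt_trans (cmodD _ _) _.
have := hN n a; have := hM n b; lra.
Qed.

Lemma ccvgM u v l k : ccvg u l -> ccvg v k -> ccvg (fun n => u n * v n) (l * k).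
Proof.
move=> h1 h2 e e0; have [B B0 hB] := ccvg_bdd h2.
have e1 : 0 < e / 2 / B by rewrite !divr_gt0.
have c1 : 0 < cmod l + 1 by rewrite ltr_wpDl ?cmod_ge0.
have e2 : 0 < e / 2 / (cmod l + 1) by rewrite !divr_gt0.
have [N hN] := h1 _ e1; have [M hM] := h2 _ e2.
exists (maxn N M) => n; rewrite geq_max => /andP[a b].
have -> : u n * v n - l * k = (u n - l) * v n + l * (v n - k) by ring.
apply: le_lt_trans (cmodD _ _) _; rewrite !cmodM.
have p1 : cmod (u n - l) * cmod (v n) < e / 2.
  apply: (@le_lt_trans _ _ (cmod (u n - l) * B)); first by rewrite ler_wpM2l ?cmod_ge0.
  by rewrite -ltr_pdivlMr// hN.
have p2 : cmod l * cmod (v n - k) < e / 2.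
  apply: (@le_lt_trans _ _ ((cmod l + 1) * cmod (v n - k))).
    by rewrite ler_wpM2r ?cmod_ge0// lerDl.
  by rewrite mulrC -ltr_pdivlMr// hM.
lra.
Qed.

Lemma ccvg_cmod_le u l (B : R) : ccvg u l -> (exists N, forall n, (N <= n)%N -> cmod (u n) <= B) -> cmod l <= B.
Proof.
move=> h [M hB]; apply/ler_addgt0Pr => e e0; have [N hN] := h e e0.
have := hN (maxn N M) (leq_maxl _ _); have := hB (maxn N M) (leq_maxr _ _).
have := cmodBr (u (maxn N M)) l; lra.
Qed.

Lemma ccvg_shift u l : ccvg u l -> ccvg (fun n => u n.+1) l.
Proof.
move=> h e e0; have [N hN] := h e e0; exists N => n Nn; apply: hN.
exact: leq_trans Nn (leqnSn _).
Qed.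

Lemma geo_small (r B e : R) : 0 <= r < 1 -> 0 < e -> exists N, forall n, (N <= n)%N -> B * r ^+ n < e.
Proof.
move=> /andP[r0 r1] e0.
have r1' : `|r| < 1 by rewrite ger0_norm.
have /cvgrPdist_lt h := cvg_expr r1'.
have B1 : 0 < `|B| + 1 by rewrite ltr_wpDl.
have [N _ hN] := h (e / (`|B| + 1)) (divr_gt0 e0 B1).
exists N => n Nn; have := hN n Nn => /=; rewrite sub0r normrN ger0_norm ?exprn_ge0//.
rewrite ltr_pdivlMr// => h2; apply: le_lt_trans h2.
rewrite mulrC ler_wpM2l ?exprn_ge0//; have := ler_norm B; lra.
Qed.

(** Completeness comes from [R] through real and imaginary parts, since [CC R] carries only the
    structure of a [numFieldType]. *)
Lemma ccauchy_cvg (u : nat -> C) :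
  (forall e : R, 0 < e -> exists N, forall n m, (N <= n)%N -> (N <= m)%N -> cmod (u n - u m) < e) ->
  exists l, ccvg u l.
Proof.
move=> h.
have aux (f : C -> R) : (forall x y, f (x - y) = f x - f y) -> (forall z, `|f z| <= cmod z) ->
    exists l : R, forall e : R, 0 < e -> exists N, forall n, (N <= n)%N -> `|f (u n) - l| < e.
  move=> fB fc; pose v n := f (u n).
  have cv : cvgn v.
    apply/cauchy_cvgP/cauchy_exP => e e0.
    have [N hN] := h e e0; exists (v N); exists N => // n /= Nn.
    by rewrite /ball /= /v -fB; apply: le_lt_trans (fc _) _; apply: hN.
  exists (limn v) => e e0; move/cvgrPdist_lt : cv => /(_ e e0)[N _ hN].
  by exists N => n Nn; rewrite distrC; exact: hN.
have [a ha] := aux (@complex.Re R) (fun x y => raddfB (@complex.Re R) x y) cmod_Re.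
have [b hb] := aux (@complex.Im R) (fun x y => raddfB (@complex.Im R) x y) cmod_Im.
exists (a +i* b) => e e0; have e2 : 0 < e / 2 by rewrite divr_gt0.
have [N hN] := ha _ e2; have [M hM] := hb _ e2.
exists (maxn N M) => n; rewrite geq_max => /andP[h1 h2].
apply: le_lt_trans (cmod_ReIm _) _.
rewrite (raddfB (@complex.Re R)) (raddfB (@complex.Im R)) /=.
have := hN n h1; have := hM n h2; lra.
Qed.

End Modulus.

Section UniformClosure.
Variable R : realType.
Local Notation C := (CC R).

(** The boundedness clause is what makes uniform limits stable under products. *)
Record funalg (T : Type) (P : (T -> C) -> Prop) (Om : T -> Prop) : Prop := FunAlg {
  falg_cst : forall c, P (fun=> c);
  falg_add : forall f g, P f -> P g -> P (fun t => f t + g t);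
  falg_mul : forall f g, P f -> P g -> P (fun t => f t * g t);
  falg_bdd : forall f, P f -> exists M, forall t, Om t -> cmod (f t) <= M }.

(* Uniform limits of the functions in [P]. For [P] the polynomials or the Laurent
   polynomials this replaces holomorphy: it is stable under all limits needed,
   and Cauchy's estimates reduce to means over roots of unity. *)
Definition ucl (T : Type) (P : (T -> C) -> Prop) (Om : T -> Prop) (f : T -> C) :=
  forall e : R, 0 < e -> exists2 g, P g & forall t, Om t -> cmod (f t - g t) <= e.

Section Theory.
Variables (T : Type) (P : (T -> C) -> Prop) (Om : T -> Prop).

Lemma ucl_base f : P f -> ucl P Om f.
Proof. by move=> Pf e e0; exists f => // t _; rewrite subrr cmod0 ltW. Qed.

Lemma ucl_ext f g : (forall t, Om t -> f t = g t) -> ucl P Om f -> ucl P Om g.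
Proof.
by move=> fg h e e0; have [k Pk hk] := h e e0; exists k => // t Ot; rewrite -fg// hk.
Qed.

Lemma ucl_sub (Om' : T -> Prop) f : (forall t, Om' t -> Om t) -> ucl P Om f -> ucl P Om' f.
Proof.
by move=> s h e e0; have [k Pk hk] := h e e0; exists k => // t /s; exact: hk.
Qed.

Lemma ucl_lim f : (forall e : R, 0 < e -> exists2 g, ucl P Om g & forall t, Om t -> cmod (f t - g t) <= e) ->
  ucl P Om f.
Proof.
move=> h e e0; have e2 : 0 < e / 2 by rewrite divr_gt0.
have [g ug hg] := h _ e2; have [k Pk hk] := ug _ e2.
exists k => // t Ot; have -> : f t - k t = (f t - g t) + (g t - k t) by ring.
apply: le_trans (cmodD _ _) _; have := hg t Ot; have := hk t Ot; lra.
Qed.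

Hypothesis PA : funalg P Om.

Lemma ucl_cst c : ucl P Om (fun=> c).
Proof. exact/ucl_base/(falg_cst PA). Qed.

Lemma ucl_bdd f : ucl P Om f -> exists2 M : R, 0 < M & forall t, Om t -> cmod (f t) <= M.
Proof.
move=> h; have [g Pg hg] := h 1 ltr01; have [M hM] := falg_bdd PA Pg.
exists (`|M| + 1) => [|t Ot]; first by rewrite ltr_wpDl.
have := hM t Ot; have := hg t Ot; have := cmodBl (f t) (g t); have := ler_norm M; lra.
Qed.

Lemma ucl_add f g : ucl P Om f -> ucl P Om g -> ucl P Om (fun t => f t + g t).
Proof.
move=> h1 h2 e e0; have e2 : 0 < e / 2 by rewrite divr_gt0.
have [a Pa ha] := h1 _ e2; have [b Pb hb] := h2 _ e2.
exists (fun t => a t + b t) => [|t Ot]; first exact: (falg_add PA).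
rewrite opprD addrACA; apply: le_trans (cmodD _ _) _.
have := ha t Ot; have := hb t Ot; lra.
Qed.

Lemma ucl_mul f g : ucl P Om f -> ucl P Om g -> ucl P Om (fun t => f t * g t).
Proof.
move=> h1 h2 e e0.
have [M M0 hM] := ucl_bdd h1.
have e1 : 0 < e / 2 / M by rewrite !divr_gt0.
have [b Pb hb] := h2 _ e1; have [N hN] := falg_bdd PA Pb.
have N1 : 0 < `|N| + 1 by rewrite ltr_wpDl.
have e2 : 0 < e / 2 / (`|N| + 1) by rewrite !divr_gt0.
have [a Pa ha] := h1 _ e2.
exists (fun t => a t * b t) => [|t Ot]; first exact: (falg_mul PA).
have -> : f t * g t - a t * b t = f t * (g t - b t) + (f t - a t) * b t by ring.
apply: le_trans (cmodD _ _) _; rewrite !cmodM.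
have p1 : cmod (f t) * cmod (g t - b t) <= e / 2.
  rewrite (_ : e / 2 = M * (e / 2 / M)); last by field; rewrite gt_eqF.
  by apply: ler_pM; rewrite ?cmod_ge0 ?hM ?hb.
have p2 : cmod (f t - a t) * cmod (b t) <= e / 2.
  rewrite (_ : e / 2 = e / 2 / (`|N| + 1) * (`|N| + 1)); last by field; rewrite gt_eqF.
  apply: ler_pM; rewrite ?cmod_ge0 ?ha//.
  have := hN t Ot; have := ler_norm N; lra.
lra.
Qed.

Lemma ucl_opp f : ucl P Om f -> ucl P Om (fun t => - f t).
Proof.
move=> h; apply: ucl_ext (ucl_mul (ucl_cst (-1)) h) => t _ /=.
by rewrite mulN1r.
Qed.

Lemma ucl_subr f g : ucl P Om f -> ucl P Om g -> ucl P Om (fun t => f t - g t).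
Proof. by move=> h1 h2; apply: ucl_add => //; exact: ucl_opp. Qed.

Lemma ucl_exp f n : ucl P Om f -> ucl P Om (fun t => f t ^+ n).
Proof.
move=> h; elim: n => [|n IH]; first by apply: ucl_ext (ucl_cst 1) => t _; rewrite expr0.
by apply: ucl_ext (ucl_mul h IH) => t _; rewrite exprS.
Qed.

Lemma ucl_prod (I : Type) (s : seq I) (Q : pred I) (F : I -> T -> C) :
  (forall i, ucl P Om (F i)) -> ucl P Om (fun t => \prod_(i <- s | Q i) F i t).
Proof.
move=> h; elim: s => [|i s IH].
  by apply: ucl_ext (ucl_cst 1) => t _; rewrite big_nil.
case Qi: (Q i); last by apply: ucl_ext IH => t _; rewrite big_cons Qi.
by apply: ucl_ext (ucl_mul (h i) IH) => t _; rewrite big_cons Qi.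
Qed.

Lemma ucl_prod_in (I : eqType) (s : seq I) (F : I -> T -> C) :
  (forall i, i \in s -> ucl P Om (F i)) -> ucl P Om (fun t => \prod_(i <- s) F i t).
Proof.
elim: s => [|i s IH] h.
  by apply: ucl_ext (ucl_cst 1) => t _; rewrite big_nil.
have h1 : ucl P Om (F i) by apply: h; rewrite mem_head.
have h2 := IH (fun j (js : j \in s) => h j (mem_behead (s := i :: s) js)).
by apply: ucl_ext (ucl_mul h1 h2) => t _; rewrite big_cons.
Qed.

Lemma ucl_sum (I : Type) (s : seq I) (Q : pred I) (F : I -> T -> C) :
  (forall i, ucl P Om (F i)) -> ucl P Om (fun t => \sum_(i <- s | Q i) F i t).
Proof.
move=> h; elim: s => [|i s IH].
  by apply: ucl_ext (ucl_cst 0) => t _; rewrite big_nil.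
case Qi: (Q i); last by apply: ucl_ext IH => t _; rewrite big_cons Qi.
by apply: ucl_ext (ucl_add (h i) IH) => t _; rewrite big_cons Qi.
Qed.

(** The partial sums of the geometric series converge uniformly because [th] does not depend on the
    point. Inverses of holomorphic functions are all obtained from this. *)
Lemma ucl_geom u (th : R) : 0 <= th < 1 -> ucl P Om u -> (forall t, Om t -> cmod (u t) <= th) ->
  ucl P Om (fun t => (1 - u t)^-1).
Proof.
move=> /andP[th0 th1] hu hb; apply: ucl_lim => e e0.
have [N hN] := geo_small (1 - th)^-1 (introT andP (conj th0 th1)) e0.
exists (fun t => \sum_(i < N) u t ^+ i).
  by apply: ucl_sum => i; exact: ucl_exp.
move=> t Ot.
have u1 : cmod (1 - u t) >= 1 - th.
  have := cmodBl 1 (u t); have := hb t Ot; rewrite cmod1; lra.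
have nz : 1 - u t != 0 by rewrite -cmod_gt0; lra.
have -> : (1 - u t)^-1 - \sum_(i < N) u t ^+ i = (1 - u t)^-1 * u t ^+ N.
  apply: (mulfI nz); rewrite mulrBr !mulrA divff// mul1r.
  have E : u t ^+ N = 1 + (u t - 1) * \sum_(i < N) u t ^+ i by rewrite -subrX1; ring.
  by rewrite E; ring.
rewrite cmodM cmodV cmodX; apply: le_trans (ltW (hN N (leqnn _))).
apply: ler_pM; rewrite ?invr_ge0 ?cmod_ge0 ?exprn_ge0 ?cmod_ge0//.
  rewrite lef_pV2 ?posrE; lra.
by apply: lerXn2r; rewrite ?nnegrE ?cmod_ge0 ?hb.
Qed.

Lemma ucl_inv f (c : C) : c != 0 -> ucl P Om f -> (forall t, Om t -> cmod (f t - c) <= cmod c / 2) ->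
  ucl P Om (fun t => (f t)^-1).
Proof.
move=> c0 hf hb.
have c1 : 0 < cmod c by rewrite cmod_gt0.
have hu : ucl P Om (fun t => 1 - f t * c^-1).
  by apply: ucl_subr; [exact: ucl_cst|apply: ucl_mul => //; exact: ucl_cst].
have h1 : ucl P Om (fun t => (1 - (1 - f t * c^-1))^-1).
  apply: (@ucl_geom _ (1 / 2)) => //; first by apply/andP; split; lra.
  move=> t Ot; have -> : 1 - f t * c^-1 = (f t - c) * (- c^-1) by field.
  rewrite cmodM cmodN cmodV ler_pdivrMr//; have := hb t Ot; lra.
apply: ucl_ext (ucl_mul h1 (ucl_cst c^-1)) => t _ /=.
by rewrite opprB addrCA subrr addr0 invfM invrK -mulrA divff// mulr1.
Qed.

End Theory.
End UniformClosure.

(** * Infinite products *)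

Section InfiniteProducts.
Variable R : realType.
Local Notation C := (CC R).

Lemma big_iota (T : Type) (idx : T) (op : T -> T -> T) (F : nat -> T) n :
  \big[op/idx]_(i <- iota 0 n) F i = \big[op/idx]_(i < n) F i.
Proof. by rewrite -(big_mkord xpredT F) /index_iota subn0. Qed.

Lemma geo_sum_le (r : R) n : 0 <= r < 1 -> \sum_(k < n) r ^+ k <= (1 - r)^-1.
Proof.
move=> /andP[r0 r1]; have p : 0 < 1 - r by lra.
rewrite -[leRHS]mul1r ler_pdivlMr// mulrC.
have -> : (1 - r) * \sum_(k < n) r ^+ k = 1 - r ^+ n.
  by have := subrX1 r n; lra.
by have := exprn_ge0 n r0; lra.
Qed.

(** By induction |prod - 1| is at most exp(sum |u_i - 1|) - 1, and the inequality exp(S) - 1 <= S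
    exp(S) amounts to 1 - S <= exp(-S). *)
Lemma prod_near1 (I : Type) (s : seq I) (u : I -> C) (S : R) :
  \sum_(i <- s) cmod (u i - 1) <= S ->
  cmod (\prod_(i <- s) u i) <= expR S /\ cmod (\prod_(i <- s) u i - 1) <= S * expR S.
Proof.
move=> hS.
have [h1 h2] : cmod (\prod_(i <- s) u i) <= expR (\sum_(i <- s) cmod (u i - 1)) /\
   cmod (\prod_(i <- s) u i - 1) <= expR (\sum_(i <- s) cmod (u i - 1)) - 1.
  elim: s {hS} => [|i s [IH1 IH2]]; first by rewrite !big_nil expR0 !subrr cmod0 cmod1.
  rewrite !big_cons expRD.
  set a := cmod (u i - 1) in IH1 IH2 *; set Q := \prod_(_ <- _) _ in IH1 IH2 *.
  set E := expR (\sum_(_ <- _) _) in IH1 IH2 *.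
  have ea : 1 + a <= expR a by exact: expR_ge1Dx.
  have E0 : 0 <= E by exact: expR_ge0.
  have a0 : 0 <= a by exact: cmod_ge0.
  have ua : cmod (u i) <= 1 + a.
    by have := cmodBl (u i) 1; rewrite cmod1 -/a; lra.
  have m1 : (1 + a) * E <= expR a * E by rewrite ler_wpM2r.
  split; first by rewrite cmodM; apply: le_trans m1; rewrite ler_pM ?cmod_ge0.
  have -> : u i * Q - 1 = (Q - 1) + (u i - 1) * Q by ring.
  apply: le_trans (cmodD _ _) _; rewrite cmodM -/a.
  have : a * cmod Q <= a * E by rewrite ler_wpM2l.
  lra.
have S1 : expR (\sum_(i <- s) cmod (u i - 1)) <= expR S by rewrite ler_expR.
split; first exact: le_trans h1 S1.
apply: le_trans h2 _; apply: (@le_trans _ _ (expR S - 1)); first by rewrite lerB.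
have := expR_ge1Dx (- S); rewrite expRN => h.
have E0 : 0 < expR S by exact: expR_gt0.
have : (1 + - S) * expR S <= 1 by rewrite -ler_pdivlMr// div1r.
lra.
Qed.

Definition iprod_err (B r : R) : R := B / (1 - r) * expR (B / (1 - r)).

(** The rate depends on [B] and [r] alone, so the convergence is uniform in any parameters that obey
    the same bounds. *)
Lemma iprod_cvg (u : nat -> C) (B r : R) : 0 <= r < 1 -> (forall k, cmod (u k - 1) <= B * r ^+ k) ->
  exists2 l, ccvg (fun N => \prod_(k < N) u k) l &
    forall N, cmod (\prod_(k < N) u k - l) <= expR (B / (1 - r)) * iprod_err B r * r ^+ N.
Proof.
move=> hr hu; have /andP[r0 r1] := hr.
have B0 : 0 <= B by have := le_trans (cmod_ge0 _) (hu 0%N); rewrite expr0 mulr1.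
have r1' : 0 < 1 - r by lra.
have Bd : 0 <= B / (1 - r) by rewrite divr_ge0// ltW.
have sumB m n : \sum_(i <- iota m n) cmod (u i - 1) <= B / (1 - r) * r ^+ m.
  have -> : iota m n = map (addn m) (iota 0 n) by rewrite -iotaDl addn0.
  rewrite big_map; apply: (@le_trans _ _ (\sum_(i <- iota 0 n) B * r ^+ m * r ^+ i)).
    by apply: ler_sum => i _; rewrite -mulrA -exprD hu.
  rewrite -mulr_sumr big_iota.
  have -> : B / (1 - r) * r ^+ m = B * r ^+ m * (1 - r)^-1 by ring.
  by rewrite ler_wpM2l ?mulr_ge0 ?exprn_ge0// geo_sum_le.
have split m n : \prod_(k < m + n) u k = (\prod_(k < m) u k) * \prod_(i <- iota m n) u i.
  rewrite -(big_mkord xpredT u) -(big_mkord xpredT u) /index_iota !subn0 iotaD big_cat /=.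
  by rewrite add0n.
have bd m n : cmod (\prod_(k < m + n) u k - \prod_(k < m) u k) <=
    expR (B / (1 - r)) * iprod_err B r * r ^+ m.
  rewrite split -{2}(mulr1 (\prod_(k < m) _)) -mulrBr cmodM.
  have [h1 _] := prod_near1 (sumB 0%N m).
  move: h1; rewrite expr0 mulr1 big_iota => h1.
  have [_ h2] := prod_near1 (sumB m n).
  rewrite -mulrA; apply: ler_pM; rewrite ?cmod_ge0//.
  apply: le_trans h2 _; rewrite /iprod_err -[leLHS]mulrA -[leRHS]mulrA; apply: ler_pM => //.
    by rewrite mulr_ge0 ?exprn_ge0 ?expR_ge0.
  rewrite mulrC; apply: ler_pM => //; rewrite ?exprn_ge0 ?expR_ge0//.
  rewrite ler_expR -[leRHS]mulr1; apply: ler_pM => //; rewrite ?exprn_ge0//.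
  by rewrite exprn_ile1// ltW.
have [l hl] : exists l, ccvg (fun N => \prod_(k < N) u k) l.
  apply: ccauchy_cvg => e e0.
  have e2 : 0 < e / 2 by rewrite divr_gt0.
  have [N hN] := geo_small (expR (B / (1 - r)) * iprod_err B r) hr e2.
  exists N => n m Nn Nm.
  have := bd N (n - N)%N; have := bd N (m - N)%N; rewrite !subnKC//.
  have := hN N (leqnn _); set P := \prod_(k < N) _; set Q := \prod_(k < m) _; set S := \prod_(k < n) _.
  have -> : S - Q = (S - P) - (Q - P) by ring.
  have := cmodB (S - P) (Q - P); lra.
exists l => // N.
have h := ccvgD (ccvg_cst (\prod_(k < N) u k)) (ccvgM (ccvg_cst (-1)) hl).
have := @ccvg_cmod_le _ _ _ (expR (B / (1 - r)) * iprod_err B r * r ^+ N) h; rewrite mulN1r; apply.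
exists N => n Nn; have := bd N (n - N)%N; rewrite subnKC// mulN1r cmodBC; apply.
Qed.

(** From some index on the remaining product is at distance less than 1 from 1, hence nonzero; the
    finitely many earlier factors are nonzero by hypothesis. *)
Lemma iprod_neq0 (u : nat -> C) (B r : R) l : 0 <= r < 1 -> (forall k, cmod (u k - 1) <= B * r ^+ k) ->
  ccvg (fun N => \prod_(k < N) u k) l -> (forall k, u k != 0) -> l != 0.
Proof.
move=> hr hu hl nz; have /andP[r0 r1] := hr.
have r1' : 0 < 1 - r by lra.
have B0 : 0 <= B by have := le_trans (cmod_ge0 _) (hu 0%N); rewrite expr0 mulr1.
have [K hK] := geo_small (expR (B / (1 - r)) * (expR (B / (1 - r)) * (B / (1 - r)))) hr ltr01.
have hv k : cmod (u (K + k)%N - 1) <= B * r ^+ K * r ^+ k by rewrite -mulrA -exprD hu.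
have [l' hl' herr] := iprod_cvg hr hv.
have l'1 : cmod (l' - 1) < 1.
  have := herr 0%N; rewrite big_ord0 expr0 mulr1 cmodBC => h; apply: le_lt_trans h _.
  apply: le_lt_trans (hK K (leqnn _)).
  rewrite /iprod_err.
  have rK : 0 <= r ^+ K <= 1 by rewrite exprn_ge0//= exprn_ile1// ltW.
  have /andP[rK0 rK1] := rK.
  have BK : B * r ^+ K / (1 - r) <= B / (1 - r).
    by rewrite ler_wpM2r ?invr_ge0 ?(ltW r1')// -[leRHS]mulr1 ler_wpM2l.
  have e1 : expR (B * r ^+ K / (1 - r)) <= expR (B / (1 - r)) by rewrite ler_expR.
  have -> : expR (B / (1 - r)) * (expR (B / (1 - r)) * (B / (1 - r))) * r ^+ K =
     expR (B / (1 - r)) * (B * r ^+ K / (1 - r) * expR (B / (1 - r))) by ring.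
  have p0 : 0 <= B * r ^+ K / (1 - r) by rewrite divr_ge0 ?mulr_ge0// ltW.
  have q1 : 0 <= B * r ^+ K / (1 - r) * expR (B * r ^+ K / (1 - r)) by rewrite mulr_ge0 ?expR_ge0.
  have q2 : B * r ^+ K / (1 - r) * expR (B * r ^+ K / (1 - r)) <= B * r ^+ K / (1 - r) * expR (B / (1 - r)).
    by rewrite ler_wpM2l.
  exact: ler_pM (expR_ge0 _) q1 e1 q2.
have E : l = (\prod_(k < K) u k) * l'.
  apply: (@ccvg_unique _ (fun N => \prod_(k < K + N) u k)).
    by move=> e e0; have [N hN] := hl e e0; exists N => n Nn; apply: hN; exact: leq_trans Nn (leq_addl _ _).
  apply: ccvg_eq (ccvgM (ccvg_cst (\prod_(k < K) u k)) hl').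
  by exists 0%N => n _; rewrite big_split_ord.
rewrite E mulf_neq0//.
  by rewrite prodf_seq_neq0; apply/allP => i _; rewrite nz.
by apply: contraTneq l'1 => ->; rewrite sub0r cmodN cmod1 ltxx.
Qed.

(** The cells whose larger coordinate is n. Listing squares shell by shell turns the double product
    over squares into a simple infinite product, whose factors approach 1 geometrically. *)
Definition shell (n : nat) : seq (nat * nat) :=
  [seq (n, k) | k <- iota 0 n] ++ [seq (j, n) | j <- iota 0 n.+1].
Definition shells (K n : nat) : seq (nat * nat) := flatten [seq shell i | i <- iota K n].
Definition cells (n : nat) := shells 0 n.

Lemma cellsD K n : cells (K + n) = cells K ++ shells K n.
Proof. by rewrite /cells /shells iotaD map_cat flatten_cat. Qed.

Lemma shellsS K n : shells K n.+1 = shells K n ++ shell (K + n).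
Proof. by rewrite /shells -addn1 iotaD map_cat flatten_cat /= cats0. Qed.

Lemma mem_shell n c : c \in shell n -> (c.1 <= n)%N && (c.2 <= n)%N && ((c.1 == n) || (c.2 == n)).
Proof.
rewrite mem_cat => /orP[] /mapP[k]; rewrite mem_iota /= add0n => hk -> /=; lia.
Qed.

Lemma mem_cells n c : (c \in cells n) = (c.1 < n)%N && (c.2 < n)%N.
Proof.
case: c => a b; elim: n => [|n IH] //=.
rewrite /cells shellsS mem_cat -/(cells n) IH /= add0n mem_cat.
have -> : ((a, b) \in [seq (n, k) | k <- iota 0 n]) = (a == n) && (b < n)%N.
  apply/mapP/idP => [[k]|/andP[/eqP -> h]].
    by rewrite mem_iota /= add0n => h [-> ->]; rewrite eqxx.
  by exists b => //; rewrite mem_iota.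
have -> : ((a, b) \in [seq (j, n) | j <- iota 0 n.+1]) = (b == n) && (a <= n)%N.
  apply/mapP/idP => [[k]|/andP[/eqP -> h]].
    by rewrite mem_iota /= add0n ltnS => h [-> ->]; rewrite eqxx.
  by exists a => //; rewrite mem_iota add0n ltnS.
lia.
Qed.

Lemma mem_shells K n c : c \in shells K n -> (K <= c.1 + c.2)%N /\ ((K <= c.1) || (K <= c.2))%N.
Proof.
elim: n => [|n IH] //; rewrite shellsS mem_cat => /orP[/IH//|].
rewrite mem_cat => /orP[] /mapP[k]; rewrite mem_iota /= add0n => hk -> /=; lia.
Qed.

Lemma cells_uniq n : uniq (cells n).
Proof.
elim: n => [|n IH] //; rewrite /cells shellsS cat_uniq -/(cells n) IH /= add0n.
apply/andP; split.
  apply/hasPn => -[a b] /= /mem_shell /= h; rewrite mem_cells /=; lia.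
rewrite cat_uniq !map_inj_uniq ?iota_uniq; try by move=> x y [].
rewrite andbT; apply/hasPn => x /mapP[j _ ->].
apply/mapP => -[k]; rewrite mem_iota add0n => /= h [_ e]; lia.
Qed.

Lemma big_cells (F : nat -> nat -> C) n :
  \prod_(j < n) \prod_(k < n) F j k = \prod_(c <- cells n) F c.1 c.2.
Proof.
elim: n => [|n IH]; first by rewrite big_ord0 big_nil.
rewrite /cells shellsS big_cat -/(cells n) -IH /= add0n big_cat !big_map /=.
rewrite (big_iota _ _ (fun j => F n j)) -/(iota 0 n.+1) (big_iota _ _ (fun j => F j n)).
rewrite big_ord_recr /= [X in X * _ = _](eq_bigr (fun j : 'I_n => (\prod_(k < n) F j k) * F j n)); last first.
  by move=> j _; rewrite big_ord_recr.
rewrite big_split /= -!mulrA; congr (_ * _).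
by rewrite !big_ord_recr /= !mulrA; congr (_ * _); rewrite mulrC.
Qed.

Lemma shell_sum (r : R) n : 0 <= r < 1 -> \sum_(c <- shell n) r ^+ (c.1 + c.2) <= 2 / (1 - r) * r ^+ n.
Proof.
move=> hr; have /andP[r0 r1] := hr; rewrite big_cat !big_map /=.
have s k : \sum_(j <- iota 0 k) r ^+ j <= (1 - r)^-1.
  by rewrite big_iota geo_sum_le.
have -> : \sum_(j <- iota 0 n) r ^+ (n + j) = r ^+ n * \sum_(j <- iota 0 n) r ^+ j.
  by rewrite mulr_sumr; apply: eq_bigr => j _; rewrite exprD.
have -> : \sum_(j <- iota 0 n.+1) r ^+ (j + n) = r ^+ n * \sum_(j <- iota 0 n.+1) r ^+ j.
  by rewrite mulr_sumr; apply: eq_bigr => j _; rewrite exprD mulrC.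
have p : 0 <= r ^+ n by exact: exprn_ge0.
have := ler_wpM2l p (s n); have := ler_wpM2l p (s n.+1); lra.
Qed.

Definition shell_bd (B r : R) : R := B * (2 / (1 - r)) * expR (B * (2 / (1 - r))).

Lemma shell_prod_near1 (F : nat * nat -> C) (B r : R) n : 0 <= r < 1 -> 0 <= B ->
  (forall c, c \in shell n -> cmod (F c - 1) <= B * r ^+ (c.1 + c.2)) ->
  cmod (\prod_(c <- shell n) F c - 1) <= shell_bd B r * r ^+ n.
Proof.
move=> hr B0 hF; have /andP[r0 r1] := hr.
have r1' : 0 < 1 - r by lra.
have hs : \sum_(c <- shell n) cmod (F c - 1) <= B * (2 / (1 - r)) * r ^+ n.
  rewrite big_seq; apply: (@le_trans _ _ (\sum_(c <- shell n) B * r ^+ (c.1 + c.2))).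
    by rewrite [leRHS]big_seq; apply: ler_sum => c; exact: hF.
  by rewrite -mulr_sumr -mulrA ler_wpM2l// shell_sum.
have [_ h] := prod_near1 hs; apply: le_trans h _; rewrite /shell_bd.
have p : 0 <= B * (2 / (1 - r)) by rewrite mulr_ge0// divr_ge0// ltW.
rewrite -mulrA -[leRHS]mulrA; apply: ler_pM => //.
  by rewrite mulr_ge0 ?exprn_ge0 ?expR_ge0.
rewrite mulrC; apply: ler_pM => //; rewrite ?exprn_ge0 ?expR_ge0//.
rewrite ler_expR -[leRHS]mulr1; apply: ler_pM => //; rewrite ?exprn_ge0//.
by rewrite exprn_ile1// ltW.
Qed.

Lemma shells_prod (F : nat * nat -> C) K n :
  \prod_(c <- shells K n) F c = \prod_(i < n) \prod_(c <- shell (K + i)) F c.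
Proof.
elim: n => [|n IH]; first by rewrite big_nil big_ord0.
by rewrite shellsS big_cat /= IH big_ord_recr.
Qed.

Lemma dprod_cvg (F : nat * nat -> C) (B r : R) K : 0 <= r < 1 -> 0 <= B ->
  (forall c, ((K <= c.1) || (K <= c.2))%N -> cmod (F c - 1) <= B * r ^+ (c.1 + c.2)) ->
  exists2 l, ccvg (fun N => \prod_(c <- shells K N) F c) l &
   forall N, cmod (\prod_(c <- shells K N) F c - l) <=
      expR (shell_bd B r / (1 - r)) * iprod_err (shell_bd B r) r * r ^+ N.
Proof.
move=> hr B0 hF; have /andP[r0 r1] := hr.
have hu k : cmod (\prod_(c <- shell (K + k)) F c - 1) <= shell_bd B r * r ^+ k.
  have p : 0 <= shell_bd B r.
    by rewrite /shell_bd !mulr_ge0 ?expR_ge0 ?divr_ge0 ?invr_ge0//; lra.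
  apply: (@le_trans _ _ (shell_bd B r * r ^+ (K + k))).
    apply: shell_prod_near1 => // c hc; apply: hF.
    by move: hc; rewrite mem_cat => /orP[] /mapP[j _ ->] /=; lia.
  by rewrite ler_wpM2l// exprD -[leRHS]mul1r ler_wpM2r ?exprn_ge0// exprn_ile1// ltW.
have [l h1 h2] := iprod_cvg hr hu.
by exists l => [|N]; [apply: ccvg_eq h1; exists 0%N => n _; rewrite shells_prod|rewrite shells_prod].
Qed.

Lemma dprod_neq0 (F : nat * nat -> C) (B r : R) l : 0 <= r < 1 -> 0 <= B ->
  (forall c, cmod (F c - 1) <= B * r ^+ (c.1 + c.2)) ->
  ccvg (fun N => \prod_(c <- cells N) F c) l -> (forall c, F c != 0) -> l != 0.
Proof.
move=> hr B0 hF hl nz.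
apply: (@iprod_neq0 (fun i => \prod_(c <- shell i) F c) (shell_bd B r) r) => //.
- by move=> k; apply: shell_prod_near1.
- by apply: ccvg_eq hl; exists 0%N => n _; rewrite /cells shells_prod.
- by move=> k; rewrite prodf_seq_neq0; apply/allP => i _; rewrite nz.
Qed.

(** Starting at shell [K] confines the assumptions to the outside of a square, where the inverse
    factors of the gamma function have no poles. *)
Lemma ucl_dprod (T : Type) (P : (T -> C) -> Prop) (Om : T -> Prop) (F : nat * nat -> T -> C)
    (B r : R) K (f : T -> C) : funalg P Om -> 0 <= r < 1 -> 0 <= B ->
  (forall c, ((K <= c.1) || (K <= c.2))%N -> ucl P Om (F c)) ->
  (forall c t, Om t -> ((K <= c.1) || (K <= c.2))%N -> cmod (F c t - 1) <= B * r ^+ (c.1 + c.2)) ->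
  (forall t, Om t -> ccvg (fun N => \prod_(c <- shells K N) F c t) (f t)) ->
  ucl P Om f.
Proof.
move=> PA hr B0 hF hb hf; apply: ucl_lim => e e0.
have [N hN] := geo_small (expR (shell_bd B r / (1 - r)) * iprod_err (shell_bd B r) r) hr e0.
exists (fun t => \prod_(c <- shells K N) F c t).
  by apply: ucl_prod_in => // c /mem_shells[_]; exact: hF.
move=> t Ot; have [l hl herr] := dprod_cvg hr B0 (fun c => hb c t Ot).
by rewrite (ccvg_unique (hf t Ot) hl) cmodBC; apply: le_trans (herr N) (ltW (hN N _)).
Qed.

Lemma ucl_iprod (T : Type) (P : (T -> C) -> Prop) (Om : T -> Prop) (F : nat -> T -> C)
    (B r : R) (f : T -> C) : funalg P Om -> 0 <= r < 1 ->
  (forall k, ucl P Om (F k)) ->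
  (forall k t, Om t -> cmod (F k t - 1) <= B * r ^+ k) ->
  (forall t, Om t -> ccvg (fun N => \prod_(k < N) F k t) (f t)) ->
  ucl P Om f.
Proof.
move=> PA hr hF hb hf; apply: ucl_lim => e e0.
have [N hN] := geo_small (expR (B / (1 - r)) * iprod_err B r) hr e0.
exists (fun t => \prod_(k < N) F k t); first by apply: ucl_prod.
move=> t Ot; have [l hl herr] := iprod_cvg hr (fun k => hb k t Ot).
by rewrite (ccvg_unique (hf t Ot) hl) cmodBC; apply: le_trans (herr N) (ltW (hN N _)).
Qed.

End InfiniteProducts.

(** * Constant terms of Laurent series *)

Section RootsOfUnity.
Variable R : realType.
Local Notation C := (CC R).

(** A primitive root of unity of order 2^(k+1), by iterated square roots of -1. *)
Definition uroot (k : nat) : C := iter k (@sqrtc R) (-1).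

Lemma uroot_half k : uroot k ^+ (2 ^ k) = -1.
Proof.
elim: k => [|k IH]; first by rewrite expn0 expr1.
by rewrite expnS exprM /uroot iterS (sqr_sqrtc (iter k (@sqrtc R) (-1))).
Qed.

Lemma uroot_full k : uroot k ^+ (2 ^ k.+1) = 1.
Proof. by rewrite expnS mulnC exprM uroot_half sqrrN expr1n. Qed.

Lemma cmod_uroot k : cmod (uroot k) = 1.
Proof.
have h : cmod (uroot k) ^+ (2 ^ k) = 1 by rewrite -cmodX uroot_half cmodN cmod1.
by apply/eqP; rewrite -(@pexpr_eq1 _ (cmod (uroot k)) (2 ^ k)) ?cmod_ge0 ?expn_gt0// h.
Qed.

Lemma uroot_neq0 k : uroot k != 0.
Proof. by rewrite -cmod_gt0 cmod_uroot. Qed.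

(** With m = 2^v b and b odd, raising the power to the exponent 2^(k - v) gives (-1)^b = -1, which
    is not a power of 1. *)
Lemma uroot_pow_neq1 k m : (0 < m)%N -> (m < 2 ^ k.+1)%N -> uroot k ^+ m != 1.
Proof.
move=> m0 mk; apply/negP => /eqP h1.
have [b bo E] : exists2 b, odd b & m = (2 ^ logn 2 m * b)%N.
  have := @pfactor_coprime 2 m isT m0 => -[b cb E].
  by exists b; [rewrite -coprime2n|rewrite mulnC].
have lk : (logn 2 m <= k)%N.
  rewrite -ltnS -(ltn_exp2l _ _ (isT : 1 < 2)%N); apply: leq_ltn_trans mk.
  by rewrite {2}E leq_pmulr// lt0n; apply: contraTneq bo => ->.
have : (uroot k ^+ m) ^+ (2 ^ (k - logn 2 m)) = -1.
  rewrite -exprM {1}E mulnAC -expnD subnKC// exprM uroot_half -signr_odd bo expr1//.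
rewrite h1 expr1n => /eqP; rewrite -subr_eq0 opprK -mulr2n => /eqP/(congr1 (@cmod R)).
by rewrite cmod_nat cmod0 => /eqP; rewrite pnatr_eq0.
Qed.

Lemma sum_uroot_pow k (m : int) : (`|m| < 2 ^ k.+1)%N ->
  \sum_(j < 2 ^ k.+1) (uroot k ^+ j) ^ m = (if m == 0 then (2 ^ k.+1)%:R else 0).
Proof.
move=> hm; case: eqP => [->|/eqP m0].
  by rewrite (eq_bigr (fun=> 1)) ?sumr_const ?card_ord// => j _; rewrite expr0z.
pose y := uroot k ^ m.
have y1 : y != 1.
  rewrite /y; case: m m0 hm {y} => [m|m] m0 hm.
    by rewrite -exprnP uroot_pow_neq1//; lia.
  rewrite NegzE -exprnN invr_eq1 uroot_pow_neq1//; lia.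
have y2 : y ^+ (2 ^ k.+1) = 1.
  by rewrite /y exprnP exprz_exp mulrC -exprz_exp -exprnP uroot_full exp1rz.
rewrite (eq_bigr (fun j : 'I__ => y ^+ j)); last first.
  by move=> j _; rewrite /y !exprnP !exprz_exp mulrC.
apply/eqP; have := subrX1 y (2 ^ k.+1); rewrite y2 subrr => /esym/eqP.
by rewrite mulf_eq0 subr_eq0 (negPf y1).
Qed.

Definition cavg (k : nat) (r : R) (phi : C -> C) : C :=
  (2 ^ k.+1)%:R^-1 * \sum_(j < 2 ^ k.+1) phi (r%:C * uroot k ^+ j).

(* The constant term of a Laurent series converging on [cmod z = r], as a limit of
   means over the roots of unity of order [2 ^ k.+1]. *)
Definition CT (r : R) (phi : C -> C) : C := limn (fun k => cavg k r phi).

Lemma cmod_circ k (r : R) j : 0 <= r -> cmod (r%:C * uroot k ^+ j) = r.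
Proof. by move=> r0; rewrite cmodM cmodC cmodX cmod_uroot expr1n mulr1 ger0_norm. Qed.

Lemma natr2_neq0 k : (2 ^ k.+1)%:R != 0 :> C.
Proof. by rewrite pnatr_eq0 expn_eq0. Qed.

Lemma cavg_le k (r : R) phi (M : R) : 0 <= r -> (forall z, cmod z = r -> cmod (phi z) <= M) ->
  cmod (cavg k r phi) <= M.
Proof.
move=> r0 h; rewrite /cavg cmodM cmodV cmod_nat mulrC ler_pdivrMr ?ltr0n ?expn_gt0//.
apply: le_trans (cmod_sum _ _ _) _;
rewrite (@le_trans _ _ (\sum_(j < 2 ^ k.+1) M))//.
  by apply: ler_sum => j _; apply: h; exact: cmod_circ.
by rewrite sumr_const card_ord mulr_natr.
Qed.

Lemma cavgD k r phi psi : cavg k r (fun z => phi z + psi z) = cavg k r phi + cavg k r psi.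
Proof. by rewrite /cavg big_split mulrDr. Qed.
Lemma cavgZ k r c phi : cavg k r (fun z => c * phi z) = c * cavg k r phi.
Proof. by rewrite /cavg -mulr_sumr mulrCA. Qed.

Definition leval (s : seq (C * int)) (z : C) : C := \sum_(x <- s) x.1 * z ^ x.2.
Definition lct (s : seq (C * int)) : C := \sum_(x <- s | x.2 == 0) x.1.

(** The mean is exact once 2^(k+1) exceeds the absolute values of all exponents. *)
Lemma cavg_leval (r : R) s : 0 < r -> exists K, forall k, (K <= k)%N -> cavg k r (leval s) = lct s.
Proof.
move=> r0; elim: s => [|[c m] s [K IH]].
  exists 0%N => k _; rewrite /cavg /lct big_nil big1 ?mulr0// => j _.
  by rewrite /leval big_nil.
exists (maxn K `|m|) => k; rewrite geq_max => /andP[Kk mk].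
have -> : leval ((c, m) :: s) = (fun z => c * z ^ m + leval s z).
  by apply/funext => z; rewrite /leval big_cons.
rewrite cavgD cavgZ IH// /lct big_cons /=.
have -> : cavg k r (fun z => z ^ m) = if m == 0 then 1 else 0.
  rewrite /cavg (eq_bigr (fun j : 'I__ => (r%:C) ^ m * (uroot k ^+ j) ^ m)); last first.
    by move=> j _; rewrite exprzMl ?unitfE ?expf_neq0 ?uroot_neq0// -cmod_gt0 cmodC gtr0_norm.
  rewrite -mulr_sumr sum_uroot_pow; last first.
    by apply: leq_ltn_trans mk _; apply: ltn_trans (ltn_expl k (isT : 1 < 2)%N) _; rewrite ltn_exp2l.
  by case: eqP => [->|_]; rewrite ?mulr0// expr0z mul1r mulVf ?natr2_neq0.
by case: eqP => _; rewrite ?mulr1// mulr0 add0r.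
Qed.

Lemma lct_le (r : R) s (M : R) : 0 < r -> (forall z, cmod z = r -> cmod (leval s z) <= M) ->
  cmod (lct s) <= M.
Proof.
move=> r0 h; have [K hK] := cavg_leval s r0.
by rewrite -(hK K (leqnn _)); apply: cavg_le => //; exact: ltW.
Qed.

(** Characterises the constant term through approximating Laurent polynomials; with [lapp_CT] it is
    then identified by exhibiting such polynomials, the means being left aside. *)
Definition lapp (r : R) (phi : C -> C) (c : C) := forall e : R, 0 < e -> exists2 s,
  (forall z, cmod z = r -> cmod (phi z - leval s z) <= e) & cmod (c - lct s) <= e.

Lemma lapp_ccvg r phi c : 0 < r -> lapp r phi c -> ccvg (fun k => cavg k r phi) c.
Proof.
move=> r0 h e e0; have e3 : 0 < e / 3 by rewrite divr_gt0.
have [s h1 h2] := h _ e3; have [K hK] := cavg_leval s r0.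
exists K => k Kk.
have d : cmod (cavg k r phi - lct s) <= e / 3.
  have -> : cavg k r phi - lct s = cavg k r (fun z => phi z + (-1) * leval s z).
    by rewrite cavgD cavgZ hK// mulN1r.
  by apply: cavg_le => [|z zr]; [exact: ltW|rewrite mulN1r h1].
have -> : cavg k r phi - c = (cavg k r phi - lct s) - (c - lct s) by ring.
apply: le_lt_trans (cmodB _ _) _; lra.
Qed.

Lemma lapp_CT r phi c : 0 < r -> lapp r phi c -> CT r phi = c.
Proof. by move=> r0 h; apply: ccvg_lim; exact: lapp_ccvg. Qed.

Definition lau (phi : C -> C) := exists s, forall z, z != 0 -> phi z = leval s z.

Lemma lapp_ucl r phi : 0 < r -> ucl lau (fun z => cmod z = r) phi -> lapp r phi (CT r phi).
Proof.
move=> r0 h.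
have cir z : cmod z = r -> z != 0 by move=> zr; rewrite -cmod_gt0 zr.
have ap (e : R) : 0 < e -> exists s, forall z, cmod z = r -> cmod (phi z - leval s z) <= e.
  by move=> e0; have [g [s gs] hg] := h e e0; exists s => z zr; rewrite -gs ?hg// cir.
have [c hc] : exists c, ccvg (fun k => cavg k r phi) c.
  apply: ccauchy_cvg => e e0; have e3 : 0 < e / 3 by rewrite divr_gt0.
  have [s hs] := ap _ e3; have [K hK] := cavg_leval s r0.
  have d k : (K <= k)%N -> cmod (cavg k r phi - lct s) <= e / 3.
    move=> Kk; have -> : cavg k r phi - lct s = cavg k r (fun z => phi z + (-1) * leval s z).
      by rewrite cavgD cavgZ hK// mulN1r.
    by apply: cavg_le => [|z zr]; [exact: ltW|rewrite mulN1r hs].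
  exists K => n m /d h1 /d h2.
  have -> : cavg n r phi - cavg m r phi = (cavg n r phi - lct s) - (cavg m r phi - lct s) by ring.
  apply: le_lt_trans (cmodB _ _) _; lra.
have -> : CT r phi = c by exact: ccvg_lim.
move=> e e0; have [s hs] := ap _ e0; exists s => //.
have [K hK] := cavg_leval s r0.
have hd := ccvgD hc (ccvg_cst (- lct s)).
apply: (ccvg_cmod_le hd); exists K => k Kk.
have -> : cavg k r phi - lct s = cavg k r (fun z => phi z + (-1) * leval s z).
  by rewrite cavgD cavgZ hK// mulN1r.
by apply: cavg_le => [|z zr]; [exact: ltW|rewrite mulN1r hs].
Qed.

Lemma CT_approx r phi s (e : R) : 0 < r -> ucl lau (fun z => cmod z = r) phi ->
  (forall z, cmod z = r -> cmod (phi z - leval s z) <= e) -> cmod (CT r phi - lct s) <= e.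
Proof.
move=> r0 u h; have hc := lapp_ccvg r0 (lapp_ucl r0 u).
have hd := ccvgD hc (ccvg_cst (- lct s)).
apply: (ccvg_cmod_le hd); have [K hK] := cavg_leval s r0; exists K => k Kk.
have -> : cavg k r phi - lct s = cavg k r (fun z => phi z + (-1) * leval s z).
  by rewrite cavgD cavgZ hK// mulN1r.
by apply: cavg_le => [|z zr]; [exact: ltW|rewrite mulN1r h].
Qed.

Lemma CT_le r phi (M : R) : 0 < r -> ucl lau (fun z => cmod z = r) phi ->
  (forall z, cmod z = r -> cmod (phi z) <= M) -> cmod (CT r phi) <= M.
Proof.
move=> r0 u h; have hc := lapp_ccvg r0 (lapp_ucl r0 u).
by apply: (ccvg_cmod_le hc); exists 0%N => k _; apply: cavg_le => //; exact: ltW.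
Qed.

Lemma CTD r phi psi : 0 < r -> ucl lau (fun z => cmod z = r) phi -> ucl lau (fun z => cmod z = r) psi ->
  CT r (fun z => phi z + psi z) = CT r phi + CT r psi.
Proof.
move=> r0 h1 h2; apply: ccvg_lim.
apply: ccvg_eq (ccvgD (lapp_ccvg r0 (lapp_ucl r0 h1)) (lapp_ccvg r0 (lapp_ucl r0 h2))).
by exists 0%N => n _; rewrite cavgD.
Qed.

Lemma CTZ r c phi : 0 < r -> ucl lau (fun z => cmod z = r) phi -> CT r (fun z => c * phi z) = c * CT r phi.
Proof.
move=> r0 h1; apply: ccvg_lim.
apply: ccvg_eq (ccvgM (ccvg_cst c) (lapp_ccvg r0 (lapp_ucl r0 h1))).
by exists 0%N => n _; rewrite cavgZ.
Qed.

Lemma CT_ext r phi psi : 0 < r -> (forall z, cmod z = r -> phi z = psi z) -> CT r phi = CT r psi.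
Proof.
move=> r0 h; congr (limn _); apply/funext => k; congr (_ * _); apply: eq_bigr => j _.
by apply: h; apply: cmod_circ; exact: ltW.
Qed.

Lemma leval_cat s1 s2 z : leval (s1 ++ s2) z = leval s1 z + leval s2 z.
Proof. by rewrite /leval big_cat. Qed.

Definition lmul (s1 s2 : seq (C * int)) := [seq (x.1 * y.1, x.2 + y.2) | x <- s1, y <- s2].

Lemma leval_mul s1 s2 z : z != 0 -> leval (lmul s1 s2) z = leval s1 z * leval s2 z.
Proof.
move=> z0; rewrite /leval /lmul big_allpairs_dep /= mulr_suml; apply: eq_bigr => x _.
rewrite mulr_sumr; apply: eq_bigr => y _ /=.
by rewrite expfzDr// mulrACA.
Qed.

Lemma lau_cst c : lau (fun=> c).
Proof. by exists [:: (c, 0)] => z _; rewrite /leval big_seq1 expr0z mulr1. Qed.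
Lemma lau_exp (m : int) : lau (fun z => z ^ m).
Proof. by exists [:: (1, m)] => z _; rewrite /leval big_seq1 mul1r. Qed.
Lemma lau_add f g : lau f -> lau g -> lau (fun z => f z + g z).
Proof. by move=> [s hs] [u hu]; exists (s ++ u) => z z0; rewrite leval_cat hs// hu. Qed.
Lemma lau_mul f g : lau f -> lau g -> lau (fun z => f z * g z).
Proof. by move=> [s hs] [u hu]; exists (lmul s u) => z z0; rewrite leval_mul// hs// hu. Qed.

Lemma expz_bdd (r1 r2 : R) (m : int) : 0 < r1 -> exists M : R, forall z : C, r1 <= cmod z -> cmod z <= r2 -> cmod (z ^ m) <= M.
Proof.
move=> r10; case: m => n.
  exists (r2 ^+ n) => z _ h; rewrite -exprnP cmodX lerXn2r// ?nnegrE ?cmod_ge0//.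
  exact: le_trans (cmod_ge0 z) h.
exists (r1 ^- n.+1) => z h _; rewrite NegzE -exprnN cmodV cmodX lef_pV2 ?posrE ?exprn_gt0//.
  by rewrite lerXn2r// nnegrE ?cmod_ge0// ltW.
exact: lt_le_trans h.
Qed.

Definition ann (r1 r2 : R) (z : C) : Prop := r1 <= cmod z /\ cmod z <= r2.

Lemma ann_neq0 r1 r2 z : 0 < r1 -> ann r1 r2 z -> z != 0.
Proof. by move=> h [h1 _]; rewrite -cmod_gt0; exact: lt_le_trans h1. Qed.

Lemma lau_falg (Om : C -> Prop) (r1 r2 : R) : 0 < r1 -> (forall z, Om z -> ann r1 r2 z) -> funalg lau Om.
Proof.
move=> r10 hO; split; [exact: lau_cst|exact: lau_add|exact: lau_mul|].
move=> f [s hs].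
suff [M hM] : exists M : R, forall z, ann r1 r2 z -> cmod (leval s z) <= M.
  by exists M => z /hO az; rewrite hs ?hM//; exact: ann_neq0 az.
elim: s {hs} => [|[c m] s [M IH]]; first by exists 0 => z _; rewrite /leval big_nil cmod0.
have [B hB] := expz_bdd r2 m r10.
exists (cmod c * B + M) => z az; rewrite /leval big_cons /=.
apply: le_trans (cmodD _ _) _; apply: lerD; last exact: IH.
by case: az => a b; rewrite cmodM ler_wpM2l ?cmod_ge0// hB.
Qed.

Lemma circ_ann (r : R) z : cmod z = r -> ann r r z. Proof. by rewrite /ann => ->. Qed.

Lemma CT_exp (r : R) (m : int) : 0 < r -> CT r (fun z => z ^ m) = if m == 0 then 1 else 0.
Proof.
move=> r0; apply: lapp_CT => // e e0; exists [:: (1, m)].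
  by move=> z _; rewrite /leval big_seq1 mul1r subrr cmod0 ltW.
by rewrite /lct big_cons big_nil /=; case: eqP => _; rewrite ?addr0 subrr cmod0 ltW.
Qed.

(** One Laurent polynomial approximates on both circles and has a single constant term: this is
    Cauchy's theorem for an annulus. *)
Lemma CT_radius (r1 r2 r r' : R) phi : 0 < r1 -> r1 <= r <= r2 -> r1 <= r' <= r2 -> ucl lau (ann r1 r2) phi ->
  CT r phi = CT r' phi.
Proof.
move=> r10 /andP[a1 a2] /andP[b1 b2] u.
have r0 : 0 < r by exact: lt_le_trans a1.
have r'0 : 0 < r' by exact: lt_le_trans b1.
apply: lapp_CT => // e e0; have [g [s gs] hg] := u e e0.
have hb z : ann r1 r2 z -> cmod (phi z - leval s z) <= e.
  by move=> az; rewrite -gs ?hg//; exact: ann_neq0 az.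
exists s => [z zr|]; first by apply: hb; rewrite /ann zr.
apply: CT_approx => //; first by apply: ucl_sub u => z zr; rewrite /ann zr.
by move=> z zr; apply: hb; rewrite /ann zr.
Qed.

Lemma CT_inv (r : R) phi : 0 < r -> ucl lau (fun z => cmod z = r) phi ->
  CT r^-1 (fun z => phi z^-1) = CT r phi.
Proof.
move=> r0 u; apply: lapp_CT; first by rewrite invr_gt0.
move=> e e0; have [s hs hc] := lapp_ucl r0 u e0.
exists [seq (x.1, - x.2) | x <- s].
  move=> z zr; have := hs z^-1; rewrite cmodV zr invrK => /(_ erefl).
  rewrite /leval big_map; congr (cmod (_ - _) <= _); apply: eq_bigr => x _ /=.
  by rewrite -exprz_inv.
by move: hc; rewrite /lct big_map; under [in X in _ -> X]eq_bigl => x do rewrite /= oppr_eq0.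
Qed.

End RootsOfUnity.

(** * Laurent series depending on parameters *)

Section ParametricLaurent.
Variable R : realType.
Local Notation C := (CC R).
Variables (T : Type) (A : (T -> C) -> Prop).

(** Functions have no decidable equality, so the condition on the coefficients is stated through
    [nth]; its default value 0 must then lie in [A] too. *)
Definition lpar (phi : T * C -> C) := exists2 s : seq ((T -> C) * int),
  (forall i, A (nth (fun=> 0, 0) s i).1) &
  forall t z, z != 0 -> phi (t, z) = \sum_(x <- s) x.1 t * z ^ x.2.

Variable W : T -> Prop.
Hypothesis AA : funalg A W.

Lemma lpar_falg (Om : T * C -> Prop) (r1 r2 : R) : 0 < r1 ->
  (forall t z, Om (t, z) -> W t /\ ann r1 r2 z) -> funalg lpar Om.
Proof.
move=> r10 hO; split.
- move=> c; exists [:: (fun=> c, 0)] => [[|i] /=|t z _]; first exact: (falg_cst AA).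
    by rewrite nth_nil; exact: (falg_cst AA).
  by rewrite big_seq1 expr0z mulr1.
- move=> f g [s h1 h2] [u k1 k2]; exists (s ++ u) => [i|t z z0].
    by rewrite nth_cat; case: ifP.
  by rewrite big_cat h2// k2.
- move=> f g [s h1 h2] [u k1 k2].
  exists [seq (fun t => x.1 t * y.1 t, x.2 + y.2) | x <- s, y <- u] => [|t z z0].
    have h0 : A (fun=> 0) by exact: (falg_cst AA).
    (* [nth] is awkward on a list of products, so the condition is transferred to [List.In] and
       back. *)
    have aux : forall v : seq ((T -> C) * int), (forall i, A (nth (fun=> 0, 0) v i).1) <-> (forall x, List.In x v -> A x.1).
      elim=> [|x v IH]; first by split => // _ i; rewrite nth_nil.
      split=> [h y /= [<-|]|h [|i] /=]; first exact: (h 0%N).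
      - exact: (IH.1 (fun i => h i.+1)).
      - by apply: h; left.
      - by move: i; apply: IH.2 => y yv; apply: h; right.
    apply/aux => x; move/aux: h1 => h1; move/aux: k1 => k1.
    elim: s {h2} h1 => [|y s IH] h1 //= hx0.
    case: (@List.in_app_or _ _ _ _ hx0) => hx; last by apply: IH hx => v vs; apply: h1; right.
    have : exists2 w, List.In w u & x = (fun t => y.1 t * w.1 t, y.2 + w.2).
      elim: u {k1 k2 IH hx0} hx => [|w u IH] //= [<-|/IH [v vu ->]]; first by exists w; [left|].
      by exists v; [right|].
    case=> w wu -> /=; apply: (falg_mul AA); last exact: k1.
    by apply: h1; left.
  rewrite h2// k2// big_allpairs_dep /= mulr_suml; apply: eq_bigr => x _.
  rewrite mulr_sumr; apply: eq_bigr => y _ /=.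
  by rewrite expfzDr// mulrACA.
move=> f [s h1 h2].
suff [M hM] : exists M : R, forall t z, W t -> ann r1 r2 z -> cmod (\sum_(x <- s) x.1 t * z ^ x.2) <= M.
  by exists M => -[t z] /hO [Wt az]; rewrite h2 ?hM//; exact: ann_neq0 az.
elim: s h1 {h2} => [|[c m] s IH] h1; first by exists 0 => t z _ _; rewrite big_nil cmod0.
have [|M hM] := IH; first by move=> i; exact: (h1 i.+1).
have [B hB] := expz_bdd r2 m r10; have [D hD] := falg_bdd AA (h1 0%N).
exists (D * B + M) => t z Wt az; rewrite big_cons /=.
apply: le_trans (cmodD _ _) _; apply: lerD; last exact: hM.
by case: az => a b; rewrite cmodM ler_pM ?cmod_ge0 ?hB//; exact: hD.
Qed.

Lemma lpar_fst f : A f -> lpar (fun x => f x.1).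
Proof.
move=> Af; exists [:: (f, 0)] => [[|i] //=|t z _]; last by rewrite big_seq1 expr0z mulr1.
by rewrite nth_nil; exact: (falg_cst AA).
Qed.

Lemma lpar_exp (m : int) : lpar (fun x => x.2 ^ m).
Proof.
exists [:: (fun=> 1, m)] => [[|i] /=|t z _]; [exact: (falg_cst AA)| |by rewrite big_seq1 mul1r].
by rewrite nth_nil; exact: (falg_cst AA).
Qed.

Lemma ucl_fst (Om : T * C -> Prop) f : (forall t z, Om (t, z) -> W t) -> ucl A W f -> ucl lpar Om (fun x => f x.1).
Proof.
move=> hO h e e0; have [g Ag hg] := h e e0; exists (fun x => g x.1); first exact: lpar_fst.
by move=> [t z] /hO Wt; exact: hg.
Qed.

Lemma ucl_at (Om : T * C -> Prop) (Om' : C -> Prop) phi t : (forall z, Om' z -> Om (t, z)) ->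
  ucl lpar Om phi -> ucl (@lau R) Om' (fun z => phi (t, z)).
Proof.
move=> hO h e e0; have [g [s _ hs] hg] := h e e0.
exists (fun z => g (t, z)); last by move=> z /hO; exact: hg.
exists [seq (x.1 t, x.2) | x <- s] => z z0; rewrite hs// /leval big_map.
by apply: eq_bigr.
Qed.

(** The constant term of an approximating Laurent polynomial with coefficients in [A] lies in [A],
    and taking constant terms does not increase sup norms. This plays the role of holomorphic
    dependence of an integral on parameters. *)
Lemma ucl_CT (r : R) phi : 0 < r -> ucl lpar (fun x => W x.1 /\ cmod x.2 = r) phi ->
  ucl A W (fun t => CT r (fun z => phi (t, z))).
Proof.
move=> r0 h e e0; have [g [s As hs] hg] := h e e0.
have cir z : cmod z = r -> z != 0 by move=> zr; rewrite -cmod_gt0 zr.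
exists (fun t => \sum_(x <- s | x.2 == 0) x.1 t).
  elim: s As {hs} => [|x s IH] As.
    rewrite (_ : (fun t => _) = fun=> 0); first exact: (falg_cst AA).
    by apply/funext => t; rewrite big_nil.
  have IH' := IH (fun i => As i.+1).
  case x0 : (x.2 == 0); last first.
    rewrite (_ : (fun t => _) = (fun t => \sum_(x <- s | x.2 == 0) x.1 t))//.
    by apply/funext => t; rewrite big_cons x0.
  rewrite (_ : (fun t => _) = (fun t => x.1 t + \sum_(x <- s | x.2 == 0) x.1 t)).
    by apply: (falg_add AA) IH'; exact: (As 0%N).
  by apply/funext => t; rewrite big_cons x0.
move=> t Wt.
have -> : \sum_(x <- s | x.2 == 0) x.1 t = lct [seq (x.1 t, x.2) | x <- s] by rewrite /lct big_map.
apply: CT_approx => //.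
  by apply: (ucl_at (t := t) _ h) => z zr.
move=> z zr; have := hg (t, z) (conj Wt zr); rewrite hs ?cir//.
by rewrite /leval big_map.
Qed.

End ParametricLaurent.

(** * Holomorphic functions of several variables *)

Section Holomorphic.
Variable R : realType.
Local Notation C := (CC R).
Variable V : normedModType C.

Definition vn (v : V) : R := complex.Re `|v|.

Lemma vnE v : `|v| = (vn v)%:C.
Proof.
have := normr_ge0 v; rewrite /vn lecE => /andP[/eqP + _].
by case: (`|v|) => a b /= ->.
Qed.
Lemma vn_ge0 v : 0 <= vn v.
Proof. by have := normr_ge0 v; rewrite vnE lecR. Qed.
Lemma vnD u v : vn (u + v) <= vn u + vn v.
Proof. by have := ler_normD u v; rewrite !vnE -rmorphD lecR. Qed.
Lemma vnZ (a : C) v : vn (a *: v) = cmod a * vn v.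
Proof. by have := normrZ a v; rewrite !vnE cmodE -rmorphM => -[]. Qed.
Lemma vn0 : vn 0 = 0.
Proof. by rewrite -(scale0r 0) vnZ cmod0 mul0r. Qed.

Lemma nearV (x : V) (Q : V -> Prop) :
  (\forall y \near x, Q y) <-> exists2 d : R, 0 < d & forall y, vn (y - x) < d -> Q y.
Proof.
split=> [/nbhs_ballP[e /= e0 h]|[d d0 h]].
  have e0' : 0 < complex.Re e /\ e = (complex.Re e)%:C.
    by move: e0; rewrite ltcE => /andP[/eqP]; case: (e) => a b /= ->.
  case: e0' => e1 e2; exists (complex.Re e) => // y yx; apply: h.
  by rewrite -ball_normE /= distrC vnE e2 ltcR.
apply/nbhs_ballP; exists d%:C => /=; first by rewrite ltcR.
by move=> y; rewrite -ball_normE /= distrC vnE ltcR; exact: h.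
Qed.

Variables (I : Type) (X : I -> V -> C).
Hypothesis XD : forall i u v, X i (u + v) = X i u + X i v.
Hypothesis XZ : forall i a v, X i (a *: v) = a * X i v.
Hypothesis Xle : forall i v, cmod (X i v) <= vn v.

(** Abstract linear coordinates [X] let the theory apply to the product of a row space with the
    plane of (p, q), normed by a maximum. *)
Inductive polyf : (V -> C) -> Prop :=
| polyf_cst c : polyf (fun=> c)
| polyf_X i : polyf (X i)
| polyf_add f g : polyf f -> polyf g -> polyf (fun v => f v + g v)
| polyf_mul f g : polyf f -> polyf g -> polyf (fun v => f v * g v).

Definition bal (x : V) (d : R) (y : V) : Prop := vn (y - x) < d.

Lemma polyf_falg (W : V -> Prop) (B : R) : (forall y, W y -> vn y <= B) -> funalg polyf W.
Proof.
move=> hB; split; [exact: polyf_cst|exact: polyf_add|exact: polyf_mul|].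
move=> f; elim=> [c|i|f1 f2 _ [M1 h1] _ [M2 h2]|f1 f2 _ [M1 h1] _ [M2 h2]].
- by exists (cmod c).
- by exists B => t /hB; apply: le_trans.
- exists (M1 + M2) => t Wt; apply: le_trans (cmodD _ _) _.
  by rewrite lerD ?h1 ?h2.
- exists (M1 * M2) => t Wt; rewrite cmodM ler_pM ?cmod_ge0 ?h1 ?h2//.
Qed.

Lemma bal_bdd x d y : bal x d y -> vn y <= vn x + d.
Proof.
rewrite /bal => h; have := vnD (y - x) x; rewrite subrK; lra.
Qed.

Lemma polyf_bal x d : funalg polyf (bal x d).
Proof. exact: polyf_falg (@bal_bdd x d). Qed.

(** On a line through [y] a polynomial function becomes a polynomial in one variable, to which
    Cauchy's estimates apply; [df] is the derivative at [y] as a linear map of the direction. *)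
Lemma poly_line f y : polyf f -> exists df : V -> C,
  [/\ forall u v, df (u + v) = df u + df v, forall (a : C) v, df (a *: v) = a * df v &
    forall v, exists2 p : {poly C}, forall z, f (y + z *: v) = p.[z] & p`_1 = df v].
Proof.
elim=> [c|i|f1 f2 _ [d1 [a1 b1 h1]] _ [d2 [a2 b2 h2]]|f1 f2 _ [d1 [a1 b1 h1]] _ [d2 [a2 b2 h2]]].
- exists (fun=> 0); split=> [*|*|v]; rewrite ?addr0 ?mulr0//.
  by exists c%:P => [z|]; rewrite ?hornerC ?coefC.
- exists (X i); split=> // v; exists ((X i y)%:P + X i v *: 'X) => [z|].
    by rewrite XD XZ !hornerE mulrC.
  by rewrite coefD coefC coefZ coefX /= add0r mulr1.
- exists (fun v => d1 v + d2 v); split=> [u v|a v|v].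
  + by rewrite a1 a2 addrACA.
  + by rewrite b1 b2 mulrDr.
  + have [p hp p1] := h1 v; have [q hq q1] := h2 v.
    by exists (p + q) => [z|]; rewrite ?hornerD ?hp ?hq ?coefD ?p1 ?q1.
- exists (fun v => f1 y * d2 v + d1 v * f2 y); split=> [u v|a v|v].
  + by rewrite a1 a2; ring.
  + by rewrite b1 b2; ring.
  + have [p hp p1] := h1 v; have [q hq q1] := h2 v.
    exists (p * q) => [z|]; first by rewrite hornerM hp hq.
    rewrite coefM big_ord_recr big_ord1 /= p1 q1.
    have -> : p`_0 = f1 y by rewrite -horner_coef0 -hp scale0r addr0.
    have -> : q`_0 = f2 y by rewrite -horner_coef0 -hq scale0r addr0.
    by [].
Qed.

(** The coefficient is the constant term of p(z) z^(-k): Cauchy's estimate on the unit circle. *)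
Lemma coef_le (p : {poly C}) (M : R) k : (forall z, cmod z = 1 -> cmod p.[z] <= M) -> cmod p`_k <= M.
Proof.
move=> h; pose s := [seq (p`_i, i%:Z - k%:Z) | i <- iota 0 (size p)].
have -> : p`_k = lct s.
  rewrite /lct big_map /=.
  have [kp|pk] := ltnP k (size p).
    rewrite -big_filter (@eq_filter _ _ (pred1 k)); last first.
      by move=> i /=; rewrite subr_eq0 eqz_nat.
    by rewrite filter_pred1_uniq ?iota_uniq ?mem_iota// big_seq1.
  rewrite nth_default// big1_seq// => i /andP[/eqP/subr0_eq[->]].
  by rewrite mem_iota add0n ltnNge pk.
apply: (@lct_le _ 1) => // z z1; have z0 : z != 0 by rewrite -cmod_gt0 z1.
have -> : leval s z = p.[z] * z ^- k.
  rewrite horner_coef mulr_suml /leval big_map (big_iota _ _ (fun j => p`_j * z ^ (j%:Z - k%:Z))).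
  by apply: eq_bigr => i _; rewrite expfzDr// -mulrA exprnN.
by rewrite cmodM cmodV cmodX z1 expr1n invr1 mulr1 h.
Qed.

(** Each coefficient is at most [M] and |z| <= 1/2, so the remainder is dominated by a geometric
    series with sum 2. *)
Lemma taylor2 (p : {poly C}) (M : R) z : (forall z, cmod z = 1 -> cmod p.[z] <= M) -> cmod z <= 1 / 2 ->
  cmod (p.[z] - p`_0 - p`_1 * z) <= 2 * M * cmod z ^+ 2.
Proof.
move=> h z2; have M0 : 0 <= M by apply: le_trans (cmod_ge0 _) (h 1 _); rewrite cmod1.
have zz : 0 <= cmod z by exact: cmod_ge0.
have -> : p.[z] - p`_0 - p`_1 * z = \sum_(i < size p) p`_(i.+2) * z ^+ i.+2.
  have E : p.[z] = \sum_(i < (size p).+2) p`_i * z ^+ i.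
    rewrite (@horner_coef_wide _ (size p).+2)//; exact: leqW.
  rewrite E !big_ord_recl expr0 mulr1 !lift0 expr1.
  rewrite (eq_bigr (fun i : 'I_(size p) => p`_(i.+2) * z ^+ i.+2)); first by ring.
  by move=> i _; rewrite !lift0.
apply: le_trans (cmod_sum _ _ _) _.
apply: (@le_trans _ _ (\sum_(i < size p) M * cmod z ^+ 2 * (1 / 2) ^+ i)).
  apply: ler_sum => i _; rewrite cmodM cmodX -mulrA -addn2 addnC exprD.
  rewrite ler_pM ?cmod_ge0 ?mulr_ge0 ?exprn_ge0 ?coef_le//.
  by rewrite ler_wpM2l ?exprn_ge0// lerXn2r// nnegrE; lra.
rewrite -mulr_sumr.
have hh : 0 <= (1 / 2 : R) < 1 by apply/andP; split; lra.
have := geo_sum_le (size p) hh.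
have -> : (1 - 1 / 2 : R)^-1 = 2 by field.
have := mulr_ge0 M0 (exprn_ge0 2 zz); set a := M * _; set b := \sum_(_ < _) _ => a0 b2.
have ab : a * b <= a * 2 by rewrite ler_wpM2l.
by apply: le_trans ab _; rewrite /a (_ : _ * 2 = 2 * M * cmod z ^+ 2)//; ring.
Qed.

(** Cauchy's estimate, applied to differences of approximating polynomials, makes their derivatives
    at [y] converge to a linear map [D]; the second order Taylor remainders are bounded uniformly in
    the approximation, and the bound passes to the limit. *)
Theorem ucl_differentiable f x0 (rho : R) y : ucl polyf (bal x0 rho) f -> bal x0 rho y -> differentiable f y.
Proof.
move=> uf by0.
pose de := rho - vn (y - x0); have de0 : 0 < de by move: by0; rewrite /bal /de; lra.
have inb h : vn h < de -> bal x0 rho (y + h).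
  by rewrite /bal /de => hh; have := vnD (y - x0) h; rewrite addrAC; lra.
have [M M0 hM] := ucl_bdd (polyf_bal x0 rho) uf.
have ap n : exists P, polyf P /\ forall t, bal x0 rho t -> cmod (f t - P t) <= n.+1%:R^-1.
  by have [|g Pg hg] := uf (n.+1%:R^-1); [rewrite invr_gt0 ltr0n|exists g].
have [P hP] := choice ap.
have ap2 n : exists df : V -> C, [/\ forall u v, df (u + v) = df u + df v, forall (a : C) v, df (a *: v) = a * df v &
    forall v, exists2 p : {poly C}, forall z, P n (y + z *: v) = p.[z] & p`_1 = df v].
  by apply: poly_line; case: (hP n).
have [d hd] := choice ap2.
have inv_le n m : (n <= m)%N -> (m.+1%:R^-1 : R) <= n.+1%:R^-1.
  by move=> nm; rewrite lef_pV2 ?posrE ?ltr0n// ler_nat.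
have ddiff n m h : vn h < de -> cmod (d n h - d m h) <= n.+1%:R^-1 + m.+1%:R^-1.
  move=> hh; case: (hd n) => _ _ /(_ h)[p hp <-]; case: (hd m) => _ _ /(_ h)[q hq <-].
  rewrite -coefB; apply: coef_le => z z1; rewrite hornerD hornerN -hp -hq.
  have bz : bal x0 rho (y + z *: h) by apply: inb; rewrite vnZ z1 mul1r.
  have -> : P n (y + z *: h) - P m (y + z *: h) =
     (f (y + z *: h) - P m (y + z *: h)) - (f (y + z *: h) - P n (y + z *: h)) by ring.
  apply: le_trans (cmodB _ _) _; rewrite addrC.
  by apply: lerD; [case: (hP n) => _|case: (hP m) => _]; exact.
have cv v : exists l, ccvg (fun n => d n v) l.
  (* [ddiff] controls directions shorter than [de]; any [v] is scaled into that range. *)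
  pose a : R := de / 2 / (vn v + 1).
  have v1 : 0 < vn v + 1 by rewrite ltr_wpDl ?vn_ge0.
  have a0 : 0 < a by rewrite !divr_gt0.
  have av : vn (a%:C *: v) < de.
    rewrite vnZ cmodC gtr0_norm// /a -mulrA -ltr_pdivlMl ?divr_gt0//.
    rewrite mulrC -ltr_pdivlMr ?invr_gt0//.
    rewrite (_ : (de / 2)^-1 * de / (vn v + 1)^-1 = 2 * (vn v + 1)); last by field; rewrite !gt_eqF.
    have := vn_ge0 v; lra.
  apply: ccauchy_cvg => e e0.
  have [N hN] : exists N : nat, N.+1%:R^-1 < a * e / 2.
    have p : 0 < a * e / 2 by rewrite divr_gt0// mulr_gt0.
    exists (Num.truncn (a * e / 2)^-1); rewrite invf_plt ?posrE ?ltr0n//.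
    by exact: truncnS_gt.
  exists N => n m Nn Nm; rewrite -(ltr_pM2l a0).
  have -> : a * cmod (d n v - d m v) = cmod (d n (a%:C *: v) - d m (a%:C *: v)).
    case: (hd n) => _ -> _; case: (hd m) => _ -> _.
    by rewrite -mulrBr cmodM cmodC gtr0_norm.
  apply: le_lt_trans (ddiff n m _ av) _.
  rewrite (splitr (a * e)); apply: ltrD; apply: le_lt_trans hN; exact: inv_le.
have [D hD] := choice cv.
have DD u v : D (u + v) = D u + D v.
  apply: ccvg_unique (hD _) _; apply: ccvg_eq (ccvgD (hD u) (hD v)).
  by exists 0%N => n _; case: (hd n) => ->.
have DZ (a : C) v : D (a *: v) = a * D v.
  apply: ccvg_unique (hD _) _; apply: ccvg_eq (ccvgM (ccvg_cst a) (hD v)).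
  by exists 0%N => n _; case: (hd n) => _ ->.
have Pf t : bal x0 rho t -> ccvg (fun n => P n t) (f t).
  move=> bt e e0; exists (Num.truncn e^-1) => n nn; rewrite cmodBC.
  case: (hP n) => _ /(_ t bt) h; apply: le_lt_trans h _.
  rewrite invf_plt ?posrE ?ltr0n//; apply: lt_le_trans (truncnS_gt _) _.
  by rewrite ler_nat.
have P1 n t : bal x0 rho t -> cmod (P n t) <= M + 1.
  move=> bt; case: (hP n) => _ /(_ t bt) h.
  have := cmodBr (f t) (P n t); have := hM t bt.
  have : (n.+1%:R^-1 : R) <= 1 by rewrite invf_le1 ?ltr0n// ler1n.
  by move: h; move: (n.+1%:R^-1) => u; lra.
have quad h : vn h <= de / 4 -> cmod (f (y + h) - f y - D h) <= 8 * (M + 1) / de ^+ 2 * vn h ^+ 2.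
  (* With this scale z^-1 h has norm de / 2, so the closed unit disc of the line it spans stays in
     the ball, and [taylor2] applies at [z], which has modulus at most 1/2. *)
  move=> hh; pose z : C := (2 / de * vn h)%:C.
  have [h0|h0] := eqVneq (vn h) 0.
    have -> : h = 0 by apply/eqP; rewrite -normr_eq0 vnE h0.
    have D0 : D 0 = 0 by have := DZ 0 0; rewrite scale0r mul0r.
    by rewrite addr0 subrr D0 subr0 cmod0 vn0 expr0n /= mulr0.
  have hp : 0 < vn h by rewrite lt0r h0 vn_ge0.
  have z0 : z != 0.
    by rewrite -cmod_gt0 cmodC normr_gt0 mulf_neq0// ?gt_eqF ?divr_gt0.
  have cz : cmod z = 2 / de * vn h by rewrite cmodC gtr0_norm// mulr_gt0 ?divr_gt0.
  have vz : vn (z^-1 *: h) < de.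
    rewrite vnZ cmodV cz (_ : _ * _ = de / 2); last by field; rewrite !gt_eqF.
    by lra.
  have hz : h = z *: (z^-1 *: h) by rewrite scalerA divff// scale1r.
  have E : 2 * (M + 1) * cmod z ^+ 2 = 8 * (M + 1) / de ^+ 2 * vn h ^+ 2.
    by rewrite cz; field; rewrite gt_eqF.
  have lim := ccvgD (ccvgD (Pf _ (inb h _)) (ccvgM (ccvg_cst (-1)) (Pf y by0))) (ccvgM (ccvg_cst (-1)) (hD h)).
  rewrite -E; have /lim/ccvg_cmod_le : vn h < de by lra.
  rewrite !mulN1r; apply; exists 0%N => n _; rewrite !mulN1r.
  case: (hd n) => _ dZ /(_ (z^-1 *: h))[p hp1 hp2].
  have -> : P n (y + h) = p.[z] by rewrite -hp1 -hz.
  have -> : P n y = p`_0 by rewrite -horner_coef0 -hp1 scale0r addr0.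
  have -> : d n h = p`_1 * z by rewrite hp2 mulrC -dZ -hz.
  apply: taylor2; last first.
    rewrite cz; have : 2 / de * vn h <= 2 / de * (de / 4) by rewrite ler_wpM2l// divr_ge0// ltW.
    by rewrite (_ : 2 / de * (de / 4) = 1 / 2)//; field; rewrite gt_eqF.
  move=> w w1; rewrite -hp1; apply: P1; apply: inb.
  by rewrite vnZ w1 mul1r.
pose K := 8 * (M + 1) / de ^+ 2.
have K0 : 0 <= K by rewrite /K divr_ge0 ?exprn_ge0 ?mulr_ge0 ?(ltW de0)//; lra.
pose Dl : {linear V -> C} := HB.pack D (GRing.isLinear.Build _ _ _ _ D (fun a u v => etrans (DD _ _) (congr1 (+%R^~ (D v)) (DZ a u)))).
have Dc : continuous Dl.
  apply: bounded_linear_continuous; apply/ex_bound.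
  exists (2 * M + K * (de / 4) ^+ 2)%:C; apply/nearV; exists (de / 4); first by rewrite divr_gt0.
  move=> h; rewrite subr0 => hh /=; rewrite cmodE lecR.
  have -> : D h = (f (y + h) - f y) - (f (y + h) - f y - D h) by ring.
  apply: le_trans (cmodB _ _) _; apply: lerD.
    apply: le_trans (cmodB _ _) _.
    have := hM y by0; have := hM (y + h); have : bal x0 rho (y + h) by apply: inb; lra.
    by move=> b /(_ b); lra.
  apply: le_trans (quad h (ltW hh)) _; rewrite -/K ler_wpM2l//.
  by rewrite lerXn2r ?nnegrE ?vn_ge0// ?divr_ge0 ?ltW.
have key : f \o shift y = cst (f y) + Dl +o_0 id.
  apply/eqaddoP => e /= e0.
  have [e1 e2] : 0 < complex.Re e /\ e = (complex.Re e)%:C.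
    by move: e0; rewrite ltcE => /andP[/eqP]; case: (e) => a b /= ->.
  apply/nearV; exists (Order.min (de / 4) (complex.Re e / (K + 1))).
    by rewrite lt_min !divr_gt0//; lra.
  move=> h; rewrite subr0 lt_min => /andP[h1 h2].
  rewrite /= !fctE vnE cmodE e2 -rmorphM lecR.
  rewrite opprD addrA [h + y]addrC; apply: le_trans (quad h (ltW h1)) _.
  rewrite -/K expr2 mulrA ler_wpM2r ?vn_ge0//.
  apply: (@le_trans _ _ ((K + 1) * vn h)); first by rewrite ler_wpM2r ?vn_ge0//; lra.
  by rewrite mulrC -ler_pdivlMr ?(ltW h2)//; lra.
have dE := diff_unique Dc key.
by apply/diff_locallyP; rewrite dE.
Qed.

End Holomorphic.

(** * Contour integrals *)

Section RealIntegrals.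
Variable R : realType.
Local Notation mu := (@lebesgue_measure R).
Local Notation U := (`[0%R, 1%R]%classic : set R).

Lemma meas_off_countable (D O : set R) (f : R -> R) : O `<=` D -> measurable O -> countable (D `\` O) ->
  measurable_fun O f -> measurable_fun D f.
Proof.
move=> OD mO cN mf mD Y mY.
rewrite (_ : D `&` f @^-1` Y = (O `&` f @^-1` Y) `|` ((D `\` O) `&` f @^-1` Y)); last first.
  apply/seteqP; split=> [x [Dx Yx]|x [[Ox Yx]|[[Dx _] Yx]]].
  - by have [Ox|nOx] := pselect (O x); [left|right].
  - by split => //; exact: OD.
  - by split.
apply: measurableU; first exact: mf.
apply: countable_measurable => //.
by apply: sub_countable cN; apply: subset_card_le => x [].
Qed.

(** The integrands take junk values at countably many parameters. A countable set has measure zero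
    and all its subsets are measurable, so measurability and integral are inherited from [f']. *)
Lemma int_off_countable (N : set R) (f f' : R -> R) : countable N -> measurable_fun U f' ->
  (forall s, U s -> ~ N s -> f s = f' s) ->
  measurable_fun U f /\ (\int[mu]_(s in U) f s = \int[mu]_(s in U) f' s).
Proof.
move=> cN mf' ff.
have mU : measurable U by [].
have mN : measurable N by exact: countable_measurable.
have mf : measurable_fun U f.
  apply: (@meas_off_countable _ (U `\` N)) => //.
  - exact: measurableD.
  - by apply: sub_countable cN; apply: subset_card_le => x [Ux] /not_andP[//|/contrapT].
  - apply: (@eq_measurable_fun _ _ _ _ _ f').
      by move=> x /[!inE] -[Ux Nx]; rewrite ff.
    by apply: measurable_funS mf'.
split=> //; congr fine; apply: ae_eq_integral => //; try exact/measurable_EFinP.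
exists N; split=> //; first exact: countable_lebesgue_measure0.
move=> x /= /not_implyP[Ux h]; apply: contrapT => Nx; apply: h.
by rewrite ff.
Qed.

Definition bmf (f : R -> R) := measurable_fun U f /\ exists M : R, forall s, U s -> `|f s| <= M.

Lemma muUE : mu U = 1%E.
Proof. by rewrite (lebesgue_measure_itv `[0%R, 1%R]) /= lte01 oppr0 adde0. Qed.
Lemma muU : (mu U < +oo)%E.
Proof. by rewrite muUE ltry. Qed.

Lemma bmf_int f : bmf f -> mu.-integrable U (EFin \o f).
Proof.
move=> [mf [M hM]]; apply: measurable_bounded_integrable => //; first exact: muU.
exists M; split; first exact: num_real.
by move=> r rM x Ux; apply: le_trans (hM x Ux) (ltW rM).
Qed.

Lemma bmfD f g : bmf f -> bmf g -> bmf (fun s => f s + g s).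
Proof.
move=> [mf [M hM]] [mg [N hN]]; split; first exact: measurable_funD.
exists (M + N) => s Us; apply: le_trans (ler_normD _ _) _; exact: lerD (hM s Us) (hN s Us).
Qed.
Lemma bmfM f g : bmf f -> bmf g -> bmf (fun s => f s * g s).
Proof.
move=> [mf [M hM]] [mg [N hN]]; split; first exact: measurable_funM.
by exists (M * N) => s Us; rewrite normrM ler_pM ?hM ?hN.
Qed.
Lemma bmf_cst c : bmf (fun=> c).
Proof. by split; [exact: measurable_cst|exists `|c|]. Qed.
Lemma bmfB f g : bmf f -> bmf g -> bmf (fun s => f s - g s).
Proof.
move=> hf hg; have := bmfD hf (bmfM (bmf_cst (-1)) hg).
by congr bmf; apply/funext => s; rewrite mulN1r.
Qed.

Lemma bmf_cont f : {within U, continuous f} -> bmf f.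
Proof.
move=> cf; split; first exact: subspace_continuous_measurable_fun.
have [M [_ hM]] := compact_bounded (continuous_compact cf (@segment_compact R 0 1)).
exists (`|M| + 1) => s Us; apply: (hM (`|M| + 1)); last by exists s.
by apply: le_lt_trans (ler_norm _) _; rewrite ltrDl.
Qed.

Lemma int_bound f (M : R) : bmf f -> (forall s, U s -> `|f s| <= M) -> `|\int[mu]_(s in U) f s| <= M.
Proof.
move=> hf hM; apply: le_trans (le_normr_Rintegral _ (bmf_int hf)) _ => //.
have hc : bmf (fun=> M) by exact: bmf_cst.
apply: (@le_trans _ _ (\int[mu]_(s in U) M)).
  apply: le_Rintegral => //; last exact: bmf_int.
  apply: (@bmf_int (fun s => `|f s|)); case: hf => mf _; split; first exact: measurableT_comp.
  by exists M => s Us; rewrite normr_id hM.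
have E : fine (mu U) = 1 by rewrite muUE.
by rewrite Rintegral_cst// [X in _ * X]E mulr1.
Qed.

(** Off finitely many points the derivative is continuous, hence measurable. Its one-sided limits
    bound it near each point of the interval, and compactness makes the bound uniform. *)
Lemma pc1_bmf f : piecewise_C1 f -> bmf (derive1 f).
Proof.
move=> [_ [B [h1 h2 h3]]]; pose O := (`]0, 1[ `\` [set` B])%classic : set R.
have oO : open O.
  rewrite /O setDE; apply: openI; first exact: interval_open.
  by apply: closed_openC; apply: compact_closed => //; apply: finite_compact; exact: finite_seq.
split.
  apply: (@meas_off_countable _ O) => //.
  - by move=> x [+ _]; exact: subset_itv_oo_cc.
  - exact: open_measurable.
  - apply: (@sub_countable _ _ _ [set` 0 :: 1 :: B]); last exact/finite_set_countable/finite_seq.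
    apply: subset_card_le => x [+ nO]; rewrite /= in_itv /= => /andP[x0 x1]; rewrite !inE.
    case: eqP => //= xn0; case: eqP => //= xn1; apply: contrapT => xB; apply: nO; split => //=.
    rewrite in_itv /= !lt_neqAle x0 x1 !andbT; apply/andP; split; apply/eqP => e //.
    exact: xn0 (esym e).
  - apply: open_continuous_measurable_fun => // x; rewrite inE => -[x01 xB].
    by have [] := h1 x x01 (introN idP xB).
suff loc x : x \in `[0, 1] -> exists d M : R, 0 < d /\ forall u, U u -> `|u - x| < d -> `|derive1 f u| <= M.
  have cpt := (compact_near_coveringP _).1 (@segment_compact R 0 1).
  have [|M [_ hM]] := cpt _ (@pinfty_nbhs R) (fun M x => U x -> `|derive1 f x| <= M) _.
    move=> x Ux; have [d [M [d0 hd]]] := loc x Ux.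
    exists (ball x d, [set i | M <= i]) => /=.
      split; first exact: nbhsx_ballx.
      by exists M; split; [exact: num_real|move=> y /ltW].
    move=> [u i] /= [bu Mi] Uu; apply: le_trans Mi; apply: hd => //.
    by move: bu; rewrite /ball /= distrC.
  by exists (M + 1) => s Us; apply: hM => //=; rewrite ltrDl.
rewrite in_itv /= => /andP[x0 x1].
have lim1 (Q : R -> bool) : cvg (derive1 f u @[u --> within Q (nbhs x)]) -> ProperFilter (within Q (nbhs x)) ->
    exists d M : R, 0 < d /\ forall u, Q u -> `|u - x| < d -> `|derive1 f u| <= M.
  move=> cf pf; move/cvgrPdist_lt: cf => /(_ 1 ltr01) /nbhs_ballP[d /= d0 hd].
  exists d, (`|lim (derive1 f u @[u --> within Q (nbhs x)])| + 1); split => // u Qu ux.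
  have := hd u; rewrite /ball /= distrC => /(_ ux Qu); rewrite distrC => h.
  by rewrite -lerBlDl; apply: le_trans (lerB_dist _ _) (ltW h).
have [dr [Mr [dr0 hr]]] : exists d M : R, 0 < d /\ forall u, U u -> x < u -> `|u - x| < d -> `|derive1 f u| <= M.
  have [x1'|x1'] := eqVneq x 1.
    exists 1, 0; split => // u; rewrite /= in_itv /= x1' => /andP[_ u1] u2.
    by move: (lt_le_trans u2 u1); rewrite ltxx.
  have [|d [M [d0 hd]]] := lim1 (fun u => x < u) _ (at_right_proper_filter x); last by exists d, M; split=> // u _; exact: hd.
  by apply: h2; rewrite in_itv /= x0 lt_neqAle x1'.
have [dl [Ml [dl0 hl]]] : exists d M : R, 0 < d /\ forall u, U u -> u < x -> `|u - x| < d -> `|derive1 f u| <= M.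
  have [x1'|x1'] := eqVneq x 0.
    exists 1, 0; split => // u; rewrite /= in_itv /= x1' => /andP[u1 _] u2.
    by move: (le_lt_trans u1 u2); rewrite ltxx.
  have [|d [M [d0 hd]]] := lim1 (fun u => u < x) _ (at_left_proper_filter x); last by exists d, M; split=> // u _; exact: hd.
  by apply: h3; rewrite in_itv /= x1 lt_neqAle eq_sym x1' x0.
exists (Order.min dr dl), (Order.max (Order.max Mr Ml) `|derive1 f x|); split; first by rewrite lt_min dr0.
move=> u Uu; rewrite lt_min => /andP[u1 u2]; rewrite !le_max.
have [ux|ux|->] := ltgtP u x; last by rewrite lexx orbT.
  by rewrite (hl u)// orbT.
by rewrite (hr u).
Qed.

(** The exceptional points are removed one at a time by splitting the interval at each of them;
    continuity glues the pieces. *)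
Lemma derive_zero_cst (G : R -> R) (B : seq R) a b : a <= b -> {within `[a, b], continuous G} ->
  (forall s, s \in `]a, b[ -> s \notin B -> is_derive s 1 G 0) -> G a = G b.
Proof.
elim: B a b => [|c B IH] a b ab cG dG.
  have [|c _ E] := @MVT_segment _ G (fun=> 0) a b ab _ cG; first by move=> x /dG; exact.
  by apply/esym/eqP; rewrite -subr_eq0 E mul0r.
have [cab|cab] := boolP (c \in `]a, b[); last first.
  apply: IH => // s sab sB; apply: dG => //; rewrite inE negb_or sB andbT.
  by apply: contraNneq cab => <-.
move: (cab); rewrite in_itv /= => /andP[ac cb].
have h1 : G a = G c.
  refine (IH a c (ltW ac) _ _).
    by apply: continuous_subspaceW cG; apply: subset_itv; rewrite bnd_simp// ltW.
  move=> s; rewrite in_itv /= => /andP[s1 s2] sB; apply: dG.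
    by rewrite in_itv /= s1 (lt_trans s2).
  by rewrite inE negb_or sB andbT lt_eqF.
have cb' : c <= b by exact: ltW.
have h2 : {within `[c, b], continuous G}.
  by apply: continuous_subspaceW cG; apply: subset_itv; rewrite bnd_simp// ltW.
have h3 : forall s, s \in `]c, b[ -> s \notin B -> is_derive s 1 G 0.
  move=> s; rewrite in_itv /= => /andP[s1 s2] sB; apply: dG.
    by rewrite in_itv /= s2 (lt_trans ac).
  by rewrite inE negb_or sB andbT gt_eqF.
have h4 := IH c b.
have h5 := h4 cb'.
have h6 := h5 h2.
have h7 := h6 h3.
exact: etrans h1 h7.
Qed.

(** The difference of [G] and the indefinite integral [F] is continuous with derivative zero off
    [B]. *)
Lemma FTC_piecewise (G f : R -> R) (B : seq R) : bmf f -> {within `[0, 1], continuous G} ->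
  (forall s, s \in `]0, 1[ -> s \notin B -> is_derive s 1 G (f s) /\ {for s, continuous f}) ->
  \int[mu]_(s in U) f s = G 1 - G 0.
Proof.
move=> bf cG h; have intf := bmf_int bf.
pose F x := (\int[mu]_(t in [set` `[0%R, x]]) f t)%R.
have cF : {within `[0, 1], continuous F}.
  exact: (@parameterized_integral_continuous _ _ _ f ler01 intf).
have F0 : F 0 = 0 by rewrite /F set_itv1 Rintegral_set1.
suff : G 0 - F 0 = G 1 - F 1 by rewrite F0 subr0 => ->; rewrite opprB addrC subrK.
apply: (@derive_zero_cst (fun x => G x - F x) B); first exact: ler01.
  by move=> x; apply: cvgB; [exact: cG|exact: cF].
move=> s s01 sB; have [dG cf] := h s s01 sB.
move: (s01); rewrite in_itv /= => /andP[s0 s1].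
have [dF F'] := @continuous_FTC1_closed _ f 0 s 1 s1 intf s0 cf.
have isF : is_derive s 1 F (f s) by apply: DeriveDef; [exact: dF|rewrite -derive1E; exact: F'].
have := is_deriveB dG isF; rewrite subrr; apply.
Qed.

End RealIntegrals.

Section ComplexCurves.
Variable R : realType.
Local Notation C := (CC R).
Local Notation mu := (@lebesgue_measure R).
Local Notation U := (`[0%R, 1%R]%classic : set R).
Local Notation Re := (@complex.Re R).
Local Notation Im := (@complex.Im R).

(** Real and imaginary parts are treated separately, as contours and their integrals are defined
    through them. *)
Definition cbm (u : R -> C) := bmf (fun s => Re (u s)) /\ bmf (fun s => Im (u s)).
Definition cc (u : R -> C) :=
  {within U, continuous (fun s => Re (u s))} /\ {within U, continuous (fun s => Im (u s))}.
Definition ccat (u : R -> C) (s : R) :=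
  {for s, continuous (fun s => Re (u s))} /\ {for s, continuous (fun s => Im (u s))}.
Definition rder (f : R -> R) (s d : R) : Prop := is_derive s 1 f d.
Definition cder (u : R -> C) (s : R) (d : C) :=
  rder (fun s => Re (u s)) s (Re d) /\ rder (fun s => Im (u s)) s (Im d).
Definition cint (w : R -> C) : C :=
  (\int[mu]_(s in U) Re (w s)) +i* (\int[mu]_(s in U) Im (w s)).

Lemma ReM (a b : C) : Re (a * b) = Re a * Re b - Im a * Im b.
Proof. by case: a => ? ?; case: b. Qed.
Lemma ImM (a b : C) : Im (a * b) = Re a * Im b + Im a * Re b.
Proof. by case: a => ? ?; case: b. Qed.
Lemma ReD (a b : C) : Re (a + b) = Re a + Re b.
Proof. by case: a => ? ?; case: b. Qed.
Lemma ImD (a b : C) : Im (a + b) = Im a + Im b.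
Proof. by case: a => ? ?; case: b. Qed.
Lemma ReV (a : C) : Re a^-1 = Re a * (Re a * Re a + Im a * Im a)^-1.
Proof. by case: a => a b; rewrite /GRing.inv /= !expr2. Qed.
Lemma ImV (a : C) : Im a^-1 = - (Im a * (Re a * Re a + Im a * Im a)^-1).
Proof. by case: a => a b; rewrite /GRing.inv /= !expr2. Qed.
Lemma ReDf (u v : R -> C) : (fun s => Re (u s + v s)) = (fun s => Re (u s) + Re (v s)).
Proof. by apply/funext => s; rewrite ReD. Qed.
Lemma ImDf (u v : R -> C) : (fun s => Im (u s + v s)) = (fun s => Im (u s) + Im (v s)).
Proof. by apply/funext => s; rewrite ImD. Qed.
Lemma ReMf (u v : R -> C) : (fun s => Re (u s * v s)) = (fun s => Re (u s) * Re (v s) - Im (u s) * Im (v s)).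
Proof. by apply/funext => s; rewrite ReM. Qed.
Lemma ImMf (u v : R -> C) : (fun s => Im (u s * v s)) = (fun s => Re (u s) * Im (v s) + Im (u s) * Re (v s)).
Proof. by apply/funext => s; rewrite ImM. Qed.
Lemma ReVf (u : R -> C) : (fun s => Re (u s)^-1) =
  (fun s => Re (u s) * (Re (u s) * Re (u s) + Im (u s) * Im (u s))^-1).
Proof. by apply/funext => s; rewrite ReV. Qed.
Lemma ImVf (u : R -> C) : (fun s => Im (u s)^-1) =
  (fun s => - (Im (u s) * (Re (u s) * Re (u s) + Im (u s) * Im (u s))^-1)).
Proof. by apply/funext => s; rewrite ImV. Qed.
Lemma ReIm_eq (a b : C) : Re a = Re b -> Im a = Im b -> a = b.
Proof. by case: a => a a'; case: b => b b' /= -> ->. Qed.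
Lemma normsq_neq0 (a : C) : a != 0 -> Re a * Re a + Im a * Im a != 0.
Proof.
case: a => a b; apply: contra => /= /eqP h.
have := sqr_ge0 a; have := sqr_ge0 b; rewrite !expr2 => hb ha.
have /eqP : a * a = 0 by lra. have /eqP : b * b = 0 by lra.
by rewrite !mulf_eq0 !orbb => /eqP -> /eqP ->.
Qed.

Lemma cbm_cst c : cbm (fun=> c). Proof. by split; exact: bmf_cst. Qed.
Lemma cbmM u v : cbm u -> cbm v -> cbm (fun s => u s * v s).
Proof.
move=> [a b] [c d]; split; [have := bmfB (bmfM a c) (bmfM b d)|have := bmfD (bmfM a d) (bmfM b c)]; congr bmf;
by apply/funext => s; rewrite ?ReM ?ImM.
Qed.
Lemma cc_cbm u : cc u -> cbm u.
Proof. by move=> [a b]; split; exact: bmf_cont. Qed.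

Lemma cc_cst c : cc (fun=> c).
Proof. by split => x; exact: cvg_cst. Qed.
Lemma ccD u v : cc u -> cc v -> cc (fun s => u s + v s).
Proof.
move=> [a b] [c d]; split.
  by rewrite ReDf; move=> x; apply: cvgD; [exact: a|exact: c].
by rewrite ImDf; move=> x; apply: cvgD; [exact: b|exact: d].
Qed.
Lemma ccM u v : cc u -> cc v -> cc (fun s => u s * v s).
Proof.
move=> [a b] [c d]; split.
  by rewrite ReMf; move=> x; apply: cvgB; apply: cvgM; [exact: a|exact: c|exact: b|exact: d].
by rewrite ImMf; move=> x; apply: cvgD; apply: cvgM; [exact: a|exact: d|exact: b|exact: c].
Qed.
Lemma cc_eq u v : (forall s, u s = v s) -> cc u -> cc v.
Proof. by move=> uv; congr cc; exact/funext. Qed.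
Lemma ccB u v : cc u -> cc v -> cc (fun s => u s - v s).
Proof. by move=> a b; apply: cc_eq (ccD a (ccM (cc_cst (-1)) b)) => s; rewrite mulN1r. Qed.

Lemma within_ulim (f : R -> R) : (forall e : R, 0 < e -> exists2 h : R -> R, {within U, continuous h} &
   forall s, U s -> `|f s - h s| <= e) -> {within U, continuous f}.
Proof.
move=> H x; apply/cvgrPdist_lt => e e0.
have e4 : 0 < e / 4 by rewrite divr_gt0.
have [h ch hh] := H _ e4.
have [xU|xU] := pselect (U x); last first.
  by rewrite -[nbhs_subspace _]nbhs_subspace_out// => _ ->; rewrite subrr normr0.
move/cvgrPdist_lt: (ch x) => /(_ _ e4) h1.
have h1' : within U (nbhs (x : R)) [set t | `|h x - h t| < e / 4].
  by rewrite nbhs_subspace_in//; exact: h1.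
rewrite -[nbhs_subspace _]nbhs_subspace_in//.
move: h1'; rewrite /within /=; apply: filterS => y /= hy yU; have hxy := hy yU; rewrite /from_subspace.
have -> : f x - f y = (f x - h x) + (h x - h y) - (f y - h y) by ring.
have := hh x xU; have := hh y yU.
have := ler_normB (f x - h x + (h x - h y)) (f y - h y); have := ler_normD (f x - h x) (h x - h y); lra.
Qed.

Lemma cc_ulim u : (forall e : R, 0 < e -> exists2 v, cc v & forall s, U s -> cmod (u s - v s) <= e) -> cc u.
Proof.
move=> H; split; apply: within_ulim => e /H[v [cv1 cv2] hv].
  exists (fun s => Re (v s)) => // s /hv; apply: le_trans; apply: le_trans (cmod_Re _).
  by rewrite (raddfB (@complex.Re R)).
exists (fun s => Im (v s)) => // s /hv; apply: le_trans; apply: le_trans (cmod_Im _).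
by rewrite (raddfB (@complex.Im R)).
Qed.

Lemma within_inv (f : R -> R) : {within U, continuous f} -> (forall s, U s -> f s != 0) -> {within U, continuous (fun s => (f s)^-1)}.
Proof.
move=> cf f0 x; have [xU|xU] := pselect (U x); first by apply: cvgV; [exact: f0|exact: cf].
apply/cvgrPdist_lt => e e0.
by rewrite -[nbhs_subspace _]nbhs_subspace_out// => _ ->; rewrite subrr normr0.
Qed.

Lemma ccV u : cc u -> (forall s, U s -> u s != 0) -> cc (fun s => (u s)^-1).
Proof.
move=> [a b] u0.
have cn : {within U, continuous (fun s => (Re (u s) * Re (u s) + Im (u s) * Im (u s))^-1)}.
  apply: within_inv => [x|s Us]; last by apply: normsq_neq0; exact: u0.
  by apply: cvgD; apply: cvgM; [exact: a|exact: a|exact: b|exact: b].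
split.
  by rewrite ReVf; move=> x; apply: cvgM; [exact: a|exact: cn].
by rewrite ImVf; move=> x; apply: cvgN; apply: cvgM; [exact: b|exact: cn].
Qed.

Lemma cc_exprz u (m : int) : cc u -> (forall s, U s -> u s != 0) -> cc (fun s => u s ^ m).
Proof.
move=> cu u0.
have hn n : cc (fun s => u s ^+ n).
  elim: n => [|n IH]; first by apply: cc_eq (cc_cst 1) => s; rewrite expr0.
  by apply: cc_eq (ccM cu IH) => s; rewrite exprS.
case: m => n; first by apply: cc_eq (hn n) => s; rewrite exprnP.
apply: cc_eq (ccV (hn n.+1) _) => s; last by move=> Us; rewrite expf_neq0// u0.
by rewrite NegzE -exprnN.
Qed.

Lemma cc_sum I (s : seq I) (F : I -> R -> C) : (forall i, cc (F i)) -> cc (fun t => \sum_(i <- s) F i t).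
Proof.
move=> h; elim: s => [|i s IH]; first by apply: cc_eq (cc_cst 0) => t; rewrite big_nil.
by apply: cc_eq (ccD (h i) IH) => t; rewrite big_cons.
Qed.

Lemma ccatM u v s : ccat u s -> ccat v s -> ccat (fun s => u s * v s) s.
Proof.
move=> [a b] [c d]; split; rewrite /prop_for.
  by rewrite ReMf; apply: cvgB; apply: cvgM; [exact: a|exact: c|exact: b|exact: d].
by rewrite ImMf; apply: cvgD; apply: cvgM; [exact: a|exact: d|exact: b|exact: c].
Qed.

Lemma rder_eq (f : R -> R) (s d d' : R) : rder f s d -> d = d' -> rder f s d'.
Proof. by move=> h <-. Qed.
Lemma rder_cst (c s : R) : rder (fun=> c) s 0. Proof. exact: is_derive_cst. Qed.
Lemma rderD (f h : R -> R) (s d e : R) : rder f s d -> rder h s e -> rder (fun s => f s + h s) s (d + e).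
Proof. by rewrite /rder => a b; exact: is_deriveD. Qed.
Lemma rderB (f h : R -> R) (s d e : R) : rder f s d -> rder h s e -> rder (fun s => f s - h s) s (d - e).
Proof. by rewrite /rder => a b; exact: is_deriveB. Qed.
Lemma rderN (f : R -> R) (s d : R) : rder f s d -> rder (fun s => - f s) s (- d).
Proof. by rewrite /rder => a; exact: is_deriveN. Qed.
Lemma rderM (f h : R -> R) (s d e : R) : rder f s d -> rder h s e -> rder (fun s => f s * h s) s (f s * e + h s * d).
Proof. by rewrite /rder => a b; exact: is_deriveM. Qed.
Lemma rderV (f : R -> R) (s d : R) : f s != 0 -> rder f s d -> rder (fun s => (f s)^-1) s (- (f s ^- 2) * d).
Proof. by rewrite /rder => f0 a; have := is_deriveV f0 a. Qed.
Lemma rder_cont (f : R -> R) (s d : R) : rder f s d -> {for s, continuous f}.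
Proof. by move=> [h _]; apply: differentiable_continuous; exact/derivable1_diffP. Qed.
Lemma rder_derive1 (f : R -> R) (s : R) : derivable f s 1 -> rder f s (derive1 f s).
Proof. by rewrite derive1E => h; exact: derivableP. Qed.

Lemma cder_ccat u s d : cder u s d -> ccat u s.
Proof.
by move=> [a b]; split; [exact: rder_cont a|exact: rder_cont b].
Qed.

Lemma cder_eq u s d d' : d = d' -> cder u s d -> cder u s d'. Proof. by move=> ->. Qed.
Lemma cder_ext u v s d : (forall s, u s = v s) -> cder u s d -> cder v s d.
Proof. by move=> uv; rewrite (_ : u = v)//; exact/funext. Qed.

Lemma cder_cst c s : cder (fun=> c) s 0.
Proof. by split; exact: rder_cst. Qed.

Lemma cderD u v s d e : cder u s d -> cder v s e -> cder (fun s => u s + v s) s (d + e).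
Proof.
move=> [a b] [a' b']; split.
  by rewrite ReDf; rewrite ReD; exact: rderD.
by rewrite ImDf; rewrite ImD; exact: rderD.
Qed.

Lemma cderM u v s d e : cder u s d -> cder v s e -> cder (fun s => u s * v s) s (u s * e + v s * d).
Proof.
move=> [a b] [a' b']; split.
  rewrite ReMf.
  apply: rder_eq; first exact: (rderB (rderM a a') (rderM b b')).
  by rewrite ReD !ReM; ring.
rewrite ImMf.
apply: rder_eq; first exact: (rderD (rderM a b') (rderM b a')).
by rewrite ImD !ImM; ring.
Qed.

Lemma cderX u s d n : cder u s d -> cder (fun s => u s ^+ n.+1) s (n.+1%:R * u s ^+ n * d).
Proof.
move=> h; elim: n => [|n IH].
  by apply: cder_ext (cder_eq _ h) => [s'|]; rewrite ?expr1// expr0 !mul1r.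
apply: cder_ext (cder_eq _ (cderM h IH)) => [s'|]; first by rewrite [in RHS]exprS.
by rewrite -[in RHS]natr1 [u s ^+ n.+1]exprS; ring.
Qed.

Lemma cderV u s d : u s != 0 -> cder u s d -> cder (fun s => (u s)^-1) s (- d / u s ^+ 2).
Proof.
move=> u0 [a b].
pose n s := Re (u s) * Re (u s) + Im (u s) * Im (u s).
have dn := is_deriveD (rderM a a) (rderM b b).
have n0 : n s != 0 by exact: normsq_neq0.
have dn' := rderV (f := n) n0 dn.
have E : (- d / u s ^+ 2) = - d * (u s)^-1 * (u s)^-1 by rewrite expr2 invfM mulrA.
have N0 := normsq_neq0 u0.
split.
  rewrite ReVf.
  apply: rder_eq; first exact: (rderM a dn').
  rewrite E !(ReM, ImM) !(ReV, ImV) /n; case: (d) => x y /=.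
  by field.
rewrite ImVf.
apply: rder_eq; first exact: (rderN (rderM b dn')).
rewrite E !(ReM, ImM) !(ReV, ImV) /n; case: (d) => x y /=.
by field.
Qed.

Lemma cderXz u s d (m : int) : u s != 0 -> cder u s d -> cder (fun s => u s ^ (m + 1)) s ((m + 1)%:~R * u s ^ m * d).
Proof.
move=> u0 h; case: m => n.
  apply: cder_ext (cder_eq _ (cderX n h)) => [s'|]; first by rewrite exprnP -addn1.
  by rewrite -exprnP (_ : Posz n + 1 = n.+1%:Z)//; lia.
rewrite NegzE; case: n => [|n].
  apply: cder_ext (cder_eq _ (cder_cst 1 s)) => [s'|]; first by rewrite addNr expr0z.
  by rewrite addNr mulr0z !mul0r.
have -> : - n.+2%:Z + 1 = - n.+1%:Z by lia.
apply: cder_ext (cder_eq _ (cderV _ (cderX n h))) => [s'||]; first by rewrite -exprnN.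
  rewrite -exprnN mulrNz -pmulrn.
  have e1 : u s ^+ n.+2 = u s * (u s * u s ^+ n) by rewrite !exprS.
  by rewrite e1 [u s ^+ n.+1]exprS; field; rewrite u0 expf_neq0.
by rewrite expf_neq0.
Qed.

Lemma cintD u v : cbm u -> cbm v -> cint (fun s => u s + v s) = cint u + cint v.
Proof.
move=> [a b] [c d]; rewrite /cint.
under eq_Rintegral do rewrite ReD.
under [X in _ +i* X]eq_Rintegral do rewrite ImD.
by rewrite !RintegralD//; exact: bmf_int.
Qed.

Lemma cintZ c u : cbm u -> cint (fun s => c * u s) = c * cint u.
Proof.
move=> [a b]; rewrite /cint.
have hZ r f : bmf f -> \int[mu]_(s in U) (r * f s) = r * \int[mu]_(s in U) f s.
  by move=> bf; rewrite RintegralZl//; exact: bmf_int.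
have hi r f : bmf f -> mu.-integrable U (EFin \o (fun s => r * f s)).
  by move=> bf; apply: bmf_int; apply: bmfM => //; exact: bmf_cst.
apply: ReIm_eq; rewrite ?ReM ?ImM /=.
  have E : (fun s => Re (c * u s)) = (fun s => Re c * Re (u s) - Im c * Im (u s)).
    by apply/funext => s; rewrite ReM.
  rewrite -!hZ// E.
  by rewrite RintegralB//; exact: hi.
have E : (fun s => Im (c * u s)) = (fun s => Re c * Im (u s) + Im c * Re (u s)).
  by apply/funext => s; rewrite ImM.
rewrite -!hZ// E.
by rewrite RintegralD//; exact: hi.
Qed.

Lemma cint_le u (M : R) : cbm u -> (forall s, U s -> cmod (u s) <= M) -> cmod (cint u) <= 2 * M.
Proof.
move=> [a b] h; apply: le_trans (cmod_ReIm _) _; rewrite /= mulr_natl mulr2n; apply: lerD.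
  by apply: int_bound => // s Us; apply: le_trans (cmod_Re _) (h s Us).
by apply: int_bound => // s Us; apply: le_trans (cmod_Im _) (h s Us).
Qed.

Lemma cint_off (N : set R) u v : countable N -> cbm v -> (forall s, U s -> ~ N s -> u s = v s) -> cint u = cint v.
Proof.
move=> cN [[a _] [b _]] uv; rewrite /cint.
have [_ ->] := int_off_countable cN a (fun s Us Ns => congr1 Re (uv s Us Ns)).
by have [_ ->] := int_off_countable cN b (fun s Us Ns => congr1 Im (uv s Us Ns)).
Qed.

Lemma cint_ext u v : (forall s, U s -> u s = v s) -> cint u = cint v.
Proof.
move=> uv; rewrite /cint; congr (_ +i* _); apply: eq_Rintegral => s; rewrite inE => Us; by rewrite uv.
Qed.

Lemma cFTC (u w : R -> C) (B : seq R) : cbm w -> cc u ->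
  (forall s, s \in `]0, 1[ -> s \notin B -> cder u s (w s) /\ ccat w s) -> cint w = u 1 - u 0.
Proof.
move=> [bw1 bw2] [cu1 cu2] h; apply: ReIm_eq.
  rewrite (raddfB (@complex.Re R)) /=.
  apply: (@FTC_piecewise _ (fun s => Re (u s)) (fun s => Re (w s)) B) => // s s1 s2.
  by have [[d _] [c _]] := h s s1 s2.
rewrite (raddfB (@complex.Im R)) /=.
apply: (@FTC_piecewise _ (fun s => Im (u s)) (fun s => Im (w s)) B) => // s s1 s2.
by have [[_ d] [_ c]] := h s s1 s2.
Qed.

(** The integrand is the derivative of v^(m+1) / (m+1) along a closed curve. *)
Lemma int_dpow (v v' : R -> C) (B : seq R) (m : int) : cc v -> cbm v' -> (forall s, U s -> v s != 0) ->
  v 0 = v 1 -> m != -1 ->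
  (forall s, s \in `]0, 1[ -> s \notin B -> cder v s (v' s) /\ ccat v' s) ->
  cint (fun s => v s ^ m * v' s) = 0.
Proof.
move=> cv bv v0 v01 m1 h.
have m10 : (m + 1)%:~R != 0 :> C by rewrite intr_eq0 addr_eq0.
have bw : cbm (fun s => v s ^ m * v' s) by apply: cbmM => //; apply: cc_cbm; exact: cc_exprz.
have cw (m' : int) : cc (fun s => v s ^ m') by exact: cc_exprz.
have := @cFTC (fun s => ((m + 1)%:~R)^-1 * v s ^ (m + 1)) (fun s => v s ^ m * v' s) B bw.
rewrite v01 subrr; apply; first by apply: ccM => //; exact: cc_cst.
move=> s s01 sB; have [d c] := h s s01 sB.
have vs : v s != 0 by apply: v0; exact: subset_itv_oo_cc.
split.
  have := cderM (cder_cst ((m + 1)%:~R)^-1 s) (cderXz m vs d).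
  by apply: cder_eq; rewrite mulr0 addr0 !mulrA mulVf// mul1r.
apply: ccatM => //.
have [->|mp] := eqVneq m 0; first by apply: (@cder_ccat _ _ 0); apply: cder_ext (cder_cst 1 s) => s'; rewrite expr0z.
have := cderXz (m - 1) vs d; rewrite subrK; exact: cder_ccat.
Qed.

End ComplexCurves.

Section Contour.
Variable R : realType.
Local Notation C := (CC R).
Local Notation U := (`[0%R, 1%R]%classic : set R).
Variable g : R -> C.
Hypothesis hg : closed_contour g.

Lemma contour_cc : cc g.
Proof. by case: hg => -[a _] [b _] _ _. Qed.

Lemma contour_cbm : cbm (curve_deriv g).
Proof. by case: hg => a b _ _; split; [exact: (pc1_bmf a)|exact: (pc1_bmf b)]. Qed.

Lemma contour_good : exists B : seq R, forall s, s \in `]0, 1[ -> s \notin B ->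
  cder g s (curve_deriv g s) /\ ccat (curve_deriv g) s.
Proof.
case: hg => -[_ [B [h1 _ _]]] [_ [B' [h1' _ _]]] _ _.
exists (B ++ B') => s s01; rewrite mem_cat negb_or => /andP[sB sB'].
have [d c] := h1 s s01 sB; have [d' c'] := h1' s s01 sB'.
by split; [split; [exact: (rder_derive1 d)|exact: (rder_derive1 d')]|split; [exact: c|exact: c']].
Qed.

Lemma contour_closed : g 0 = g 1. Proof. by case: hg. Qed.

Lemma contour_intE f : contour_integral g f = cint (fun s => f (g s) * curve_deriv g s).
Proof. by []. Qed.

Definition oint (phi : C -> C) : C := two_pi_i^-1 * contour_integral g (fun z => phi z / z).
Definition gok (phi : C -> C) := cc (fun s => phi (g s)).

Hypothesis g0 : avoids g 0.

Lemma avoidsU a s : avoids g a -> U s -> g s != a. Proof. by move=> h Us; apply: h. Qed.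

Lemma gok_cst c : gok (fun=> c). Proof. exact: cc_cst. Qed.
Lemma gokD f h : gok f -> gok h -> gok (fun z => f z + h z). Proof. exact: ccD. Qed.
Lemma gokM f h : gok f -> gok h -> gok (fun z => f z * h z). Proof. exact: ccM. Qed.
Lemma gok_id : gok id. Proof. exact: contour_cc. Qed.
Lemma gokV f : gok f -> (forall s, U s -> f (g s) != 0) -> gok (fun z => (f z)^-1). Proof. exact: ccV. Qed.
Lemma gok_exprz (m : int) : gok (fun z => z ^ m).
Proof. by apply: cc_exprz; [exact: contour_cc|move=> s Us; exact: avoidsU]. Qed.

Lemma gok_bm f : gok f -> cbm (fun s => f (g s) / g s * curve_deriv g s).
Proof.
move=> h; apply: cbmM; last exact: contour_cbm.
apply: cc_cbm; apply: ccM => //; apply: ccV; first exact: contour_cc.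
by move=> s Us; exact: avoidsU.
Qed.

Lemma ointD f h : gok f -> gok h -> oint (fun z => f z + h z) = oint f + oint h.
Proof.
move=> a b; rewrite /oint !contour_intE -mulrDr -cintD; try exact: gok_bm.
by congr (_ * cint _); apply/funext => s; rewrite !mulrDl.
Qed.

Lemma ointZ c f : gok f -> oint (fun z => c * f z) = c * oint f.
Proof.
move=> a; rewrite /oint !contour_intE mulrCA -(cintZ c (gok_bm a)).
by congr (_ * cint _); apply/funext => s; rewrite !mulrA.
Qed.

Lemma oint_ext f h : (forall s, U s -> f (g s) = h (g s)) -> oint f = oint h.
Proof. by move=> e; rewrite /oint !contour_intE; congr (_ * _); apply: cint_ext => s Us; rewrite e. Qed.

Lemma tpi_neq0 : two_pi_i != 0 :> C.
Proof. by rewrite -cmod_gt0; apply: lt_le_trans (cmod_Im _); rewrite /= normr_gt0 mulf_neq0// gt_eqF// pi_gt0. Qed.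

Lemma oint_pow (lam lam' : C -> C) (m : int) : gok lam -> gok lam' -> (forall s, U s -> lam (g s) != 0) -> m != -1 ->
  (forall s d, g s != 0 -> cder g s d -> cder (fun s => lam (g s)) s (lam' (g s) * d)) ->
  (forall s, g s != 0 -> ccat g s -> ccat (fun s => lam' (g s)) s) ->
  oint (fun z => z * (lam z ^ m * lam' z)) = 0.
Proof.
move=> cl cl' l0 m1 hd hc; have [B hB] := contour_good.
have := @int_dpow _ (fun s => lam (g s)) (fun s => lam' (g s) * curve_deriv g s) B m cl _ l0 _ m1.
rewrite /oint contour_intE => H.
rewrite -[RHS](mulr0 two_pi_i^-1) -H.
- congr (_ * _); apply: cint_ext => s Us /=; have gs := avoidsU g0 Us.
  by field; rewrite gs.
- by apply: cbmM; [exact: cc_cbm|exact: contour_cbm].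
- by rewrite contour_closed.
- move=> s s01 sB; have [d c] := hB s s01 sB.
  have gs : g s != 0 by apply: g0; exact: subset_itv_oo_cc.
  split; first exact: hd.
  by apply: ccatM => //; apply: hc => //; exact: cder_ccat d.
Qed.

Lemma ccat_cst (c : C) s : ccat (fun=> c) s.
Proof. exact: cder_ccat (cder_cst c s). Qed.

Lemma oint_exp (k : int) : k != 0 -> oint (fun z => z ^ k) = 0.
Proof.
move=> k0; have m1 : k - 1 != -1 by rewrite subr_eq addNr.
have := @oint_pow id (fun=> 1) (k - 1) gok_id (gok_cst 1) (fun s Us => avoidsU g0 Us) m1.
move=> <-.
- apply: oint_ext => s Us /=; have gs := avoidsU g0 Us.
  rewrite mulr1 (_ : g s ^ k = g s ^ (1 + (k - 1))); last by congr (_ ^ _); lia.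
  by rewrite expfzDr// expr1z.
- by move=> s d _ h /=; rewrite mul1r.
- by move=> s _ _; exact: ccat_cst.
Qed.

(** For d = 0 the integral is a multiple of the winding number around x^-1, which is 0; for d > 0
    the form dz / (1 - x z)^(d+1) has a primitive. *)
Lemma oint_out (x : C) d : x != 0 -> excludes g x^-1 -> oint (fun z => z / (1 - x * z) ^+ d.+1) = 0.
Proof.
move=> x0 [av W].
have nz s : U s -> 1 - x * g s != 0.
  move=> Us; rewrite subr_eq0 eq_sym; apply: contraNneq (av s Us) => h.
  by rewrite -[g s]mul1r -(mulVf x0) -mulrA h mulr1.
case: d => [|d].
  rewrite /oint contour_intE; move: W; rewrite /winding_number contour_intE => W.
  have b : cbm (fun s => (g s - x^-1)^-1 * curve_deriv g s).
    apply: cbmM; last exact: contour_cbm.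
    apply: cc_cbm; apply: ccV; first by apply: ccB; [exact: contour_cc|exact: cc_cst].
    by move=> s Us; rewrite subr_eq0; exact: av.
  rewrite (@cint_ext _ _ (fun s => - x^-1 * ((g s - x^-1)^-1 * curve_deriv g s))).
    by rewrite cintZ// mulrCA W mulr0.
  move=> s Us; have gs := avoidsU g0 Us; have ns := nz s Us; rewrite expr1 mulrA; congr (_ * _).
  have ns' : g s - x^-1 != 0 by rewrite subr_eq0; exact: av.
  have -> : g s - x^-1 = - (1 - x * g s) / x by field.
  by field; rewrite gs x0 ns.
have m1 : - d.+2%:Z != -1 :> int by lia.
have ok : gok (fun z => 1 - x * z).
  by apply: ccB; [exact: cc_cst|apply: ccM; [exact: cc_cst|exact: contour_cc]].
have := @oint_pow (fun z => 1 - x * z) (fun=> - x) (- d.+2%:Z) ok (gok_cst _) nz m1.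
move=> H; rewrite (_ : oint _ = - x^-1 * oint (fun z => z * ((1 - x * z) ^ (- d.+2%:Z) * - x))).
  rewrite H ?mulr0//.
  - move=> s e gs h.
    have D := cderD (cder_cst 1 s) (cderM (cder_cst (- x) s) h).
    by apply: cder_ext (cder_eq _ D) => [s'|]; rewrite ?mulNr ?mulr0 ?addr0 ?add0r.
  - by move=> s _ _; exact: ccat_cst.
rewrite -ointZ; last first.
  apply: gokM; first exact: gok_id.
  by apply: gokM; [exact: cc_exprz|exact: gok_cst].
apply: oint_ext => s Us; rewrite -exprnN.
have X0 : (1 - x * g s) ^+ d.+2 != 0 by rewrite expf_neq0// nz.
by move: (_ ^+ d.+2) X0 => Y Y0; field; rewrite x0 Y0.
Qed.

(** For d = 0 the form is y^-1 (1/(z - y) - 1/z) dz, and both winding numbers are 1; for d > 0 there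
    is a primitive. *)
Lemma oint_in (y : C) d : y != 0 -> winding_number g 0 = 1 -> encloses g y ->
  oint (fun z => z^-1 / (1 - y / z) ^+ d.+1) = 0.
Proof.
move=> y0 W0 [av W].
have nz s : U s -> 1 - y / g s != 0.
  move=> Us; have gs := avoidsU g0 Us; rewrite subr_eq0 eq_sym; apply: contraNneq (av s Us) => h.
  by rewrite -[g s]mul1r -h mulfVK.
have okV : gok (fun z => z^-1) by apply: gokV; [exact: gok_id|move=> s Us; exact: avoidsU].
case: d => [|d].
  rewrite /oint contour_intE; move: W W0; rewrite /winding_number !contour_intE => W W0.
  have b a : avoids g a -> cbm (fun s => (g s - a)^-1 * curve_deriv g s).
    move=> ava; apply: cbmM; last exact: contour_cbm.
    apply: cc_cbm; apply: ccV; first by apply: ccB; [exact: contour_cc|exact: cc_cst].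
    by move=> s Us; rewrite subr_eq0; exact: ava.
  rewrite (@cint_ext _ _ (fun s => y^-1 * ((g s - y)^-1 * curve_deriv g s) + - y^-1 * ((g s - 0)^-1 * curve_deriv g s))).
    rewrite cintD; last 2 first.
    - by apply: cbmM; [exact: cbm_cst|exact: b].
    - by apply: cbmM; [exact: cbm_cst|exact: b].
    rewrite !cintZ; try exact: b.
    by rewrite mulrDr mulrCA W [X in _ + X]mulrCA W0 !mulr1 subrr.
  move=> s Us; have gs := avoidsU g0 Us; have ns := nz s Us; rewrite expr1 subr0.
  have ns' : g s - y != 0 by rewrite subr_eq0; exact: av.
  have -> : 1 - y / g s = (g s - y) / g s by field.
  by field; rewrite gs y0 ns'.
have m1 : - d.+2%:Z != -1 :> int by lia.
have ok : gok (fun z => 1 - y / z).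
  by apply: ccB; [exact: cc_cst|apply: ccM; [exact: cc_cst|exact: okV]].
have ok' : gok (fun z => y / z ^+ 2).
  apply: ccM; first exact: cc_cst.
  by apply: cc_eq (ccM okV okV) => s; rewrite expr2 invfM.
have := @oint_pow (fun z => 1 - y / z) (fun z => y / z ^+ 2) (- d.+2%:Z) ok ok' nz m1.
have dV s e : g s != 0 -> cder g s e -> cder (fun s => (g s)^-1) s (- e / g s ^+ 2) by exact: cderV.
move=> H; rewrite (_ : oint _ = y^-1 * oint (fun z => z * ((1 - y / z) ^ (- d.+2%:Z) * (y / z ^+ 2)))).
  rewrite H ?mulr0//.
  - move=> s e gs h.
    have D := cderD (cder_cst 1 s) (cderM (cder_cst (- y) s) (dV s e gs h)).
    apply: cder_ext (cder_eq _ D) => [s'|]; first by rewrite mulNr.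
    by rewrite mulr0 addr0 add0r; ring.
  - move=> s gs [c1 c2].
    have cV : ccat (fun s => (g s)^-1) s.
      have n0 := normsq_neq0 gs.
      split; rewrite /prop_for ?ReVf ?ImVf.
        apply: cvgM; first exact: c1.
        by apply: cvgV => //; apply: cvgD; apply: cvgM; [exact: c1|exact: c1|exact: c2|exact: c2].
      apply: cvgN; apply: cvgM; first exact: c2.
      by apply: cvgV => //; apply: cvgD; apply: cvgM; [exact: c1|exact: c1|exact: c2|exact: c2].
    apply: ccatM; first exact: ccat_cst.
    rewrite (_ : (fun s => _) = (fun s => (g s)^-1 * (g s)^-1)); first exact: ccatM.
    by apply/funext => s'; rewrite expr2 invfM.
rewrite -ointZ; last first.
  apply: gokM; first exact: gok_id.
  by apply: gokM; [exact: cc_exprz|].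
apply: oint_ext => s Us; rewrite -exprnN; have gs := avoidsU g0 Us; have ns := nz s Us.
have X0 : (1 - y / g s) ^+ d.+2 != 0 by rewrite expf_neq0.
by move: (_ ^+ d.+2) X0 => Y Y0; field; rewrite gs y0 Y0.
Qed.

End Contour.

(** * Integrals against rational weights *)

Section RationalFunctionals.
Variable R : realType.
Local Notation C := (CC R).

(* Contour integrals and constant terms are both of this kind; such a functional is
   determined on products of simple poles by its values on the powers of [z]
   and by the vanishing of the pole terms, see [goodfun_eq]. *)
Record goodfun (K : C -> Prop) (ok : (C -> C) -> Prop) (L : (C -> C) -> C) : Prop := GoodFun {
  gf_ext : forall f h, (forall z, K z -> f z = h z) -> L f = L h;
  gf_cst : forall c, ok (fun=> c);
  gf_okD : forall f h, ok f -> ok h -> ok (fun z => f z + h z);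
  gf_okM : forall f h, ok f -> ok h -> ok (fun z => f z * h z);
  gf_D : forall f h, ok f -> ok h -> L (fun z => f z + h z) = L f + L h;
  gf_Z : forall c f, ok f -> L (fun z => c * f z) = c * L f }.

Section Uniqueness.
Variables (K : C -> Prop) (ok : (C -> C) -> Prop) (L : (C -> C) -> C) (xi : C -> C) (S : C -> Prop).
Hypothesis gf : goodfun K ok L.
Hypothesis xi0 : forall z, K z -> xi z != 0.
Hypothesis S0 : forall a, S a -> a != 0.
Hypothesis Snz : forall a z, S a -> K z -> 1 - a * xi z != 0.
Hypothesis okxi : forall k : int, ok (fun z => xi z ^ k).
Hypothesis okS : forall a, S a -> ok (fun z => (1 - a * xi z)^-1).
Hypothesis Lk : forall k : int, L (fun z => xi z ^ k) = if k == 0 then 1 else 0.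
Hypothesis LS : forall a d, S a -> L (fun z => xi z / (1 - a * xi z) ^+ d.+1) = 0.

Definition rprod (A : seq C) (z : C) : C := \prod_(a <- A) (1 - a * xi z)^-1.
Definition allS (A : seq C) := forall a, a \in A -> S a.

Lemma allS_cons a A : allS (a :: A) <-> S a /\ allS A.
Proof.
split=> [h|[h1 h2] b]; first by split; [apply: h; rewrite mem_head|move=> b bA; apply: h; rewrite inE bA orbT].
by rewrite inE => /orP[/eqP ->//|/h2].
Qed.

Lemma ok_rprod A : allS A -> ok (rprod A).
Proof.
elim: A => [|a A IH]; first by move=> _; rewrite (_ : rprod [::] = fun=> 1); [exact: (gf_cst gf)|apply/funext => z; rewrite /rprod big_nil].
move=> /allS_cons[Sa SA]; rewrite (_ : rprod (a :: A) = fun z => (1 - a * xi z)^-1 * rprod A z).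
  by apply: (gf_okM gf); [exact: okS|exact: IH].
by apply/funext => z; rewrite /rprod big_cons.
Qed.

Lemma ok_xrprod (k : int) A : allS A -> ok (fun z => xi z ^ k * rprod A z).
Proof. by move=> SA; apply: (gf_okM gf) => //; exact: ok_rprod. Qed.

Lemma LB f h : ok f -> ok h -> L (fun z => f z - h z) = L f - L h.
Proof.
move=> of_ oh; have := gf_Z gf (-1) oh; have ohn : ok (fun z => -1 * h z) by apply: (gf_okM gf) => //; exact: (gf_cst gf).
have := gf_D gf of_ ohn => e1 e2; rewrite -[X in _ = _ + X]mulN1r -e2 -e1.
by apply: (gf_ext gf) => z _; rewrite mulN1r.
Qed.

(** If all poles coincide this is [LS]. Otherwise two distinct ones are separated by 1/((1 - a x)(1
    - b x)) = (a - b)^-1 (a/(1 - a x) - b/(1 - b x)), and each term has one factor less. *)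
Lemma L_one A : allS A -> L (fun z => xi z ^ (1 : int) * rprod A z) = 0.
Proof.
move: {2}(size A) (leqnn (size A)) => n; elim: n A => [|n IH] A.
  rewrite leqn0 => /nilP -> _.
  by rewrite -[RHS](Lk 1); apply: (gf_ext gf) => z _; rewrite /rprod big_nil mulr1.
case: A => [|a A] sA; first by move=> _; exact: (IH [::]).
move=> hS; have [Sa SA] := (allS_cons a A).1 hS.
have [/allP hall|/allPn[b bA /eqP ba]] := boolP (all (pred1 a) A).
  rewrite -(LS (size A) Sa); apply: (gf_ext gf) => z Kz.
  rewrite /rprod big_cons (eq_big_seq (fun=> (1 - a * xi z)^-1)); last by move=> c /hall/eqP ->.
  rewrite expr1z; congr (_ * _); rewrite big_const_seq count_predT iter_mulr_1.
  by rewrite -exprS exprVn.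
have ab : a - b != 0 by rewrite subr_eq0 eq_sym; apply/eqP.
have Sb : S b by exact: SA.
have SA' : allS (rem b A) by move=> c /mem_rem; exact: SA.
have sz : (size (rem b A)).+1 = size A.
  by rewrite size_rem// prednK//; case: (A) bA.
have S1 : allS (a :: rem b A) by apply/allS_cons.
have S2 : allS (b :: rem b A) by apply/allS_cons.
have I1 := IH (a :: rem b A); have I2 := IH (b :: rem b A).
have o1 := ok_xrprod 1 S1; have o2 := ok_xrprod 1 S2.
have m c f : ok f -> ok (fun z => c * f z) by move=> h; apply: (gf_okM gf) => //; exact: (gf_cst gf).
rewrite (@gf_ext _ _ _ gf _ (fun z => (a - b)^-1 * a * (xi z ^ (1 : int) * rprod (a :: rem b A) z) -
   (a - b)^-1 * b * (xi z ^ (1 : int) * rprod (b :: rem b A) z))).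
  rewrite LB; try exact: m.
  by rewrite !(gf_Z gf)// I1 ?I2 ?mulr0 ?subrr//= sz.
move=> z Kz; rewrite {1}/rprod big_cons (perm_big _ (perm_to_rem bA)) big_cons /rprod !big_cons /=.
have n1 := Snz Sa Kz; have n2 := Snz Sb Kz.
by field; rewrite n1 n2 ab.
Qed.

Lemma L_pos A (k : nat) : allS A -> L (fun z => xi z ^ k.+1 * rprod A z) = 0.
Proof.
elim: k A => [|k IH] A SA; first exact: L_one.
case: A SA => [|a A] SA.
  by rewrite -[RHS](Lk k.+2); apply: (gf_ext gf) => z _; rewrite /rprod big_nil mulr1.
have [Sa SA'] := (allS_cons a A).1 SA.
have m c f : ok f -> ok (fun z => c * f z) by move=> h; apply: (gf_okM gf) => //; exact: (gf_cst gf).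
have o1 := ok_xrprod k.+1 SA; have o2 := ok_xrprod k.+1 SA'.
rewrite (@gf_ext _ _ _ gf _ (fun z => a^-1 * (xi z ^ k.+1 * rprod (a :: A) z) -
   a^-1 * (xi z ^ k.+1 * rprod A z))).
  rewrite LB; try exact: m.
  by rewrite !(gf_Z gf)// !IH// mulr0 subrr.
move=> z Kz; rewrite /rprod !big_cons -!exprnP exprS.
have n1 := Snz Sa Kz; have a0 := S0 Sa.
by field; rewrite n1 a0.
Qed.

(** The complete homogeneous symmetric polynomial of degree [k] in [A], by its recursion on the
    first element. What matters is that [L] does not enter. *)
Fixpoint rval (A : seq C) (k : nat) : C :=
  if A is a :: A' then rval A' k + a * (if k is k'.+1 then (fix aux k := rval A' k + a * if k is k'.+1 then aux k' else 0) k' else 0)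
  else (k == 0)%:R.

Lemma L_neg A (k : nat) : allS A -> L (fun z => xi z ^ (- k%:Z) * rprod A z) = rval A k.
Proof.
elim: A k => [|a A IHA] k SA.
  rewrite (_ : rval _ _ = if - k%:Z == 0 then 1 else 0); last by rewrite oppr_eq0 eqz_nat /=; case: eqP.
  by rewrite -Lk; apply: (gf_ext gf) => z _; rewrite /rprod big_nil mulr1.
have [Sa SA'] := (allS_cons a A).1 SA.
have m c f : ok f -> ok (fun z => c * f z) by move=> h; apply: (gf_okM gf) => //; exact: (gf_cst gf).
have step (j : int) : L (fun z => xi z ^ j * rprod (a :: A) z) =
    L (fun z => xi z ^ j * rprod A z) + a * L (fun z => xi z ^ (j + 1) * rprod (a :: A) z).
  have o1 := ok_xrprod j SA'; have o2 := ok_xrprod (j + 1) SA.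
  rewrite -(gf_Z gf)// -(gf_D gf)//; last exact: m.
  apply: (gf_ext gf) => z Kz; rewrite /rprod !big_cons expfzDr ?xi0// expr1z.
  have n1 := Snz Sa Kz; by field.
elim: k => [|k IHk].
  rewrite step IHA//= oppr0 add0r.
  by rewrite (L_pos 0 SA) mulr0.
rewrite step IHA//= (_ : - k.+1%:Z + 1 = - k%:Z); last by lia.
by rewrite IHk; case: (k).
Qed.

End Uniqueness.

(** Both functionals are computed by the same relations: positive powers of [xi] give 0, the others
    give [rval]. *)
Lemma goodfun_eq (K1 K2 : C -> Prop) ok1 ok2 L1 L2 (xi : C -> C) (S : C -> Prop) A (k : int) :
  goodfun K1 ok1 L1 -> goodfun K2 ok2 L2 ->
  (forall a, S a -> a != 0) ->
  (forall z, K1 z -> xi z != 0) -> (forall a z, S a -> K1 z -> 1 - a * xi z != 0) ->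
  (forall k : int, ok1 (fun z => xi z ^ k)) -> (forall a, S a -> ok1 (fun z => (1 - a * xi z)^-1)) ->
  (forall k : int, L1 (fun z => xi z ^ k) = if k == 0 then 1 else 0) ->
  (forall a d, S a -> L1 (fun z => xi z / (1 - a * xi z) ^+ d.+1) = 0) ->
  (forall z, K2 z -> xi z != 0) -> (forall a z, S a -> K2 z -> 1 - a * xi z != 0) ->
  (forall k : int, ok2 (fun z => xi z ^ k)) -> (forall a, S a -> ok2 (fun z => (1 - a * xi z)^-1)) ->
  (forall k : int, L2 (fun z => xi z ^ k) = if k == 0 then 1 else 0) ->
  (forall a d, S a -> L2 (fun z => xi z / (1 - a * xi z) ^+ d.+1) = 0) ->
  allS S A ->
  L1 (fun z => xi z ^ k * rprod xi A z) = L2 (fun z => xi z ^ k * rprod xi A z).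
Proof.
move=> g1 g2 S0 a1 a2 a3 a4 a5 a6 b1 b2 b3 b4 b5 b6 SA.
case: k => [[|k]|k].
- by rewrite (L_neg g1 a1 S0 a2 a3 a4 a5 a6 0 SA) (L_neg g2 b1 S0 b2 b3 b4 b5 b6 0 SA).
- by rewrite (L_pos g1 S0 a2 a3 a4 a5 a6 k SA) (L_pos g2 S0 b2 b3 b4 b5 b6 k SA).
- by rewrite NegzE (L_neg g1 a1 S0 a2 a3 a4 a5 a6 k.+1 SA) (L_neg g2 b1 S0 b2 b3 b4 b5 b6 k.+1 SA).
Qed.

Section CTgood.
Variable r : R.
Hypothesis r0 : 0 < r.
Local Notation circ := (fun z : C => cmod z = r).

Lemma lau_circ : funalg (@lau R) circ.
Proof. by apply: (@lau_falg _ _ r r) => // z zr; exact: circ_ann. Qed.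

Lemma CT_good : goodfun circ (ucl (@lau R) circ) (CT r).
Proof.
split.
- by move=> f h e; apply: CT_ext.
- by move=> c; exact: (ucl_cst lau_circ).
- by move=> f h a b; exact: (ucl_add lau_circ).
- by move=> f h a b; exact: (ucl_mul lau_circ).
- by move=> f h a b; exact: CTD.
- by move=> c f a; exact: CTZ.
Qed.

(** Polynomials in z: their uniform limits on the circle extend holomorphically inside, so that
    multiplication by z kills the constant term, as in [CT_lau0]. *)
Definition lau0 (phi : C -> C) := exists2 s : seq (C * nat), True & forall z, phi z = \sum_(x <- s) x.1 * z ^+ x.2.

Lemma lau0_falg : funalg lau0 circ.
Proof.
split.
- by move=> c; exists [:: (c, 0%N)] => // z; rewrite big_seq1 expr0 mulr1.
- by move=> f h [s _ hs] [u _ hu]; exists (s ++ u) => // z; rewrite big_cat hs hu.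
- move=> f h [s _ hs] [u _ hu]; exists [seq (x.1 * y.1, (x.2 + y.2)%N) | x <- s, y <- u] => // z.
  rewrite hs hu big_allpairs_dep /= mulr_suml; apply: eq_bigr => x _.
  by rewrite mulr_sumr; apply: eq_bigr => y _ /=; rewrite exprD mulrACA.
- move=> f [s _ hs]; exists (\sum_(x <- s) cmod x.1 * r ^+ x.2) => z zr; rewrite hs.
  apply: le_trans (cmod_sum _ _ _) _; apply: ler_sum => x _.
  by rewrite cmodM cmodX zr.
Qed.

Lemma lau0_lau f : lau0 f -> lau f.
Proof.
move=> [s _ hs]; exists [seq (x.1, x.2%:Z) | x <- s] => z _.
by rewrite hs /leval big_map.
Qed.

Lemma ucl0_lau f : ucl lau0 circ f -> ucl (@lau R) circ f.
Proof. by move=> h e /h[g lg hg]; exists g => //; exact: lau0_lau. Qed.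

Lemma CT_lau0 f : ucl lau0 circ f -> CT r (fun z => z * f z) = 0.
Proof.
move=> h; apply: lapp_CT => // e e0; have er : 0 < e / r by rewrite divr_gt0.
have [g [s _ hs] hg] := h _ er.
exists [seq (x.1, x.2.+1%:Z) | x <- s].
  move=> z zr; rewrite /leval big_map /=.
  have -> : \sum_(x <- s) x.1 * z ^ x.2.+1 = z * g z.
    by rewrite hs mulr_sumr; apply: eq_bigr => x _; rewrite -exprnP exprS mulrCA.
  by rewrite -mulrBr cmodM zr mulrC -ler_pdivlMr//; exact: hg.
by rewrite /lct big_map /= big_pred0 ?subrr ?cmod0 ?ltW.
Qed.

Lemma lau0_id : lau0 id.
Proof. by exists [:: (1, 1%N)] => // z; rewrite big_seq1 mul1r expr1. Qed.

Lemma circ_geom0 a : cmod a * r <= 1 / 2 -> ucl lau0 circ (fun z => (1 - a * z)^-1).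
Proof.
move=> ar; apply: (ucl_geom lau0_falg (th := 1/2)); first by apply/andP; split; lra.
  by apply: (ucl_mul lau0_falg); [exact: (ucl_cst lau0_falg)|apply: ucl_base; exact: lau0_id].
by move=> z zr; rewrite cmodM zr.
Qed.

Lemma circ_nz a z : cmod a * r <= 1 / 2 -> cmod z = r -> 1 - a * z != 0.
Proof.
move=> ar zr; rewrite -cmod_gt0; have := cmodBl 1 (a * z); rewrite cmod1 cmodM zr; lra.
Qed.

Lemma circ_neq0 (z : C) : cmod z = r -> z != 0.
Proof. by move=> zr; rewrite -cmod_gt0 zr. Qed.

Lemma circ_okexp (k : int) : ucl (@lau R) circ (fun z => z ^ k).
Proof. by apply: ucl_base; exact: lau_exp. Qed.

Lemma CT_out a d : cmod a * r <= 1 / 2 -> CT r (fun z => z / (1 - a * z) ^+ d.+1) = 0.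
Proof.
move=> ar; apply: (@CT_lau0 (fun z => ((1 - a * z) ^+ d.+1)^-1)).
apply: ucl_ext (ucl_exp lau0_falg d.+1 (circ_geom0 ar)) => z _.
by rewrite exprVn.
Qed.

End CTgood.

Lemma circ_inv (r : R) z : cmod z = r^-1 -> cmod z^-1 = r.
Proof. by rewrite cmodV => ->; rewrite invrK. Qed.

Lemma ucl_circ_inv (r : R) f : 0 < r -> ucl (@lau R) (fun z => cmod z = r) f ->
  ucl (@lau R) (fun z => cmod z = r^-1) (fun z => f z^-1).
Proof.
move=> r0 h e /h[g [s hs] hg]; exists (fun z => g z^-1); last by move=> z /circ_inv; exact: hg.
exists [seq (x.1, - x.2) | x <- s] => z z0; rewrite hs ?invr_eq0// /leval big_map.
by apply: eq_bigr => x _; rewrite /= -exprz_inv.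
Qed.

End RationalFunctionals.

(** * Contours separating two families of simple poles *)

Section Lfunctional.
Variable R : realType.
Local Notation C := (CC R).
Local Notation U := (`[0%R, 1%R]%classic : set R).
Local Notation rout := (rprod (fun z : C => z)).
Local Notation rin := (rprod (fun z : C => z^-1)).

(** Both functionals are bounded by sup norms, so agreement on z^k phi passes from Laurent
    polynomials to their uniform limit [h]. *)
Lemma goodfun_ucl (K1 K2 Om : C -> Prop) ok1 ok2 L1 L2 (B1 B2 C1 C2 : R) h phi :
  goodfun K1 ok1 L1 -> goodfun K2 ok2 L2 ->
  (forall f M, ok1 f -> (forall z, K1 z -> cmod (f z) <= M) -> cmod (L1 f) <= C1 * M) ->
  (forall f M, ok2 f -> (forall z, K2 z -> cmod (f z) <= M) -> cmod (L2 f) <= C2 * M) ->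
  0 <= C1 -> 0 <= C2 ->
  (forall z, K1 z -> Om z /\ z != 0) -> (forall z, K2 z -> Om z /\ z != 0) ->
  (forall z, K1 z -> cmod (phi z) <= B1) -> (forall z, K2 z -> cmod (phi z) <= B2) ->
  ucl (@lau R) Om h -> ok1 h -> ok2 h -> ok1 phi -> ok2 phi ->
  (forall k : int, ok1 (fun z => z ^ k)) -> (forall k : int, ok2 (fun z => z ^ k)) ->
  (forall k : int, L1 (fun z => z ^ k * phi z) = L2 (fun z => z ^ k * phi z)) ->
  L1 (fun z => h z * phi z) = L2 (fun z => h z * phi z).
Proof.
move=> g1 g2 bd1 bd2 C10 C20 KO1 KO2 b1 b2 uh oh1 oh2 op1 op2 oz1 oz2 E.
have aux s : [/\ ok1 (leval s), ok2 (leval s) & L1 (fun z => leval s z * phi z) = L2 (fun z => leval s z * phi z)].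
  elim: s => [|[c k] s [I1 I2 I3]].
    have e0 : leval [::] = (fun=> 0) :> (C -> C) by apply/funext => z; rewrite /leval big_nil.
    split; rewrite ?e0; [exact: (gf_cst g1)|exact: (gf_cst g2)|].
    have z1 : L1 (fun z => 0 * phi z) = 0 by rewrite (gf_Z g1)// mul0r.
    have z2 : L2 (fun z => 0 * phi z) = 0 by rewrite (gf_Z g2)// mul0r.
    by rewrite z1 z2.
  have e0 : leval ((c, k) :: s) = (fun z => c * z ^ k + leval s z) by apply/funext => z; rewrite /leval big_cons.
  have m1 : ok1 (fun z => c * z ^ k) by apply: (gf_okM g1) => //; exact: (gf_cst g1).
  have m2 : ok2 (fun z => c * z ^ k) by apply: (gf_okM g2) => //; exact: (gf_cst g2).
  rewrite e0; split; [exact: (gf_okD g1)|exact: (gf_okD g2)|].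
  have e1 : (fun z => (c * z ^ k + leval s z) * phi z) = (fun z => c * (z ^ k * phi z) + leval s z * phi z).
    by apply/funext => z; rewrite mulrDl mulrA.
  have p1 : ok1 (fun z => z ^ k * phi z) by exact: (gf_okM g1).
  have p2 : ok2 (fun z => z ^ k * phi z) by exact: (gf_okM g2).
  have q1 : ok1 (fun z => leval s z * phi z) by exact: (gf_okM g1).
  have q2 : ok2 (fun z => leval s z * phi z) by exact: (gf_okM g2).
  rewrite e1 (gf_D g1)//; last by apply: (gf_okM g1) => //; exact: (gf_cst g1).
  rewrite (gf_D g2)//; last by apply: (gf_okM g2) => //; exact: (gf_cst g2).
  by rewrite (gf_Z g1)// (gf_Z g2)// E I3.
apply/eqP; rewrite -subr_eq0 -cmod_eq0; apply/eqP/le_anti; rewrite cmod_ge0 andbT.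
apply/ler_addgt0Pr => e e0; rewrite add0r.
pose Q := C1 * `|B1| + C2 * `|B2| + 1.
have Q0 : 0 < Q by rewrite /Q ltr_wpDl// addr_ge0 ?mulr_ge0.
have [f [s fs] hf] := uh _ (divr_gt0 e0 Q0).
have [I1 I2 I3] := aux s.
have d1 : cmod (L1 (fun z => h z * phi z) - L1 (fun z => leval s z * phi z)) <= C1 * (e / Q * `|B1|).
  rewrite -(LB g1); try exact: (gf_okM g1).
  apply: bd1.
    rewrite (_ : (fun z => _) = (fun z => h z * phi z + -1 * (leval s z * phi z))).
      by apply: (gf_okD g1); [exact: (gf_okM g1)|apply: (gf_okM g1); [exact: (gf_cst g1)|exact: (gf_okM g1)]].
    by apply/funext => z; rewrite mulN1r.
  move=> z Kz; rewrite -mulrBl cmodM ler_pM ?cmod_ge0//.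
    by have [Oz z0] := KO1 z Kz; rewrite -fs ?hf.
  by apply: le_trans (b1 z Kz) (ler_norm _).
have d2 : cmod (L2 (fun z => h z * phi z) - L2 (fun z => leval s z * phi z)) <= C2 * (e / Q * `|B2|).
  rewrite -(LB g2); try exact: (gf_okM g2).
  apply: bd2.
    rewrite (_ : (fun z => _) = (fun z => h z * phi z + -1 * (leval s z * phi z))).
      by apply: (gf_okD g2); [exact: (gf_okM g2)|apply: (gf_okM g2); [exact: (gf_cst g2)|exact: (gf_okM g2)]].
    by apply/funext => z; rewrite mulN1r.
  move=> z Kz; rewrite -mulrBl cmodM ler_pM ?cmod_ge0//.
    by have [Oz z0] := KO2 z Kz; rewrite -fs ?hf.
  by apply: le_trans (b2 z Kz) (ler_norm _).
have -> : L1 (fun z => h z * phi z) - L2 (fun z => h z * phi z) =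
  (L1 (fun z => h z * phi z) - L1 (fun z => leval s z * phi z)) -
  (L2 (fun z => h z * phi z) - L2 (fun z => leval s z * phi z)) by rewrite I3; ring.
apply: le_trans (cmodB _ _) _; apply: le_trans (lerD d1 d2) _.
have -> : C1 * (e / Q * `|B1|) + C2 * (e / Q * `|B2|) = e / Q * (C1 * `|B1| + C2 * `|B2|) by ring.
rewrite -mulrA ger_pMr// mulrC ler_pdivrMr// mul1r /Q lerDl//.
Qed.

Section OneH.
Variables (h : C -> C) (r : R).
Hypothesis r01 : 0 < r < 1.
Hypothesis uh : ucl (@lau R) (ann r r^-1) h.

Let r0 : 0 < r. Proof. by case/andP: r01. Qed.
Let ri0 : 0 < r^-1. Proof. by rewrite invr_gt0 r0. Qed.
Let rri : r <= r^-1.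
Proof. by case/andP: r01 => a b; apply: (@le_trans _ _ 1); rewrite ?ltW// invf_gt1. Qed.

Lemma uh_r : ucl (@lau R) (fun z => cmod z = r) h.
Proof. by apply: ucl_sub uh => z zr; rewrite /ann zr lexx rri. Qed.
Lemma uh_ri : ucl (@lau R) (fun z => cmod z = r^-1) h.
Proof. by apply: ucl_sub uh => z zr; rewrite /ann zr lexx rri. Qed.

Definition small (x : C) := cmod x * r <= 1 / 2.

Lemma ucl_rout X : (forall x, x \in X -> small x) -> ucl (@lau R) (fun z => cmod z = r) (rout X).
Proof.
move=> hX; apply: (ok_rprod (CT_good r0) (S := small)) => // a sa.
exact/ucl0_lau/circ_geom0.
Qed.

Lemma ucl_rin Y : (forall y, y \in Y -> small y) -> ucl (@lau R) (fun z => cmod z = r^-1) (rin Y).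
Proof.
move=> hX; apply: (ok_rprod (CT_good ri0) (S := small)) => // a sa.
apply: (ucl_circ_inv (f := fun z => (1 - a * z)^-1)) => //.
exact/ucl0_lau/circ_geom0.
Qed.

Definition bout X := CT r (fun z => h z * rout X z).
Definition bin Y := CT r^-1 (fun z => h z * rin Y z).

(* The value of the integral of
     h z * \prod_(x <- X) (1 - x * z)^-1 * \prod_(y <- Y) (1 - y / z)^-1
   against dz / (2 pi i z) when the 1 / x lie outside and the y inside the contour,
   computed from
     (1 - x * y) / ((1 - x * z) * (1 - y / z)) = 1 / (1 - x * z) + 1 / (1 - y / z) - 1.
   It makes sense as soon as no x * y is 1, even when no contour exists. *)
Fixpoint Lrec (X : seq C) : seq C -> C :=
  match X with
  | [::] => bin
  | x :: X' => fix aux Y := match Y with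
     | [::] => bout (x :: X')
     | y :: Y' => (1 - x * y)^-1 * (aux Y' + Lrec X' (y :: Y') - Lrec X' Y') end
  end.

Lemma rout_nil : rout [::] = fun=> 1. Proof. by apply/funext => z; rewrite /rprod big_nil. Qed.
Lemma rin_nil : rin [::] = fun=> 1. Proof. by apply/funext => z; rewrite /rprod big_nil. Qed.

Lemma bnil : bin [::] = bout [::].
Proof.
rewrite /bin /bout rout_nil rin_nil.
apply: (@CT_radius _ r r^-1) => //; rewrite ?lexx ?rri//.
by apply: ucl_ext uh => z _; rewrite mulr1.
Qed.

Lemma Lrec_nil X : Lrec X [::] = bout X.
Proof. by case: X => [|x X] //=; exact: bnil. Qed.

Lemma Lrec_cons x X y Y : Lrec (x :: X) (y :: Y) =
  (1 - x * y)^-1 * (Lrec (x :: X) Y + Lrec X (y :: Y) - Lrec X Y).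
Proof. by []. Qed.

Definition nondeg (X Y : seq C) := forall x y, x \in X -> y \in Y -> 1 - x * y != 0.

Lemma nondeg_cons x X y Y : nondeg (x :: X) (y :: Y) ->
  [/\ 1 - x * y != 0, nondeg (x :: X) Y, nondeg X (y :: Y) & nondeg X Y].
Proof.
move=> nd; split; first by apply: nd; exact: mem_head.
- by move=> a b aX bY; apply: nd => //; rewrite inE bY orbT.
- by move=> a b aX bY; apply: nd => //; rewrite inE aX orbT.
- by move=> a b aX bY; apply: nd; rewrite inE ?aX ?bY orbT.
Qed.

Definition allsm (X : seq C) := forall x, x \in X -> x != 0 /\ small x.
Lemma allsm_cons x X : allsm (x :: X) -> (x != 0 /\ small x) /\ allsm X.
Proof. by move=> sm; split; [apply: sm; exact: mem_head|move=> a aX; apply: sm; rewrite inE aX orbT]. Qed.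

Section WithContour.
Variable g : R -> C.
Hypothesis hg : closed_contour g.
Hypothesis g0 : avoids g 0.
Hypothesis W0 : winding_number g 0 = 1.
Hypothesis gann : forall s, U s -> ann r r^-1 (g s).
Let K z := exists2 s, U s & z = g s.

Lemma oint_good : goodfun K (gok g) (oint g).
Proof.
split.
- by move=> f k e; apply: oint_ext => s Us; apply: e; exists s.
- exact: gok_cst.
- exact: gokD.
- exact: gokM.
- exact: ointD.
- exact: ointZ.
Qed.

Lemma oint_bound : exists2 B : R, 0 <= B & forall f M, gok g f -> (forall z, K z -> cmod (f z) <= M) ->
  cmod (oint g f) <= B * M.
Proof.
have [[_ [M1 h1]] [_ [M2 h2]]] := contour_cbm hg.
pose D := `|M1| + `|M2|.
have hD s : U s -> cmod (curve_deriv g s) <= D.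
  move=> Us; apply: le_trans (cmod_ReIm _) _; apply: lerD.
    exact: le_trans (h1 s Us) (ler_norm _).
  exact: le_trans (h2 s Us) (ler_norm _).
have D0 : 0 <= D by rewrite addr_ge0.
pose t := cmod (two_pi_i (R := R))^-1.
(* The constant collects the factor 1/(2 pi i), the 2 of [cint_le], the bound r^-1 of 1/z on the
   annulus and the bound [D] of the speed. *)
exists (t * (2 * (r^-1 * D))); first by rewrite !mulr_ge0 ?cmod_ge0// ltW.
move=> f M of_ hM; rewrite /oint contour_intE cmodM -/t -mulrA.
rewrite ler_wpM2l ?cmod_ge0// -mulrA; apply: cint_le.
  exact: gok_bm.
move=> s Us; rewrite !cmodM cmodV.
have [a1 a2] := gann Us.
have f0 : cmod (f (g s)) <= M by apply: hM; exists s.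
have M0 : 0 <= M by exact: le_trans (cmod_ge0 _) f0.
have gi : (cmod (g s))^-1 <= r^-1 by rewrite lef_pV2 ?posrE//; exact: lt_le_trans a1.
rewrite -mulrA mulrC; apply: ler_pM => //; rewrite ?mulr_ge0 ?invr_ge0 ?cmod_ge0//.
by apply: ler_pM; rewrite ?invr_ge0 ?cmod_ge0 ?hD.
Qed.

Lemma gok_h : gok g h.
Proof.
apply: cc_ulim => e e0; have [f [s fs] hf] := uh e0.
exists (fun t => leval s (g t)).
  by apply: cc_sum => x; apply: ccM; [exact: cc_cst|exact: gok_exprz].
by move=> t Ut; rewrite -fs ?hf//; [exact: gann|exact: g0].
Qed.

Lemma gok_bounded f : gok g f -> exists B : R, forall z, K z -> cmod (f z) <= B.
Proof.
move=> /cc_cbm[[_ [M1 h1]] [_ [M2 h2]]]; exists (M1 + M2) => z [s Us ->].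
by apply: le_trans (cmod_ReIm _) _; apply: lerD; [exact: h1|exact: h2].
Qed.

Definition outok x := [/\ x != 0, small x & excludes g x^-1].
Definition inok x := [/\ x != 0, small x & encloses g x].

Lemma outok_nz x z : outok x -> K z -> 1 - x * z != 0.
Proof.
move=> [x0 _ [av _]] [s Us ->].
rewrite subr_eq0 eq_sym; apply: contraNneq (av s Us) => e.
by rewrite -[g s]mul1r -(mulVf x0) -mulrA e mulr1.
Qed.

Lemma inok_nz y z : inok y -> K z -> 1 - y / z != 0.
Proof.
move=> [y0 _ [av _]] [s Us ->]; have gs := avoidsU g0 Us.
rewrite subr_eq0 eq_sym; apply: contraNneq (av s Us) => e.
by rewrite -[g s]mul1r -e mulfVK.
Qed.

Lemma gok_out x : outok x -> gok g (fun z => (1 - x * z)^-1).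
Proof.
move=> ox; apply: gokV; last by move=> s Us; apply: outok_nz => //; exists s.
by apply: ccB; [exact: cc_cst|apply: ccM; [exact: cc_cst|exact: contour_cc]].
Qed.

Lemma gok_in y : inok y -> gok g (fun z => (1 - y / z)^-1).
Proof.
move=> oy; apply: gokV; last by move=> s Us; apply: inok_nz => //; exists s.
apply: ccB; [exact: cc_cst|apply: ccM; [exact: cc_cst|]].
by apply: ccV; [exact: contour_cc|move=> s Us; exact: avoidsU].
Qed.

Lemma winding_one : oint g (fun=> 1) = 1.
Proof.
rewrite -[RHS]W0 /winding_number /oint !contour_intE; congr (_ * _).
by apply: cint_ext => s Us; rewrite mul1r subr0.
Qed.

Lemma oint_exp_all (k : int) : oint g (fun z => z ^ k) = if k == 0 then 1 else 0.
Proof.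
case: eqP => [->|/eqP k0]; last exact: oint_exp.
by rewrite -[RHS]winding_one; apply: oint_ext => s _; rewrite expr0z.
Qed.

Lemma K_neq0 z : K z -> z != 0.
Proof. by move=> [s Us ->]; exact: g0. Qed.

(** The contour and the circle of radius [r] both have every 1/x outside, so [goodfun_eq] identifies
    the two functionals on powers times [rout X], and boundedness admits the factor [h]. In
    [oint_bin] the circle of radius r^-1 has every y inside. *)
Lemma oint_bout X : (forall x, x \in X -> outok x) -> oint g (fun z => h z * rout X z) = bout X.
Proof.
move=> hX; have [B B0 hB] := oint_bound.
have gr : gok g (rout X) by apply: (ok_rprod oint_good (S := outok)) => // a; exact: gok_out.
have ur : ucl (@lau R) (fun z => cmod z = r) (rout X) by apply: ucl_rout => x /hX[].
have [M1 hM1] := gok_bounded gr; have [M2 _ hM2] := ucl_bdd (lau_circ r0) ur.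
apply: (@goodfun_ucl K (fun z => cmod z = r) (ann r r^-1) _ _ _ _ M1 M2 B 1 _ _ oint_good (CT_good r0) hB) => //.
- by move=> f M uf hf; rewrite mul1r; exact: CT_le.
- by move=> z Kz; split; [case: Kz => s Us ->; exact: gann|exact: K_neq0].
- by move=> z zr; split; [rewrite /ann zr lexx rri|exact: circ_neq0 zr].
- exact: gok_h.
- exact: uh_r.
- by move=> k; exact: gok_exprz.
- by move=> k; exact: circ_okexp.
- move=> k; apply: (goodfun_eq k oint_good (CT_good r0) (S := outok)) => //.
  + by move=> a [].
  + by move=> z; exact: K_neq0.
  + by move=> a z; exact: outok_nz.
  + by move=> j; exact: gok_exprz.
  + by move=> a; exact: gok_out.
  + exact: oint_exp_all.
  + by move=> a d [a0 _ ex]; exact: oint_out.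
  + by move=> z; exact: circ_neq0.
  + by move=> a z [_ sa _]; exact: circ_nz.
  + by move=> j; exact: circ_okexp.
  + by move=> a [_ sa _]; exact/ucl0_lau/circ_geom0.
  + by move=> j; exact: CT_exp.
  + by move=> a d [_ sa _]; exact: CT_out.
Qed.

Lemma oint_bin Y : (forall y, y \in Y -> inok y) -> oint g (fun z => h z * rin Y z) = bin Y.
Proof.
move=> hY; have [B B0 hB] := oint_bound.
have gr : gok g (rin Y) by apply: (ok_rprod oint_good (S := inok)) => // a; exact: gok_in.
have ur : ucl (@lau R) (fun z => cmod z = r^-1) (rin Y) by apply: ucl_rin => x /hY[].
have [M1 hM1] := gok_bounded gr; have [M2 _ hM2] := ucl_bdd (lau_circ ri0) ur.
have g3 := CT_good ri0.
apply: (@goodfun_ucl K (fun z => cmod z = r^-1) (ann r r^-1) _ _ _ _ M1 M2 B 1 _ _ oint_good g3 hB) => //.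
- by move=> f M uf hf; rewrite mul1r; exact: CT_le.
- by move=> z Kz; split; [case: Kz => s Us ->; exact: gann|exact: K_neq0].
- by move=> z zr; split; [rewrite /ann zr lexx rri|exact: circ_neq0 zr].
- exact: gok_h.
- exact: uh_ri.
- by move=> k; exact: gok_exprz.
- by move=> k; exact: circ_okexp.
- move=> k.
  have E (L : (C -> C) -> C) : L (fun z => z ^ k * rin Y z) = L (fun z => z^-1 ^ (- k) * rin Y z).
    by congr L; apply/funext => z; rewrite exprz_inv opprK.
  rewrite (E (oint g)) (E (CT r^-1)).
  apply: (goodfun_eq (- k) oint_good g3 (S := inok)) => //.
  + by move=> a [].
  + by move=> z /K_neq0; rewrite invr_eq0.
  + by move=> a z; exact: inok_nz.
  + by move=> j; apply: cc_eq (gok_exprz hg g0 (- j)) => s; rewrite exprz_inv.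
  + by move=> a; exact: gok_in.
  + move=> j; rewrite -(oppr_eq0 j) -oint_exp_all; apply: oint_ext => s _; by rewrite exprz_inv.
  + by move=> a d [a0 _ ex]; exact: oint_in.
  + by move=> z /(circ_neq0 ri0); rewrite invr_eq0.
  + by move=> a z [_ sa _] /circ_inv zr; exact: (circ_nz sa).
  + by move=> j; apply: ucl_ext (circ_okexp r^-1 (- j)) => z _; rewrite exprz_inv.
  + move=> a [_ sa _]; apply: (ucl_circ_inv (f := fun z => (1 - a * z)^-1)) => //.
    exact/ucl0_lau/circ_geom0.
  + move=> j; rewrite -(oppr_eq0 j) -(CT_exp (- j) ri0); apply: CT_ext => // z _; by rewrite exprz_inv.
  + move=> a d [_ sa _]; rewrite -(CT_out r0 d sa).
    apply: (CT_inv (phi := fun z => z / (1 - a * z) ^+ d.+1)) => //.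
    apply: (ucl_mul (lau_circ r0)); first by apply: ucl_ext (circ_okexp r 1) => z _; rewrite expr1z.
    have u1 := ucl0_lau (circ_geom0 sa).
    have u2 := ucl_exp (lau_circ r0) d.+1 u1.
    by apply: ucl_ext u2 => z _; rewrite exprVn.
Qed.

Lemma oint_Lrec X Y : (forall x, x \in X -> outok x) -> (forall y, y \in Y -> inok y) -> nondeg X Y ->
  oint g (fun z => h z * (rout X z * rin Y z)) = Lrec X Y.
Proof.
move=> hX; elim: X hX Y => [|x X IHX] hX Y hY.
  move=> _; rewrite /= -oint_bin//; apply: oint_ext => s _.
  by rewrite rout_nil mul1r.
have ox : outok x by apply: hX; exact: mem_head.
have hX' a : a \in X -> outok a by move=> aX; apply: hX; rewrite inE aX orbT.
elim: Y hY => [|y Y IHY] hY.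
  move=> _; rewrite /= -oint_bout//; apply: oint_ext => s _.
  by rewrite rin_nil mulr1.
have oy : inok y by apply: hY; exact: mem_head.
have hY' a : a \in Y -> inok a by move=> aX; apply: hY; rewrite inE aX orbT.
move=> /nondeg_cons[xy n1 n2 n3].
rewrite Lrec_cons -IHY// -IHX// -(IHX hX' Y)//.
have ok1 A : (forall a, a \in A -> outok a) -> gok g (rout A).
  by move=> hA; apply: (ok_rprod oint_good (S := outok)) => // a; exact: gok_out.
have ok2 A : (forall a, a \in A -> inok a) -> gok g (rin A).
  by move=> hA; apply: (ok_rprod oint_good (S := inok)) => // a; exact: gok_in.
have ok3 A B : (forall a, a \in A -> outok a) -> (forall a, a \in B -> inok a) ->
    gok g (fun z => h z * (rout A z * rin B z)).
  by move=> hA hB; apply: gokM; [exact: gok_h|apply: gokM; [exact: ok1|exact: ok2]].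
rewrite -ointD//; try exact: ok3.
rewrite -(LB oint_good); [|by apply: gokD; exact: ok3|exact: ok3].
rewrite -ointZ//; last first.
  apply: ccB; first by apply: ccD; exact: ok3.
  exact: ok3.
apply: oint_ext => s Us; have Kg : K (g s) by exists s.
have e1 := outok_nz ox Kg; have e2 := inok_nz oy Kg; have gs := K_neq0 Kg.
rewrite /rprod !big_cons.
have e3 : g s - y != 0.
  by apply: contraNneq e2 => e; rewrite (_ : y = g s) ?divff ?subrr//; apply/esym/eqP; rewrite -subr_eq0 e.
have e4 : 1 - y / g s = (g s - y) / g s by field.
by rewrite e4; field; rewrite e1 e3 xy gs.
Qed.

End WithContour.

(** The partial fraction coefficient of (1 - x z)^-1: the other factors of [rout X] and [rin Y]
    evaluated at z = 1/x. With the lists exchanged it is the coefficient of (1 - y/z)^-1, evaluated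
    at z = y. *)
Definition alp (X Y : seq C) (x : C) : C :=
  (\prod_(a <- X | a != x) (1 - a / x) * \prod_(y <- Y) (1 - y * x))^-1.
(* For h the sum of the a_k z^k, [psi x] is the sum of the a_(-k) x^k and [phi y] the
   sum of the a_k y^k, both over k >= 0. *)
Definition psi x := CT r (fun z => h z * (1 - x * z)^-1).
Definition phi y := CT r^-1 (fun z => h z * (1 - y / z)^-1).
Definition h0 := CT r h.

(** Lagrange interpolation: the difference of the two sides is a polynomial of degree less than the
    size of [X] that vanishes at all the 1/x. *)
Lemma partial_fractions (X : seq C) z : uniq X -> (forall x, x \in X -> x != 0) -> X != [::] ->
  \sum_(x <- X) alp X [::] x * \prod_(a <- X | a != x) (1 - a * z) = 1.
Proof.
move=> uX X0 Xn.
pose F x : {poly C} := \prod_(a <- X | a != x) (1 - a *: 'X).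
pose p := \sum_(x <- X) alp X [::] x *: F x - 1.
have szF x : x \in X -> (size (F x) <= size X)%N.
  move=> xX; rewrite /F -big_filter.
  apply: (@leq_trans (size [seq a <- X | a != x]).+1).
    move: [seq a <- X | a != x] => s; elim: s => [|a s IH]; first by rewrite big_nil size_poly1.
    rewrite big_cons; apply: leq_trans (size_polyMleq _ _) _.
    have : (size (1 - a *: 'X : {poly C})%R <= 2)%N.
      apply: leq_trans (size_polyD _ _) _; rewrite size_polyN size_poly1 geq_max /=.
      by apply: leq_trans (size_scale_leq _ _) _; rewrite size_polyX.
    have aux (u v w : nat) : (v <= w.+1)%N -> (u <= 2)%N -> ((u + v).-1 <= w.+2)%N by lia.
    exact: aux.
  have -> : [seq a <- X | a != x] = rem x X by rewrite rem_filter.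
  by rewrite size_rem// prednK//; case: (X) xX.
have szp : (size p <= size X)%N.
  apply: leq_trans (size_polyD _ _) _; rewrite size_polyN size_poly1 geq_max; apply/andP; split.
    rewrite big_seq; apply: leq_trans (size_sum _ _ _) _; apply/bigmax_leqP_seq => x xX _.
    apply: leq_trans (size_scale_leq _ _) _; exact: szF.
  by case: (X) Xn.
have hF x w : (F x).[w] = \prod_(a <- X | a != x) (1 - a * w).
  by rewrite /F horner_prod; apply: eq_bigr => a _; rewrite !hornerE.
have rp : all (root p) [seq x^-1 | x <- X].
  apply/allP => _ /mapP[x xX ->]; rewrite rootE /p hornerD hornerN hornerC horner_sum.
  rewrite (bigD1_seq x)//= hornerZ hF [X in _ + X - _]big1_seq ?addr0.
    rewrite /alp big_nil mulr1 mulVf ?subrr//.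
    rewrite prodf_seq_neq0; apply/allP => a aX; apply/implyP => ax.
    rewrite subr_eq0 eq_sym; apply: contraNneq ax => e.
    by rewrite -[a]mulr1 -(mulVf (X0 x xX)) mulrA e mul1r.
  move=> y /andP[yx yX]; rewrite hornerZ hF (_ : \prod_(a <- X | a != y) _ = 0) ?mulr0//.
  apply/eqP; rewrite prodf_seq_eq0; apply/hasP; exists x => //.
  by rewrite eq_sym yx divff ?X0// subrr eqxx.
have p0 : p = 0.
  apply: (@roots_geq_poly_eq0 _ _ [seq x^-1 | x <- X]) => //.
    by rewrite map_inj_uniq//; exact: invr_inj.
  by rewrite size_map.
have := congr1 (fun q : {poly C} => q.[z]) p0; rewrite hornerD hornerN hornerC horner_sum horner0.
move/eqP; rewrite subr_eq0 => /eqP E; rewrite -[RHS]E; apply: eq_bigr => x _.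
by rewrite hornerZ hF.
Qed.

Lemma CT_sum (rr : R) (s : seq C) (F : C -> C -> C) : 0 < rr ->
  (forall x, x \in s -> ucl (@lau R) (fun z => cmod z = rr) (F x)) ->
  CT rr (fun z => \sum_(x <- s) F x z) = \sum_(x <- s) CT rr (F x).
Proof.
move=> rr0; elim: s => [|x s IH] hF.
  rewrite big_nil; apply: lapp_CT => // e e0; exists [::]; last by rewrite /lct big_nil subrr cmod0 ltW.
  by move=> z _; rewrite /leval !big_nil subrr cmod0 ltW.
have hF' y : y \in s -> ucl (@lau R) (fun z => cmod z = rr) (F y) by move=> ys; apply: hF; rewrite inE ys orbT.
rewrite big_cons -IH// -CTD//; last 2 first.
- by apply: hF; exact: mem_head.
- elim: (s) hF' => [|y s' IH'] hs.
    by apply: ucl_ext (ucl_cst (lau_circ rr0) 0) => z _; rewrite big_nil.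
  have u1 : ucl (@lau R) (fun z => cmod z = rr) (F y) by apply: hs; exact: mem_head.
  have u2 := IH' (fun a as' => hs a (mem_behead (s := y :: s') as')).
  by apply: ucl_ext (ucl_add (lau_circ rr0) u1 u2) => z _; rewrite big_cons.
by apply: CT_ext => // z _; rewrite big_cons.
Qed.

Lemma rprod_pf (xi : C -> C) X z : uniq X -> (forall x, x \in X -> x != 0) -> X != [::] ->
  (forall x, x \in X -> 1 - x * xi z != 0) ->
  rprod xi X z = \sum_(x <- X) alp X [::] x * (1 - x * xi z)^-1.
Proof.
move=> uX X0 Xn nz; have E := partial_fractions (xi z) uX X0 Xn.
have -> : rprod xi X z = (\sum_(x <- X) alp X [::] x * \prod_(a <- X | a != x) (1 - a * xi z)) * rprod xi X z.
  by rewrite E mul1r.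
rewrite mulr_suml big_seq [RHS]big_seq; apply: eq_bigr => x xX.
rewrite -mulrA; congr (_ * _); rewrite /rprod [X in _ * X](bigD1_seq x)//= mulrCA -[RHS]mulr1; congr (_ * _).
rewrite -big_split /= big1_seq// => a /andP[ax aX]; rewrite divff// nz//.
Qed.

Lemma bout_pf X : uniq X -> allsm X -> X != [::] -> bout X = \sum_(x <- X) alp X [::] x * psi x.
Proof.
move=> uX sX Xn; rewrite /bout.
have u1 x : x \in X -> ucl (@lau R) (fun z => cmod z = r) (fun z => h z * (1 - x * z)^-1).
  by move=> /sX[_ sx]; apply: (ucl_mul (lau_circ r0)); [exact: uh_r|exact/ucl0_lau/circ_geom0].
rewrite (@CT_ext _ _ _ (fun z => \sum_(x <- X) alp X [::] x * (h z * (1 - x * z)^-1)))//; last first.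
  move=> z zr; rewrite rprod_pf//; last 2 first.
  - by move=> x /sX[].
  - by move=> x /sX[_ sx]; exact: (circ_nz sx zr).
  by rewrite mulr_sumr; apply: eq_bigr => x _; rewrite mulrCA.
rewrite CT_sum//; last first.
  by move=> x /u1; apply: (ucl_mul (lau_circ r0)); exact: (ucl_cst (lau_circ r0)).
by rewrite big_seq [RHS]big_seq; apply: eq_bigr => x /u1; exact: CTZ.
Qed.

Lemma bin_pf X : uniq X -> allsm X -> X != [::] -> bin X = \sum_(x <- X) alp X [::] x * phi x.
Proof.
move=> uX sX Xn; rewrite /bin.
have u1 x : x \in X -> ucl (@lau R) (fun z => cmod z = r^-1) (fun z => h z * (1 - x / z)^-1).
  move=> /sX[_ sx]; apply: (ucl_mul (lau_circ ri0)); first exact: uh_ri.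
  apply: (ucl_circ_inv (f := fun z => (1 - x * z)^-1)) => //.
  exact/ucl0_lau/circ_geom0.
rewrite (@CT_ext _ _ _ (fun z => \sum_(x <- X) alp X [::] x * (h z * (1 - x / z)^-1)))//; last first.
  move=> z zr; rewrite (@rprod_pf (fun z => z^-1))//; last 2 first.
  - by move=> x /sX[].
  - by move=> x /sX[_ sx]; apply: (circ_nz sx); exact: circ_inv.
  by rewrite mulr_sumr; apply: eq_bigr => x _; rewrite mulrCA.
rewrite CT_sum//; last first.
  by move=> x /u1; apply: (ucl_mul (lau_circ ri0)); exact: (ucl_cst (lau_circ ri0)).
by rewrite big_seq [RHS]big_seq; apply: eq_bigr => x /u1; exact: CTZ.
Qed.

Lemma alp_sum1 X : uniq X -> allsm X -> X != [::] -> \sum_(x <- X) alp X [::] x = 1.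
Proof.
move=> uX sX Xn; have := @partial_fractions X 0 uX (fun x xX => (sX x xX).1) Xn.
move=> <-; apply: eq_bigr => x _; rewrite big1 ?mulr1// => a _; by rewrite mulr0 subr0.
Qed.

Lemma alp_rec x y X Y (a : C) : a != 0 -> x \notin X -> x != a -> 1 - y * a != 0 -> 1 - x * y != 0 ->
  alp (x :: X) (y :: Y) a = (1 - x * y)^-1 * (alp (x :: X) Y a + alp X (y :: Y) a - alp X Y a).
Proof.
move=> a0 xX xa ya xy; rewrite /alp !big_cons xa.
have n1 : 1 - x / a != 0.
  rewrite subr_eq0 eq_sym; apply: contraNneq xa => e.
  by rewrite -[x]mulr1 -(mulVf a0) mulrA e mul1r.
set P := \prod_(_ <- X | _) _; set Q := \prod_(_ <- Y) _.
rewrite !invfM.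
have n2 : a - x != 0 by rewrite subr_eq0 eq_sym.
have e1 : 1 - x / a = (a - x) / a by field.
move: (P^-1) (Q^-1) => P' Q'; rewrite e1; field.
by rewrite n2 ya a0 xy.
Qed.

Lemma alp_head x y X Y : x \notin X -> 1 - x * y != 0 ->
  alp (x :: X) (y :: Y) x = (1 - x * y)^-1 * alp (x :: X) Y x.
Proof.
by move=> xX xy; rewrite /alp !big_cons eqxx /= [y * x]mulrC !invfM mulrCA.
Qed.

(** The recursion of [Lrec] is matched by [alp_rec] and [alp_head]. The constant term [h0] belongs
    to both [psi] and [phi] and must be counted once: it is subtracted from [psi], and added back
    for empty [Y], where for nonempty [X] the coefficients sum to 1 by [alp_sum1]. *)
Lemma Lrec_pf X Y : uniq X -> uniq Y -> allsm X -> allsm Y -> nondeg X Y ->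
  Lrec X Y = (Y == [::])%:R * h0 + \sum_(x <- X) alp X Y x * (psi x - h0) + \sum_(y <- Y) alp Y X y * phi y.
Proof.
elim: X Y => [|x X IHX] Y.
  move=> _ uY _ sY _; rewrite big_nil addr0; case: Y uY sY => [|y Y] uY sY.
    rewrite big_nil eqxx mul1r addr0 /= bnil /bout rout_nil /h0.
    by apply: CT_ext => // z _; rewrite mulr1.
  by rewrite mul0r add0r -bin_pf.
elim: Y => [|y Y IHY].
  move=> uX _ sX _ _; rewrite big_nil eqxx mul1r addr0 Lrec_nil bout_pf//.
  rewrite (_ : \sum_(a <- x :: X) _ * (_ - _) = \sum_(a <- x :: X) alp (x :: X) [::] a * psi a - (\sum_(a <- x :: X) alp (x :: X) [::] a) * h0).
    by rewrite alp_sum1// mul1r addrC subrK.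
  by rewrite mulr_suml -sumrB; apply: eq_bigr => a _; rewrite mulrBr.
move=> uxX uyY sxX syY nd; have [xy n1 n2 n3] := nondeg_cons nd.
have [xX uX] := andP uxX; have [yY uY] := andP uyY.
have [[x0 _] sX] := allsm_cons sxX; have [[y0 _] sY] := allsm_cons syY.
rewrite Lrec_cons IHY// IHX// (IHX Y)//.
rewrite (_ : (y :: Y == [::]) = false)// mul0r !add0r.
rewrite !big_cons.
have S1 : \sum_(j <- X) alp (x :: X) (y :: Y) j * (psi j - h0) = (1 - x * y)^-1 *
   (\sum_(j <- X) alp (x :: X) Y j * (psi j - h0) + \sum_(j <- X) alp X (y :: Y) j * (psi j - h0)
    - \sum_(j <- X) alp X Y j * (psi j - h0)).
  rewrite -big_split -sumrB mulr_sumr /= big_seq [RHS]big_seq; apply: eq_bigr => j jX.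
  rewrite alp_rec//; first by move: (psi j - h0) => c; ring.
  - by case: (sX j jX).
  - by apply: contraNneq xX => ->.
  - by have := n2 j y jX (mem_head _ _); rewrite mulrC.
have S2 : \sum_(j <- Y) alp (y :: Y) (x :: X) j * phi j = (1 - x * y)^-1 *
   (\sum_(j <- Y) alp Y (x :: X) j * phi j + \sum_(j <- Y) alp (y :: Y) X j * phi j
    - \sum_(j <- Y) alp Y X j * phi j).
  rewrite -big_split -sumrB mulr_sumr /= big_seq [RHS]big_seq; apply: eq_bigr => j jY.
  rewrite alp_rec//; first by rewrite [y * x]mulrC; ring.
  - by case: (sY j jY).
  - by apply: contraNneq yY => ->.
  - by have := n1 x j (mem_head _ _) jY.
  - by rewrite mulrC.
rewrite S1 S2 alp_head// (@alp_head y x)//; last by rewrite mulrC.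
rewrite [y * x]mulrC; move: (1 - x * y)^-1 => D.
by ring.
Qed.

End OneH.

End Lfunctional.

(** * Independence of the truncation, dependence on parameters *)

Section Independence.
Variable R : realType.
Local Notation C := (CC R).
Local Notation rout := (rprod (fun z : C => z)).
Local Notation rin := (rprod (fun z : C => z^-1)).

Lemma rprod_cons (xi : C -> C) a A z : rprod xi (a :: A) z = (1 - a * xi z)^-1 * rprod xi A z.
Proof. by rewrite /rprod big_cons. Qed.
Lemma rprod_rcons (xi : C -> C) a A z : rprod xi (rcons A a) z = rprod xi A z * (1 - a * xi z)^-1.
Proof. by rewrite /rprod big_rcons. Qed.

Lemma small_cons (r : R) x X : {in x :: X, forall a, small r a} -> small r x /\ {in X, forall a, small r a}.
Proof. by move=> h; split=> [|a aX]; apply: h; rewrite inE ?eqxx ?aX ?orbT. Qed.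

Lemma small_rcons (r : R) x X : {in rcons X x, forall a, small r a} -> small r x /\ {in X, forall a, small r a}.
Proof. by move=> h; split=> [|a aX]; apply: h; rewrite mem_rcons inE ?eqxx ?aX ?orbT. Qed.

Section Fixed.
Variable r : R.
Hypothesis r01 : 0 < r < 1.
Let r0 : 0 < r. Proof. by case/andP: r01. Qed.
Let ri0 : 0 < r^-1. Proof. by rewrite invr_gt0 r0. Qed.
Let rri : r <= r^-1.
Proof. by case/andP: r01 => a b; apply: (@le_trans _ _ 1); rewrite ?ltW// invf_gt1. Qed.

Lemma ann_falg : funalg (@lau R) (ann r r^-1).
Proof. by apply: (@lau_falg _ _ r r^-1) => // z. Qed.

Lemma ucl_ann_exp (k : int) : ucl (@lau R) (ann r r^-1) (fun z => z ^ k).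
Proof. by apply: ucl_base; exact: lau_exp. Qed.

Lemma ucl_mulout h x : ucl (@lau R) (ann r r^-1) h -> ucl (@lau R) (ann r r^-1) (fun z => h z * (1 - x * z)).
Proof.
move=> uh; apply: (ucl_mul ann_falg) => //; apply: (ucl_subr ann_falg); first exact: (ucl_cst ann_falg).
by apply: (ucl_mul ann_falg); [exact: (ucl_cst ann_falg)|apply: ucl_ext (ucl_ann_exp 1) => z _; rewrite expr1z].
Qed.

Lemma ucl_mulin h x : ucl (@lau R) (ann r r^-1) h -> ucl (@lau R) (ann r r^-1) (fun z => h z * (1 - x / z)).
Proof.
move=> uh; apply: (ucl_mul ann_falg) => //; apply: (ucl_subr ann_falg); first exact: (ucl_cst ann_falg).
by apply: (ucl_mul ann_falg); [exact: (ucl_cst ann_falg)|apply: ucl_ext (ucl_ann_exp (-1)) => z _].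
Qed.

Lemma ucl_inv1 a : small r a -> ucl (@lau R) (fun z => cmod z = r^-1) (fun z => (1 - a / z)^-1).
Proof.
move=> sa; apply: (ucl_circ_inv (f := fun z => (1 - a * z)^-1)) => //.
exact/ucl0_lau/circ_geom0.
Qed.

Section Peel.
Variable h : C -> C.
Hypothesis uh : ucl (@lau R) (ann r r^-1) h.

Lemma bout_rcons X a : {in rcons X a, forall x, small r x} ->
  bout (fun z => h z * (1 - a * z)) r (rcons X a) = bout h r X.
Proof.
move=> /small_rcons[sa sX]; apply: CT_ext => // z zr.
rewrite rprod_rcons -mulrA [_ * (rprod _ _ _ / _)]mulrC mulfVK//.
exact: circ_nz sa zr.
Qed.

Lemma bin_rcons X a : {in rcons X a, forall x, small r x} ->
  bin (fun z => h z * (1 - a / z)) r (rcons X a) = bin h r X.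
Proof.
move=> /small_rcons[sa sX]; apply: CT_ext => // z zr.
rewrite rprod_rcons -mulrA [_ * (rprod _ _ _ / _)]mulrC mulfVK//.
exact: (circ_nz sa (circ_inv zr)).
Qed.

(** From 1 - a y = (1 - y/z) + (1 - a z) - (1 - a z)(1 - y/z), the identity behind the recursion of
    [Lrec]; [bout_step] is its mirror image. *)
Lemma bin_step a y Y : {in y :: Y, forall x, small r x} ->
  (1 - a * y) * bin h r (y :: Y) = bin h r Y + bin (fun z => h z * (1 - a * z)) r (y :: Y)
    - bin (fun z => h z * (1 - a * z)) r Y.
Proof.
move=> sY; have [sy sY'] := small_cons sY.
have g := CT_good ri0.
have u1 : ucl (@lau R) (fun z => cmod z = r^-1) h := uh_ri r01 uh.
have u2 : ucl (@lau R) (fun z => cmod z = r^-1) (fun z => h z * (1 - a * z)) := uh_ri r01 (ucl_mulout a uh).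
have u3 := ucl_rin r01 sY. have u4 := ucl_rin r01 sY'.
rewrite /bin -(gf_Z g); last exact: (gf_okM g).
rewrite -(gf_D g); try exact: (gf_okM g).
rewrite -(LB g); [|by apply: (gf_okD g); exact: (gf_okM g)|exact: (gf_okM g)].
apply: (gf_ext g) => z zr; have zi := circ_inv zr.
have nz := circ_nz sy zi; have z0 : z != 0 := circ_neq0 ri0 zr.
rewrite rprod_cons; field; rewrite z0 /=.
have E : 1 - y / z = (z - y) / z by field.
by apply: contraNneq nz => e; rewrite E e mul0r.
Qed.

Lemma bout_step b x X : {in x :: X, forall a, small r a} ->
  (1 - x * b) * bout h r (x :: X) = bout (fun z => h z * (1 - b / z)) r (x :: X) + bout h r X
    - bout (fun z => h z * (1 - b / z)) r X.
Proof.
move=> sY; have [sy sY'] := small_cons sY.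
have g := CT_good r0.
have u1 : ucl (@lau R) (fun z => cmod z = r) h := uh_r r01 uh.
have u2 : ucl (@lau R) (fun z => cmod z = r) (fun z => h z * (1 - b / z)) := uh_r r01 (ucl_mulin b uh).
have u3 := ucl_rout r01 sY. have u4 := ucl_rout r01 sY'.
rewrite /bout -(gf_Z g); last exact: (gf_okM g).
rewrite -(gf_D g); try exact: (gf_okM g).
rewrite -(LB g); [|by apply: (gf_okD g); exact: (gf_okM g)|exact: (gf_okM g)].
apply: (gf_ext g) => z zr.
have nz := circ_nz sy zr; have z0 : z != 0 := circ_neq0 r0 zr.
by rewrite rprod_cons; field; rewrite z0 nz.
Qed.

Lemma nondeg_rconsr (X : seq C) a (Y : seq C) : nondeg X (rcons Y a) -> nondeg X Y.
Proof. by move=> nd x y xX yY; apply: nd; rewrite // mem_rcons inE yY orbT. Qed.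

(** A pole cancelled by a factor 1 - a z of the kernel contributes nothing. It is appended at the
    end because [Lrec] consumes its lists from the front. *)
Lemma Lrec_rcons_out X a Y : {in rcons X a, forall x, small r x} -> {in Y, forall x, small r x} ->
  nondeg (rcons X a) Y -> Lrec (fun z => h z * (1 - a * z)) r (rcons X a) Y = Lrec h r X Y.
Proof.
elim: X Y => [|x X IHX] Y.
  move=> sX; elim: Y => [|y Y IHY] sY nd.
    by rewrite (Lrec_nil r01 (ucl_mulout a uh)) bout_rcons// -(bnil r01 uh).
  have [sy sY'] := small_cons sY; have [xy n1 n2 n3] := nondeg_cons nd.
  rewrite /rcons Lrec_cons. rewrite (IHY sY' n1).
  apply: (mulfI xy); rewrite mulrA divff// mul1r.
  by rewrite [RHS](bin_step a sY).
elim: Y => [|y Y IHY] sX sY nd.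
  by rewrite !Lrec_nil// ?bout_rcons//; exact: ucl_mulout.
have [sy sY'] := small_cons sY; have [xy n1 n2 n3] := nondeg_cons nd.
have [sx sX'] := small_cons sX.
by rewrite rcons_cons !Lrec_cons -IHY// -IHX// -IHX.
Qed.

Lemma Lrec_rcons_in X Y b : {in X, forall x, small r x} -> {in rcons Y b, forall x, small r x} ->
  nondeg X (rcons Y b) -> Lrec (fun z => h z * (1 - b / z)) r X (rcons Y b) = Lrec h r X Y.
Proof.
elim: X Y => [|x X IHX] Y; first by move=> _ sY _ /=; exact: bin_rcons.
elim: Y => [|y Y IHY] sX sY nd.
  have [sx sX'] := small_cons sX; have [xy n1 n2 n3] := nondeg_cons nd.
  have E := IHX [::] sX' sY n2.
  rewrite /= in E; rewrite /rcons Lrec_cons [Lrec _ _ X [:: b]]E.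
  rewrite !(Lrec_nil r01)//; try exact: ucl_mulin.
  by apply: (mulfI xy); rewrite mulrA divff// mul1r (bout_step b sX).
have [sy sY'] := small_cons sY; have [xy n1 n2 n3] := nondeg_cons nd.
have [sx sX'] := small_cons sX.
by rewrite rcons_cons !Lrec_cons -IHY// -IHX// -IHX.
Qed.

End Peel.

Lemma Lrec_ext h h' X Y : (forall z, ann r r^-1 z -> h z = h' z) -> Lrec h r X Y = Lrec h' r X Y.
Proof.
move=> e.
have e1 A : bout h r A = bout h' r A.
  by apply: CT_ext => // z zr; rewrite e// /ann zr lexx rri.
have e2 A : bin h r A = bin h' r A.
  by apply: CT_ext => // z zr; rewrite e// /ann zr lexx rri.
elim: X Y => [|x X IHX] Y //=; elim: Y => [|y Y IHY] //=.
by move: IHY => /= ->; rewrite !IHX.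
Qed.

(** Enlarging a truncation adds poles together with the kernel factors that cancel them, on both
    sides of the contour at once. *)
Lemma Lrec_cat h X Z : ucl (@lau R) (ann r r^-1) h -> {in X ++ Z, forall x, small r x} ->
  nondeg (X ++ Z) (X ++ Z) ->
  Lrec (fun z => h z * \prod_(x <- Z) ((1 - x * z) * (1 - x / z))) r (X ++ Z) (X ++ Z) = Lrec h r X X.
Proof.
elim: Z X h => [|z Z IH] X h uh sm nd.
  by rewrite cats0; apply: Lrec_ext => w _; rewrite big_nil mulr1.
rewrite -cat_rcons in sm nd *.
have sm' : {in rcons X z, forall x, small r x} by move=> x xX; apply: sm; rewrite mem_cat xX.
have nd' : nondeg (rcons X z) (rcons X z) by move=> x y xX yX; apply: nd; rewrite mem_cat ?xX ?yX.
have u1 := ucl_mulout z uh; have u2 := ucl_mulin z u1.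
transitivity (Lrec (fun w => (h w * (1 - z * w) * (1 - z / w)) * \prod_(x <- Z) ((1 - x * w) * (1 - x / w))) r (rcons X z ++ Z) (rcons X z ++ Z)).
  by apply: Lrec_ext => w _; rewrite big_cons !mulrA.
rewrite IH// (Lrec_rcons_in u1)// ?(Lrec_rcons_out uh)//.
- by have [] := small_rcons sm'.
- exact: nondeg_rconsr nd'.
Qed.

Lemma CT_geom_out a (k : int) : small r a -> CT r (fun z => z ^ k * (1 - a * z)^-1) =
  if (0 < k)%R then 0 else a ^+ `|k|%N.
Proof.
move=> sa.
have g := CT_good r0; have oz := circ_okexp r; have oa : ucl (@lau R) (fun z => cmod z = r) (fun z => (1 - a * z)^-1) := ucl0_lau (circ_geom0 sa).
have rec (j : int) : CT r (fun z => z ^ j * (1 - a * z)^-1) = (if j == 0 then 1 else 0) + a * CT r (fun z => z ^ (j + 1) * (1 - a * z)^-1).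
  rewrite -(CT_exp j r0) -(gf_Z g); last by apply: (gf_okM g).
  rewrite -(gf_D g)//; last by apply: (gf_okM g); [exact: (gf_cst g)|exact: (gf_okM g)].
  apply: (gf_ext g) => z zr; have nz := circ_nz sa zr; have z0 := circ_neq0 r0 zr.
  by rewrite exprzDr ?unitfE// expr1z; field.
have pos (j : nat) : CT r (fun z => z ^ j.+1%:Z * (1 - a * z)^-1) = 0.
  rewrite -(CT_lau0 r0 (f := fun z => z ^+ j * (1 - a * z)^-1)).
    by apply: CT_ext => // z _; rewrite -exprnP exprS mulrA.
  apply: (ucl_mul (lau0_falg r)); last exact: circ_geom0.
  by apply: (ucl_exp (lau0_falg r)); apply: ucl_base; exact: lau0_id.
have neg (j : nat) : CT r (fun z => z ^ (- j%:Z) * (1 - a * z)^-1) = a ^+ j.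
  elim: j => [|j IH]; first by rewrite oppr0 rec eqxx add0r (pos 0%N) mulr0 addr0 expr0.
  rewrite rec (_ : - j.+1%:Z + 1 = - j%:Z); last by lia.
  by rewrite IH exprS (_ : (- j.+1%:Z == 0) = false) ?add0r//; apply/eqP; lia.
case: k => [[|k]|k].
- by have := neg 0%N; rewrite oppr0 => ->.
- by rewrite pos.
- by rewrite NegzE neg abszN.
Qed.

Lemma CT_geom_in a (k : int) : small r a -> CT r^-1 (fun z => z ^ k * (1 - a / z)^-1) =
  if (k < 0)%R then 0 else a ^+ `|k|%N.
Proof.
move=> sa; have := CT_geom_out (- k) sa; rewrite oppr_gt0 abszN => <-.
rewrite -(@CT_inv _ _ (fun z => z ^ (- k) * (1 - a * z)^-1))//.
  by apply: CT_ext => // z _; rewrite exprz_inv opprK.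
apply: (ucl_mul (lau_circ r0)); first exact: circ_okexp.
exact/ucl0_lau/circ_geom0.
Qed.

Lemma geom_le (u : C) : cmod u <= 1 / 2 -> cmod (1 - u)^-1 <= 2.
Proof.
move=> hu; rewrite cmodV -[leRHS]invrK lef_pV2 ?posrE ?invr_gt0//.
- by have := cmodBl 1 u; rewrite cmod1; lra.
- by have := cmodBl 1 u; rewrite cmod1; lra.
Qed.

(** Both sides are bounded functionals of [h] that agree on powers of z: the left one adds the two
    halves of the Laurent series at [x] and removes the constant term counted twice. *)
Lemma laurent_split h x : ucl (@lau R) (ann r r^-1) h -> x != 0 -> small r x -> small r x^-1 ->
  phi h r x + psi h r x^-1 - h0 h r = h x.
Proof.
move=> uh x0 sx sxi.
have ax : ann r r^-1 x.
  have xp : 0 < cmod x by rewrite cmod_gt0.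
  move: sx sxi; rewrite /small /ann cmodV => a b; split.
    by rewrite -[leRHS]invrK -[leLHS]invrK lef_pV2 ?posrE ?invr_gt0//; rewrite -ler_pdivlMr// in b; apply: le_trans b _; rewrite ler_piMl// ?invr_ge0 ?ltW//; lra.
  by rewrite -ler_pdivlMr// in a; apply: le_trans a _; rewrite ler_piMl// ?invr_ge0 ?ltW//; lra.
have A := ann_falg; have g := CT_good r0; have g' := CT_good ri0.
have o1 : ucl (@lau R) (fun z => cmod z = r^-1) (fun z => (1 - x / z)^-1) by exact: ucl_inv1.
have o2 : ucl (@lau R) (fun z => cmod z = r) (fun z => (1 - x^-1 * z)^-1) := ucl0_lau (circ_geom0 sxi).
have so f : ucl (@lau R) (ann r r^-1) f -> ucl (@lau R) (fun z => cmod z = r) f.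
  by apply: ucl_sub => z zr; rewrite /ann zr lexx.
have si f : ucl (@lau R) (ann r r^-1) f -> ucl (@lau R) (fun z => cmod z = r^-1) f.
  by apply: ucl_sub => z zr; rewrite /ann zr lexx.
have ro f z : ann r r^-1 z -> True by [].
pose L1 f := phi f r x + psi f r x^-1 - h0 f r.
pose L2 (f : C -> C) := f x.
have ao z : cmod z = r -> ann r r^-1 z by move=> zr; rewrite /ann zr lexx.
have ai z : cmod z = r^-1 -> ann r r^-1 z by move=> zr; rewrite /ann zr lexx.
have G1 : goodfun (ann r r^-1) (ucl (@lau R) (ann r r^-1)) L1.
  split.
  - move=> f f' e; rewrite /L1 /phi /psi /h0; congr (_ + _ - _); apply: CT_ext => // z zr; rewrite e//; by [exact: ai|exact: ao].
  - by move=> c; exact: (ucl_cst A).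
  - by move=> f f'; exact: (ucl_add A).
  - by move=> f f'; exact: (ucl_mul A).
  - move=> f f' uf uf'; rewrite /L1 /phi /psi /h0.
    rewrite (gf_D g (so _ uf) (so _ uf')).
    rewrite (gf_ext g' (h := fun z => f z * (1 - x / z)^-1 + f' z * (1 - x / z)^-1)); last by move=> z _; rewrite mulrDl.
    rewrite (gf_ext g (h := fun z => f z * (1 - x^-1 * z)^-1 + f' z * (1 - x^-1 * z)^-1)); last by move=> z _; rewrite mulrDl.
    rewrite (gf_D g') ?(gf_D g); try (by apply: (gf_okM g) => //; exact: so); try (by apply: (gf_okM g') => //; exact: si).
    by ring.
  - move=> c f uf; rewrite /L1 /phi /psi /h0 (gf_Z g c (so _ uf)).
    rewrite (gf_ext g' (h := fun z => c * (f z * (1 - x / z)^-1))); last by move=> z _; rewrite mulrA.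
    rewrite (gf_ext g (h := fun z => c * (f z * (1 - x^-1 * z)^-1))); last by move=> z _; rewrite mulrA.
    rewrite (gf_Z g') ?(gf_Z g); try (by apply: (gf_okM g) => //; exact: so); try (by apply: (gf_okM g') => //; exact: si).
    by ring.
have G2 : goodfun (ann r r^-1) (ucl (@lau R) (ann r r^-1)) L2.
  split=> //; rewrite /L2.
  - by move=> f f'; exact.
  - by move=> c; exact: (ucl_cst A).
  - by move=> f f'; exact: (ucl_add A).
  - by move=> f f'; exact: (ucl_mul A).
have nz z : ann r r^-1 z -> ann r r^-1 z /\ z != 0.
  by move=> az; split=> //; rewrite -cmod_gt0; case: az => a _; exact: lt_le_trans a.
have B1 f M : ucl (@lau R) (ann r r^-1) f -> (forall z, ann r r^-1 z -> cmod (f z) <= M) -> cmod (L1 f) <= 5 * M.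
  move=> uf hM.
  have b1 : cmod (phi f r x) <= M * 2.
    apply: CT_le => //; first by apply: (gf_okM g') => //; exact: si.
    move=> z zr; rewrite cmodM ler_pM ?cmod_ge0//; first exact/hM/ai.
    by apply: geom_le; rewrite cmodM (circ_inv zr).
  have b2 : cmod (psi f r x^-1) <= M * 2.
    apply: CT_le => //; first by apply: (gf_okM g) => //; exact: so.
    move=> z zr; rewrite cmodM ler_pM ?cmod_ge0//; first exact/hM/ao.
    by apply: geom_le; rewrite cmodM zr.
  have b3 : cmod (h0 f r) <= M by apply: CT_le => //; [exact: so|move=> z /ao; exact: hM].
  apply: le_trans (cmodB _ _) _; have := cmodD (phi f r x) (psi f r x^-1); lra.
have B2 f M : ucl (@lau R) (ann r r^-1) f -> (forall z, ann r r^-1 z -> cmod (f z) <= M) -> cmod (L2 f) <= 1 * M.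
  by move=> uf hM; rewrite mul1r; exact: hM.
have := @goodfun_ucl _ _ _ _ _ _ _ _ 1 1 5 1 h (fun=> 1) G1 G2 B1 B2.
have e : (fun z => h z * 1) = h by apply/funext => z; rewrite mulr1.
rewrite e /L1 /L2; apply => //; try by move=> z _; rewrite cmod1.
all: try exact: nz.
all: try exact: uh.
all: try exact: (ucl_cst A 1).
all: try exact: ucl_ann_exp.
move=> k; rewrite mulr1.
have -> : (fun z : C => z ^ k * 1) = (fun z : C => z ^ k) by apply/funext => z; rewrite mulr1.
rewrite /phi /psi /h0 CT_geom_in// CT_geom_out// CT_exp//.
case: k => [[|k]|k] /=.
- by rewrite !expr0 expr0z; ring.
- by rewrite addr0 subr0.
- by rewrite add0r subr0 NegzE exprVn -exprnN.
Qed.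

Lemma Lrec_diag h X : ucl (@lau R) (ann r r^-1) h -> uniq X -> allsm r X -> nondeg X X -> X != [::] ->
  Lrec h r X X = \sum_(x <- X) alp X X x * (psi h r x + phi h r x - h0 h r).
Proof.
move=> uh uX sX nd /negbTE Xn; rewrite (Lrec_pf r01 uh)// Xn mul0r add0r -big_split /=.
by apply: eq_bigr => x _; rewrite -mulrDr addrAC.
Qed.

End Fixed.

(** No pole lies between the two radii, so each constant term of the recursion is unchanged by
    [CT_radius]. *)
Lemma Lrec_radius (r r' : R) h X Y : 0 < r' <= r -> r < 1 -> ucl (@lau R) (ann r' r'^-1) h ->
  {in X, forall x, small r x} -> {in Y, forall x, small r x} -> Lrec h r X Y = Lrec h r' X Y.
Proof.
move=> /andP[r'0 r'r] r1 uh.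
have r0 : 0 < r by exact: lt_le_trans r'r.
have ri : r^-1 <= r'^-1 by rewrite lef_pV2 ?posrE.
have rri : r <= r^-1 by apply: (@le_trans _ _ 1); rewrite ?ltW// invf_gt1.
have e1 A : {in A, forall x, small r x} -> bout h r A = bout h r' A.
  move=> sA; apply: (@CT_radius _ r' r) => //; rewrite ?lexx ?r'r//.
  have F : funalg (@lau R) (ann r' r) by apply: (@lau_falg _ _ r' r) => // z.
  apply: (ucl_mul F).
    by apply: ucl_sub uh => z [a b]; split=> //; apply: le_trans b _; exact: le_trans ri.
  apply: (ucl_prod_in F) => a /sA sa.
  apply: (ucl_geom F (th := 1/2)); first by apply/andP; split; lra.
    apply: (ucl_mul F); first exact: (ucl_cst F).
    by apply: ucl_ext (ucl_base _ (lau_exp _ 1)) => z _; rewrite expr1z.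
  by move=> z [_ zr]; rewrite cmodM; apply: le_trans sa; rewrite ler_pM ?cmod_ge0.
have e2 A : {in A, forall x, small r x} -> bin h r A = bin h r' A.
  move=> sA; apply: (@CT_radius _ r^-1 r'^-1) => //; rewrite ?lexx ?invr_gt0 ?ri//.
  have F : funalg (@lau R) (ann r^-1 r'^-1) by apply: (@lau_falg _ _ r^-1 r'^-1); rewrite ?invr_gt0.
  apply: (ucl_mul F).
    by apply: ucl_sub uh => z [a b]; split=> //; apply: le_trans a; exact: le_trans rri.
  apply: (ucl_prod_in F) => a /sA sa.
  apply: (ucl_geom F (th := 1/2)); first by apply/andP; split; lra.
    apply: (ucl_mul F); first exact: (ucl_cst F).
    by apply: ucl_ext (ucl_base _ (lau_exp _ (-1))) => z _.
  move=> z [zr _]; rewrite cmodM; apply: le_trans sa; rewrite ler_pM ?cmod_ge0//.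
  by rewrite cmodV -[leRHS]invrK lef_pV2 ?posrE ?invr_gt0//; apply: lt_le_trans zr; rewrite invr_gt0.
elim: X Y => [|x X IHX] Y sX sY /=; first exact: e2.
have [sx sX'] := small_cons sX.
elim: Y sY => [|y Y IHY] sY /=; first exact: e1.
by have [sy sY'] := small_cons sY; move: (IHY sY') => /= ->; rewrite !IHX.
Qed.

Section Param.
Variables (T : Type) (A : (T -> C) -> Prop) (W : T -> Prop).
Hypothesis AA : funalg A W.
Variable r : R.
Hypothesis r01 : 0 < r < 1.
Variable hh : T * C -> C.
Hypothesis uhh : ucl (lpar A) (fun x => W x.1 /\ ann r r^-1 x.2) hh.
Let r0 : 0 < r. Proof. by case/andP: r01. Qed.
Let ri0 : 0 < r^-1. Proof. by rewrite invr_gt0 r0. Qed.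
Let rri : r <= r^-1.
Proof. by case/andP: r01 => a b; apply: (@le_trans _ _ 1); rewrite ?ltW// invf_gt1. Qed.

Definition hol_small (x : T -> C) := ucl A W x /\ forall t, W t -> small r (x t).
Definition hol_smalls (X : seq (T -> C)) := forall i, hol_small (nth (fun=> 0) X i).
Definition evs (X : seq (T -> C)) (t : T) : seq C := [seq x t | x : T -> C <- X].

Lemma hol_small0 : hol_small (fun=> 0).
Proof. by split; [exact: (ucl_cst AA)|move=> t _; rewrite /small cmod0 mul0r; lra]. Qed.

Lemma evs_cons x X t : evs (x :: X) t = x t :: evs X t. Proof. by []. Qed.

Lemma hol_smalls_cons x X : hol_smalls (x :: X) -> hol_small x /\ hol_smalls X.
Proof. by move=> h; split; [exact: (h 0%N)|move=> i; exact: (h i.+1)]. Qed.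

Lemma circ_falg (rr : R) : 0 < rr -> funalg (lpar A) (fun x : T * C => W x.1 /\ cmod x.2 = rr).
Proof. by move=> rr0; apply: (@lpar_falg _ _ _ _ AA _ rr rr) => // t z [Wt zr]; split=> //; exact: circ_ann. Qed.

Lemma ucl_gout x : hol_small x -> ucl (lpar A) (fun y : T * C => W y.1 /\ cmod y.2 = r) (fun y => (1 - x y.1 * y.2)^-1).
Proof.
move=> [ux sx]; have F := circ_falg r0.
apply: (ucl_geom F (th := 1/2)); first by apply/andP; split; lra.
  apply: (ucl_mul F); first by apply: (ucl_fst AA) => // t z [].
  by apply: ucl_ext (ucl_base _ (lpar_exp AA 1)) => z _; rewrite expr1z.
by move=> [t z] /= [Wt zr]; rewrite cmodM zr; exact: sx.
Qed.

Lemma ucl_gin x : hol_small x -> ucl (lpar A) (fun y : T * C => W y.1 /\ cmod y.2 = r^-1) (fun y => (1 - x y.1 / y.2)^-1).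
Proof.
move=> [ux sx]; have F := circ_falg ri0.
apply: (ucl_geom F (th := 1/2)); first by apply/andP; split; lra.
  apply: (ucl_mul F); first by apply: (ucl_fst AA) => // t z [].
  by apply: ucl_ext (ucl_base _ (lpar_exp AA (-1))) => z _.
by move=> [t z] /= [Wt zr]; rewrite cmodM (circ_inv zr); exact: sx.
Qed.

Lemma ucl_rprod (rr : R) (xi : C -> C) X : 0 < rr ->
  (forall x, hol_small x -> ucl (lpar A) (fun y : T * C => W y.1 /\ cmod y.2 = rr) (fun y => (1 - x y.1 * xi y.2)^-1)) ->
  hol_smalls X -> ucl (lpar A) (fun y : T * C => W y.1 /\ cmod y.2 = rr) (fun y => rprod xi (evs X y.1) y.2).
Proof.
move=> rr0 hx; have F := circ_falg rr0; elim: X => [|x X IH] sX.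
  by apply: ucl_ext (ucl_cst F 1) => y _; rewrite /rprod big_nil.
have [sx sX'] := hol_smalls_cons sX.
by apply: ucl_ext (ucl_mul F (hx _ sx) (IH sX')) => y _; rewrite /= rprod_cons.
Qed.

Lemma ucl_psi x : hol_small x -> ucl A W (fun t => psi (fun z => hh (t, z)) r (x t)).
Proof.
move=> sx; apply: (ucl_CT AA (phi := fun y => hh y * (1 - x y.1 * y.2)^-1)) => //.
apply: (ucl_mul (circ_falg r0)); last exact: ucl_gout.
by apply: ucl_sub uhh => -[t z] /= [Wt zr]; split=> //; rewrite /ann zr lexx.
Qed.

Lemma ucl_phi x : hol_small x -> ucl A W (fun t => phi (fun z => hh (t, z)) r (x t)).
Proof.
move=> sx; apply: (ucl_CT AA (phi := fun y => hh y * (1 - x y.1 / y.2)^-1)) => //.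
apply: (ucl_mul (circ_falg ri0)); last exact: ucl_gin.
by apply: ucl_sub uhh => -[t z] /= [Wt zr]; split=> //; rewrite /ann zr lexx.
Qed.

Lemma ucl_h0 : ucl A W (fun t => h0 (fun z => hh (t, z)) r).
Proof.
apply: (ucl_CT AA (phi := fun y => hh y)) => //.
by apply: ucl_sub uhh => -[t z] /= [Wt zr]; split=> //; rewrite /ann zr lexx.
Qed.

Lemma ucl_hat t : W t -> ucl (@lau R) (ann r r^-1) (fun z => hh (t, z)).
Proof. by move=> Wt; apply: (ucl_at _ uhh) => z az. Qed.

Lemma ucl_bout X : hol_smalls X -> ucl A W (fun t => bout (fun z => hh (t, z)) r (evs X t)).
Proof.
move=> sX; apply: (ucl_CT AA (phi := fun y => hh y * rout (evs X y.1) y.2)) => //.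
apply: (ucl_mul (circ_falg r0)); last by apply: (ucl_rprod r0) => // x; exact: ucl_gout.
by apply: ucl_sub uhh => -[t z] /= [Wt zr]; split=> //; rewrite /ann zr lexx.
Qed.

Lemma ucl_bin X : hol_smalls X -> ucl A W (fun t => bin (fun z => hh (t, z)) r (evs X t)).
Proof.
move=> sX; apply: (ucl_CT AA (phi := fun y => hh y * rin (evs X y.1) y.2)) => //.
apply: (ucl_mul (circ_falg ri0)); last by apply: (ucl_rprod ri0) => // x; exact: ucl_gin.
by apply: ucl_sub uhh => -[t z] /= [Wt zr]; split=> //; rewrite /ann zr lexx.
Qed.

Definition cross (X Y : seq C) : C := \prod_(x <- X) \prod_(y <- Y) (1 - x * y).

(** Each step of the recursion divides by one 1 - x y, so the product over all pairs clears the
    denominators. The resulting [P] is holomorphic also where some 1 - x y vanishes, which continues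
    the integral. *)
Lemma Lrec_clear X Y : hol_smalls X -> hol_smalls Y -> exists2 P, ucl A W P &
  forall t, W t -> nondeg (evs X t) (evs Y t) ->
    P t = cross (evs X t) (evs Y t) * Lrec (fun z => hh (t, z)) r (evs X t) (evs Y t).
Proof.
have u1 (X' : seq (T -> C)) (y : T -> C) : hol_smalls X' -> ucl A W y -> ucl A W (fun t => \prod_(x <- evs X' t) (1 - x * y t)).
  move=> + uy; elim: X' => [|x X' IH] sX.
    by apply: ucl_ext (ucl_cst AA 1) => t _; rewrite big_nil.
  have [[ux _] sX'] := hol_smalls_cons sX.
  apply: ucl_ext (ucl_mul AA (ucl_subr AA (ucl_cst AA 1) (ucl_mul AA ux uy)) (IH sX')) => t _.
  by rewrite /= big_cons.
elim: X Y => [|x X IHX] Y sX sY.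
  exists (fun t => bin (fun z => hh (t, z)) r (evs Y t)); first exact: ucl_bin.
  by move=> t Wt _; rewrite /cross big_nil mul1r.
have [sx sX'] := hol_smalls_cons sX.
elim: Y sY => [|y Y IHY] sY.
  exists (fun t => bout (fun z => hh (t, z)) r (evs (x :: X) t)); first exact: ucl_bout.
  move=> t Wt _; rewrite (Lrec_nil r01); last exact: ucl_hat.
  by rewrite /cross big1 ?mul1r// => a _; rewrite big_nil.
have [sy sY'] := hol_smalls_cons sY.
have [P1 uP1 hP1] := IHY sY'.
have [P2 uP2 hP2] := IHX (y :: Y) sX' sY.
have [P3 uP3 hP3] := IHX Y sX' sY'.
have ua := u1 X y sX' sy.1; have ub := u1 Y x sY' sx.1.
exists (fun t => (\prod_(a <- evs X t) (1 - a * y t)) * P1 t + (\prod_(a <- evs Y t) (1 - a * x t)) * P2 t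
   - (\prod_(a <- evs X t) (1 - a * y t)) * (\prod_(a <- evs Y t) (1 - a * x t)) * P3 t).
  apply: (ucl_subr AA); first by apply: (ucl_add AA); exact: (ucl_mul AA).
  by apply: (ucl_mul AA) => //; exact: (ucl_mul AA).
move=> t Wt nd; rewrite !evs_cons in nd; have [xy n1 n2 n3] := nondeg_cons nd.
rewrite hP1// hP2// hP3// !evs_cons (Lrec_cons _ r (x t) (evs X t) (y t)).
have -> : \prod_(a <- evs Y t) (1 - a * x t) = \prod_(a <- evs Y t) (1 - x t * a).
  by apply: eq_bigr => a _; rewrite mulrC.
have e1 : cross (x t :: evs X t) (evs Y t) = \prod_(a <- evs Y t) (1 - x t * a) * cross (evs X t) (evs Y t).
  by rewrite /cross big_cons.
have e2 : cross (evs X t) (y t :: evs Y t) = \prod_(a <- evs X t) (1 - a * y t) * cross (evs X t) (evs Y t).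
  by rewrite /cross -big_split /=; apply: eq_bigr => a _; rewrite big_cons.
have e3 : cross (x t :: evs X t) (y t :: evs Y t) = (1 - x t * y t) * \prod_(a <- evs Y t) (1 - x t * a) * cross (evs X t) (y t :: evs Y t).
  by rewrite /cross big_cons big_cons.
rewrite e3 e2 e1; field.
exact: xy.
Qed.

End Param.
End Independence.

(** * Theta and elliptic gamma functions *)

Section Products.
Variable R : realType.
Local Notation C := (CC R).

Definition qp (x p : C) : C := limn (fun N => \prod_(i < N) (1 - p ^+ i * x)).
(* [S] marks a factor to be left out: the one that vanishes at a residue. *)
Definition dfac (S : option (nat * nat)) (x p q : C) (i j : nat) : C :=
  if S == Some (i, j) then 1 else 1 - p ^+ i * q ^+ j * x.
Definition dp (F : nat -> nat -> C) : C := limn (fun N => \prod_(i < N) \prod_(j < N) F i j).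
Definition P2 S x p q := dp (dfac S x p q).
(** The denominators of the gamma function outside the [K] by [K] square; for large [K] none of
    their zeros meets a given annulus. *)
Definition itail K (x p q : C) : C := limn (fun N => \prod_(c <- shells K N) (1 - p ^+ c.1 * q ^+ c.2 * x)^-1).
Definition th (x p : C) : C := qp x p * qp (p / x) p.

Lemma qpoch2E x p q : qpoch2 x p q = P2 None x p q.
Proof. by []. Qed.

Lemma cmod_geo (p x : C) (rho B : R) i : cmod p <= rho -> cmod x <= B -> cmod (1 - p ^+ i * x - 1) <= B * rho ^+ i.
Proof.
move=> hp hx; rewrite addrAC subrr sub0r cmodN cmodM cmodX mulrC.
have r0 : 0 <= rho := le_trans (cmod_ge0 _) hp.
by apply: ler_pM => //; rewrite ?exprn_ge0 ?cmod_ge0// lerXn2r// ?nnegrE ?cmod_ge0.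
Qed.

Lemma cmod_geo2 (p q x : C) (rho B : R) i j : cmod p <= rho -> cmod q <= rho -> cmod x <= B ->
  cmod (p ^+ i * q ^+ j * x) <= B * rho ^+ (i + j).
Proof.
move=> hp hq hx; rewrite !cmodM !cmodX mulrC exprD.
have r0 : 0 <= rho := le_trans (cmod_ge0 _) hp.
apply: ler_pM => //; rewrite ?cmod_ge0 ?mulr_ge0 ?exprn_ge0 ?cmod_ge0//.
by apply: ler_pM; rewrite ?exprn_ge0 ?cmod_ge0// lerXn2r// ?nnegrE ?cmod_ge0.
Qed.

Lemma dfac_near1 S (p q x : C) (rho B : R) i j : cmod p <= rho -> cmod q <= rho -> cmod x <= B ->
  cmod (dfac S x p q i j - 1) <= B * rho ^+ (i + j).
Proof.
move=> hp hq hx; rewrite /dfac; case: ifP => _.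
  by rewrite subrr cmod0 mulr_ge0 ?exprn_ge0//; [exact: le_trans (cmod_ge0 _) hx|exact: le_trans (cmod_ge0 _) hp].
by rewrite addrAC subrr sub0r cmodN; exact: cmod_geo2.
Qed.

Lemma max_rho (p q : C) : cmod p < 1 -> cmod q < 1 ->
  [/\ 0 <= Order.max (cmod p) (cmod q) < 1, cmod p <= Order.max (cmod p) (cmod q) & cmod q <= Order.max (cmod p) (cmod q)].
Proof.
move=> p1 q1; rewrite !le_max !lexx orbT; split=> //; apply/andP; split.
  by rewrite cmod_ge0.
by rewrite gt_max p1.
Qed.

Lemma qp_cvg (x p : C) : cmod p < 1 -> ccvg (fun N => \prod_(i < N) (1 - p ^+ i * x)) (qp x p).
Proof.
move=> p1; have hr : 0 <= cmod p < 1 by rewrite cmod_ge0.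
have [l hl _] := iprod_cvg hr (fun i => cmod_geo i (lexx _) (lexx (cmod x))).
by rewrite /qp (ccvg_lim hl).
Qed.

Lemma qp_neq0 (x p : C) : cmod p < 1 -> (forall k, p ^+ k * x != 1) -> qp x p != 0.
Proof.
move=> p1 h; have hr : 0 <= cmod p < 1 by rewrite cmod_ge0.
apply: (iprod_neq0 hr (fun i => cmod_geo i (lexx _) (lexx (cmod x))) (qp_cvg x p1)) => k.
by rewrite subr_eq0 eq_sym h.
Qed.

Lemma qp_rec (x p : C) : cmod p < 1 -> qp x p = (1 - x) * qp (p * x) p.
Proof.
move=> p1; apply: (ccvg_unique (ccvg_shift (qp_cvg x p1))).
apply: ccvg_eq (ccvgM (ccvg_cst (1 - x)) (qp_cvg (p * x) p1)); exists 0%N => n _.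
rewrite big_ord_recl expr0 mul1r; congr (_ * _); apply: eq_bigr => i _.
by rewrite lift0 exprSr mulrA.
Qed.

Section DP.
Variables (B rho : R).
Hypothesis hr : 0 <= rho < 1.
Hypothesis B0 : 0 <= B.

Lemma dp_cells F : (forall i j, cmod (F i j - 1) <= B * rho ^+ (i + j)) ->
  ccvg (fun N => \prod_(c <- cells N) F c.1 c.2) (dp F).
Proof.
move=> hF; have [l hl _] := @dprod_cvg _ (fun c => F c.1 c.2) B rho 0 hr B0 (fun c _ => hF c.1 c.2).
have hl' : ccvg (fun N => \prod_(c <- cells N) F c.1 c.2) l by [].
rewrite /dp (@ccvg_lim _ _ l)//; apply: ccvg_eq hl'; exists 0%N => n _.
by rewrite big_cells.
Qed.

Lemma dp_cvg F : (forall i j, cmod (F i j - 1) <= B * rho ^+ (i + j)) ->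
  ccvg (fun N => \prod_(i < N) \prod_(j < N) F i j) (dp F).
Proof. by move=> hF; apply: ccvg_eq (dp_cells hF); exists 0%N => n _; rewrite big_cells. Qed.

Lemma dp_neq0 F : (forall i j, cmod (F i j - 1) <= B * rho ^+ (i + j)) -> (forall i j, F i j != 0) -> dp F != 0.
Proof.
move=> hF nz.
by apply: (@dprod_neq0 _ (fun c => F c.1 c.2) B rho (dp F) hr B0) => [c||c]; [exact: hF|exact: dp_cells|exact: nz].
Qed.

Lemma dp_recl F s : (forall i j, cmod (F i j - 1) <= B * rho ^+ (i + j)) ->
  ccvg (fun N => \prod_(j < N) F 0%N j) s ->
  dp F = s * dp (fun i => F i.+1).
Proof.
move=> hF hs; have /andP[r0 r1] := hr.
have hF' i j : cmod (F i.+1 j - 1) <= B * rho ^+ (i + j).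
  apply: le_trans (hF _ _) _; rewrite ler_wpM2l// addSn exprS ler_piMl ?exprn_ge0// ltW//.
(* Row 0 followed by the shifted square of side N is the square of side N completed by its row of
   index N, whose product tends to 1. *)
have hb : ccvg (fun N => \prod_(j < N) F N j) 1.
  move=> e e0.
  have [N hN] := geo_small (B / (1 - rho) * expR (B / (1 - rho))) hr e0.
  exists N => n Nn; apply: le_lt_trans (hN n Nn).
  have hS : \sum_(j <- index_enum 'I_n) cmod (F n j - 1) <= B / (1 - rho) * rho ^+ n.
    apply: (@le_trans _ _ (\sum_(j < n) B * rho ^+ n * rho ^+ j)).
      by apply: ler_sum => j _; rewrite -mulrA -exprD.
    rewrite -mulr_sumr [leRHS]mulrAC ler_wpM2l ?mulr_ge0 ?exprn_ge0//.
    exact: geo_sum_le.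
  have [_ h2] := prod_near1 hS; apply: le_trans h2 _.
  have a0 : 0 <= B / (1 - rho) by rewrite divr_ge0// subr_ge0 ltW.
  rewrite mulrAC ler_wpM2r ?exprn_ge0// ler_wpM2l// ler_expR ler_piMr//.
  by rewrite exprn_ile1// ltW.
have h2 := ccvgM hs (dp_cvg hF').
have h1 : ccvg (fun N => (\prod_(i < N) \prod_(j < N) F i j) * \prod_(j < N) F N j) (s * dp (fun i => F i.+1)).
  apply: ccvg_eq h2; exists 0%N => N _.
  rewrite -(big_ord_recr N (fun i => \prod_(j < N) F i j)) big_ord_recl /=; congr (_ * _).
by rewrite -(ccvg_unique (ccvgM (dp_cvg hF) hb) h1) mulr1.
Qed.

End DP.

Lemma dp_sym (F : nat -> nat -> C) : dp F = dp (fun i j => F j i).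
Proof. by rewrite /dp; congr (limn _); apply/funext => N; rewrite exchange_big. Qed.

Section PQ.
Variables p q : C.
Hypotheses (p1 : cmod p < 1) (q1 : cmod q < 1).
Let rho := Order.max (cmod p) (cmod q).
Let hr : 0 <= rho < 1. Proof. by have [] := max_rho p1 q1. Qed.
Let hp : cmod p <= rho. Proof. by have [] := max_rho p1 q1. Qed.
Let hq : cmod q <= rho. Proof. by have [] := max_rho p1 q1. Qed.
Let near S x i j : cmod (dfac S x p q i j - 1) <= cmod x * rho ^+ (i + j).
Proof. exact: dfac_near1. Qed.

Lemma P2_cells S x : ccvg (fun N => \prod_(c <- cells N) dfac S x p q c.1 c.2) (P2 S x p q).
Proof. exact: (dp_cells hr (cmod_ge0 x) (near S x)). Qed.

Lemma P2_recN x : P2 None x p q = qp x q * P2 None (p * x) p q.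
Proof.
rewrite [LHS](dp_recl hr (cmod_ge0 x) (near None x) (s := qp x q)); last first.
  by apply: ccvg_eq (qp_cvg x q1); exists 0%N => N _; apply: eq_bigr => j _; rewrite /dfac /= expr0 mul1r.
congr (_ * dp _); apply/funext => i; apply/funext => j; rewrite /dfac /=.
by congr (1 - _); rewrite exprS; ring.
Qed.

Lemma P2_recS a b x : P2 (Some (a.+1, b)) x p q = qp x q * P2 (Some (a, b)) (p * x) p q.
Proof.
rewrite [LHS](dp_recl hr (cmod_ge0 x) (near _ x) (s := qp x q)); last first.
  by apply: ccvg_eq (qp_cvg x q1); exists 0%N => N _; apply: eq_bigr => j _; rewrite /dfac /= expr0 mul1r.
congr (_ * dp _); apply/funext => i; apply/funext => j; rewrite /dfac.
have -> : (Some (a.+1, b) == Some (i.+1, j)) = (Some (a, b) == Some (i, j)) by [].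
by case: ifP => // _; congr (1 - _); rewrite exprS; ring.
Qed.

Lemma P2_neq0 x : (forall a b, p ^+ a * q ^+ b * x != 1) -> P2 None x p q != 0.
Proof.
move=> nz; apply: (dp_neq0 hr (cmod_ge0 x) (near None x)) => i j.
by rewrite /dfac /= subr_eq0 eq_sym.
Qed.

Section Tail.
Variables (K : nat) (x : C).
Hypothesis hK : cmod x * rho ^+ K <= 1 / 2.

Lemma tail_half c : ((K <= c.1) || (K <= c.2))%N -> cmod (p ^+ c.1 * q ^+ c.2 * x) <= 1 / 2.
Proof.
move=> hc; apply: le_trans hK; apply: le_trans (cmod_geo2 _ _ hp hq (lexx (cmod x))) _.
rewrite ler_wpM2l ?cmod_ge0//; have /andP[r0 r1] := hr.
apply: ler_wiXn2l => //; first exact: ltW.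
by case/orP: hc => h; lia.
Qed.

Lemma inv_near1 (u : C) : cmod u <= 1 / 2 -> 1 - u != 0 /\ cmod ((1 - u)^-1 - 1) <= 2 * cmod u.
Proof.
move=> hu; have h : 1 / 2 <= cmod (1 - u) by have := cmodBl 1 u; rewrite cmod1; lra.
have nz : 1 - u != 0 by rewrite -cmod_gt0; lra.
split=> //; have -> : (1 - u)^-1 - 1 = u / (1 - u) by field.
rewrite cmodM cmodV mulrC ler_wpM2r ?cmod_ge0// -[leRHS]invrK lef_pV2 ?posrE ?invr_gt0; lra.
Qed.

Lemma itail_near1 c : ((K <= c.1) || (K <= c.2))%N ->
  cmod ((1 - p ^+ c.1 * q ^+ c.2 * x)^-1 - 1) <= 2 * cmod x * rho ^+ (c.1 + c.2).
Proof.
move=> hc; have [_ h] := inv_near1 (tail_half hc); apply: le_trans h _.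
rewrite -[leRHS]mulrA; apply: ler_pM; rewrite ?cmod_ge0//; exact: cmod_geo2.
Qed.

Lemma itail_cvg : ccvg (fun N => \prod_(c <- shells K N) (1 - p ^+ c.1 * q ^+ c.2 * x)^-1) (itail K x p q).
Proof.
have B0 : 0 <= 2 * cmod x by rewrite mulr_ge0 ?cmod_ge0.
have [l hl _] := @dprod_cvg _ (fun c => (1 - p ^+ c.1 * q ^+ c.2 * x)^-1) _ rho K hr B0 itail_near1.
by rewrite /itail (ccvg_lim hl).
Qed.

Lemma P2_split S : (if S is Some c then c \in cells K else true) ->
  P2 S x p q * itail K x p q = \prod_(c <- cells K) dfac S x p q c.1 c.2.
Proof.
move=> hS.
have h1 : ccvg (fun n => \prod_(c <- cells (K + n)) dfac S x p q c.1 c.2) (P2 S x p q).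
  by move=> e e0; have [N hN] := P2_cells S x e0; exists N => n Nn; apply: hN; rewrite (leq_trans Nn)// leq_addl.
apply: (ccvg_unique (ccvgM h1 itail_cvg)).
apply: ccvg_eq (ccvg_cst _); exists 0%N => n _.
rewrite cellsD big_cat -mulrA -big_split /= [X in _ * X]big1_seq ?mulr1// => c /andP[_ cs].
have [_ hc] := mem_shells cs.
have -> : dfac S x p q c.1 c.2 = 1 - p ^+ c.1 * q ^+ c.2 * x.
  rewrite /dfac; case: ifP => // /eqP E; rewrite E in hS.
  by move: hS; rewrite mem_cells => /andP[]; rewrite !ltnNge => /negbTE a /negbTE b; move: hc; rewrite a b.
by have [nz _] := inv_near1 (tail_half hc); rewrite divff.
Qed.

(** Valid at the poles too, where the convention for the inverse of 0 makes both sides 0. *)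
Lemma egamma_split : x != 0 ->
  egamma x p q = qpoch2 (p * q / x) p q * \prod_(c <- cells K) (1 - p ^+ c.1 * q ^+ c.2 * x)^-1 * itail K x p q.
Proof.
move=> x0; apply: ccvg_lim.
have h1 : ccvg (fun n => \prod_(c <- cells (K + n)) (1 - p ^+ c.1 * q ^+ c.2 * (p * q / x))) (P2 None (p * q / x) p q).
  by move=> e e0; have [N hN] := P2_cells None (p * q / x) e0; exists N => n Nn; apply: hN; rewrite (leq_trans Nn)// leq_addl.
have h2 := ccvgM (ccvgM h1 (ccvg_cst (\prod_(c <- cells K) (1 - p ^+ c.1 * q ^+ c.2 * x)^-1))) itail_cvg.
have h3 : ccvg (fun n => \prod_(c <- cells (K + n)) ((1 - p ^+ c.1.+1 * q ^+ c.2.+1 / x) * (1 - p ^+ c.1 * q ^+ c.2 * x)^-1))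
   (qpoch2 (p * q / x) p q * \prod_(c <- cells K) (1 - p ^+ c.1 * q ^+ c.2 * x)^-1 * itail K x p q).
  apply: ccvg_eq h2; exists 0%N => n _.
  rewrite -mulrA -big_cat /= -cellsD -big_split /=; apply: eq_bigr => c _.
  by congr ((1 - _) * _); rewrite !exprSr; ring.
move=> e e0; have [N hN] := h3 e e0; exists (K + N)%N => n Nn.
have := hN (n - K)%N.
rewrite (big_cells (fun j k => (1 - p ^+ j.+1 * q ^+ k.+1 / x) * (1 - p ^+ j * q ^+ k * x)^-1)) subnKC; last by apply: leq_trans Nn; rewrite leq_addr.
by apply; rewrite leq_subRL ?(leq_trans (leq_addr _ _) Nn).
Qed.

Lemma egamma_gen : x != 0 -> (forall a b, p ^+ a * q ^+ b * x != 1) ->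
  egamma x p q = P2 None (p * q / x) p q / P2 None x p q.
Proof.
move=> x0 nz; rewrite egamma_split// -mulrA; congr (_ * _).
have E := P2_split (S := None) isT; have n0 := P2_neq0 nz.
rewrite prodfV -[\prod_(c <- cells K) _]E invfM -mulrA mulVf ?mulr1//.
have : P2 None x p q * itail K x p q != 0.
  rewrite E prodf_seq_neq0; apply/allP => c _; rewrite /= /dfac /=.
  by rewrite subr_eq0 eq_sym nz.
by rewrite mulf_eq0 negb_or => /andP[].
Qed.
End Tail.

Lemma exists_tail x : exists K, cmod x * rho ^+ K <= 1 / 2.
Proof.
have h12 : 0 < 1 / 2 :> R by lra.
have [N hN] := geo_small (cmod x) hr h12.
by exists N; apply/ltW/hN.
Qed.

Lemma egamma_quot x : x != 0 -> (forall a b, p ^+ a * q ^+ b * x != 1) ->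
  egamma x p q = P2 None (p * q / x) p q / P2 None x p q.
Proof. by have [K hK] := exists_tail x; exact: (egamma_gen hK). Qed.

End PQ.

Lemma P2_swap S x p q : P2 S x p q = P2 (omap (fun c => (c.2, c.1)) S) x q p.
Proof.
rewrite /P2 dp_sym; congr dp; apply/funext => i; apply/funext => j; rewrite /dfac.
case: S => [[a b]|] /=; last by rewrite [p ^+ _ * _]mulrC.
have -> : (Some (a, b) == Some (j, i)) = (Some (b, a) == Some (i, j)).
  by apply/eqP/eqP => -[-> ->].
by rewrite [p ^+ _ * _]mulrC.
Qed.

Lemma P2_recN' p q x : cmod p < 1 -> cmod q < 1 -> P2 None x p q = qp x p * P2 None (q * x) p q.
Proof.
move=> p1 q1; have sw y : P2 None y p q = P2 None y q p := P2_swap None y p q.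
by rewrite !sw; exact: P2_recN.
Qed.

Section Theta.
Variable p : C.
Hypotheses (p0 : p != 0) (p1 : cmod p < 1).

Lemma th_shift x : x != 0 -> th (p * x) p = - x^-1 * th x p.
Proof.
move=> x0; rewrite /th (_ : p / (p * x) = x^-1); last by field; rewrite x0 p0.
by rewrite (qp_rec x p1) (qp_rec x^-1 p1); field.
Qed.

Lemma th_inv x : x != 0 -> th x^-1 p = - x^-1 * th x p.
Proof.
move=> x0; rewrite /th invrK.
by rewrite (qp_rec x p1) (qp_rec x^-1 p1); field.
Qed.

Lemma th_shiftn j x : x != 0 -> th (p ^+ j * x) p = (\prod_(i < j) - (p ^+ i * x)^-1) * th x p.
Proof.
move=> x0; elim: j => [|j IH]; first by rewrite expr0 mul1r big_ord0 mul1r.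
rewrite exprS -mulrA th_shift; last by rewrite mulf_neq0// expf_neq0.
by rewrite IH big_ord_recr /= mulrCA mulrA.
Qed.

Lemma th_neq0 x : x != 0 -> (forall k, p ^+ k * x != 1) -> (forall k, p ^+ k.+1 != x) -> th x p != 0.
Proof.
move=> x0 h1 h2; rewrite mulf_neq0// qp_neq0// => k.
apply: contraNneq (h2 k) => e; rewrite exprSr -[eqbRHS]mul1r -e mulrA mulfVK//.
Qed.

Lemma qp1 : qp 1 p = 0.
Proof. by rewrite qp_rec// subrr mul0r. Qed.

Lemma th1 : th 1 p = 0.
Proof. by rewrite /th qp1 mul0r. Qed.

Lemma thN1_neq0 : th (-1) p != 0.
Proof.
have pk k : p ^+ k * -1 != 1.
  apply/eqP => e; have := congr1 (@cmod R) e; rewrite cmodM cmodX cmodN cmod1 mulr1 => e1.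
  case: k e e1 => [|k] e e1.
    move: e; rewrite expr0 mul1r => /eqP; rewrite eq_sym -subr_eq0 opprK => /eqP/(congr1 (@cmod R)).
    by rewrite cmod0 -[1 + 1]/(2%:R) cmod_nat => /eqP; rewrite pnatr_eq0.
  by have := exprn_ilt1 k.+1 (cmod_ge0 p) p1; rewrite e1 ltxx.
apply: th_neq0 => //.
move=> k; apply: contraNneq (pk k.+1) => ->.
by rewrite mulrN1 opprK.
Qed.

End Theta.

(** The double products at x and at 1/x are reduced to those at p q x and p q / x by one step in p
    and one in q, taken in opposite orders. The simple products left over form a theta function of
    base p and one of base q, which is what separates the two bases in the integrand. *)
Lemma gamma_refl p q x : p != 0 -> q != 0 -> cmod p < 1 -> cmod q < 1 -> x != 0 ->
  (forall a b, p ^+ a * q ^+ b * x != 1) -> (forall a b, p ^+ a * q ^+ b / x != 1) ->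
  (egamma x p q * egamma x^-1 p q)^-1 = th x p * th x^-1 q.
Proof.
move=> p0 q0 p1 q1 x0 h1 h2.
have xi0 : x^-1 != 0 by rewrite invr_eq0.
rewrite !egamma_quot// invrK.
have n1 : P2 None x p q != 0 by exact: P2_neq0.
have n2 : P2 None x^-1 p q != 0 by exact: P2_neq0.
have n3 : P2 None (p * q * x) p q != 0.
  by apply: P2_neq0 => // a b; have := h1 a.+1 b.+1; rewrite !exprSr !mulrA (mulrAC _ p).
have n4 : P2 None (p * q / x) p q != 0.
  by apply: P2_neq0 => // a b; have := h2 a.+1 b.+1; rewrite !exprSr !mulrA (mulrAC _ p).
have e1 : P2 None x p q = qp x p * (qp (q * x) q * P2 None (p * q * x) p q).
  by rewrite (P2_recN' x p1 q1) (P2_recN p1 q1 (q * x)) (mulrA p q x).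
have e2 : P2 None x^-1 p q = qp x^-1 q * (qp (p / x) p * P2 None (p * q / x) p q).
  by rewrite (P2_recN p1 q1) (P2_recN' (p / x) p1 q1) (mulrA q p) [q * p]mulrC.
rewrite /th invrK !invfM !invrK e1 e2; field.
by rewrite n3 n4.
Qed.

Section Ucl.
Variables (T : Type) (P : (T -> C) -> Prop) (Om : T -> Prop).
Hypothesis PA : funalg P Om.
Variables (p q x : T -> C) (rho B : R).
Hypothesis hr : 0 <= rho < 1.
Hypotheses (up : ucl P Om p) (hp : forall t, Om t -> cmod (p t) <= rho).
Hypotheses (uq : ucl P Om q) (hq : forall t, Om t -> cmod (q t) <= rho).
Hypotheses (ux : ucl P Om x) (hx : forall t, Om t -> cmod (x t) <= B).

Let r1 : rho < 1. Proof. by case/andP: hr. Qed.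
Let p1 t : Om t -> cmod (p t) < 1. Proof. by move=> /hp h; exact: le_lt_trans h r1. Qed.
Let q1 t : Om t -> cmod (q t) < 1. Proof. by move=> /hq h; exact: le_lt_trans h r1. Qed.

Lemma ucl_qp : ucl P Om (fun t => qp (x t) (p t)).
Proof.
apply: (@ucl_iprod _ _ _ _ (fun i t => 1 - p t ^+ i * x t) B rho _ PA hr).
- move=> i; apply: (ucl_subr PA); first exact: (ucl_cst PA).
  by apply: (ucl_mul PA) => //; exact: (ucl_exp PA).
- by move=> i t Ot; apply: cmod_geo; [exact: hp|exact: hx].
- by move=> t Ot; exact/qp_cvg/p1.
Qed.

Lemma ucl_dfac c : ucl P Om (fun t => 1 - p t ^+ c.1 * q t ^+ c.2 * x t).
Proof.
apply: (ucl_subr PA); first exact: (ucl_cst PA).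
by apply: (ucl_mul PA) => //; apply: (ucl_mul PA); exact: (ucl_exp PA).
Qed.

Lemma ucl_P2 : ucl P Om (fun t => P2 None (x t) (p t) (q t)).
Proof.
have [/asboolP [t0 Ot0]|nO] := boolP `[< exists t, Om t >]; last first.
  apply: ucl_ext (ucl_cst PA 0) => t Ot; case/asboolP: nO; by exists t.
have B0 : 0 <= B := le_trans (cmod_ge0 _) (hx Ot0).
apply: (@ucl_dprod _ _ _ _ (fun c t => 1 - p t ^+ c.1 * q t ^+ c.2 * x t) B rho 0 _ PA hr B0).
- by move=> c _; exact: ucl_dfac.
- move=> c t Ot _; rewrite addrAC subrr sub0r cmodN.
  by apply: cmod_geo2; [exact: hp|exact: hq|exact: hx].
- by move=> t Ot; exact: (P2_cells (p1 Ot) (q1 Ot) None (x t)).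
Qed.

Lemma ucl_itail K : B * rho ^+ K <= 1 / 2 -> ucl P Om (fun t => itail K (x t) (p t) (q t)).
Proof.
move=> hK.
have [/asboolP [t0 Ot0]|nO] := boolP `[< exists t, Om t >]; last first.
  apply: ucl_ext (ucl_cst PA 0) => t Ot; case/asboolP: nO; by exists t.
have B0 : 0 <= B := le_trans (cmod_ge0 _) (hx Ot0).
have /andP[r0 _] := hr.
have half c t : Om t -> ((K <= c.1) || (K <= c.2))%N -> cmod (p t ^+ c.1 * q t ^+ c.2 * x t) <= 1 / 2.
  move=> Ot hc; apply: le_trans hK; apply: le_trans (cmod_geo2 _ _ (hp Ot) (hq Ot) (hx Ot)) _.
  rewrite ler_wpM2l//; apply: ler_wiXn2l => //; first exact: ltW.
  by case/orP: hc => h; lia.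
apply: (@ucl_dprod _ _ _ _ (fun c t => (1 - p t ^+ c.1 * q t ^+ c.2 * x t)^-1) (2 * B) rho K _ PA hr).
- by rewrite mulr_ge0.
- move=> c hc; apply: (ucl_geom PA (th := 1/2)); first by apply/andP; split; lra.
    by apply: (ucl_mul PA) => //; apply: (ucl_mul PA); exact: (ucl_exp PA).
  by move=> t Ot; exact: half.
- move=> c t Ot hc; have [_ h] := inv_near1 (half _ _ Ot hc); apply: le_trans h _.
  rewrite -[leRHS]mulrA; apply: ler_pM; rewrite ?cmod_ge0//.
  by apply: cmod_geo2; [exact: hp|exact: hq|exact: hx].
- move=> t Ot; apply: (itail_cvg (p1 Ot) (q1 Ot)).
  apply: le_trans hK; apply: ler_pM; rewrite ?cmod_ge0 ?exprn_ge0 ?hx//.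
    by rewrite le_max cmod_ge0.
  rewrite lerXn2r// ?nnegrE ?le_max ?cmod_ge0//.
  by rewrite ge_max hp// hq.
Qed.

End Ucl.

Lemma qpochE (p : C) : cmod p < 1 -> qpoch p = qp p p.
Proof.
move=> p1; apply: ccvg_lim => e e0; have [N hN] := qp_cvg p p1 e0; exists N.+1 => -[//|n] Nn.
rewrite big_add1 /= big_mkord; have := hN n Nn; congr (cmod (_ - _) < e).
by apply: eq_bigr => i _; rewrite exprSr.
Qed.

End Products.

(** * Theta functions and their addition formula *)

Section ThetaSpace.
Variable R : realType.
Local Notation C := (CC R).

Lemma CT_scale (r : R) (a : C) f : 0 < r -> a != 0 -> ucl (@lau R) (fun z => cmod z = cmod a * r) f ->
  CT r (fun z => f (a * z)) = CT (cmod a * r) f.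
Proof.
move=> r0 a0 uf; have ar : 0 < cmod a * r by rewrite mulr_gt0// cmod_gt0.
apply: lapp_CT => // e e0; have [s hs hc] := lapp_ucl ar uf e0.
exists [seq (x.1 * a ^ x.2, x.2) | x <- s].
  move=> z zr; rewrite /leval big_map /=.
  have -> : \sum_(j <- s) j.1 * a ^ j.2 * z ^ j.2 = leval s (a * z).
    by apply: eq_bigr => x _; rewrite expfzMl mulrA.
  by apply: hs; rewrite cmodM zr.
rewrite /lct big_map /= (eq_bigr (fun x => x.1))// => x /eqP ->.
by rewrite expr0z mulr1.
Qed.

Lemma CT_ann0 (r : R) f g : 0 < r -> ucl (@lau R) (fun z => cmod z = r) f -> ucl (@lau R) (fun z => cmod z = r) g ->
  (forall k : int, CT r (fun z => z ^ k * f z) = 0) -> CT r (fun z => g z * f z) = 0.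
Proof.
move=> r0 uf ug h; have G := CT_good r0; have [M M0 hM] := ucl_bdd (lau_circ r0) uf.
have hs s : CT r (fun z => leval s z * f z) = 0.
  have us s' : ucl (@lau R) (fun z => cmod z = r) (leval s') by apply: ucl_base; exists s'.
  elim: s => [|[c k] s IH].
    rewrite (gf_ext G (h := fun z => 0 * f z)) ?(gf_Z G)// ?mul0r// => z _.
    by rewrite /leval big_nil.
  rewrite (gf_ext G (h := fun z => c * (z ^ k * f z) + leval s z * f z)); last first.
    by move=> z _; rewrite /leval big_cons /= mulrDl mulrA.
  have o1 : ucl (@lau R) (fun z => cmod z = r) (fun z => z ^ k * f z).
    by apply: (gf_okM G) => //; exact: circ_okexp.
  rewrite (gf_D G) ?(gf_Z G)// ?h ?IH ?mulr0 ?addr0//; last exact: (gf_okM G).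
  by apply: (gf_okM G) => //; exact: (gf_cst G).
apply/eqP; rewrite -cmod_eq0; apply/eqP/le_anti; rewrite cmod_ge0 andbT.
apply/ler_addgt0Pr => e e0; rewrite add0r.
have [g' [s gs] hg] := ug _ (divr_gt0 e0 M0).
have us : ucl (@lau R) (fun z => cmod z = r) (leval s) by apply: ucl_base; exists s.
rewrite -[CT _ _]subr0 -(hs s) -(LB G); try exact: (gf_okM G).
apply: CT_le => //.
  apply: (ucl_subr (lau_circ r0)); exact: (gf_okM G).
move=> z zr; rewrite -mulrBl cmodM -[e](mulfVK (lt0r_neq0 M0)).
by rewrite ler_pM ?cmod_ge0 ?hM// -gs ?hg// (circ_neq0 r0 zr).
Qed.

(** Functions with a Laurent expansion on the whole punctured plane. *)
Definition lent (f : C -> C) := forall r : R, 0 < r < 1 -> ucl (@lau R) (ann r r^-1) f.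

Lemma ann_pick (x : C) : x != 0 -> exists r : R, [/\ 0 < r < 1, small r x & small r x^-1].
Proof.
move=> x0; have c0 : 0 < cmod x by rewrite cmod_gt0.
pose r := (2 * (1 + cmod x + (cmod x)^-1))^-1.
have i0 : 0 < (cmod x)^-1 by rewrite invr_gt0.
have d0 : 0 < 2 * (1 + cmod x + (cmod x)^-1) by lra.
exists r; rewrite /small cmodV /r; split.
- by rewrite invr_gt0 d0 invf_lt1//; lra.
- by rewrite ler_pdivrMr//; lra.
- by rewrite ler_pdivrMr//; lra.
Qed.

Lemma lent_zero f : lent f -> (forall (r : R) (k : int), 0 < r < 1 -> CT r (fun z => z ^ k * f z) = 0) ->
  forall x, x != 0 -> f x = 0.
Proof.
move=> lf h x x0; have [r [r01 s1 s2]] := ann_pick x0.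
have /andP[r0 r1] := r01.
have ri0 : 0 < r^-1 by rewrite invr_gt0.
have rri : r <= r^-1 by apply: (@le_trans _ _ 1); rewrite ?ltW// invf_gt1.
have uf := lf _ r01.
have u1 := uh_r r01 uf; have u2 := uh_ri r01 uf.
have hk (k : int) : CT r^-1 (fun z => z ^ k * f z) = 0.
  rewrite -(h r k)//; apply: (@CT_radius _ r r^-1) => //; rewrite ?lexx ?rri//.
  by apply: (ucl_mul (ann_falg r01)) => //; exact: ucl_ann_exp.
rewrite -(laurent_split r01 uf x0 s1 s2) /phi /psi /h0.
have -> : CT r f = 0.
  by rewrite -(h r 0 r01); apply: CT_ext => // z _; rewrite expr0z mul1r.
have -> : CT r^-1 (fun z => f z * (1 - x / z)^-1) = 0.
  rewrite -(CT_ann0 ri0 u2 (ucl_inv1 r01 s1) hk).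
  by apply: CT_ext => // z _; rewrite mulrC.
have -> : CT r (fun z => f z * (1 - x^-1 * z)^-1) = 0.
  rewrite -(CT_ann0 r0 u1 (ucl0_lau (circ_geom0 s2)) (fun k => h r k r01)).
  by apply: CT_ext => // z _; rewrite mulrC.
by rewrite !addr0 subr0.
Qed.

Section OneP.
Variable p : C.
Hypotheses (p0 : p != 0) (p1 : cmod p < 1).

Definition quasi2 (f : C -> C) := forall z, z != 0 -> f (p * z) = (p * z ^+ 2)^-1 * f z.

(** Comparing the constant terms c_k of z^k f on the circles of radius [rr] and |p| [rr] gives c_k =
    p^(k-1) c_(k-2), so two consecutive ones determine all. *)
Lemma quasi2_zero f (rr : R) : 0 < rr < 1 -> lent f -> quasi2 f ->
  CT rr f = 0 -> CT rr (fun z => z * f z) = 0 -> forall x, x != 0 -> f x = 0.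
Proof.
move=> rr01 lf qf c0 c1; apply: lent_zero => //.
have /andP[rr0 rr1] := rr01.
pose c (k : int) := CT rr (fun z => z ^ k * f z).
have pp : 0 < cmod p by rewrite cmod_gt0.
have lk (k : int) : lent (fun z => z ^ k * f z).
  by move=> r r01; apply: (ucl_mul (ann_falg r01)); [exact: ucl_ann_exp|exact: lf].
have indep (r : R) (k : int) : 0 < r < 1 -> CT r (fun z => z ^ k * f z) = c k.
  move=> r01; wlog rr' : r rr rr01 rr0 rr1 r01 @c {c0 c1} / r <= rr.
    by move=> W; have [h|/ltW h] := leP r rr; [exact: W|apply/esym; apply: W => //; case/andP: r01].
  have /andP[r0 r1] := r01.
  apply: (@CT_radius _ r r^-1) => //.
  - by rewrite lexx /= (@le_trans _ _ 1)// ?ltW// invf_gt1.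
  - by rewrite rr' /= (@le_trans _ _ 1)// ?ltW// invf_gt1.
  - exact: lk.
have rec (k : int) : c k = p ^ (k - 1) * c (k - 2).
  have pr01 : 0 < cmod p * rr < 1 by rewrite mulr_gt0//= mulr_ilt1 ?cmod_ge0 ?ltW.
  have /andP[pr0 _] := pr01.
  rewrite -(indep _ k pr01) -(CT_scale rr0 p0); last exact: (uh_r pr01 (lk k _ pr01)).
  rewrite /c -(gf_Z (CT_good rr0)); last exact: (uh_r rr01 (lk _ _ rr01)).
  apply: CT_ext => // z zr; have z0 := circ_neq0 rr0 zr.
  rewrite qf// expfzMl !expfzDr// -!exprnN expr1 !expr2; field.
  by rewrite z0 p0.
have back (k : int) : c k = p ^ (- (k + 1)) * c (k + 2).
  rewrite (rec (k + 2)) mulrA -expfzDr//.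
  have -> : - (k + 1) + (k + 2 - 1) = 0 by ring.
  by rewrite expr0z mul1r addrK.
have C0 : c 0 = 0 by rewrite -c0; apply: CT_ext => // z _; rewrite expr0z mul1r.
have C1 : c 1 = 0 by rewrite -c1; apply: CT_ext => // z _; rewrite expr1z.
have pos (n : nat) : c n = 0 /\ c n.+1 = 0.
  elim: n => [//|n [I1 I2]]; split=> //.
  by rewrite rec (_ : n.+2%:Z - 2 = n) ?I1 ?mulr0//; lia.
have neg (n : nat) : c (- n%:Z) = 0 /\ c (1 - n%:Z) = 0.
  elim: n => [|n [I1 I2]]; first by rewrite oppr0 subr0.
  have -> : 1 - n.+1%:Z = - n%:Z by lia.
  split=> //.
  by rewrite back (_ : - n.+1%:Z + 2 = 1 - n%:Z) ?I2 ?mulr0//; lia.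
move=> r k r01; rewrite indep//.
case: k => n; first by have [] := pos n.
by rewrite NegzE; have [] := neg n.+1.
Qed.

Lemma lentM f g : lent f -> lent g -> lent (fun z => f z * g z).
Proof. by move=> lf lg r r01; apply: (ucl_mul (ann_falg r01)); [exact: lf|exact: lg]. Qed.
Lemma lentD f g : lent f -> lent g -> lent (fun z => f z + g z).
Proof. by move=> lf lg r r01; apply: (ucl_add (ann_falg r01)); [exact: lf|exact: lg]. Qed.
Lemma lent_cst c : lent (fun=> c).
Proof. by move=> r r01; exact: (ucl_cst (ann_falg r01)). Qed.
Lemma lent_id : lent (fun z => z).
Proof. by move=> r r01; apply: ucl_ext (ucl_ann_exp r 1) => z _; rewrite expr1z. Qed.
Lemma lent_inv : lent (fun z => z^-1).
Proof. by move=> r r01; apply: ucl_ext (ucl_ann_exp r (-1)) => z _. Qed.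

Lemma lent_qp g : lent g -> lent (fun z => qp (g z) p).
Proof.
move=> lg r r01; have A := ann_falg r01; have [B _ hB] := ucl_bdd A (lg r r01).
have hr : 0 <= cmod p < 1 by rewrite cmod_ge0.
by apply: (ucl_qp A (rho := cmod p) (B := B) hr (p := fun=> p)) => //; [exact: (ucl_cst A)|exact: lg].
Qed.

Lemma lent_th c : c != 0 -> lent (fun z => th (c * z) p).
Proof.
move=> c0; apply: lentM; first by apply: lent_qp; apply: lentM; [exact: lent_cst|exact: lent_id].
have : lent (fun z => qp ((p / c) * z^-1) p) by apply: lent_qp; apply: lentM; [exact: lent_cst|exact: lent_inv].
by congr lent; apply/funext => z; rewrite invfM mulrA.
Qed.

Definition dth (z x : C) : C := z^-1 * th (z * x) p * th (z / x) p.

Lemma lent_dth x : x != 0 -> lent (fun z => dth z x).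
Proof.
move=> x0; apply: lentM; first apply: lentM; first exact: lent_inv.
  by have := lent_th x0; congr lent; apply/funext => z; rewrite mulrC.
by have := @lent_th x^-1; rewrite invr_eq0 => /(_ x0); congr lent; apply/funext => z; rewrite mulrC.
Qed.

Lemma quasi2_dth x : x != 0 -> quasi2 (fun z => dth z x).
Proof.
move=> x0 z z0.
have e1 := th_shift p0 p1 (mulf_neq0 z0 x0).
have e2 := th_shift p0 p1 (mulf_neq0 z0 (invr_neq0 x0)).
rewrite /dth -(mulrA p z x) e1 -(mulrA p z) e2.
by field; rewrite x0 z0 p0.
Qed.

(* The three functions of [z] satisfy [quasi2], hence are linearly dependent, such
   functions being determined by two Laurent coefficients; [z = 1] and [z = -1]
   give the relation. *)
Lemma addition z x : z != 0 -> x != 0 ->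
  dth z x * dth 1 (-1) = dth z 1 * dth x (-1) - dth z (-1) * dth x 1.
Proof.
move=> z0 x0.
have N10 : (-1 : C) != 0 by rewrite oppr_eq0 oner_eq0.
pose rr : R := 1 / 2.
have rr01 : 0 < rr < 1 by rewrite /rr; apply/andP; split; lra.
have /andP[rr0 _] := rr01.
pose v (i : 'I_3) : C := if i == 0 :> nat then x else if i == 1%N :> nat then 1 else -1.
have v0 i : v i != 0 by rewrite /v; case: ifP => // _; case: ifP => // _; exact: oner_neq0.
pose u (i : 'I_3) (w : C) := dth w (v i).
have lu i : lent (u i) := lent_dth (v0 i).
have qu i : quasi2 (u i) := quasi2_dth (v0 i).
pose M : 'M[C]_(3, 2) := \matrix_(i, j) (if j == 0 :> nat then CT rr (u i) else CT rr (fun w => w * u i w)).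
have rk : kermx M != 0.
  apply/eqP => /(congr1 (@mxrank _ _ _)); rewrite mxrank_ker mxrank0 => /eqP; rewrite subn_eq0 => h.
  by have := leq_trans h (rank_leq_col M).
pose w := nz_row (kermx M).
have w0 : w != 0 by rewrite nz_row_eq0.
have wM : w *m M = 0 by apply/sub_kermxP; exact: nz_row_sub.
have G := CT_good rr0.
have ou i : ucl (@lau R) (fun z => cmod z = rr) (u i) := uh_r rr01 (lu i rr rr01).
have ozu i : ucl (@lau R) (fun z => cmod z = rr) (fun z => z * u i z) := uh_r rr01 (lentM lent_id (lu i) rr01).
pose Phi y := w 0 0 * u 0 y + (w 0 1 * u 1 y + w 0 2%:R * u 2%:R y).
have lin (F : 'I_3 -> C -> C) (s : C) : (forall i, ucl (@lau R) (fun z => cmod z = rr) (F i)) ->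
   CT rr (fun y => w 0 0 * F 0 y + (w 0 1 * F 1 y + w 0 2%:R * F 2%:R y)) =
   w 0 0 * CT rr (F 0) + (w 0 1 * CT rr (F 1) + w 0 2%:R * CT rr (F 2%:R)).
  move=> oF; have oc (c : C) i : ucl (@lau R) (fun z => cmod z = rr) (fun y => c * F i y).
    by apply: (gf_okM G) => //; exact: (gf_cst G).
  rewrite (gf_D G)//; last exact: (gf_okD G).
  by rewrite (gf_D G)// !(gf_Z G).
have colE j : w 0 0 * M 0 j + (w 0 1 * M 1 j + w 0 2%:R * M 2%:R j) = 0.
  have := congr1 (fun A : 'M[C]_(1, 2) => A 0 j) wM; rewrite [LHS]mxE [RHS]mxE !big_ord_recl big_ord0 addr0.
  have -> : lift ord0 (lift ord0 ord0) = 2%:R :> 'I_3 by apply/val_inj.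
  by have -> : lift ord0 ord0 = 1 :> 'I_3 by apply/val_inj.
have PZ y : y != 0 -> Phi y = 0.
  apply: (@quasi2_zero Phi rr rr01).
  - by apply: lentD; [|apply: lentD]; apply: lentM; do ?exact: lent_cst; exact: lu.
  - move=> y' y0; rewrite /Phi !qu//; ring.
  - rewrite /Phi (lin u 0)//; have := colE 0; by rewrite !mxE /=.
  - have := colE 1; rewrite !mxE /= -(lin (fun i y => y * u i y) 0)// => E; rewrite -[RHS]E.
    by apply: CT_ext => // y1 _; rewrite /Phi; ring.
have th1 : th 1 p = 0 by exact: th1.
have tN := thN1_neq0 p1.
have E1 := PZ 1 (oner_neq0 _). have E2 := PZ (-1) N10. have E3 := PZ z z0.
move: E1 E2 E3; rewrite /Phi /u /v /=.
have dN : dth 1 (-1) = th (-1) p ^+ 2 by rewrite /dth !(invrN, invr1, mulrN1, mulN1r, mul1r, mulr1); ring.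
have d1 : dth 1 1 = 0 by rewrite /dth mul1r th1 mulr0 mul0r.
have dNN : dth (-1) (-1) = 0 by rewrite /dth !(invrN, invr1, mulrN1, mulN1r, opprK) th1 mulr0.
have dN1 : dth (-1) 1 = - th (-1) p ^+ 2 by rewrite /dth !(invrN, invr1, mulr1); ring.
have dx : dth 1 x = - dth x 1.
  by rewrite /dth !(invr1, mul1r, mulr1) (th_inv p1 x0); field.
have xn0 : - x != 0 by rewrite oppr_eq0.
have dNx : dth (-1) x = - dth x (-1).
  rewrite /dth !(invrN, invr1, mulrN1, mulN1r).
  by have := th_inv p1 xn0; rewrite invrN => ->; field.
rewrite d1 dNN dN1 dx dNx dN; move: (dth x 1) (dth x (-1)) (dth z x) (dth z 1) (dth z (-1)) => a b c d e.
set t := th (-1) p in tN *; set w0' := w 0 0; set w1 := w 0 1; set w2 := w 0 2%:R.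
move=> E1 E2 E3.
have e1 : w2 * t ^+ 2 = w0' * a by apply/eqP; rewrite -subr_eq0 -E1; apply/eqP; ring.
have e2 : w1 * t ^+ 2 = - (w0' * b) by apply/eqP; rewrite -subr_eq0 -oppr_eq0 -E2; apply/eqP; ring.
have t2 : t ^+ 2 != 0 by rewrite expf_neq0.
have w00 : w0' != 0.
  apply: contraNneq w0 => W0; apply/eqP/matrixP => i j; rewrite mxE ord1.
  have z1 : w1 = 0 by apply: (mulIf t2); rewrite e2 W0 !mul0r oppr0.
  have z2 : w2 = 0 by apply: (mulIf t2); rewrite e1 W0 !mul0r.
  case: j => -[|[|[|//]]] h.
  - by rewrite -[RHS]W0; congr (w _ _); apply/val_inj.
  - by rewrite -[RHS]z1; congr (w _ _); apply/val_inj.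
  - by rewrite -[RHS]z2; congr (w _ _); apply/val_inj.
apply: (mulfI w00); apply/eqP; rewrite -subr_eq0; apply/eqP.
have : (w0' * c + (w1 * d + w2 * e)) * t ^+ 2 = 0 by rewrite E3 mul0r.
have -> : (w0' * c + (w1 * d + w2 * e)) * t ^+ 2 = w0' * (c * t ^+ 2) + (w1 * t ^+ 2) * d + (w2 * t ^+ 2) * e by ring.
rewrite e1 e2 => E; rewrite -[RHS]E; ring.
Qed.

(** By [addition], [dth z x] is up to a constant [bA z * bB x - bB z * bA x], so the product over
    pairs becomes a homogeneous Vandermonde determinant in [bA] and [bB]; [vt] accounts for the
    gamma functions of z^2 and z^-2. *)
Definition bA (z : C) : C := z^-1 * th z p ^+ 2.
Definition bB (z : C) : C := z^-1 * th (- z) p ^+ 2.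
Definition vt (z : C) : C := z^-1 * th (z ^+ 2) p.

Lemma bA_dth z : bA z = dth z 1.
Proof. by rewrite /bA /dth mulr1 divr1 expr2 mulrA. Qed.
Lemma bB_dth z : bB z = dth z (-1).
Proof. by rewrite /bB /dth mulrN1 invrN invr1 mulrN1 expr2 mulrA. Qed.

Lemma bA_shift z : z != 0 -> bA (p * z) = (p * z ^+ 2)^-1 * bA z.
Proof. by move=> z0; rewrite !bA_dth quasi2_dth// oner_neq0. Qed.
Lemma bB_shift z : z != 0 -> bB (p * z) = (p * z ^+ 2)^-1 * bB z.
Proof. by move=> z0; rewrite !bB_dth quasi2_dth// oppr_eq0 oner_neq0. Qed.
Lemma vt_shift z : z != 0 -> vt (p * z) = ((p * z ^+ 2)^-1) ^+ 2 * vt z.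
Proof.
move=> z0; have z20 : z ^+ 2 != 0 by rewrite expf_neq0.
rewrite /vt (_ : (p * z) ^+ 2 = p * (p * z ^+ 2)); last by ring.
by rewrite (th_shift p0 p1) ?mulf_neq0// (th_shift p0 p1)//; field; rewrite z0 p0.
Qed.
Lemma bA_inv z : z != 0 -> bA z^-1 = bA z.
Proof. by move=> z0; rewrite /bA (th_inv p1 z0); field. Qed.
Lemma bB_inv z : z != 0 -> bB z^-1 = bB z.
Proof. by move=> z0; rewrite /bB -invrN (th_inv p1) ?oppr_eq0//; field. Qed.
Lemma vt_inv z : z != 0 -> vt z^-1 = - vt z.
Proof. by move=> z0; rewrite /vt exprVn (th_inv p1) ?expf_neq0//; field. Qed.

Definition ffn n k z := bA z ^+ k * bB z ^+ (n.-1 - k).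
Definition ph n k z := vt z * ffn n k z.

(** The exponent n + 1 is 2 from [vt] plus n - 1 from a form of degree n - 1 in [bA] and [bB]. *)
Lemma ph_shift n k z : (k < n)%N -> z != 0 -> ph n k (p * z) = ((p * z ^+ 2)^-1) ^+ n.+1 * ph n k z.
Proof.
move=> kn z0; rewrite /ph /ffn vt_shift// bA_shift// bB_shift// !exprMn.
have -> : n.+1 = (2 + (k + (n.-1 - k)))%N by lia.
by rewrite !exprD; ring.
Qed.

Lemma ph_inv n k z : z != 0 -> ph n k z^-1 = - ph n k z.
Proof. by move=> z0; rewrite /ph /ffn vt_inv// bA_inv// bB_inv// mulNr. Qed.

Lemma ph_shiftn n k a z : (k < n)%N -> z != 0 ->
  ph n k (p ^+ a * z) = (\prod_(c < a) (p * (p ^+ c * z) ^+ 2)^-1) ^+ n.+1 * ph n k z.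
Proof.
move=> kn z0; elim: a => [|a IH]; first by rewrite expr0 mul1r big_ord0 expr1n mul1r.
have az : p ^+ a * z != 0 by rewrite mulf_neq0// expf_neq0.
rewrite exprS -mulrA (ph_shift kn az).
by rewrite IH big_ord_recr /= mulrA -exprMn [X in X ^+ _]mulrC.
Qed.

End OneP.

Section Vandermonde.
Variables (n : nat) (a b : 'I_n -> C).
Hypothesis b0 : forall i, b i != 0.

Lemma prod_pairs (F : 'I_n -> C) : \prod_(i < n) \prod_(j < n | (i < j)%N) (F i * F j) = \prod_(i < n) F i ^+ n.-1.
Proof.
have -> : \prod_(i < n) \prod_(j < n | (i < j)%N) (F i * F j) =
   \prod_(i < n) \prod_(j < n | (i < j)%N) F i * \prod_(i < n) \prod_(j < n | (j < i)%N) F i.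
  rewrite (_ : \prod_(i < n) \prod_(j < n | (j < i)%N) F i = \prod_(i < n) \prod_(j < n | (i < j)%N) F j).
    by rewrite -big_split; apply: eq_bigr => i _; rewrite big_split.
  by rewrite (exchange_big_dep xpredT).
rewrite -big_split /=; apply: eq_bigr => i _.
have -> : F i ^+ n.-1 = \prod_(j < n | j != i) F i.
  by rewrite prodr_const cardC1 card_ord.
rewrite (bigID (fun j : 'I_n => (i < j)%N) (fun j => j != i)) /=; congr (_ * _).
  by apply: eq_bigl => j; rewrite -val_eqE /=; lia.
by apply: eq_bigl => j; rewrite -val_eqE /=; lia.
Qed.

(** Dividing row i by b_i^(n-1) leaves the Vandermonde matrix of the quotients a_i / b_i. *)
Lemma hvandermonde : \prod_(i < n) \prod_(j < n | (i < j)%N) (a i * b j - b i * a j) =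
  \prod_(i < n) \prod_(j < n | (i < j)%N) (-1) * \det (\matrix_(i < n, k < n) (a i ^+ k * b i ^+ (n.-1 - k))).
Proof.
pose w : 'rV[C]_n := \row_i (a i / b i).
have -> : \det (\matrix_(i < n, k < n) (a i ^+ k * b i ^+ (n.-1 - k))) = \prod_(i < n) b i ^+ n.-1 * \det (Vandermonde n w).
  have -> : \prod_(i < n) b i ^+ n.-1 = \det (diag_mx (\row_(i < n) b i ^+ n.-1)).
    by rewrite det_diag; apply: eq_bigr => i _; rewrite mxE.
  rewrite -[\det (Vandermonde n w)]det_tr -det_mulmx; congr (\det _); apply/matrixP => i k; rewrite mul_diag_mx !mxE exprMn exprVn.
  have kn : (k <= n.-1)%N by have := ltn_ord k; lia.
  rewrite -{2}(subnK kn) exprD; have := b0 i; move=> bi; field.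
  by rewrite expf_neq0.
rewrite det_Vandermonde -prod_pairs mulrA -!big_split /=; apply: eq_bigr => i _.
rewrite -!big_split /=; apply: eq_bigr => j _; rewrite !mxE; field.
by rewrite !b0.
Qed.

End Vandermonde.

End ThetaSpace.

(** * The contour formula *)

Section Countable.
Variable R : realType.
Local Notation C := (CC R).

Lemma countable_sub (T : Type) (A B : set T) : A `<=` B -> countable B -> countable A.
Proof. by move=> AB; apply: sub_countable; exact: subset_card_le. Qed.

Lemma countableU (T : Type) (A B : set T) : countable A -> countable B -> countable (A `|` B).
Proof.
move=> cA cB; apply: (@countable_sub _ _ (\bigcup_(b in [set: bool]) (if b then A else B))).
  by move=> x [Ax|Bx]; [exists true|exists false].
by apply: bigcup_countable => [|[]//]; exact: countableP.
Qed.

Lemma countable_inj (T T' : Type) (A : set T) (B : set T') (f : T -> T') :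
  (forall x y, A x -> A y -> f x = f y -> x = y) -> (forall x, A x -> B (f x)) -> countable B -> countable A.
Proof.
move=> fi AB cB; have cf : countable (f @` A) by apply: countable_sub cB => _ [x Ax <-]; exact: AB.
have /card_eqPle[_ h] : (f @` A #= A)%card by apply: inj_card_eq => x y /[!inE] Ax Ay; exact: fi.
exact: sub_countable h cf.
Qed.

Lemma countable_fin (T : eqType) (A : set T) (s : seq T) : (forall x, A x -> x \in s) -> countable A.
Proof.
move=> h; apply: (@countable_sub _ A [set` s]); first by move=> x /h.
exact/finite_set_countable/finite_seq.
Qed.

Lemma countable_sqr (A : set C) : countable A -> countable [set z : C | A (z ^+ 2)].
Proof.
move=> cA; apply: (@countable_sub _ _ (\bigcup_(c in A) [set z : C | z ^+ 2 = c])); first by move=> z Az; exists (z ^+ 2).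
apply: bigcup_countable => // c Ac.
have [[z0 hz0]|no] := pselect (exists z0 : C, z0 ^+ 2 = c); last first.
  by apply: (@countable_fin _ _ [::]) => z /= zc; case: no; exists z.
apply: (@countable_fin _ _ [:: z0; - z0]) => z /= zc.
by rewrite !inE -eqf_sqr zc hz0.
Qed.

Lemma countable_im (T T' : Type) (A : set T) (f : T -> T') : countable A -> countable (f @` A).
Proof. by move=> cA; apply: sub_countable cA; exact: card_image_le. Qed.

End Countable.

Section Multilinear.
Variable R : realType.
Local Notation C := (CC R).
Local Notation U := (`[0%R, 1%R]%classic : set R).
Variable g : R -> C.
Hypothesis hg : closed_contour g.
Hypothesis g0 : avoids g 0.

(** A closed contour is injective on [0, 1[, so it meets a countable set at countably many
    parameters. *)
Lemma contour_preimage (A : set C) : countable A -> countable [set s : R | U s /\ A (g s)].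
Proof.
move=> cA; apply: (@countable_sub _ _ ([set s : R | (s \in `[0, 1[%R) /\ A (g s)] `|` [set 1])).
  move=> s [/= Us As]; have [->|s1] := eqVneq s 1; [by right|left; split=> //].
  by move: Us; rewrite /= !in_itv /= => /andP[-> h]; rewrite lt_neqAle s1 h.
apply: countableU; last exact: finite_set_countable.
apply: (countable_inj (f := g)) cA => [x y [x1 _] [y1 _]|x []//].
by case: hg => _ _ _; apply.
Qed.

Lemma gok_sum (J : Type) (s : seq J) (F : J -> C -> C) : (forall j, gok g (F j)) -> gok g (fun z => \sum_(j <- s) F j z).
Proof.
move=> h; elim: s => [|j s IH].
  by rewrite (_ : (fun z => _) = fun=> 0); [exact: gok_cst|apply/funext => z; rewrite big_nil].
rewrite (_ : (fun z => _) = fun z => F j z + \sum_(j <- s) F j z); first exact: gokD.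
by apply/funext => z; rewrite big_cons.
Qed.

Lemma oint_sum (J : Type) (s : seq J) (F : J -> C -> C) : (forall j, gok g (F j)) ->
  oint g (fun z => \sum_(j <- s) F j z) = \sum_(j <- s) oint g (F j).
Proof.
move=> h; elim: s => [|j s IH].
  transitivity (oint g (fun=> 0 * 1)); first by apply: oint_ext => s _; rewrite big_nil mul0r.
  by rewrite ointZ ?mul0r ?big_nil//; exact: gok_cst.
rewrite big_cons -IH -ointD//; last exact: gok_sum.
by apply: oint_ext => t _; rewrite big_cons.
Qed.

(** [Ex w] is the countable set excluded for the next variable once the previous ones are [w]. The
    integral being iterated, a countable set can be discarded in each variable in turn. *)
Lemma power_contour_multilinear n (Ex : seq C -> set C) (f : n.-tuple C -> C) (J : Type) (sJ : seq J) (a : J -> C)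
    (psi : J -> 'I_n -> C -> C) :
  (forall w, countable (Ex w)) -> (forall j i, gok g (psi j i)) ->
  (forall z : n.-tuple C, (forall i : 'I_n, ~ Ex (take i z) (tnth z i) /\ exists2 s, U s & tnth z i = g s) ->
     f z = \sum_(j <- sJ) a j * \prod_(i < n) psi j i (tnth z i)) ->
  power_contour_integral g f = \sum_(j <- sJ) a j * \prod_(i < n) oint g (psi j i).
Proof.
elim: n Ex f a psi => [|n IH] Ex f a psi cE ok hf.
  rewrite /= hf; last by case.
  by apply: eq_bigr => j _; rewrite !big_ord0.
pose c j := a j * \prod_(i < n) oint g (psi j (lift ord0 i)).
have inner z : ~ Ex [::] z -> (exists2 s, U s & z = g s) ->
    power_contour_integral g (fun w : n.-tuple C => f [tuple of z :: w]) = \sum_(j <- sJ) c j * psi j ord0 z.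
  move=> Ez zg.
  rewrite (IH (fun w => Ex (z :: w)) _ (fun j => a j * psi j ord0 z) (fun j i => psi j (lift ord0 i)))//.
    by apply: eq_bigr => j _; rewrite /c mulrAC.
  move=> w hw; rewrite hf.
    apply: eq_bigr => j _; rewrite big_ord_recl -mulrA; congr (_ * (_ * _)).
    by apply: eq_bigr => i _; rewrite !(tnth_nth 0) /=.
  case=> -[|i] hi /=; first by rewrite (tnth_nth 0).
  by have := hw (Ordinal (hi : (i < n)%N)); rewrite !(tnth_nth 0).
have okc j : gok g (fun z => c j * psi j ord0 z) by apply: gokM => //; exact: gok_cst.
transitivity (oint g (fun z => \sum_(j <- sJ) c j * psi j ord0 z)); last first.
  rewrite oint_sum//; apply: eq_bigr => j _; rewrite ointZ// big_ord_recl /c.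
  by rewrite -mulrA; congr (_ * _); rewrite mulrC.
have okS := gok_sum sJ okc.
rewrite /= /oint !contour_intE.
rewrite -(cintZ _ (gok_bm hg g0 okS)).
apply: (cint_off (contour_preimage (cE [::]))).
  have := gok_bm hg g0 (gokM (gok_cst g two_pi_i^-1) okS).
  by congr cbm; apply/funext => s; rewrite !mulrA.
move=> s Us Ns; rewrite inner; last by exists s.
  by rewrite invfM; ring.
by move=> Es; apply: Ns.
Qed.

End Multilinear.

Section Andreief.
Variable R : realType.
Local Notation C := (CC R).

Lemma det_prod_expand n (A B : 'M[C]_n) (w : 'I_n -> C) :
  \prod_i w i * (\det A * \det B) =
  \sum_(s : ({perm 'I_n} * {perm 'I_n})%type) ((-1) ^+ s.1 * (-1) ^+ s.2) * \prod_i (w i * A i (s.1 i) * B i (s.2 i)).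
Proof.
rewrite /determinant mulr_suml mulr_sumr.
rewrite -(pair_bigA _ (fun s1 s2 : 'S_n => ((-1) ^+ s1 * (-1) ^+ s2) * \prod_i (w i * A i (s1 i) * B i (s2 i)))) /=.
apply: eq_bigr => s1 _; rewrite !mulr_sumr; apply: eq_bigr => s2 _.
have aux (x a u b v : C) : x * (a * u * (b * v)) = a * b * (x * u * v) by ring.
by rewrite !big_split /=; exact: aux.
Qed.

(** For fixed s.1 the inner sum is a determinant with permuted rows, whose sign cancels; the n!
    choices of s.1 contribute equally. With [det_prod_expand] this is Andreief's identity. *)
Lemma sum_perm_pairs n (L : 'M[C]_n) :
  \sum_(s : ({perm 'I_n} * {perm 'I_n})%type) ((-1) ^+ s.1 * (-1) ^+ s.2) * \prod_i L (s.1 i) (s.2 i) = n`!%:R * \det L.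
Proof.
rewrite -(pair_bigA _ (fun s1 s2 : 'S_n => ((-1) ^+ s1 * (-1) ^+ s2) * \prod_i L (s1 i) (s2 i))) /=.
transitivity (\sum_(s1 : 'S_n) \det L); last by rewrite sumr_const card_Sn mulr_natl.
apply: eq_bigr => s _.
transitivity ((-1) ^+ s * \det (row_perm s L)).
  rewrite /determinant mulr_sumr; apply: eq_bigr => s2 _; rewrite -mulrA.
  by congr (_ * (_ * _)); apply: eq_bigr => i _; rewrite mxE.
by rewrite row_permE det_mulmx det_perm mulrA -expr2 sqrr_sign mul1r.
Qed.

End Andreief.

(** * The entries of the determinant *)

Section Kernel.
Variable R : realType.
Local Notation C := (CC R).
Local Notation rout := (rprod (fun z : C => z)).
Local Notation rin := (rprod (fun z : C => z^-1)).

Definition nker N (t : 'I_N -> C) (p q z : C) : C :=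
  \prod_u (P2 None (p * q / (t u * z)) p q * P2 None (p * q / (t u / z)) p q).
Definition tker N (t : 'I_N -> C) (p q : C) K (z : C) : C :=
  \prod_u (itail K (t u * z) p q * itail K (t u / z) p q).
Definition pker n i k (p q z : C) : C := - (ph p n i z * ph q n k z).
(* The integrand of the entry (i, k) without its poles at [poles t p q (cells K)]
   and their inverses; it is holomorphic on an annulus. *)
Definition hker n N (t : 'I_N -> C) (p q : C) K i k (z : C) : C :=
  pker n i k p q z * nker t p q z * tker t p q K z.
Definition pole N (t : 'I_N -> C) (p q : C) (c : nat * nat) (u : 'I_N) : C := p ^+ c.1 * q ^+ c.2 * t u.
Definition poles N (t : 'I_N -> C) (p q : C) (s : seq (nat * nat)) : seq C := [seq pole t p q c u | c <- s, u <- enum 'I_N].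

Section KernelUcl.
Variables (T : Type) (A : (T -> C) -> Prop) (W : T -> Prop).
Hypothesis AA : funalg A W.
Variables (n N : nat) (t : 'I_N -> T -> C) (p q : T -> C) (rho r B : R) (K : nat).
Hypothesis hr : 0 <= rho < 1.
Hypothesis r01 : 0 < r < 1.
Hypotheses (up : ucl A W p) (hp : forall x, W x -> cmod (p x) <= rho).
Hypotheses (uq : ucl A W q) (hq : forall x, W x -> cmod (q x) <= rho).
Hypotheses (ut : forall u, ucl A W (t u)) (uti : forall u, ucl A W (fun x => (t u x)^-1)).
Hypotheses (hK : forall u x, W x -> cmod (t u x) * rho ^+ K <= r / 2).
Let r0 : 0 < r. Proof. by case/andP: r01. Qed.
Local Notation Om := (fun y : T * C => W y.1 /\ ann r r^-1 y.2).
Local Notation UC := (ucl (lpar A) Om).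

Lemma OmA : funalg (lpar A) Om.
Proof. by apply: (@lpar_falg _ _ _ _ AA _ r r^-1) => // x z []. Qed.

Let fstU f : ucl A W f -> UC (fun y => f y.1).
Proof. by apply: (ucl_fst AA) => x z []. Qed.

Let UM f g : UC f -> UC g -> UC (fun y => f y * g y) := ucl_mul OmA (f := f) (g := g).

Let zU : UC (fun y => y.2).
Proof. by apply: ucl_ext (ucl_base _ (lpar_exp AA 1)) => z _; rewrite expr1z. Qed.
Let ziU : UC (fun y => y.2^-1).
Proof. by apply: ucl_ext (ucl_base _ (lpar_exp AA (-1))) => z _. Qed.

Let bU f : UC f -> exists B : R, forall y, Om y -> cmod (f y) <= B.
Proof. by move=> /(ucl_bdd OmA)[M _ hM]; exists M. Qed.

Let qpU s f : ucl A W s -> (forall x, W x -> cmod (s x) <= rho) -> UC f -> UC (fun y => qp (f y) (s y.1)).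
Proof.
move=> us hs uf; have [M hM] := bU uf.
by apply: (ucl_qp OmA (rho := rho) (B := M)) => //; [exact: fstU|move=> y [Wy _]; exact: hs].
Qed.

Let thU s f fi : ucl A W s -> (forall x, W x -> cmod (s x) <= rho) -> UC f -> UC fi ->
  (forall y, fi y = (f y)^-1) -> UC (fun y => th (f y) (s y.1)).
Proof.
move=> us hs uf ufi e; apply: UM; first exact: qpU.
by apply: qpU => //; apply: ucl_ext (UM (fstU us) ufi) => y _; rewrite e.
Qed.

Lemma ucl_ph s k : ucl A W s -> (forall x, W x -> cmod (s x) <= rho) -> UC (fun y => ph (s y.1) n k y.2).
Proof.
move=> us hs; apply: UM.
  apply: UM => //; apply: (@thU s (fun y => y.2 ^+ 2) (fun y => (y.2^-1) ^+ 2)) => //.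
  - exact: (ucl_exp OmA).
  - exact: (ucl_exp OmA).
  - by move=> y; rewrite exprVn.
apply: UM.
  apply: (ucl_exp OmA); apply: UM => //; apply: (ucl_exp OmA).
  exact: (@thU s (fun y => y.2) (fun y => y.2^-1)).
apply: (ucl_exp OmA); apply: UM => //; apply: (ucl_exp OmA).
apply: (@thU s (fun y => - y.2) (fun y => - y.2^-1)) => //.
- exact: (ucl_opp OmA).
- exact: (ucl_opp OmA).
- by move=> y; rewrite invrN.
Qed.

Let P2U f : UC f -> UC (fun y => P2 None (f y) (p y.1) (q y.1)).
Proof.
move=> uf; have [M hM] := bU uf.
by apply: (ucl_P2 OmA (rho := rho) (B := M)) => //; [exact: fstU|move=> y [Wy _]; exact: hp|exact: fstU|move=> y [Wy _]; exact: hq].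
Qed.

Let itU f : UC f -> (forall y, Om y -> cmod (f y) * rho ^+ K <= 1 / 2) -> UC (fun y => itail K (f y) (p y.1) (q y.1)).
Proof.
move=> uf hf.
(* For rho ^+ K = 0 the bound 1/2 / rho ^+ K is meaningless, but any bound of [f] serves. *)
have [rK|rK] := eqVneq (rho ^+ K) 0.
  have [M hM] := bU uf.
  apply: (ucl_itail OmA (rho := rho) (B := M)) => //; [exact: fstU|move=> y [Wy _]; exact: hp|exact: fstU|move=> y [Wy _]; exact: hq|].
  by rewrite rK mulr0; lra.
have rK0 : 0 < rho ^+ K by rewrite lt_neqAle eq_sym rK exprn_ge0//; case/andP: hr.
apply: (ucl_itail OmA (rho := rho) (B := 1 / 2 / rho ^+ K)) => //; [exact: fstU|move=> y [Wy _]; exact: hp|exact: fstU|move=> y [Wy _]; exact: hq| |].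
  by move=> y Oy; rewrite ler_pdivlMr//; exact: hf.
by rewrite mulfVK.
Qed.

Lemma ucl_nker : UC (fun y => nker (fun u => t u y.1) (p y.1) (q y.1) y.2).
Proof.
apply: (ucl_prod OmA) => u; apply: UM; apply: P2U; apply: UM; do ?[by apply: UM; exact: fstU].
- by apply: ucl_ext (UM (fstU (uti u)) ziU) => y _; rewrite invfM.
- by apply: ucl_ext (UM (fstU (uti u)) zU) => y _; rewrite invfM invrK.
Qed.

Lemma ucl_tker : UC (fun y => tker (fun u => t u y.1) (p y.1) (q y.1) K y.2).
Proof.
have rK : 0 <= rho ^+ K by rewrite exprn_ge0//; case/andP: hr.
have aux (a b : R) : a * rho ^+ K <= r / 2 -> 0 <= b <= r^-1 -> 0 <= a -> a * b * rho ^+ K <= 1 / 2.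
  move=> h1 /andP[b0 h2] a0; rewrite mulrAC (_ : 1 / 2 = r / 2 * r^-1); last by field; exact: lt0r_neq0.
  by apply: ler_pM => //; exact: mulr_ge0.
apply: (ucl_prod OmA) => u; apply: UM; apply: itU.
- by apply: UM => //; exact: fstU.
- by move=> y [Wy [a1 a2]]; rewrite cmodM; apply: aux; rewrite ?cmod_ge0 ?hK.
- by apply: UM => //; exact: fstU.
- move=> y [Wy [a1 a2]]; rewrite cmodM cmodV; apply: aux; rewrite ?hK ?cmod_ge0// invr_ge0 cmod_ge0 /=.
  by rewrite lef_pV2 ?posrE//; exact: lt_le_trans a1.
Qed.

Lemma ucl_hker i k : UC (fun y => hker n (fun u => t u y.1) (p y.1) (q y.1) K i k y.2).
Proof.
apply: UM; last exact: ucl_tker.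
apply: UM; last exact: ucl_nker.
by apply: (ucl_opp OmA); apply: UM; exact: ucl_ph.
Qed.

End KernelUcl.

Section Pointwise.
Variables (n N : nat) (t : 'I_N -> C) (p q : C).
Hypotheses (p0 : p != 0) (q0 : q != 0) (p1 : cmod p < 1) (q1 : cmod q < 1) (t0 : forall u, t u != 0).
Let rho := Order.max (cmod p) (cmod q).
Let hr : 0 <= rho < 1. Proof. by have [] := max_rho p1 q1. Qed.
Let hp : cmod p <= rho. Proof. by have [] := max_rho p1 q1. Qed.
Let hq : cmod q <= rho. Proof. by have [] := max_rho p1 q1. Qed.

(** The second condition puts all poles in |z| <= 1/(2r) and their inverses in |z| >= 2r; the third
    puts the poles outside the [K]-square in |z| <= r/2, off the annulus r <= |z| <= 1/r. *)
Definition valid (K : nat) (r : R) := [/\ 0 < r < 1, forall u, cmod (t u) * r <= 1 / 2 &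
  forall u, cmod (t u) * (Order.max (cmod p) (cmod q)) ^+ K <= r / 2].

Lemma valid_ex (r' : R) : 0 < r' -> exists K r, valid K r /\ r <= r'.
Proof.
move=> r'0; pose S := \sum_u cmod (t u) + 1.
have S0 : 0 < S by rewrite /S ltr_wpDl// sumr_ge0// => u _; exact: cmod_ge0.
have tS u : cmod (t u) <= S.
  by rewrite /S (bigD1 u)//= -addrA lerDl addr_ge0// sumr_ge0// => v _; exact: cmod_ge0.
pose r := Order.min (r' ) (Order.min (1 / 2) (1 / 2 / S)).
have h2 : 0 < 1 / 2 :> R by lra.
have h3 : 0 < 1 / 2 / S by rewrite divr_gt0.
have r0 : 0 < r by rewrite /r !lt_min r'0 h2 h3.
have r1 : r < 1 by rewrite /r !gt_min; apply/orP; right; apply/orP; left; lra.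
have rS : r <= 1 / 2 / S by rewrite /r !ge_min lexx !orbT.
have r2 : 0 < r / 2 by rewrite divr_gt0.
have [K hK] := geo_small S hr r2.
exists K, r; split; last by rewrite /r ge_min lexx.
split; first by rewrite r0.
- move=> u; apply: (@le_trans _ _ (S * (1 / 2 / S))).
    by apply: ler_pM => //; rewrite ?cmod_ge0 ?ltW.
  by rewrite mulrC mulfVK// gt_eqF.
- move=> u; apply: le_trans (ltW (hK K (leqnn _))).
  by apply: ler_pM => //; rewrite ?cmod_ge0 ?exprn_ge0//; case/andP: hr.
Qed.

Section Valid.
Variables (K : nat) (r : R).
Hypothesis v : valid K r.
Let r01 : 0 < r < 1. Proof. by case: v. Qed.
Let r0 : 0 < r. Proof. by case/andP: r01. Qed.

Lemma pole_small c u : small r (pole t p q c u).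
Proof.
case: v => _ h _; rewrite /small /pole; apply: le_trans (h u).
rewrite !cmodM !cmodX ler_wpM2r ?(ltW r0)// ler_piMl ?cmod_ge0//.
by rewrite mulr_ile1 ?exprn_ge0 ?cmod_ge0// exprn_ile1 ?cmod_ge0// ltW.
Qed.

Lemma pole_neq0 c u : pole t p q c u != 0.
Proof. by rewrite /pole !mulf_neq0 ?expf_neq0. Qed.

Lemma poles_small s : {in poles t p q s, forall x, small r x}.
Proof. by move=> _ /allpairsP[[c u] [_ _ ->]]; exact: pole_small. Qed.

Lemma poles_allsm s : allsm r (poles t p q s).
Proof. by move=> _ /allpairsP[[c u] [_ _ ->]]; split; [exact: pole_neq0|exact: pole_small]. Qed.

Lemma unit_falg : @funalg R unit (fun _ => True) (fun _ => True).
Proof. by split=> // f _; exists (cmod (f tt)) => -[]. Qed.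

Lemma hker_lau i k : ucl (@lau R) (ann r r^-1) (hker n t p q K i k).
Proof.
have u1 (c : C) : @ucl R unit (fun _ => True) (fun _ => True) (fun=> c) by apply: ucl_base.
have H := @ucl_hker unit _ _ unit_falg n N (fun u _ => t u) (fun=> p) (fun=> q) rho r K hr r01
  (u1 _) (fun _ _ => hp) (u1 _) (fun _ _ => hq) (fun u => u1 _) (fun u => u1 _).
apply: (@ucl_at R unit _ _ (ann r r^-1) _ tt _ (H _ i k)) => // u x _.
by case: v.
Qed.

Lemma tail_ok z u : ann r r^-1 z -> cmod (t u * z) * rho ^+ K <= 1 / 2 /\ cmod (t u / z) * rho ^+ K <= 1 / 2.
Proof.
move=> [a1 a2]; have [_ _ h] := v.
have aux (a b : R) : a * rho ^+ K <= r / 2 -> 0 <= b <= r^-1 -> 0 <= a -> a * b * rho ^+ K <= 1 / 2.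
  move=> h1 /andP[b0 h2] a0; rewrite mulrAC (_ : 1 / 2 = r / 2 * r^-1); last by field; exact: lt0r_neq0.
  by apply: ler_pM => //; apply: mulr_ge0; rewrite ?exprn_ge0//; case/andP: hr.
split; rewrite cmodM ?cmodV; apply: aux; rewrite ?h ?cmod_ge0//.
rewrite invr_ge0 cmod_ge0 /= lef_pV2 ?posrE//; exact: lt_le_trans a1.
Qed.

Lemma weight_split z : ann r r^-1 z ->
  \prod_u (egamma (t u * z) p q * egamma (t u / z) p q) =
  nker t p q z * tker t p q K z * (rout (poles t p q (cells K)) z * rin (poles t p q (cells K)) z).
Proof.
move=> az; have z0 : z != 0 by rewrite -cmod_gt0; case: az => a _; exact: lt_le_trans a.
have e1 (xi : C) : rprod (fun _ : C => xi) (poles t p q (cells K)) z = \prod_u \prod_(c <- cells K) (1 - p ^+ c.1 * q ^+ c.2 * (t u * xi))^-1.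
  rewrite /rprod /poles big_allpairs_dep /= exchange_big /= big_enum; apply: eq_bigr => u _.
  by apply: eq_bigr => c _; rewrite /pole mulrA.
have -> : rout (poles t p q (cells K)) z = \prod_u \prod_(c <- cells K) (1 - p ^+ c.1 * q ^+ c.2 * (t u * z))^-1 by exact: (e1 z).
have -> : rin (poles t p q (cells K)) z = \prod_u \prod_(c <- cells K) (1 - p ^+ c.1 * q ^+ c.2 * (t u / z))^-1 by exact: (e1 z^-1).
rewrite /nker /tker -!big_split /=; apply: eq_bigr => u _.
have [h1 h2] := tail_ok u az.
rewrite (egamma_split p1 q1 h1) ?mulf_neq0// (egamma_split p1 q1 h2) ?mulf_neq0 ?invr_eq0// !qpoch2E.
by ring.
Qed.

End Valid.

Lemma itail_step K d x : cmod x * rho ^+ K <= 1 / 2 ->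
  itail (K + d) x p q = itail K x p q * \prod_(c <- shells K d) (1 - p ^+ c.1 * q ^+ c.2 * x).
Proof.
move=> hK.
have hK' : cmod x * rho ^+ (K + d) <= 1 / 2.
  apply: le_trans hK; rewrite ler_wpM2l ?cmod_ge0//; have /andP[a b] := hr.
  by apply: ler_wiXn2l; rewrite ?leq_addr// ltW.
have nz c : c \in shells K d -> 1 - p ^+ c.1 * q ^+ c.2 * x != 0.
  by move=> /mem_shells[_ hc]; have [] := inv_near1 (tail_half p1 q1 hK hc).
have c1 := itail_cvg p1 q1 hK; have c2 := itail_cvg p1 q1 hK'.
have c3 := ccvgM c2 (ccvg_cst (\prod_(c <- shells K d) (1 - p ^+ c.1 * q ^+ c.2 * x)^-1)).
have E : itail (K + d) x p q * \prod_(c <- shells K d) (1 - p ^+ c.1 * q ^+ c.2 * x)^-1 = itail K x p q.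
  apply: (ccvg_unique c3) => e e0; have [M hM] := c1 e e0; exists M => k Mk.
  have := hM (d + k)%N (leq_trans Mk (leq_addl _ _)).
  congr (cmod (_ - _) < e).
  rewrite /shells iotaD map_cat flatten_cat big_cat /= mulrC; congr (_ * _).
rewrite -E -mulrA -big_split /= big1_seq ?mulr1// => c /andP[_ cs].
by rewrite mulVf// nz.
Qed.

Lemma poles_cat s s' : poles t p q (s ++ s') = poles t p q s ++ poles t p q s'.
Proof. by rewrite /poles map_cat flatten_cat. Qed.

Lemma hker_step K d r i k z : valid K r -> ann r r^-1 z ->
  hker n t p q (K + d) i k z = hker n t p q K i k z *
    \prod_(x <- poles t p q (shells K d)) ((1 - x * z) * (1 - x / z)).
Proof.
move=> v az; rewrite /hker -!mulrA; congr (_ * (_ * _)).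
rewrite /poles big_allpairs_dep /= exchange_big /= big_enum /tker -big_split /=; apply: eq_bigr => u _.
have [h1 h2] := tail_ok v u az.
rewrite (itail_step _ h1) (itail_step _ h2) big_split /=.
have e (w : C) : \prod_(c <- shells K d) (1 - p ^+ c.1 * q ^+ c.2 * (t u * w)) = \prod_(c <- shells K d) (1 - pole t p q c u * w).
  by apply: eq_bigr => c _; rewrite /pole !mulrA.
by rewrite (e z) (e z^-1); ring.
Qed.

(** The product of two poles depends only on the sum of their exponents, so letting one pair of
    exponents vary covers all coincidences of a pole with an inverse pole. *)
Definition poles_free := forall c u v, pole t p q c u * t v != 1.

Lemma nondeg_poles s s' : poles_free -> nondeg (poles t p q s) (poles t p q s').
Proof.
move=> nd _ _ /allpairsP[[c u] [_ _ ->]] /allpairsP[[c' u'] [_ _ ->]] /=.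
rewrite subr_eq0 eq_sym; have := nd (c.1 + c'.1, c.2 + c'.2)%N u u'; rewrite /pole /= !exprD.
by congr (_ != _); ring.
Qed.

Definition Lval K r i k := Lrec (hker n t p q K i k) r (poles t p q (cells K)) (poles t p q (cells K)).

Lemma Lval_step K d r i k : poles_free -> valid K r -> valid (K + d) r -> Lval (K + d) r i k = Lval K r i k.
Proof.
move=> nd v v'; have [r01 _ _] := v.
rewrite /Lval cellsD poles_cat -(@Lrec_cat _ r r01 (hker n t p q K i k) (poles t p q (cells K)) (poles t p q (shells K d))).
- by apply: Lrec_ext => // z az; exact: hker_step v az.
- exact: hker_lau.
- by rewrite -poles_cat; exact: (poles_small v).
- by rewrite -poles_cat; exact: nondeg_poles.
Qed.

Lemma Lval_radius K r r' i k : valid K r -> valid K r' -> r' <= r -> Lval K r i k = Lval K r' i k.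
Proof.
move=> v v' rr; have [/andP[_ r1] _ _] := v; have [/andP[r'0 _] _ _] := v'.
apply: Lrec_radius => //; first by rewrite r'0.
- exact: hker_lau.
- exact: (poles_small v).
- exact: (poles_small v).
Qed.

Lemma valid_mono K K' r : valid K r -> (K <= K')%N -> valid K' r.
Proof.
move=> [r01 h1 h2] KK; split=> // u; apply: le_trans (h2 u).
rewrite ler_wpM2l ?cmod_ge0//; have /andP[a b] := hr.
by apply: ler_wiXn2l => //; exact: ltW.
Qed.

(** Two truncations are compared through the larger [K], for which both radii are valid. *)
Lemma Lval_unique K r K' r' i k : poles_free -> valid K r -> valid K' r' -> Lval K r i k = Lval K' r' i k.
Proof.
move=> nd; wlog rr : K r K' r' / r' <= r.
  by move=> W v v'; have [h|/ltW h] := leP r' r; [exact: W|apply/esym; exact: W].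
move=> v v'; pose M := maxn K K'.
have vM := valid_mono v (leq_maxl K K' : (K <= M)%N); have vM' := valid_mono v' (leq_maxr K K' : (K' <= M)%N).
rewrite -(@Lval_step K (M - K))// ?subnKC ?leq_maxl//.
rewrite -(@Lval_step K' (M - K'))// ?subnKC ?leq_maxr//.
exact: Lval_radius.
Qed.

(* Any valid truncation gives the same value, by [LentE]. *)
Definition Lent i k := let Kr := xget (0%N, 1 : R) [set Kr : nat * R | valid Kr.1 Kr.2] in Lval Kr.1 Kr.2 i k.

Lemma LentE K r i k : poles_free -> valid K r -> Lent i k = Lval K r i k.
Proof.
move=> nd v; rewrite /Lent.
have : [set Kr : nat * R | valid Kr.1 Kr.2] (xget (0%N, 1 : R) [set Kr : nat * R | valid Kr.1 Kr.2]).
  by apply: xgetPex; exists (K, r).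
by move: (xget _ _) => -[K' r'] /= v'; exact: Lval_unique.
Qed.

End Pointwise.
End Kernel.

Section ContourFormula.
Variable R : realType.
Local Notation C := (CC R).
Local Notation U := (`[0%R, 1%R]%classic : set R).
Local Notation rout := (rprod (fun z : C => z)).
Local Notation rin := (rprod (fun z : C => z^-1)).

Section Denominator.
Variables p q : C.
Hypotheses (p0 : p != 0) (q0 : q != 0) (p1 : cmod p < 1) (q1 : cmod q < 1).

Definition bad (x : C) := exists a b : nat, p ^+ a * q ^+ b * x = 1 \/ p ^+ a * q ^+ b / x = 1.

Lemma bad_countable : countable [set x : C | bad x].
Proof.
pose e (c : nat * nat) : C := p ^+ c.1 * q ^+ c.2.
apply: (@countable_sub _ _ ([set e c | c in [set: nat * nat]] `|` [set (e c)^-1 | c in [set: nat * nat]])).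
  move=> x [a [b [h|h]]].
    right; exists (a, b) => //; have e0 : e (a, b) != 0 by rewrite mulf_neq0// expf_neq0.
    by apply: (mulfI e0); rewrite divff.
  left; exists (a, b) => //; have x0 : x != 0.
    by apply: contra_eq_neq h => ->; rewrite invr0 mulr0 eq_sym oner_neq0.
  by rewrite -[LHS](mulfVK x0) [p ^+ _ * _ / _]h mul1r.
by apply: countableU; apply: countable_im; exact: countableP.
Qed.

Lemma bad0 : ~ bad 0.
Proof. by move=> [a [b [|]]]; rewrite ?invr0 mulr0 => /eqP; rewrite eq_sym oner_eq0. Qed.

(** Off this set the reflection formula applies to every cross term between a new variable and
    itself or an earlier one from [w]. *)
Definition exset (w : seq C) : set C :=
  [set z | bad (z ^+ 2)] `|` \bigcup_(y in [set` w]) ([set z | bad (y * z)] `|` [set z | bad (y / z)]).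

Lemma exset_countable w : countable (exset w).
Proof.
apply: countableU; first exact: (countable_sqr bad_countable).
apply: bigcup_countable => [|y _]; first exact/finite_set_countable/finite_seq.
have [->|y0] := eqVneq y 0.
  by apply: (@countable_fin _ _ [::]) => z []; rewrite /= mul0r => /bad0.
apply: countableU.
  by apply: (countable_inj (f := fun z => y * z) (B := [set x | bad x])) bad_countable => // a b _ _; exact: mulfI.
apply: (countable_inj (f := fun z => y / z) (B := [set x | bad x])) bad_countable => // a b _ _ /(mulfI y0).
exact: invr_inj.
Qed.

Lemma not_bad x : ~ bad x -> (forall a b, p ^+ a * q ^+ b * x != 1) /\ (forall a b, p ^+ a * q ^+ b / x != 1).
Proof. by move=> nb; split=> a b; apply/eqP => e; apply: nb; exists a, b; [left|right]. Qed.

Lemma gamma_pair x : x != 0 -> ~ bad x -> (egamma x p q * egamma x^-1 p q)^-1 = th x p * th x^-1 q.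
Proof. by move=> x0 /not_bad[h1 h2]; exact: gamma_refl. Qed.

Lemma gamma_four z x : z != 0 -> x != 0 -> ~ bad (z * x) -> ~ bad (z / x) ->
  (egamma (z * x) p q * egamma (z * x^-1) p q * egamma (z^-1 * x) p q * egamma (z^-1 * x^-1) p q)^-1 =
  dth p z x * dth q z x.
Proof.
move=> z0 x0 b1 b2.
have zx : z * x != 0 by rewrite mulf_neq0.
have zix : z / x != 0 by rewrite mulf_neq0 ?invr_eq0.
have e1 : z^-1 * x^-1 = (z * x)^-1 by rewrite invfM.
have e2 : z^-1 * x = (z / x)^-1 by rewrite invfM invrK.
have -> : egamma (z * x) p q * egamma (z * x^-1) p q * egamma (z^-1 * x) p q * egamma (z^-1 * x^-1) p q =
   (egamma (z * x) p q * egamma (z * x)^-1 p q) * (egamma (z / x) p q * egamma (z / x)^-1 p q).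
  by rewrite e1 e2; ring.
rewrite invfM !gamma_pair// (th_inv q1 zx) (th_inv q1 zix) /dth; field.
by rewrite x0 z0.
Qed.

Lemma gamma_two z : z != 0 -> ~ bad (z ^+ 2) ->
  (egamma (z ^+ 2) p q * egamma (z ^- 2) p q)^-1 = - (vt p z * vt q z).
Proof.
move=> z0 b; have z20 : z ^+ 2 != 0 by rewrite expf_neq0.
by rewrite gamma_pair// (th_inv q1 z20) /vt; field.
Qed.

(** A zero of theta(-z) in base p or q makes z^2 an integral power of the base, which is excluded.
    This permits the division in [hvandermonde]. *)
Lemma bB_neq0 z : z != 0 -> ~ bad (z ^+ 2) -> bB p z != 0 /\ bB q z != 0.
Proof.
move=> z0 b; have [h1 h2] := not_bad b; have nz : - z != 0 by rewrite oppr_eq0.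
split; apply: mulf_neq0; rewrite ?invr_eq0// expf_neq0//; apply: th_neq0 => // k; apply/eqP => e.
- have := h1 k.*2 0%N; rewrite expr0 mulr1 -muln2 exprM -exprMn -[p ^+ k * z]opprK -mulrN e.
  by rewrite sqrrN expr1n eqxx.
- have := h2 (k.+1).*2 0%N; rewrite expr0 mulr1 -muln2 exprM e sqrrN divff ?eqxx//.
  exact: expf_neq0.
- have := h1 0%N k.*2; rewrite expr0 mul1r -muln2 exprM -exprMn -[q ^+ k * z]opprK -mulrN e.
  by rewrite sqrrN expr1n eqxx.
- have := h2 0%N (k.+1).*2; rewrite expr0 mul1r -muln2 exprM e sqrrN divff ?eqxx//.
  exact: expf_neq0.
Qed.

Definition addnorm : C := dth p 1 (-1) * dth q 1 (-1).

Lemma dthN1 (s : C) : cmod s < 1 -> dth s 1 (-1) = th (-1) s ^+ 2.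
Proof. by move=> s1; rewrite /dth !(invrN, invr1, mulrN1, mulN1r, mul1r, mulr1); ring. Qed.

Lemma addnorm_neq0 : addnorm != 0.
Proof. by rewrite /addnorm !dthN1// mulf_neq0// expf_neq0// thN1_neq0. Qed.

(** The signs of [hvandermonde], one for each pair, occur in both bases and cancel. *)
Lemma pair_product n (Z : 'I_n -> C) : (forall i, Z i != 0) -> (forall i, ~ bad (Z i ^+ 2)) ->
  \prod_(i < n) \prod_(j < n | (i < j)%N) (dth p (Z i) (Z j) * dth q (Z i) (Z j)) =
  \prod_(i < n) \prod_(j < n | (i < j)%N) addnorm^-1 *
   (\det (\matrix_(i < n, k < n) ffn p n k (Z i)) * \det (\matrix_(i < n, k < n) ffn q n k (Z i))).
Proof.
move=> Z0 bZ.
have E (s : C) : s != 0 -> cmod s < 1 -> (forall i, bB s (Z i) != 0) ->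
   \prod_(i < n) \prod_(j < n | (i < j)%N) (dth s (Z i) (Z j) * dth s 1 (-1)) =
   \prod_(i < n) \prod_(j < n | (i < j)%N) (-1) * \det (\matrix_(i < n, k < n) ffn s n k (Z i)).
  move=> s0 s1 b0; rewrite -(hvandermonde (fun i => bA s (Z i)) b0).
  apply: eq_bigr => i _; apply: eq_bigr => j _.
  by rewrite addition// -!bA_dth -!bB_dth.
have Ep := E p p0 p1 (fun i => (bB_neq0 (Z0 i) (bZ i)).1).
have Eq := E q q0 q1 (fun i => (bB_neq0 (Z0 i) (bZ i)).2).
have S1 : \prod_(i < n) \prod_(j < n | (i < j)%N) (-1 : C) * \prod_(i < n) \prod_(j < n | (i < j)%N) (-1) = 1.
  rewrite -big_split big1//= => i _; rewrite -big_split big1//= => j _.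
  by rewrite mulrNN mulr1.
set dp := \det _ in Ep *; set dq := \det _ in Eq *.
have -> : dp * dq = \prod_(i < n) \prod_(j < n | (i < j)%N) (dth p (Z i) (Z j) * dth p 1 (-1)) * \prod_(i < n) \prod_(j < n | (i < j)%N) (dth q (Z i) (Z j) * dth q 1 (-1)).
  rewrite Ep Eq; move: S1; set s := \prod_(i < n) _ => S1.
  by rewrite mulrACA S1 mul1r.
rewrite -!big_split /=; apply: eq_bigr => i _; rewrite -!big_split /=; apply: eq_bigr => j _.
have := addnorm_neq0; rewrite /addnorm mulf_eq0 negb_or => /andP[a b]; field.
by rewrite a b.
Qed.

End Denominator.

(** Besides the prefactor of the integral: the inverse of [addnorm] for each pair, from [addition]
    in both bases, and n! from Andreief's identity. *)
Definition kappa n (p q : C) : C := qpoch p ^+ n * qpoch q ^+ n / (2 ^ n * n`!)%:R *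
  ((\prod_(i < n) \prod_(j < n | (i < j)%N) (addnorm p q)^-1) * n`!%:R).

Section Formula.
Variables (n N : nat) (t : 'rV[C]_N) (p q : C) (g : R -> C).
Hypotheses (p0 : p != 0) (q0 : q != 0) (p1 : cmod p < 1) (q1 : cmod q < 1) (t0 : forall u, t 0 u != 0).
Hypothesis adm : admissible_contour t p q g.
Variable u0 : 'I_N.
Let tf u := t 0 u.
Let hg : closed_contour g. Proof. by case: adm. Qed.
Let g0 : avoids g 0. Proof. by case: adm. Qed.

(** A pole equal to an inverse pole would have winding numbers 1 and 0. *)
Lemma adm_poles_free : poles_free tf p q.
Proof.
case: adm => _ _ h c u v; apply/eqP => e.
have [[_ w1] _] := h c.1 c.2 u; have [_ [_ w2]] := h 0%N 0%N v.
have E : p ^+ c.1 * q ^+ c.2 * t 0 u = (p ^+ 0 * q ^+ 0 * t 0 v)^-1.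
  by rewrite !expr0 !mul1r; apply: (mulIf (t0 v)); rewrite mulVf//.
move: w1; rewrite E w2 => /eqP; rewrite eq_sym oner_eq0//.
Qed.

Lemma gok_bdd (f : C -> C) : gok g f -> exists2 B : R, 0 <= B & forall s, U s -> cmod (f (g s)) <= B.
Proof.
move=> gf; have [B hB] := gok_bounded gf; exists (`|B|) => // s Us.
by apply: le_trans (ler_norm _); apply: hB; exists s.
Qed.

Lemma contour_annulus : exists2 r : R, 0 < r & forall s, U s -> ann r r^-1 (g s).
Proof.
have [B1 B10 h1] := gok_bdd (gok_id hg).
have [B2 B20 h2] : exists2 B : R, 0 <= B & forall s, U s -> cmod (g s)^-1 <= B.
  by apply: (@gok_bdd (fun z => z^-1)); apply: gokV; [exact: gok_id|move=> s Us; exact: g0].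
exists (1 + B1 + B2)^-1; first by rewrite invr_gt0; lra.
move=> s Us; have gp : 0 < cmod (g s) by rewrite cmod_gt0; exact: g0.
split; last by rewrite invrK; have := h1 s Us; lra.
rewrite -[leRHS]invrK lef_pV2 ?posrE ?invr_gt0//; last lra.
by rewrite -cmodV; have := h2 s Us; lra.
Qed.

(** The poles p^i t_u tend to 0 and are enclosed, and the winding number is continuous off the
    curve. *)
Lemma winding_origin : winding_number g 0 = 1.
Proof.
have [r rp ga] := contour_annulus.
have wE a : winding_number g a = oint g (fun z => z / (z - a)).
  rewrite /winding_number /oint !contour_intE; congr (_ * _).
  apply: cint_ext => s Us; congr (_ * _); rewrite mulrAC divff ?mul1r//; exact: g0.
pose a i : C := p ^+ i * q ^+ 0 * t 0 u0.
have [_ _ h] := adm.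
have ha i : avoids g (a i) /\ winding_number g (a i) = 1 := (h i 0%N u0).1.
have hr : 0 <= cmod p < 1 by rewrite cmod_ge0.
have ar i : cmod (a i) = cmod (t 0 u0) * cmod p ^+ i by rewrite !cmodM !cmodX expr0 mulr1 mulrC.
have [/= D D0 hD] : exists2 B : R, 0 <= B & forall f M, gok g f -> (forall z, (exists2 s, U s & z = g s) -> cmod (f z) <= M) -> cmod (oint g f) <= B * M.
  (* [oint_bound] asks for a radius below 1. *)
  pose r' := Order.min r (1/2).
  have r'0 : 0 < r' by rewrite /r' lt_min rp; lra.
  have r'1 : 0 < r' < 1 by rewrite r'0 /r' gt_min; apply/orP; right; lra.
  apply: (@oint_bound _ r' r'1 g hg g0) => s /ga[b1 b2].
  split; first by apply: le_trans b1; rewrite /r' ge_min lexx.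
  by apply: le_trans b2 _; rewrite lef_pV2 ?posrE// /r' ge_min lexx.
apply/eqP; rewrite -subr_eq0 -cmod_eq0; apply/eqP/le_anti; rewrite cmod_ge0 andbT.
apply/ler_addgt0Pr => e e0; rewrite add0r.
(* The first bound keeps a_i at distance at least r/2 from the curve; the second then makes the
   difference of the integrands, a_i / (z - a_i), at most e / (D + 1) in modulus. *)
have e1 : 0 < Order.min (r / 2) (e * r / (2 * (D + 1))).
  by rewrite lt_min !divr_gt0// ?mulr_gt0//; lra.
have [i hi] := geo_small (cmod (t 0 u0)) hr e1.
have := hi i (leqnn i); rewrite -ar lt_min => /andP[a1 a2].
rewrite -(ha i).2 !wE -(LB (oint_good hg g0)); last 2 first.
- apply: gokM; first exact: gok_id.
  apply: gokV; first by apply: (gf_okD (oint_good hg g0)); [exact: gok_id|exact: gok_cst].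
  by move=> s Us; rewrite subr0; exact: g0.
- apply: gokM; first exact: gok_id.
  apply: gokV; first by apply: (gf_okD (oint_good hg g0)); [exact: gok_id|exact: gok_cst].
  by move=> s Us; rewrite subr_eq0; exact: (ha i).1.
have D1 : 0 < D + 1 by lra.
apply: (@le_trans _ _ (D * (e / (D + 1)))); last by rewrite mulrCA ger_pMr// ler_pdivrMr//; lra.
apply: hD.
  apply: (gf_okD (oint_good hg g0)).
    apply: gokM; first exact: gok_id.
    apply: gokV; first by apply: (gf_okD (oint_good hg g0)); [exact: gok_id|exact: gok_cst].
    by move=> s Us; rewrite subr0; exact: g0.
  rewrite (_ : (fun z => _) = fun z => -1 * (z / (z - a i))); last by apply/funext => z; rewrite mulN1r.
  apply: gokM; first exact: gok_cst.
  apply: gokM; first exact: gok_id.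
  apply: gokV; first by apply: (gf_okD (oint_good hg g0)); [exact: gok_id|exact: gok_cst].
  by move=> s Us; rewrite subr_eq0; exact: (ha i).1.
move=> _ [s Us ->]; have gs : g s != 0 by exact: g0.
have gp : 0 < cmod (g s) by rewrite cmod_gt0.
have ga' : g s - a i != 0 by rewrite subr_eq0; exact: (ha i).1.
rewrite subr0 divff// (_ : 1 - g s / (g s - a i) = - (a i / (g s - a i))); last by field.
have [b1 _] := ga s Us.
have h1 : r / 2 <= cmod (g s - a i) by have := cmodBl (g s) (a i); lra.
have r2 : 0 < r / 2 by rewrite divr_gt0.
rewrite cmodN cmodM cmodV ler_pdivrMr; last exact: lt_le_trans h1.
apply: (@le_trans _ _ (e / (D + 1) * (r / 2))); last by rewrite ler_wpM2l// divr_ge0// ltW.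
have D1' := lt0r_neq0 D1.
have -> : e / (D + 1) * (r / 2) = e * r / (2 * (D + 1)) by field.
exact: ltW.
Qed.

Lemma oint_entry : exists K r, [/\ valid tf p q K r, (forall s, U s -> ann r r^-1 (g s)),
  forall i k, gok g (fun z => hker n tf p q K i k z * (rout (poles tf p q (cells K)) z * rin (poles tf p q (cells K)) z)) &
  forall i k, oint g (fun z => hker n tf p q K i k z * (rout (poles tf p q (cells K)) z * rin (poles tf p q (cells K)) z)) = Lent n tf p q i k].
Proof.
have [r' r'0 ga'] := contour_annulus.
have [K [r [v rr]]] := valid_ex tf p1 q1 r'0.
have [r01 _ _] := v; have /andP[r0 r1] := r01.
have ga s : U s -> ann r r^-1 (g s).
  move=> /ga'[b1 b2]; split; first exact: le_trans b1.
  by apply: le_trans b2 _; rewrite lef_pV2.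
have nd := adm_poles_free.
have [_ _ h] := adm.
have oo x : x \in poles tf p q (cells K) -> outok r g x.
  move=> /allpairsP[[c u] [_ _ ->]]; split; [exact: pole_neq0|exact: (pole_small p1 q1 v)|].
  exact: (h c.1 c.2 u).2.
have io x : x \in poles tf p q (cells K) -> inok r g x.
  move=> /allpairsP[[c u] [_ _ ->]]; split; [exact: pole_neq0|exact: (pole_small p1 q1 v)|].
  exact: (h c.1 c.2 u).1.
have hl i k := hker_lau n p1 q1 v i k.
exists K, r; split=> // i k.
  apply: gokM; first exact: (gok_h (hl i k)).
  apply: gokM.
    apply: (ok_rprod (oint_good hg g0) (S := outok r g)) => // a; exact: gok_out.
  apply: (ok_rprod (oint_good hg g0) (S := inok r g)) => // a; exact: gok_in.
rewrite (oint_Lrec r01 (hl i k) hg g0 winding_origin ga)//; last exact: nondeg_poles.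
by rewrite (LentE n p1 q1 i k nd v).
Qed.

Lemma contour_formula : I_BC n g t p q = kappa n p q * \det (\matrix_(i < n, k < n) Lent n tf p q i k).
Proof.
have [K [r [v ga gk oe]]] := oint_entry.
have [r01 _ _] := v.
pose psi (s : {perm 'I_n} * {perm 'I_n}) (i : 'I_n) (z : C) := hker n tf p q K (s.1 i) (s.2 i) z *
   (rout (poles tf p q (cells K)) z * rin (poles tf p q (cells K)) z).
pose D : C := \prod_(i < n) \prod_(j < n | (i < j)%N) (addnorm p q)^-1.
rewrite /I_BC /kappa -[RHS]mulrA; congr (_ * _).
rewrite (power_contour_multilinear hg g0 (Ex := exset p q) (sJ := index_enum (({perm 'I_n} * {perm 'I_n})%type : finType))
   (a := fun s => D * ((-1) ^+ s.1 * (-1) ^+ s.2)) (psi := psi)); last 3 first.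
- by move=> w; exact: exset_countable.
- by move=> s i; exact: gk.
- move=> z hz.
  have Z0 i : tnth z i != 0 by have [_ [s Us ->]] := hz i; exact: g0.
  have bZ i : ~ bad p q (tnth z i ^+ 2) by have [ne _] := hz i; move=> b; apply: ne; left.
  have bP (i j : 'I_n) : (i < j)%N -> ~ bad p q (tnth z i * tnth z j) /\ ~ bad p q (tnth z i / tnth z j).
    move=> ij; have [ne _] := hz j.
    have zin : tnth z i \in take j z.
      rewrite (tnth_nth 0) -(nth_take _ ij) mem_nth// size_take size_tuple ltn_ord//.
    by split=> b; apply: ne; right; exists (tnth z i) => //; [left|right].
  rewrite /BC_integrand invfM -!prodfV.
  rewrite [X in _ * (X * _)](eq_bigr (fun i : 'I_n => \prod_(j < n | (i < j)%N) (dth p (tnth z i) (tnth z j) * dth q (tnth z i) (tnth z j)))); last first.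
    move=> i _; rewrite -prodfV; apply: eq_bigr => j ij; have [b1 b2] := bP i j ij.
    exact: gamma_four.
  rewrite pair_product// -/D.
  rewrite [X in _ * (_ * X)](eq_bigr (fun i : 'I_n => - (vt p (tnth z i) * vt q (tnth z i)))); last first.
    by move=> i _; exact: gamma_two.
  set dp := \det _; set dq := \det _; set w1 := \prod_(i < n) _; set w2 := \prod_(i < n) - _.
  have -> : w1 * (D * (dp * dq) * w2) = D * ((w1 * w2) * (dp * dq)) by ring.
  rewrite -big_split /= /dp /dq det_prod_expand mulr_sumr; apply: eq_bigr => s _.
  rewrite mulrA; congr (_ * _); apply: eq_bigr => i _; rewrite !mxE /psi /hker /pker /ph.
  have [_ [s' Us' zs]] := hz i.
  have az : ann r r^-1 (tnth z i) by rewrite zs; exact: ga.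
  have := weight_split p1 q1 t0 v az; rewrite /tf => ->.
  by ring.
transitivity (D * \sum_(s : ({perm 'I_n} * {perm 'I_n})%type) ((-1) ^+ s.1 * (-1) ^+ s.2) *
   \prod_i (\matrix_(i < n, k < n) Lent n tf p q i k) (s.1 i) (s.2 i)).
  rewrite mulr_sumr; apply: eq_bigr => s _; rewrite -[LHS]mulrA; congr (_ * (_ * _)).
  by apply: eq_bigr => i _; rewrite mxE -oe.
by rewrite sum_perm_pairs mulrA.
Qed.

End Formula.
End ContourFormula.

(** * The unit circle as an admissible contour *)

Section UnitCircle.
Variable R : realType.
Local Notation C := (CC R).
Local Notation U := (`[0%R, 1%R]%classic : set R).

Lemma rder_lin (a s : R) : rder (fun s => a * s) s a.
Proof.
have := rderM (rder_cst a s) (is_derive_id s 1 : rder id s 1).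
by move/rder_eq; apply; rewrite mulr1 mulr0 addr0.
Qed.

Lemma rder_cos (a s : R) : rder (fun s => cos (a * s)) s (- sin (a * s) * a).
Proof.
have h1 : is_derive (a * s) 1 (@cos R) (- sin (a * s)) := is_derive_cos _.
exact: (@is_derive1_comp R (@cos R) (fun s => a * s) s _ _ h1 (rder_lin a s)).
Qed.

Lemma rder_sin (a s : R) : rder (fun s => sin (a * s)) s (cos (a * s) * a).
Proof.
have h1 : is_derive (a * s) 1 (@sin R) (cos (a * s)) := is_derive_sin _.
exact: (@is_derive1_comp R (@sin R) (fun s => a * s) s _ _ h1 (rder_lin a s)).
Qed.

Lemma rder_derive1E (f : R -> R) s d : rder f s d -> derivable f s 1 /\ derive1 f s = d.
Proof. by move=> h; split; [case: h|rewrite derive1E; exact: (@derive_val _ _ _ _ _ _ _ h)]. Qed.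

Lemma smooth_pc1 (f f' f'' : R -> R) : (forall s, rder f s (f' s)) -> (forall s, rder f' s (f'' s)) -> piecewise_C1 f.
Proof.
move=> h1 h2.
have e : derive1 f = f' by apply/funext => s; have [_ ->] := rder_derive1E (h1 s).
have c1 s : {for s, continuous f} := rder_cont (h1 s).
have c2 s : {for s, continuous f'} := rder_cont (h2 s).
split; first by apply: continuous_subspaceT => s; exact: c1.
exists [::]; split.
- move=> s _ _; rewrite e; split; last exact: c2.
  by have [] := rder_derive1E (h1 s).
- by move=> s _; rewrite e; apply: cvgP; apply: cvg_at_right_filter; exact: c2.
- by move=> s _; rewrite e; apply: cvgP; apply: cvg_at_left_filter; exact: c2.
Qed.

Lemma cos_eq1 (x : R) : - (2 * pi) < x < 2 * pi -> cos x = 1 -> x = 0.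
Proof.
move=> /andP[x1 x2] c.
have pos (y : R) : 0 < y < 2 * pi -> cos y <> 1.
  move=> /andP[y0 y1] cy.
  have yh : 0 < y / 2 < pi by apply/andP; split; lra.
  have s0 := sin_gt0_pi yh.
  have : cos (y / 2 + y / 2) = 1 by rewrite -splitr.
  rewrite cosD -!expr2 => E; have := cos2Dsin2 (y / 2).
  have : 0 < sin (y / 2) ^+ 2 by rewrite exprn_gt0.
  by move: E; lra.
have [x0|x0|//] := ltgtP x 0.
- by have := pos (- x); rewrite cosN c => h; case: h => //; apply/andP; split; lra.
- by have := pos x; rewrite c => h; case: h => //; rewrite x0.
Qed.

Lemma unit_circle_contour : closed_contour (@unit_circle R).
Proof.
have p0 : 0 < pi :> R := pi_gt0 R.
split.
- apply: (@smooth_pc1 _ (fun s => - sin (2 * pi * s) * (2 * pi)) (fun s => - (cos (2 * pi * s) * (2 * pi)) * (2 * pi) )).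
    by move=> s; exact: rder_cos.
  move=> s; have := rderM (rderN (rder_sin (2 * pi) s)) (rder_cst (2 * pi) s).
  by move/rder_eq; apply; ring.
- apply: (@smooth_pc1 _ (fun s => cos (2 * pi * s) * (2 * pi)) (fun s => (- sin (2 * pi * s) * (2 * pi)) * (2 * pi) )).
    by move=> s; exact: rder_sin.
  move=> s; have := rderM (rder_cos (2 * pi) s) (rder_cst (2 * pi) s).
  by move/rder_eq; apply; ring.
- rewrite /unit_circle mulr0 mulr1 cos0 sin0.
  by rewrite [2 * pi]mulr_natl cos2pi sin2pi.
- move=> s u; rewrite !in_itv /= => /andP[s0 s1] /andP[u0 u1] [c sn].
  have : 2 * pi * s - 2 * pi * u = 0.
    apply: cos_eq1.
      rewrite -mulrBr; apply/andP; split.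
        by rewrite -[ltLHS]mulrN1 ltr_pM2l; lra.
      by rewrite -[ltRHS]mulr1 ltr_pM2l; lra.
    by rewrite cosB c sn -!expr2 cos2Dsin2.
  rewrite -mulrBr => /eqP; rewrite mulf_eq0 => /orP[/eqP|/eqP]; last lra.
  lra.
Qed.

Let hg := unit_circle_contour.

Lemma unit_circle_cmod s : cmod (unit_circle s : C) = 1.
Proof.
have : (cmod (unit_circle s : C)) ^+ 2 = 1 ^+ 2.
  rewrite /cmod /unit_circle /= sqr_sqrtr ?cos2Dsin2 ?expr1n//.
move/eqP; rewrite eqrXn2 ?cmod_ge0// => /eqP //.
Qed.

Lemma unit_circle_neq0 s : (unit_circle s : C) != 0.
Proof. by rewrite -cmod_gt0 unit_circle_cmod. Qed.

Lemma unit_avoids0 : avoids (@unit_circle R) 0.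
Proof. by move=> s _; exact: unit_circle_neq0. Qed.

Lemma unit_deriv s : curve_deriv (@unit_circle R) s = two_pi_i * unit_circle s.
Proof.
rewrite /curve_deriv /unit_circle /=.
have [_ ->] := rder_derive1E (rder_cos (2 * pi) s).
have [_ ->] := rder_derive1E (rder_sin (2 * pi) s).
by rewrite /two_pi_i; apply/eqP; rewrite eq_complex /=; apply/andP; split; apply/eqP; ring.
Qed.

Lemma unit_winding0 : winding_number (@unit_circle R) 0 = 1.
Proof.
rewrite /winding_number contour_intE (@cint_ext _ _ (fun=> two_pi_i)); last first.
  by move=> s _; rewrite subr0 unit_deriv mulrCA mulVf ?mulr1// unit_circle_neq0.
rewrite (_ : cint _ = two_pi_i) ?mulVf ?tpi_neq0//.
rewrite /cint /two_pi_i /= /Rintegral !integral_cst//= muUE !mule1.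
by [].
Qed.

(** Both functionals are bounded on the unit circle and have the same values on powers of z. *)
Lemma unit_oint h : ucl (@lau R) (fun z => cmod z = 1) h -> oint (@unit_circle R) h = CT 1 h.
Proof.
move=> uh; have g0 := unit_avoids0.
have r01 : 0 < (1 / 2 : R) < 1 by apply/andP; split; lra.
have ga s : U s -> ann (1 / 2) (1 / 2)^-1 (unit_circle s : C).
  by move=> _; rewrite /ann unit_circle_cmod; split; [lra|rewrite div1r invrK; lra].
have [B B0 hB] := oint_bound r01 hg g0 ga.
have l1 : 0 < 1 :> R by [].
have G1 := oint_good hg g0; have G2 := CT_good l1.
have gk : gok (@unit_circle R) h.
  apply: cc_ulim => e e0; have [f [s fs] hf] := uh _ e0.
  exists (fun t => leval s (unit_circle t)).
    by apply: cc_sum => x; apply: ccM; [exact: cc_cst|exact: gok_exprz].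
  by move=> t Ut; rewrite -fs ?hf//; [exact: unit_circle_cmod|exact: unit_circle_neq0].
have B2 f M : ucl (@lau R) (fun z => cmod z = 1) f -> (forall z, cmod z = 1 -> cmod (f z) <= M) -> cmod (CT 1 f) <= 1 * M.
  by move=> uf hM; rewrite mul1r; exact: CT_le.
have := @goodfun_ucl _ _ _ (fun z => cmod z = 1) _ _ _ _ 1 1 B 1 h (fun=> 1) G1 G2 hB B2.
have e : (fun z => h z * 1) = h by apply/funext => z; rewrite mulr1.
have nz (z : C) : cmod z = 1 -> cmod z = 1 /\ z != 0.
  by move=> z1; split=> //; rewrite -cmod_gt0 z1.
rewrite e; apply => //; try by move=> z _; rewrite cmod1.
all: try exact: nz.
all: try exact: uh.
all: try exact: gk.
- by move=> _ [s _ ->]; split; [exact: unit_circle_cmod|exact: unit_circle_neq0].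
- exact: gok_cst.
- exact: (ucl_cst (lau_circ l1)).
- by move=> k; exact: gok_exprz.
- by move=> k; exact: circ_okexp.
move=> k.
have -> : (fun z : C => z ^ k * 1) = (fun z : C => z ^ k) by apply/funext => z; rewrite mulr1.
rewrite CT_exp//.
exact: (oint_exp_all hg g0 unit_winding0).
Qed.

Lemma ucl_geom_ann (a : C) (r1 r2 : R) (k : int) : 0 < r1 -> (k == 1) || (k == -1) ->
  (forall z, ann r1 r2 z -> cmod (a * z ^ k) <= cmod a) -> cmod a < 1 ->
  ucl (@lau R) (ann r1 r2) (fun z => (1 - a * z ^ k)^-1).
Proof.
move=> r0 hk ha a1; have F : funalg (@lau R) (ann r1 r2) by apply: (@lau_falg _ _ r1 r2).
apply: (ucl_geom F (th := cmod a)) => //; first by rewrite cmod_ge0.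
by apply: (ucl_mul F); [exact: (ucl_cst F)|apply: ucl_base; exact: lau_exp].
Qed.

Lemma unit_wE a : avoids (@unit_circle R) a -> winding_number (@unit_circle R) a = oint (@unit_circle R) (fun z => z / (z - a)).
Proof.
move=> av; rewrite /winding_number /oint !contour_intE; congr (_ * _).
by apply: cint_ext => s Us; congr (_ * _); rewrite mulrAC divff ?mul1r ?unit_circle_neq0.
Qed.

(** The winding number is the constant term of (1 - a/z)^-1; the circle is moved to radius 2 to
    reach the bound 1/2 of [small]. For [unit_excludes] it is moved to radius 1/2. *)
Lemma unit_encloses a : cmod a < 1 -> encloses (@unit_circle R) a.
Proof.
move=> a1.
have av : avoids (@unit_circle R) a.
  by move=> s _; apply: contraTneq a1 => <-; rewrite unit_circle_cmod ltxx.
split=> //; rewrite unit_wE//.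
have h2 : 2^-1 * 2 = 1 :> R by rewrite mulVf.
have c2 : 0 < (2^-1 : R) < 1 by apply/andP; split; lra.
have ua : ucl (@lau R) (ann 1 2) (fun z => (1 - a * z ^ (-1))^-1).
  apply: ucl_geom_ann => // z [z1 _]; rewrite cmodM ler_piMr ?cmod_ge0//.
  by rewrite exprN1 cmodV invf_le1//; exact: lt_le_trans z1.
rewrite (@oint_ext _ _ _ (fun z => (1 - a * z ^ (-1))^-1)); last first.
  move=> s Us; have g0 := unit_circle_neq0 s; have ga : unit_circle s - a != 0 by rewrite subr_eq0; exact: av.
  rewrite exprN1 -[unit_circle s in RHS]invrK.
  have -> : 1 - a / ((unit_circle s)^-1)^-1 = (unit_circle s - a) / unit_circle s by rewrite invrK; field.
  by rewrite invf_div.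
rewrite unit_oint; last by apply: ucl_sub ua => z z1; rewrite /ann z1; split; lra.
rewrite (@CT_radius _ 1 2 1 2)//; last 2 first.
- by apply/andP; split; lra.
- by apply/andP; split; lra.
have sa : small 2^-1 a by rewrite /small; have := cmod_ge0 a; lra.
have := CT_geom_in c2 0 sa; rewrite invrK expr0 => E; rewrite -[RHS]E.
by apply: CT_ext => // z _; rewrite expr0z mul1r.
Qed.

Lemma unit_excludes a : a != 0 -> cmod a < 1 -> excludes (@unit_circle R) a^-1.
Proof.
move=> a0 a1; have ap : 0 < cmod a by rewrite cmod_gt0.
have av : avoids (@unit_circle R) a^-1.
  move=> s _; apply: contraTneq a1 => e; rewrite -leNgt.
  by have := unit_circle_cmod s; rewrite e cmodV => /eqP; rewrite invr_eq1 => /eqP ->.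
split=> //; rewrite unit_wE//.
have c2 : 0 < (2^-1 : R) < 1 by apply/andP; split; lra.
have hh : 0 < 2^-1 :> R by lra.
have F : funalg (@lau R) (ann 2^-1 1) by apply: (@lau_falg _ _ 2^-1 1).
have ua : ucl (@lau R) (ann 2^-1 1) (fun z => z ^ 1 * (1 - a * z ^ 1)^-1).
  apply: (ucl_mul F); first by apply: ucl_base; exact: lau_exp.
  apply: ucl_geom_ann => // z [_ z1]; rewrite cmodM expr1z ler_piMr ?cmod_ge0//.
rewrite (@oint_ext _ _ _ (fun z => (- a) * (z ^ 1 * (1 - a * z ^ 1)^-1))); last first.
  move=> s Us; have g0 := unit_circle_neq0 s; have ga : unit_circle s - a^-1 != 0 by rewrite subr_eq0; exact: av.
  rewrite expr1z.
  have -> : unit_circle s - a^-1 = (1 - a * unit_circle s) / (- a) by field; rewrite a0.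
  by rewrite invf_div; ring.
have uc : ucl (@lau R) (fun z => cmod z = 1) (fun z => z ^ 1 * (1 - a * z ^ 1)^-1).
  by apply: ucl_sub ua => z z1; rewrite /ann z1; split; lra.
rewrite unit_oint; last by apply: (ucl_mul (lau_circ ltr01)) => //; exact: (ucl_cst (lau_circ ltr01)).
rewrite CTZ// (@CT_radius _ 2^-1 1 1 2^-1)//; last 2 first.
- by apply/andP; split; lra.
- by apply/andP; split; lra.
have sa : small 2^-1 a by rewrite /small; have := cmod_ge0 a; lra.
have := CT_geom_out c2 1 sa; rewrite /= => E.
rewrite (@CT_ext _ _ _ (fun z => z ^ 1 * (1 - a * z)^-1)) ?E ?mulr0//.
Qed.

Lemma unit_admissible N (t : 'rV[C]_N) (p q : C) : p != 0 -> q != 0 -> cmod p < 1 -> cmod q < 1 ->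
  (forall u, t 0 u != 0) -> (forall u, cmod (t 0 u) < 1) -> admissible_contour t p q (@unit_circle R).
Proof.
move=> p0 q0 p1 q1 t0 t1; split; [exact: hg|exact: unit_avoids0|] => i j u.
have n0 : p ^+ i * q ^+ j * t 0 u != 0 by rewrite !mulf_neq0// expf_neq0.
have l1 : cmod (p ^+ i * q ^+ j * t 0 u) < 1.
  apply: le_lt_trans (t1 u); rewrite !cmodM !cmodX ler_piMl ?cmod_ge0//.
  by rewrite mulr_ile1 ?exprn_ge0 ?cmod_ge0// exprn_ile1 ?cmod_ge0// ltW.
by split; [exact: unit_encloses|exact: unit_excludes].
Qed.

End UnitCircle.

(** * Division of holomorphic germs *)

Section Germs.
Variable R : realType.
Local Notation C := (CC R).
Variable V : normedModType C.
Variables (I : finType) (X : I -> V -> C).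
Hypothesis XD : forall i u v, X i (u + v) = X i u + X i v.
Hypothesis XZ : forall i a v, X i (a *: v) = a * X i v.
Hypothesis Xle : forall i v, cmod (X i v) <= vn v.
Hypothesis Xge : forall v e, 0 <= e -> (forall i, cmod (X i v) <= e) -> vn v <= e.

Definition hol (x0 : V) (f : V -> C) := exists2 d : R, 0 < d & ucl (polyf X) (bal x0 d) f.

Lemma bal_id (x : V) d : 0 < d -> bal x d x.
Proof. by move=> d0; rewrite /bal subrr vn0. Qed.

Lemma bal_le (x : V) d d' y : d <= d' -> bal x d y -> bal x d' y.
Proof. by move=> dd; rewrite /bal => h; exact: lt_le_trans dd. Qed.

Lemma bal_sub (x y : V) d e z : bal x d y -> bal y e z -> bal x (d + e) z.
Proof.
rewrite /bal => a b; have -> : z - x = (z - y) + (y - x) by rewrite addrA subrK.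
by apply: le_lt_trans (vnD _ _) _; lra.
Qed.

Lemma bal_in (x y : V) d : bal x d y -> exists2 e : R, 0 < e & forall z, bal y e z -> bal x d z.
Proof.
move=> h; exists (d - vn (y - x)); first by rewrite subr_gt0.
move=> z hz; have := bal_sub (e := d - vn (y - x)) (d := vn (y - x) + (vn (y-x) - vn (y-x))) (x := x) (y := y) (z := z).
move: h hz; rewrite /bal => h hz _.
have -> : z - x = (z - y) + (y - x) by rewrite addrA subrK.
by apply: le_lt_trans (vnD _ _) _; lra.
Qed.

Lemma hol_near x0 f : hol x0 f -> exists2 d : R, 0 < d & forall y, bal x0 d y -> hol y f.
Proof.
move=> [d d0 u]; exists d => // y /bal_in[e e0 h]; exists e => //.
exact: ucl_sub u.
Qed.

Lemma hol_ext x0 f g (d : R) : 0 < d -> (forall y, bal x0 d y -> f y = g y) -> hol x0 f -> hol x0 g.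
Proof.
move=> d0 e [d' d'0 u]; exists (Order.min d d'); first by rewrite lt_min d0.
apply: ucl_ext (ucl_sub _ u); last by move=> y; apply: bal_le; rewrite ge_min lexx orbT.
by move=> y h; apply: e; apply: bal_le h; rewrite ge_min lexx.
Qed.

Let PF x d := polyf_bal Xle x d.

Lemma hol_cst x0 c : hol x0 (fun=> c).
Proof. by exists 1 => //; exact: (ucl_cst (PF _ _)). Qed.
Lemma hol_X x0 i : hol x0 (X i).
Proof. by exists 1 => //; apply: ucl_base; exact: polyf_X. Qed.

Lemma hol2 x0 f g (op : V -> C) : hol x0 f -> hol x0 g ->
  (forall d : R, ucl (polyf X) (bal x0 d) f -> ucl (polyf X) (bal x0 d) g -> ucl (polyf X) (bal x0 d) op) -> hol x0 op.
Proof.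
move=> [d d0 u] [d' d'0 u'] h; exists (Order.min d d'); first by rewrite lt_min d0.
apply: h; [apply: ucl_sub u => y|apply: ucl_sub u' => y]; apply: bal_le; by rewrite ge_min lexx ?orbT.
Qed.

Lemma hol_add x0 f g : hol x0 f -> hol x0 g -> hol x0 (fun y => f y + g y).
Proof. by move=> hf hg; apply: (hol2 hf hg) => d; exact: (ucl_add (PF _ _)). Qed.
Lemma hol_mul x0 f g : hol x0 f -> hol x0 g -> hol x0 (fun y => f y * g y).
Proof. by move=> hf hg; apply: (hol2 hf hg) => d; exact: (ucl_mul (PF _ _)). Qed.
Lemma hol_opp x0 f : hol x0 f -> hol x0 (fun y => - f y).
Proof. by move=> hf; apply: (hol2 hf hf) => d u _; exact: (ucl_opp (PF _ _)). Qed.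
Lemma hol_sub x0 f g : hol x0 f -> hol x0 g -> hol x0 (fun y => f y - g y).
Proof. by move=> hf hg; apply: (hol2 hf hg) => d; exact: (ucl_subr (PF _ _)). Qed.
Lemma hol_exp x0 f k : hol x0 f -> hol x0 (fun y => f y ^+ k).
Proof. by move=> hf; apply: (hol2 hf hf) => d u _; exact: (ucl_exp (PF _ _)). Qed.

Lemma hol_prod x0 (J : Type) (s : seq J) (Q : pred J) (F : J -> V -> C) :
  (forall j, Q j -> hol x0 (F j)) -> hol x0 (fun y => \prod_(j <- s | Q j) F j y).
Proof.
move=> hF; elim: s => [|j s IH].
  by apply: (hol_ext (d := 1) (f := fun=> 1)) => // [y _|]; [rewrite big_nil|exact: hol_cst].
apply: (hol_ext (d := 1) (f := fun y => (if Q j then F j y else 1) * \prod_(j <- s | Q j) F j y)) => //.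
  by move=> y _; rewrite big_cons; case: ifP => // _; rewrite mul1r.
by apply: hol_mul => //; have := hF j; case: (Q j) => h; [exact: h|exact: hol_cst].
Qed.

Lemma hol_sum x0 (J : Type) (s : seq J) (Q : pred J) (F : J -> V -> C) :
  (forall j, Q j -> hol x0 (F j)) -> hol x0 (fun y => \sum_(j <- s | Q j) F j y).
Proof.
move=> hF; elim: s => [|j s IH].
  by apply: (hol_ext (d := 1) (f := fun=> 0)) => // [y _|]; [rewrite big_nil|exact: hol_cst].
apply: (hol_ext (d := 1) (f := fun y => (if Q j then F j y else 0) + \sum_(j <- s | Q j) F j y)) => //.
  by move=> y _; rewrite big_cons; case: ifP => // _; rewrite add0r.
by apply: hol_add => //; have := hF j; case: (Q j) => h; [exact: h|exact: hol_cst].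
Qed.

Lemma hol_det x0 n (M : 'I_n -> 'I_n -> V -> C) : (forall i k, hol x0 (M i k)) ->
  hol x0 (fun y => \det (\matrix_(i, k) M i k y)).
Proof.
move=> hM; apply: hol_sum => s _; apply: hol_mul; first exact: hol_cst.
apply: hol_prod => i _.
by apply: (hol_ext ltr01 _ (hM i (s i))) => y _; rewrite mxE.
Qed.

(** The approximating polynomials are restricted to the line from [x0] to [y], scaled so that [y]
    has a parameter of modulus at most 1/2; [taylor2] and [coef_le] then bound their increments
    independently of the approximation. *)
Lemma hol_lip x0 f : hol x0 f -> exists L d : R, [/\ 0 <= L, 0 < d & forall y, bal x0 d y -> cmod (f y - f x0) <= L * vn (y - x0)].
Proof.
move=> [d d0 u]; have [M M0 hM] := ucl_bdd (PF x0 d) u.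
exists (4 * (M + 1) / d), (d / 4); split; rewrite ?divr_gt0//.
  by rewrite divr_ge0 ?mulr_ge0//; lra.
move=> y; rewrite /bal => hy; have [->|yx] := eqVneq y x0.
  by rewrite !subrr cmod0 vn0 mulr0.
set w := vn (y - x0) in hy *.
have w0 : 0 < w.
  rewrite lt_neqAle vn_ge0 andbT eq_sym; apply: contraNneq yx => e.
  by rewrite -subr_eq0 -normr_eq0 vnE -/w e.
pose c : C := (d / (2 * w))%:C.
have cp : 0 < d / (2 * w) by rewrite divr_gt0// mulr_gt0.
have cc : cmod c = d / (2 * w) by rewrite cmodC gtr0_norm.
have c0 : c != 0 by rewrite -cmod_gt0 cc.
pose hh := c *: (y - x0).
have vh : vn hh = d / 2 by rewrite vnZ cc -/w; field; rewrite gt_eqF.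
have yE : y = x0 + c^-1 *: hh by rewrite /hh scalerA mulVf// scale1r addrC subrK.
have zc : cmod c^-1 = 2 * w / d by rewrite cmodV cc invf_div.
have zh : cmod c^-1 <= 1 / 2 by rewrite zc ler_pdivrMr//; lra.
apply/ler_addgt0Pr => e e0; pose e1 := Order.min (e / 2) 1.
have e10 : 0 < e1 by rewrite lt_min divr_gt0//=.
have [g Pg hg] := u _ e10.
have e1e : e1 <= e / 2 by rewrite ge_min lexx.
have e11 : e1 <= 1 by rewrite ge_min lexx orbT.
have [_ [_ _ /(_ hh)[p hp _]]] := poly_line XD XZ x0 Pg.
have by_ : bal x0 d y by rewrite /bal -/w; lra.
have bx : bal x0 d x0 by exact: bal_id.
have pM z : cmod z = 1 -> cmod p.[z] <= M + 1.
  move=> z1; rewrite -hp; have bz : bal x0 d (x0 + z *: hh).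
    by rewrite /bal addrC addKr vnZ z1 vh mul1r; lra.
  have := cmodBr (f (x0 + z *: hh)) (g (x0 + z *: hh)).
  have := hg _ bz; have := hM _ bz.
  have := cmodBl (g (x0 + z *: hh)) (f (x0 + z *: hh)); rewrite cmodBC; lra.
have t2 := taylor2 pM zh; have p1 := coef_le 1 pM.
have p0 : p`_0 = g x0 by rewrite -horner_coef0 -hp scale0r addr0.
have gy : p.[c^-1] = g y by rewrite -hp -yE.
rewrite p0 gy in t2.
have gl : cmod (g y - g x0) <= 4 * (M + 1) / d * w.
  have -> : g y - g x0 = (g y - g x0 - p`_1 * c^-1) + p`_1 * c^-1 by rewrite subrK.
  apply: le_trans (cmodD _ _) _; rewrite cmodM.
  have h1 : cmod p`_1 * cmod c^-1 <= (M + 1) * cmod c^-1 by rewrite ler_wpM2r ?cmod_ge0.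
  have h2 : 2 * (M + 1) * cmod c^-1 ^+ 2 <= (M + 1) * cmod c^-1.
    rewrite expr2 mulrA ler_wpM2r ?cmod_ge0//.
    have := ler_wpM2l (_ : 0 <= 2 * (M + 1)) zh; move=> /(_ ltac:(lra)); lra.
  have -> : 4 * (M + 1) / d * w = 2 * ((M + 1) * cmod c^-1) by rewrite zc; field; exact: lt0r_neq0.
  lra.
have -> : f y - f x0 = (f y - g y) - (f x0 - g x0) + (g y - g x0) by ring.
apply: le_trans (cmodD _ _) _.
have := cmodB (f y - g y) (f x0 - g x0); have := hg _ by_; have := hg _ bx; lra.
Qed.

Lemma hol_cont x0 f (e : R) : hol x0 f -> 0 < e -> exists2 d : R, 0 < d & forall y, bal x0 d y -> cmod (f y - f x0) <= e.
Proof.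
move=> /hol_lip[L [d [L0 d0 h]]] e0; exists (Order.min d (e / (L + 1))).
  by rewrite lt_min d0 divr_gt0//; lra.
move=> y hy; have h1 : bal x0 d y by apply: bal_le hy; rewrite ge_min lexx.
have h2 : vn (y - x0) < e / (L + 1) by move: hy; rewrite /bal lt_min => /andP[].
apply: le_trans (h y h1) _; apply: (@le_trans _ _ (L * (e / (L + 1)))).
  by rewrite ler_wpM2l// ltW.
by rewrite mulrCA ger_pMr// ler_pdivrMr; lra.
Qed.

Lemma hol_bound x0 f (e : R) : hol x0 f -> cmod (f x0) < e -> exists2 d : R, 0 < d & forall y, bal x0 d y -> cmod (f y) <= e.
Proof.
move=> hf fe; have e0 : 0 < e - cmod (f x0) by rewrite subr_gt0.
have [d d0 h] := hol_cont hf e0; exists d => // y /h.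
have := cmodBl (f y) (f x0); lra.
Qed.

Lemma hol_inv x0 f : f x0 != 0 -> hol x0 f -> hol x0 (fun y => (f y)^-1).
Proof.
move=> f0 hf; have c0 : 0 < cmod (f x0) / 2 by rewrite divr_gt0 ?cmod_gt0.
have [d d0 hd] := hol_cont hf c0; have [d' d'0 u] := hf.
exists (Order.min d d'); first by rewrite lt_min d0.
apply: (ucl_inv (PF _ _) f0).
  by apply: ucl_sub u => y; apply: bal_le; rewrite ge_min lexx orbT.
by move=> y hy; apply: hd; apply: bal_le hy; rewrite ge_min lexx.
Qed.

Lemma hol_neq0 x0 f : f x0 != 0 -> hol x0 f -> exists2 d : R, 0 < d & forall y, bal x0 d y -> f y != 0.
Proof.
move=> f0 hf; have c0 : 0 < cmod (f x0) / 2 by rewrite divr_gt0 ?cmod_gt0.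
have [d d0 hd] := hol_cont hf c0; exists d => // y /hd h.
by rewrite -cmod_gt0; have := cmodBl (f x0) (f y); rewrite cmodBC; lra.
Qed.

Lemma hol_differentiable x0 f : hol x0 f -> \forall y \near x0, differentiable f y.
Proof.
move=> [d d0 u]; apply/nearV; exists d => // y hy.
exact: (ucl_differentiable XD XZ Xle u hy).
Qed.

Lemma common_radius (x0 : V) (Q : I -> V -> Prop) : (forall i, exists2 d : R, 0 < d & forall y, bal x0 d y -> Q i y) ->
  exists2 d : R, 0 < d & forall y, bal x0 d y -> forall i, Q i y.
Proof.
move=> h.
suff [d d0 hd] : exists2 d : R, 0 < d & forall y, bal x0 d y -> forall i, i \in enum I -> Q i y.
  by exists d => // y hy i; apply: hd => //; rewrite mem_enum.
elim: (enum I) => [|i s [d d0 hd]]; first by exists 1.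
have [d' d'0 hd'] := h i; exists (Order.min d d'); first by rewrite lt_min d0.
move=> y hy j; rewrite inE => /orP[/eqP ->|js].
  by apply: hd'; apply: bal_le hy; rewrite ge_min lexx orbT.
by apply: hd => //; apply: bal_le hy; rewrite ge_min lexx.
Qed.

Lemma map_cont (Psi : V -> V) x0 (e : R) : (forall i, hol x0 (fun y => X i (Psi y))) -> 0 < e ->
  exists2 d : R, 0 < d & forall y, bal x0 d y -> bal (Psi x0) e (Psi y).
Proof.
move=> hPsi e0.
have XB i u v : X i (u - v) = X i u - X i v by rewrite XD -scaleN1r XZ mulN1r.
have e2 : 0 < e / 2 by rewrite divr_gt0.
have [d d0 hd] := common_radius (fun i => hol_cont (hPsi i) e2).
exists d => // y hy; rewrite /bal; apply: (@le_lt_trans _ _ (e / 2)); last by lra.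
by apply: Xge => [|i]; [exact: ltW|rewrite XB; exact: hd].
Qed.

(** A polynomial in the coordinates of [Psi] is holomorphic, and the approximation of [f] on a ball
    is pulled back by continuity of [Psi]. *)
Lemma hol_comp (Psi : V -> V) x0 f : (forall i, hol x0 (fun y => X i (Psi y))) -> hol (Psi x0) f ->
  hol x0 (fun y => f (Psi y)).
Proof.
move=> hPsi [d d0 u].
have [d1 d10 h1] := map_cont hPsi d0.
have [d2 d20 h2] : exists2 d : R, 0 < d & forall i, ucl (polyf X) (bal x0 d) (fun y => X i (Psi y)).
  suff [d2 d20 h2] : exists2 d : R, 0 < d & forall i, i \in enum I -> ucl (polyf X) (bal x0 d) (fun y => X i (Psi y)).
    by exists d2 => // i; apply: h2; rewrite mem_enum.
  elim: (enum I) => [|i s [d' d'0 hd']]; first by exists 1.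
  have [d'' d''0 u''] := hPsi i; exists (Order.min d' d''); first by rewrite lt_min d'0.
  move=> j; rewrite inE => /orP[/eqP ->|js].
    by apply: ucl_sub u'' => y; apply: bal_le; rewrite ge_min lexx orbT.
  by apply: ucl_sub (hd' j js) => y; apply: bal_le; rewrite ge_min lexx.
pose dd := Order.min d1 d2; exists dd; first by rewrite /dd lt_min d10.
have F := PF x0 dd.
have uX i : ucl (polyf X) (bal x0 dd) (fun y => X i (Psi y)).
  by apply: ucl_sub (h2 i) => y; apply: bal_le; rewrite /dd ge_min lexx orbT.
apply: ucl_lim => e e0; have [g Pg hg] := u e e0; exists (fun y => g (Psi y)).
  elim: Pg => [c|i|g1 g2 _ I1 _ I2|g1 g2 _ I1 _ I2].
  - exact: (ucl_cst F).
  - exact: uX.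
  - exact: (ucl_add F).
  - exact: (ucl_mul F).
by move=> y hy; apply: hg; apply: h1; apply: bal_le hy; rewrite /dd ge_min lexx.
Qed.

Section Division.

Lemma lau0_disc (rr : R) : 0 < rr -> funalg (@lau0 R) (fun z => cmod z <= rr).
Proof.
move=> r0; have L := lau0_falg rr; split; [exact: (falg_cst L)|exact: (falg_add L)|exact: (falg_mul L)|].
move=> f [s _ hs]; exists (\sum_(x <- s) cmod x.1 * rr ^+ x.2) => z zr; rewrite hs.
apply: le_trans (cmod_sum _ _ _) _; apply: ler_sum => x _.
rewrite cmodM cmodX ler_wpM2l ?cmod_ge0// lerXn2r// ?nnegrE ?cmod_ge0//; exact: ltW.
Qed.

(** Cauchy's formula for the kernel 1/(z - z0), checked on powers and extended by uniform
    approximation on the disc; the term f 0 comes from the pole of dz/z. *)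
Lemma cauchy_difference (f : C -> C) (z0 : C) : ucl (@lau0 R) (fun z => cmod z <= 2) f -> cmod z0 <= 1 ->
  z0 * CT 2 (fun z => f z * (z^-1 * (1 - z0 / z)^-1)) = f z0 - f 0.
Proof.
move=> uf z01.
have r01 : 0 < (2^-1 : R) < 1 by apply/andP; split; lra.
have l2 : 0 < 2 :> R by lra.
have sz : small 2^-1 z0 by rewrite /small; lra.
have G := CT_good l2.
have uk : ucl (@lau R) (fun z => cmod z = 2) (fun z => z^-1 * (1 - z0 / z)^-1).
  have := ucl_inv1 r01 sz; rewrite invrK => u1; apply: (gf_okM G) => //.
  by apply: ucl_ext (circ_okexp 2 (-1)) => z _.
have hk (k : nat) : z0 * CT 2 (fun z => z ^+ k * (z^-1 * (1 - z0 / z)^-1)) = z0 ^+ k - 0 ^+ k.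
  have E := CT_geom_in r01 (k%:Z - 1) sz; rewrite invrK in E.
  rewrite (@CT_ext _ _ _ (fun z => z ^ (k%:Z - 1) * (1 - z0 / z)^-1))//; last first.
    move=> z z2; have zn : z != 0 := circ_neq0 l2 z2.
    by rewrite expfzDr// exprN1 mulrA.
  rewrite E; case: k {E} => [|k]; first by rewrite sub0r /= !expr0 subrr mulr0.
  have -> : (k.+1%:Z - 1 < 0) = false by apply/negbTE; rewrite -leNgt; lia.
  have -> : `|(k.+1%:Z - 1)%R|%N = k by lia.
  by rewrite [0 ^+ _]expr0n subr0 exprS.
have hs (s : seq (C * nat)) : z0 * CT 2 (fun z => (\sum_(x <- s) x.1 * z ^+ x.2) * (z^-1 * (1 - z0 / z)^-1)) =
   \sum_(x <- s) x.1 * z0 ^+ x.2 - \sum_(x <- s) x.1 * 0 ^+ x.2.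
  have os s' : ucl (@lau R) (fun z => cmod z = 2) (fun z => \sum_(x <- s') x.1 * z ^+ x.2).
    by apply: ucl0_lau; apply: ucl_base; exists s'.
  have ok k : ucl (@lau R) (fun z => cmod z = 2) (fun z => z ^+ k * (z^-1 * (1 - z0 / z)^-1)).
    by apply: (gf_okM G) => //; apply: ucl_ext (circ_okexp 2 k) => z _.
  elim: s => [|[c k] s IH].
    rewrite !big_nil subrr (gf_ext G (h := fun z => 0 * (z ^+ 0 * (z^-1 * (1 - z0 / z)^-1)))) ?(gf_Z G)// ?mul0r ?mulr0//.
    by move=> z _; rewrite big_nil !mul0r.
  rewrite !big_cons /= (gf_ext G (h := fun z => c * (z ^+ k * (z^-1 * (1 - z0 / z)^-1)) + (\sum_(x <- s) x.1 * z ^+ x.2) * (z^-1 * (1 - z0 / z)^-1))); last first.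
    by move=> z _; rewrite big_cons mulrDl -mulrA.
  rewrite (gf_D G) ?(gf_Z G)//; last 2 first.
  - by apply: (gf_okM G) => //; exact: (gf_cst G).
  - exact: (gf_okM G).
  by rewrite mulrDr IH mulrCA hk; ring.
apply/eqP; rewrite -subr_eq0 -cmod_eq0; apply/eqP/le_anti; rewrite cmod_ge0 andbT.
apply/ler_addgt0Pr => e e0; rewrite add0r.
have [M M0 hM] := ucl_bdd (lau_circ l2) uk.
have e1 : 0 < e / (M + 2) by rewrite divr_gt0//; lra.
have [g [s _ hsg] hg] := uf _ e1.
have ug : ucl (@lau R) (fun z => cmod z = 2) g by apply: ucl0_lau; apply: ucl_base; exists s.
have uf' : ucl (@lau R) (fun z => cmod z = 2) f.
  by apply: ucl0_lau; apply: ucl_sub uf => z ->.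
have E : z0 * CT 2 (fun z => g z * (z^-1 * (1 - z0 / z)^-1)) = g z0 - g 0.
  rewrite !hsg -hs; congr (_ * _); apply: CT_ext => // z _; by rewrite hsg.
have -> : z0 * CT 2 (fun z => f z * (z^-1 * (1 - z0 / z)^-1)) - (f z0 - f 0) =
   z0 * (CT 2 (fun z => f z * (z^-1 * (1 - z0 / z)^-1)) - CT 2 (fun z => g z * (z^-1 * (1 - z0 / z)^-1)))
    - ((f z0 - g z0) - (f 0 - g 0)) by rewrite mulrBr E; ring.
rewrite -(LB G); try exact: (gf_okM G).
have h1 : cmod (CT 2 (fun z => f z * (z^-1 * (1 - z0 / z)^-1) - g z * (z^-1 * (1 - z0 / z)^-1))) <= e / (M + 2) * M.
  apply: CT_le => //; first by apply: (ucl_subr (lau_circ l2)); exact: (gf_okM G).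
  by move=> z zr; rewrite -mulrBl cmodM ler_pM ?cmod_ge0 ?hM ?hg ?zr.
have h2 : cmod (f z0 - g z0) <= e / (M + 2) by apply: hg; lra.
have h3 : cmod (f 0 - g 0) <= e / (M + 2) by apply: hg; rewrite cmod0; lra.
apply: le_trans (cmodB _ _) _; rewrite cmodM.
have := cmodB (f z0 - g z0) (f 0 - g 0) => h4.
have h5 : cmod z0 * cmod (CT 2 (fun z => f z * (z^-1 * (1 - z0 / z)^-1) - g z * (z^-1 * (1 - z0 / z)^-1))) <= 1 * (e / (M + 2) * M).
  by apply: ler_pM; rewrite ?cmod_ge0.
have h6 : e / (M + 2) * M + (e / (M + 2) + e / (M + 2)) = e by field; rewrite gt_eqF//; lra.
lra.
Qed.

(** The root is 2 l / (a + s), where s is a square root of the discriminant a^2 + 4 l b whose sign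
    makes the denominator at least |a|. This form covers b = 0 as well. *)
Lemma quadratic_root (l a b : C) : a != 0 -> exists z0 : C, l - a * z0 - b * z0 ^+ 2 = 0 /\ cmod z0 * cmod a <= 2 * cmod l.
Proof.
move=> a0; have ap : 0 < cmod a by rewrite cmod_gt0.
have [s hs ss] : exists2 s : C, s ^+ 2 = a ^+ 2 + 4 * l * b & cmod a <= cmod (a + s).
  pose s : C := sqrtc (a ^+ 2 + 4 * l * b).
  have hs : s ^+ 2 = a ^+ 2 + 4 * l * b by exact: sqr_sqrtc.
  have [h|h] := leP (cmod a) (cmod (a + s)); first by exists s.
  exists (- s); first by rewrite sqrrN.
  have := cmodD (a + s) (a - s); rewrite addrACA subrr addr0 -mulr2n -mulr_natl cmodM cmod_nat; lra.
have as0 : a + s != 0 by rewrite -cmod_gt0; lra.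
exists (2 * l / (a + s)); split.
  have E : a ^+ 2 = s ^+ 2 - 4 * l * b by rewrite hs; ring.
  apply: (mulIf (expf_neq0 2 as0)); rewrite mul0r.
  have -> : (l - a * (2 * l / (a + s)) - b * (2 * l / (a + s)) ^+ 2) * (a + s) ^+ 2 = l * (s ^+ 2 - a ^+ 2 - 4 * l * b) by field.
  by rewrite E; ring.
rewrite !cmodM cmodV cmod_nat mulrAC ler_pdivrMr ?(lt_le_trans ap)// ler_wpM2l// mulr_ge0 ?cmod_ge0//.
Qed.

(** For l = 0 the value g 0 vanishes by hypothesis. Otherwise l - A z - B z^2 = (z0 - z)(A + B (z +
    z0)), with z0 in the unit disc and the second factor invertible on the disc of radius 2;
    [cauchy_difference] is applied to the quotient of g by that factor, which vanishes at z0. *)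
Lemma divide_disc (g : C -> C) (l A B : C) : ucl (@lau0 R) (fun z => cmod z <= 2) g -> A != 0 ->
  cmod l <= cmod A / 2 -> cmod B <= cmod A / 8 ->
  (forall z, cmod z <= 2 -> l - A * z - B * z ^+ 2 = 0 -> g z = 0) ->
  CT 2 (fun z => g z * (l - A * z - B * z ^+ 2)^-1) * l = g 0.
Proof.
move=> ug An k1 k2 hz; have Ap : 0 < cmod A by rewrite cmod_gt0.
have l2 : 0 < 2 :> R by lra.
have [l0|ly] := eqVneq l 0.
  by rewrite l0 mulr0 hz ?cmod0 ?l0//; ring.
have [z0 [hz0 z0A]] := quadratic_root l B An.
have z01 : cmod z0 <= 1 by rewrite -(ler_pM2r Ap) mul1r; lra.
have z0n : z0 != 0.
  by apply: contraNneq ly => e; move: hz0; rewrite e expr0n !mulr0 !subr0 => ->.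
have gz0 : g z0 = 0 by apply: hz => //; lra.
have L2 := lau0_disc l2.
pose f z := g z * (A + B * (z + z0))^-1.
have j2 : cmod B / cmod A <= 1 / 8 by rewrite ler_pdivrMr//; lra.
have idu : ucl (@lau0 R) (fun z => cmod z <= 2) id by apply: ucl_base; exact: lau0_id.
have uf : ucl (@lau0 R) (fun z => cmod z <= 2) f.
  apply: (ucl_mul L2) => //.
  apply: (ucl_ext (f := fun z => A^-1 * (1 - (- (B / A) * (z + z0)))^-1)).
    by move=> z hz'; rewrite -invfM; congr (_^-1); field; exact: An.
  apply: (ucl_mul L2); first exact: (ucl_cst L2).
  apply: (ucl_geom L2 (th := 3 / 8)); first by apply/andP; split; lra.
    apply: (ucl_mul L2); first exact: (ucl_cst L2).
    by apply: (ucl_add L2); [exact: idu|exact: (ucl_cst L2)].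
  move=> z hz'; rewrite cmodM cmodN cmodM cmodV.
  have j3 : cmod (z + z0) <= 3 by have := cmodD z z0; lra.
  apply: (@le_trans _ _ (1 / 8 * 3)); last by lra.
  by apply: ler_pM; rewrite ?mulr_ge0 ?invr_ge0 ?cmod_ge0.
have CD := cauchy_difference uf z01.
have lq : l = z0 * (A + B * z0).
  by apply/eqP; rewrite -subr_eq0 -hz0; apply/eqP; ring.
have Azn : A + B * z0 != 0 by move: ly; rewrite lq mulf_eq0 negb_or => /andP[].
have f0 : f 0 = g 0 / (A + B * z0) by rewrite /f add0r.
have fz : f z0 = 0 by rewrite /f gz0 mul0r.
have QE : CT 2 (fun z => g z * (l - A * z - B * z ^+ 2)^-1) = - CT 2 (fun z => f z * (z^-1 * (1 - z0 / z)^-1)).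
  have r01 : 0 < (2^-1 : R) < 1 by apply/andP; split; lra.
  have sz : small 2^-1 z0 by rewrite /small; lra.
  rewrite -mulN1r -CTZ//; last first.
    apply: (ucl_mul (lau_circ l2)); first by apply: ucl0_lau; apply: ucl_sub uf => z ->.
    apply: (ucl_mul (lau_circ l2)); first by apply: ucl_ext (circ_okexp 2 (-1)) => z _.
    by have := ucl_inv1 r01 sz; rewrite invrK.
  apply: CT_ext => // z z2; have zn : z != 0 := circ_neq0 l2 z2.
  have zz0 : z - z0 != 0.
    by rewrite -cmod_gt0; have := cmodBl z z0; rewrite z2; lra.
  have -> : l - A * z - B * z ^+ 2 = (z0 - z) * (A + B * (z + z0)) by rewrite lq; ring.
  have -> : 1 - z0 / z = (z - z0) / z by field.
  rewrite /f invfM; have -> : (z0 - z)^-1 = - (z - z0)^-1 by rewrite -invrN opprB.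
  move: (A + B * (z + z0))^-1 => c; rewrite invf_div; field.
  by rewrite zn zz0.
apply: (mulfI z0n); rewrite QE.
have -> : z0 * (- CT 2 (fun z => f z * (z^-1 * (1 - z0 / z)^-1)) * l) = - (z0 * CT 2 (fun z => f z * (z^-1 * (1 - z0 / z)^-1))) * l by ring.
rewrite CD fz f0 lq sub0r opprK; field.
exact: Azn.
Qed.

Lemma divide_bounds (a0 a b l bb de : R) : 0 < de -> `|a0 - a| <= a0 / 2 -> 0 < a0 -> 0 <= b <= bb -> l <= de * (a0 / 4) ->
  de * bb <= a0 / 32 -> [/\ 0 < a * de, l <= a * de / 2 & b * de ^+ 2 <= a * de / 8].
Proof.
move=> de0; rewrite ler_norml => /andP[h1 h2] a00 /andP[b0 hb] hl hd.
have ha : a0 / 2 <= a by lra.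
have h3 : de * (a0 / 4) <= de * (a / 2) by rewrite ler_pM2l//; lra.
have h4 : b * de <= bb * de by rewrite ler_wpM2r// ltW.
have h5 : (b * de) * de <= (a / 8) * de by rewrite ler_pM2r//; lra.
split; [by rewrite mulr_gt0//; lra|lra|].
by rewrite expr2; lra.
Qed.

(** On |z| = 2 the term A z dominates, so the inverse is a geometric series in [u] with |u| <=
    1/2. *)
Lemma divide_kernel (T : Type) (P : (T * C -> C) -> Prop) (Om : T * C -> Prop) (l A B z zi Ai : T * C -> C) : funalg P Om ->
  ucl P Om l -> ucl P Om B -> ucl P Om Ai -> ucl P Om z -> ucl P Om zi ->
  (forall y, Om y -> [/\ A y != 0, Ai y = (A y)^-1, zi y = (z y)^-1 & cmod (z y) = 2]) ->
  (forall y, Om y -> cmod (l y) <= cmod (A y) / 2 /\ cmod (B y) <= cmod (A y) / 8) ->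
  ucl P Om (fun y => (l y - A y * z y - B y * z y ^+ 2)^-1).
Proof.
move=> FF ul uB uAi uz uzi h1 h2.
pose u y := l y * Ai y * zi y - B y * Ai y * z y.
have uU : ucl P Om u.
  by apply: (ucl_subr FF); apply: (ucl_mul FF) => //; exact: (ucl_mul FF).
have ule y : Om y -> cmod (u y) <= 1 / 2.
  move=> Oy; rewrite /u; have [An -> -> zy] := h1 y Oy; have [k1 k2] := h2 y Oy; have Ap : 0 < cmod (A y) by rewrite cmod_gt0.
  have j1 : cmod (l y / A y) <= 1 / 2 by rewrite cmodM cmodV ler_pdivrMr//; lra.
  have j2 : cmod (B y / A y) <= 1 / 8 by rewrite cmodM cmodV ler_pdivrMr//; lra.
  apply: le_trans (cmodB _ _) _; move: j1 j2; move: (l y / A y) (B y / A y) => c1 c2 j1 j2.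
  by rewrite !cmodM cmodV zy; lra.
apply: (ucl_ext (f := fun y => - (zi y * Ai y * (1 - u y)^-1))).
  move=> y Oy; have [An e1 e2 zy] := h1 y Oy.
  have zn : z y != 0 by rewrite -cmod_gt0 zy; lra.
  rewrite (_ : l y - A y * z y - B y * z y ^+ 2 = - (z y * A y * (1 - u y))).
    by rewrite e1 e2 invrN !invfM.
  by rewrite /u e1 e2; field; rewrite An zn.
apply: (ucl_opp FF); apply: (ucl_mul FF); first exact: (ucl_mul FF).
by apply: (ucl_geom FF (th := 1 / 2)) => //; apply/andP; split; lra.
Qed.

(* The quotient is recovered as the mean of [G / l] over a circle in the
   direction [v], inside which [l] has a single zero, cancelled by one of [G]. *)
Lemma divide x0 (G l a b : V -> C) (v : V) :
  hol x0 G -> hol x0 l -> hol x0 a -> hol x0 b -> l x0 = 0 -> a x0 != 0 ->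
  (forall y z, l (y + z *: v) = l y - a y * z - b y * z ^+ 2) ->
  (exists2 d : R, 0 < d & forall y, bal x0 d y -> l y = 0 -> G y = 0) ->
  exists2 Q, hol x0 Q & exists2 d : R, 0 < d & forall y, bal x0 d y -> Q y * l y = G y.
Proof.
move=> hG hl ha hb lx a0 lE [d0 d00 hz].
have ap : 0 < cmod (a x0) by rewrite cmod_gt0.
have [dG dG0 uG] := hG.
pose m : R := Order.min d0 dG.
have m0 : 0 < m by rewrite /m lt_min d00.
have v1 : 0 < vn v + 1 by have := vn_ge0 v; lra.
have b1 : 0 < cmod (b x0) + 1 by have := cmod_ge0 (b x0); lra.
pose de : R := Order.min (m / (8 * (vn v + 1))) (cmod (a x0) / (32 * (cmod (b x0) + 1))).
have de0 : 0 < de by rewrite lt_min !divr_gt0// mulr_gt0.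
pose D : C := de%:C.
have cD : cmod D = de by rewrite cmodC gtr0_norm.
have D0 : D != 0 by rewrite -cmod_gt0 cD.
have de1 : de <= m / (8 * (vn v + 1)) by rewrite ge_min lexx.
have de2 : de <= cmod (a x0) / (32 * (cmod (b x0) + 1)) by rewrite ge_min lexx orbT.
have dv : de * vn v <= m / 8.
  apply: (@le_trans _ _ (m / (8 * (vn v + 1)) * (vn v + 1))).
    by apply: ler_pM => //; rewrite ?vn_ge0 ?ltW//; lra.
  by rewrite (_ : m / (8 * (vn v + 1)) * (vn v + 1) = m / 8)//; field; exact: lt0r_neq0.
have db : de * (cmod (b x0) + 1) <= cmod (a x0) / 32.
  apply: (@le_trans _ _ (cmod (a x0) / (32 * (cmod (b x0) + 1)) * (cmod (b x0) + 1))).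
    by apply: ler_pM => //; rewrite ltW.
  by rewrite (_ : cmod (a x0) / (32 * (cmod (b x0) + 1)) * (cmod (b x0) + 1) = cmod (a x0) / 32)//; field; exact: lt0r_neq0.
pose v' := D *: v; pose A y := a y * D; pose B y := b y * D ^+ 2.
have lE' y z : l (y + z *: v') = l y - A y * z - B y * z ^+ 2.
  by rewrite /v' scalerA lE /A /B; ring.
have vv : vn v' <= m / 8 by rewrite vnZ cD.
have c1 : 0 < cmod (a x0) / 2 by rewrite divr_gt0.
have c2 : cmod (b x0) < cmod (b x0) + 1 by rewrite ltrDl.
have c3 : cmod (l x0) < de * (cmod (a x0) / 4) by rewrite lx cmod0 mulr_gt0// divr_gt0.
have [w1 w10 hw1] := hol_cont ha c1.
have [w2 w20 hw2] := hol_bound hb c2.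
have [w3 w30 hw3] := hol_bound hl c3.
have hai := hol_inv a0 ha.
have [w4 w40 uai] := hai. have [w5 w50 ub] := hb. have [w6 w60 ul] := hl.
pose w : R := Order.min (m / 2) (Order.min w1 (Order.min w2 (Order.min w3 (Order.min w4 (Order.min w5 w6))))).
have w0 : 0 < w by rewrite /w !lt_min w10 w20 w30 w40 w50 w60 divr_gt0.
have [ww0 ww1 ww2 ww3] : [/\ w <= m / 2, w <= w1, w <= w2 & w <= w3] by rewrite /w !ge_min !lexx ?orbT.
have [ww4 ww5 ww6] : [/\ w <= w4, w <= w5 & w <= w6] by rewrite /w !ge_min !lexx ?orbT.
have Ay y : bal x0 w y -> [/\ A y != 0, cmod (l y) <= cmod (A y) / 2 & cmod (B y) <= cmod (A y) / 8].
  move=> hy; have k1 := hw1 y (bal_le ww1 hy); have k2 := hw2 y (bal_le ww2 hy); have k3 := hw3 y (bal_le ww3 hy).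
  have cA : cmod (A y) = cmod (a y) * de by rewrite /A cmodM cD.
  have cB : cmod (B y) = cmod (b y) * de ^+ 2 by rewrite /B cmodM cmodX cD.
  have k4 : `|cmod (a x0) - cmod (a y)| <= cmod (a x0) / 2.
    rewrite ler_norml; apply/andP; split.
      by rewrite lerNl opprB; exact: le_trans (cmodBl _ _) k1.
    by apply: le_trans (cmodBl _ _) _; rewrite cmodBC.
  have k5 : 0 <= cmod (b y) <= cmod (b x0) + 1 by rewrite cmod_ge0.
  have [m1 m2 m3] := divide_bounds de0 k4 ap k5 k3 db.
  by rewrite cA cB -cmod_gt0 cA; split.
have inm y z : bal x0 w y -> cmod z <= 2 -> bal x0 m (y + z *: v').
  rewrite /bal => hy hz'; have -> : y + z *: v' - x0 = (y - x0) + z *: v' by rewrite addrAC.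
  apply: le_lt_trans (vnD _ _) _; rewrite vnZ.
  have : cmod z * vn v' <= 2 * (m / 8) by apply: ler_pM; rewrite ?cmod_ge0 ?vn_ge0.
  move: hy; lra.
have mG y : bal x0 m y -> bal x0 dG y by apply: bal_le; rewrite /m ge_min lexx orbT.
have md y : bal x0 m y -> bal x0 d0 y by apply: bal_le; rewrite /m ge_min lexx.
have F := PF x0 w.
have l2 : 0 < 2 :> R by lra.
pose Om (y : V * C) := bal x0 w y.1 /\ cmod y.2 = 2.
have FF : funalg (lpar (polyf X)) Om.
  by apply: (@lpar_falg _ _ _ _ F _ 2 2) => // y z [hy zr]; split=> //; exact: circ_ann.
have zU (k : int) : ucl (lpar (polyf X)) Om (fun y => y.2 ^ k) by apply: ucl_base; exact: (lpar_exp F k).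
have fU f : ucl (polyf X) (bal x0 w) f -> ucl (lpar (polyf X)) Om (fun y => f y.1).
  by apply: (ucl_fst F) => y z [].
have GU : ucl (lpar (polyf X)) Om (fun y => G (y.1 + y.2 *: v')).
  apply: ucl_lim => e e0; have [g Pg hg] := uG e e0; exists (fun y => g (y.1 + y.2 *: v')).
    elim: Pg => [c|i|g1 g2 _ I1 _ I2|g1 g2 _ I1 _ I2].
    - exact: (ucl_cst FF).
    - apply: (ucl_ext (f := fun y => X i y.1 + y.2 ^ 1 * X i v')).
        by move=> y _; rewrite XD (XZ i y.2 v') expr1z.
      apply: (ucl_add FF); first by apply: fU; apply: ucl_base; exact: polyf_X.
      by apply: (ucl_mul FF); [exact: zU|exact: (ucl_cst FF)].
    - exact: (ucl_add FF).
    - exact: (ucl_mul FF).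
  by move=> [y z] [hy hz'] /=; apply: hg; apply: mG; apply: inm => //; rewrite hz'.
have uAi : ucl (polyf X) (bal x0 w) (fun y => (A y)^-1).
  apply: (ucl_ext (f := fun y => (a y)^-1 * D^-1)); first by move=> y _; rewrite /A invfM.
  apply: (ucl_mul F); last exact: (ucl_cst F).
  by apply: ucl_sub uai => y; exact: bal_le.
have uB : ucl (polyf X) (bal x0 w) B.
  by apply: (ucl_mul F); [apply: ucl_sub ub => y; exact: bal_le|exact: (ucl_cst F)].
have uL : ucl (polyf X) (bal x0 w) l by apply: ucl_sub ul => y; exact: bal_le.
pose Q y := CT 2 (fun z => G (y + z *: v') * (l (y + z *: v'))^-1).
exists Q.
  exists w => //.
  apply: (ucl_CT F (phi := fun y => G (y.1 + y.2 *: v') * (l (y.1 + y.2 *: v'))^-1)) => //.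
  apply: (ucl_mul FF) => //.
  apply: (ucl_ext (f := fun y => (l y.1 - A y.1 * y.2 - B y.1 * y.2 ^+ 2)^-1)).
    by move=> y _; rewrite lE'.
  apply: (divide_kernel FF (Ai := fun y => (A y.1)^-1) (zi := fun y => y.2 ^ (-1)) (fU _ uL) (fU _ uB) (fU _ uAi)) => //.
  - by apply: ucl_ext (zU 1) => y _; rewrite expr1z.
  - by move=> y [hy hz']; have [An _ _] := Ay _ hy.
  - by move=> y [hy hz']; have [_ k1 k2] := Ay _ hy.
exists w => // y hy; have [An k1 k2] := Ay _ hy.
have L2 := lau0_disc l2.
have ug : ucl (@lau0 R) (fun z => cmod z <= 2) (fun z => G (y + z *: v')).
  apply: ucl_lim => e e0; have [g Pg hg] := uG e e0; exists (fun z => g (y + z *: v')).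
    elim: Pg => [c|i|g1 g2 _ I1 _ I2|g1 g2 _ I1 _ I2].
    - exact: (ucl_cst L2).
    - apply: (ucl_ext (f := fun z => X i y + z * X i v')); first by move=> z _; rewrite XD (XZ i z v').
      apply: (ucl_add L2); first exact: (ucl_cst L2).
      apply: (ucl_mul L2); last exact: (ucl_cst L2).
      by apply: ucl_base; exact: lau0_id.
    - exact: (ucl_add L2).
    - exact: (ucl_mul L2).
  by move=> z hz' /=; apply: hg; apply: mG; exact: inm.
have := divide_disc ug An k1 k2; rewrite scale0r addr0 => <-.
  by rewrite /Q; congr (_ * _); apply: CT_ext => // z _; rewrite lE'.
by move=> z z2 e; apply: hz; [apply: md; exact: inm|rewrite lE'].
Qed.

End Division.
End Germs.

(** * Local structure in the parameters *)

Section Coordinates.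
Variable R : realType.
Local Notation C := (CC R).
Variable N : nat.
Local Notation V := ('rV[C]_N * (C * C))%type.

Definition crd (i : 'I_N + bool) (v : V) : C :=
  match i with inl u => v.1 0 u | inr true => v.2.1 | inr false => v.2.2 end.

Lemma crdD i u v : crd i (u + v) = crd i u + crd i v.
Proof. by case: i => [w|[]]; rewrite /crd //= mxE. Qed.
Lemma crdZ i a v : crd i (a *: v) = a * crd i v.
Proof. by case: i => [w|[]]; rewrite /crd //= mxE. Qed.

Lemma vn_pair (A B : normedModType C) (v : (A * B)%type) : vn v = Order.max (vn v.1) (vn v.2).
Proof.
apply/complexI; rewrite -vnE prod_normE !vnE /Order.max ltcR.
by case: ifP.
Qed.

Lemma row_norm_ge (w : 'rV[C]_N) u : `|w 0 u| <= `|w|.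
Proof.
rewrite [leRHS](_ : _ = mx_norm w)// mx_normE -[leLHS]nngE num_le.
exact: (le_bigmax _ (fun i : 'I_1 * 'I_N => `|w i.1 i.2|%:nng) (0, u)).
Qed.

Lemma row_norm_le (w : 'rV[C]_N) (e : C) : 0 <= e -> (forall u, `|w 0 u| <= e) -> `|w| <= e.
Proof.
move=> e0 h; rewrite [leLHS](_ : _ = mx_norm w)// mx_normE.
rewrite -[leRHS]/((NngNum e0)%:num) num_le; apply/bigmax_leP; split.
  by rewrite -num_le.
by move=> [i u] _; rewrite -num_le /= (ord1 i).
Qed.

Lemma crd_le i v : cmod (crd i v) <= vn v.
Proof.
rewrite vn_pair le_max; case: i => [u|b] /=.
  by apply/orP; left; rewrite -lecR -vnE -cmodE; exact: row_norm_ge.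
apply/orP; right; rewrite vn_pair le_max -!lecR -!vnE.
by case: b; rewrite -!cmodE lexx ?orbT.
Qed.

Lemma crd_ge v e : 0 <= e -> (forall i, cmod (crd i v) <= e) -> vn v <= e.
Proof.
move=> e0 h; rewrite vn_pair ge_max; apply/andP; split.
  rewrite -lecR -vnE; apply: row_norm_le; first by rewrite lecR.
  by move=> u; rewrite cmodE lecR; exact: (h (inl u)).
rewrite vn_pair ge_max -!lecR -!vnE !cmodE !lecR.
by have := h (inr true); have := h (inr false); rewrite /= => -> ->.
Qed.
End Coordinates.

Section LocalFormula.
Variable R : realType.
Local Notation C := (CC R).
Variables (n N : nat).
Local Notation V := ('rV[C]_N * (C * C))%type.
Local Notation X := (@crd R N).
Local Notation hol := (hol X).
Local Notation XD := (@crdD R N).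
Local Notation XZ := (@crdZ R N).
Local Notation Xle := (@crd_le R N).

Definition tc (y : V) (u : 'I_N) : C := y.1 0 u.
Definition regular (y : V) := [/\ y.2.1 != 0, y.2.2 != 0, cmod y.2.1 < 1, cmod y.2.2 < 1 & forall u, tc y u != 0].
Definition pfree (y : V) := poles_free (tc y) y.2.1 y.2.2.
Definition lfac (e : (nat * nat) * ('I_N * 'I_N)) (y : V) : C :=
  1 - y.2.1 ^+ e.1.1 * y.2.2 ^+ e.1.2 * tc y e.2.1 * tc y e.2.2.
(** The contour integral is replaced by its evaluation through [Lent], so that a value is defined at
    every point; it is the intended one where [pfree] holds. *)
Definition Fgen (y : V) : C := BC_prefactor y.1 y.2.1 y.2.2 *
  (kappa n y.2.1 y.2.2 * \det (\matrix_(i < n, k < n) Lent n (tc y) y.2.1 y.2.2 i k)).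

Lemma pfreeP y e : pfree y -> lfac e y != 0.
Proof. by move=> h; rewrite /lfac subr_eq0 eq_sym; exact: h. Qed.

Lemma hol_tc x0 u : hol x0 (fun y => tc y u).
Proof. exact: (hol_X X x0 (inl u)). Qed.
Lemma hol_p x0 : hol x0 (fun y => y.2.1).
Proof. exact: (hol_X X x0 (inr true)). Qed.
Lemma hol_q x0 : hol x0 (fun y => y.2.2).
Proof. exact: (hol_X X x0 (inr false)). Qed.

Lemma hol_pole x0 c u : hol x0 (fun y => pole (tc y) y.2.1 y.2.2 c u).
Proof.
apply: (hol_mul Xle); last exact: hol_tc.
by apply: (hol_mul Xle); apply: (hol_exp Xle); [exact: hol_p|exact: hol_q].
Qed.

Lemma hol_lfac x0 e : hol x0 (lfac e).
Proof.
apply: (hol_sub Xle); first exact: (hol_cst Xle).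
by apply: (hol_mul Xle); [exact: hol_pole|exact: hol_tc].
Qed.

Section At.
Variable x0 : V.
Hypothesis rx : regular x0.

Lemma rho_data : exists rho d : R, [/\ 0 <= rho < 1, 0 < d &
   forall y, bal x0 d y -> [/\ cmod y.2.1 <= rho, cmod y.2.2 <= rho & regular y]].
Proof.
have [p0 q0 p1 q1 t0] := rx.
pose mx := Order.max (cmod x0.2.1) (cmod x0.2.2).
have mx1 : mx < 1 by rewrite gt_max p1.
have mx0 : 0 <= mx by rewrite le_max cmod_ge0.
pose rho := (1 + mx) / 2.
have rm : mx < rho by rewrite /rho; lra.
have pr : cmod x0.2.1 < rho by apply: le_lt_trans rm; rewrite le_max lexx.
have qr : cmod x0.2.2 < rho by apply: le_lt_trans rm; rewrite le_max lexx orbT.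
have [d1 d10 h1] := hol_bound XD XZ Xle (hol_p x0) pr.
have [d2 d20 h2] := hol_bound XD XZ Xle (hol_q x0) qr.
have [d3 d30 h3] := hol_neq0 XD XZ Xle p0 (hol_p x0).
have [d4 d40 h4] := hol_neq0 XD XZ Xle q0 (hol_q x0).
have [d5 d50 h5] := common_radius (fun u => hol_neq0 XD XZ Xle (t0 u) (hol_tc x0 u)).
exists rho, (Order.min d1 (Order.min d2 (Order.min d3 (Order.min d4 d5)))).
have rho1 : rho < 1 by rewrite /rho; lra.
split; first by rewrite rho1 andbT /rho; lra.
  by rewrite !lt_min d10 d20 d30 d40.
move=> y hy; have hd d : Order.min d1 (Order.min d2 (Order.min d3 (Order.min d4 d5))) <= d -> bal x0 d y.
  by move=> h; exact: bal_le hy.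
have hp : cmod y.2.1 <= rho by apply/h1/hd; rewrite ge_min lexx.
have hq : cmod y.2.2 <= rho by apply/h2/hd; rewrite !ge_min lexx ?orbT.
split=> //; split.
- by apply/h3/hd; rewrite !ge_min lexx ?orbT.
- by apply/h4/hd; rewrite !ge_min lexx ?orbT.
- exact: le_lt_trans rho1.
- exact: le_lt_trans rho1.
- by move=> u; apply: h5; apply/hd; rewrite !ge_min lexx ?orbT.
Qed.

Lemma local_data k0 : exists rho r d : R, exists K : nat, (k0 <= K)%N /\ [/\ 0 <= rho < 1, 0 < r < 1, 0 < d,
  forall u, ucl (polyf X) (bal x0 d) (fun y => (tc y u)^-1) &
  forall y, bal x0 d y -> [/\ cmod y.2.1 <= rho, cmod y.2.2 <= rho, regular y,
     forall u, cmod (tc y u) * rho ^+ K <= r / 2 & valid (tc y) y.2.1 y.2.2 K r]].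
Proof.
have [rho [d0 [hr d00 h0]]] := rho_data.
have /andP[r0' r1'] := hr.
have [_ _ _ _ t0] := rx.
have hS u : cmod (tc x0 u) < cmod (tc x0 u) + 1 by rewrite ltrDl.
have [d1 d10 h1] := common_radius (fun u => hol_bound XD XZ Xle (hol_tc x0 u) (hS u)).
pose S := \sum_u (cmod (tc x0 u) + 1) + 1.
have S0 : 0 < S by rewrite /S ltr_wpDl// sumr_ge0// => u _; rewrite addr_ge0 ?cmod_ge0.
have tS y u : bal x0 d1 y -> cmod (tc y u) <= S.
  move=> hy; apply: le_trans (h1 y hy u) _; rewrite /S (bigD1 u)//= -addrA lerDl addr_ge0// sumr_ge0// => v _.
  by rewrite addr_ge0 ?cmod_ge0.
have h2 : 0 < 1 / 2 :> R by lra.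
have h3 : 0 < 1 / 2 / S by rewrite divr_gt0.
pose r := Order.min (1 / 2) (1 / 2 / S).
have r0 : 0 < r by rewrite /r lt_min h2 h3.
have r1 : r < 1 by rewrite /r gt_min; apply/orP; left; lra.
have rS : r <= 1 / 2 / S by rewrite /r ge_min lexx orbT.
have r2 : 0 < r / 2 by rewrite divr_gt0.
have [K hK] := geo_small S hr r2.
have [d2 d20 h4] : exists2 d : R, 0 < d & forall u, ucl (polyf X) (bal x0 d) (fun y => (tc y u)^-1).
  suff [d2 d20 h4] : exists2 d : R, 0 < d & forall u, u \in enum 'I_N -> ucl (polyf X) (bal x0 d) (fun y => (tc y u)^-1).
    by exists d2 => // u; apply: h4; rewrite mem_enum.
  elim: (enum 'I_N) => [|i s [d' d'0 hd']]; first by exists 1.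
  have [d'' d''0 u''] := hol_inv XD XZ Xle (t0 i) (hol_tc x0 i); exists (Order.min d' d''); first by rewrite lt_min d'0.
  move=> j; rewrite inE => /orP[/eqP ->|js].
    by apply: ucl_sub u'' => y; apply: bal_le; rewrite ge_min lexx orbT.
  by apply: ucl_sub (hd' j js) => y; apply: bal_le; rewrite ge_min lexx.
exists rho, r, (Order.min d0 (Order.min d1 d2)), (maxn k0 K); split; first exact: leq_maxl.
split=> //.
- by rewrite r0.
- by rewrite !lt_min d00 d10.
- by move=> u; apply: ucl_sub (h4 u) => y; apply: bal_le; rewrite !ge_min lexx ?orbT.
move=> y hy.
have hy0 : bal x0 d0 y by apply: bal_le hy; rewrite ge_min lexx.
have hy1 : bal x0 d1 y by apply: bal_le hy; rewrite !ge_min lexx ?orbT.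
have [hp hq ry] := h0 y hy0.
have hKK u : cmod (tc y u) * rho ^+ maxn k0 K <= r / 2.
  apply: le_trans (ltW (hK _ (leq_maxr k0 K))).
  by apply: ler_pM => //; rewrite ?cmod_ge0 ?exprn_ge0 ?tS.
split=> //; split; first by rewrite r0.
  move=> u; apply: (@le_trans _ _ (S * (1 / 2 / S))).
    by apply: ler_pM => //; rewrite ?cmod_ge0 ?tS ?ltW.
  by rewrite mulrC mulfVK// gt_eqF.
move=> u; apply: le_trans (hKK u); rewrite ler_wpM2l ?cmod_ge0//.
by rewrite lerXn2r// ?nnegrE ?le_max ?cmod_ge0// ge_max hp.
Qed.

Lemma hol_P2 f : hol x0 f -> hol x0 (fun y => P2 None (f y) y.2.1 y.2.2).
Proof.
move=> [d1 d10 uf]; have [rho [d0 [hr d00 h0]]] := rho_data.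
have [B _ hB] := ucl_bdd (polyf_bal Xle x0 d1) uf.
exists (Order.min d0 d1); first by rewrite lt_min d00.
have F := polyf_bal Xle x0 (Order.min d0 d1).
have b0 y : bal x0 (Order.min d0 d1) y -> bal x0 d0 y by apply: bal_le; rewrite ge_min lexx.
have b1 y : bal x0 (Order.min d0 d1) y -> bal x0 d1 y by apply: bal_le; rewrite ge_min lexx orbT.
apply: (ucl_P2 F (rho := rho) (B := B) (p := fun y => y.2.1) (q := fun y => y.2.2) (x := f)) => //.
- exact: ucl_base (polyf_X X (inr true)).
- by move=> y /b0/h0[].
- exact: ucl_base (polyf_X X (inr false)).
- by move=> y /b0/h0[].
- exact: ucl_sub uf.
- by move=> y /b1/hB.
Qed.

Lemma hol_qp f (b : bool) : hol x0 f -> hol x0 (fun y => qp (f y) (X (inr b) y)).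
Proof.
move=> [d1 d10 uf]; have [rho [d0 [hr d00 h0]]] := rho_data.
have [B _ hB] := ucl_bdd (polyf_bal Xle x0 d1) uf.
exists (Order.min d0 d1); first by rewrite lt_min d00.
have F := polyf_bal Xle x0 (Order.min d0 d1).
have b0 y : bal x0 (Order.min d0 d1) y -> bal x0 d0 y by apply: bal_le; rewrite ge_min lexx.
have b1 y : bal x0 (Order.min d0 d1) y -> bal x0 d1 y by apply: bal_le; rewrite ge_min lexx orbT.
apply: (ucl_qp F (rho := rho) (B := B) (p := X (inr b)) (x := f)) => //.
- exact: ucl_base (polyf_X X (inr b)).
- by move=> y /b0/h0[h1 h2 _]; case: (b).
- exact: ucl_sub uf.
- by move=> y /b1/hB.
Qed.

Lemma hol_prefactor : hol x0 (fun y => BC_prefactor y.1 y.2.1 y.2.2).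
Proof.
apply: (hol_prod Xle) => r _; apply: (hol_prod Xle) => s _.
by apply: hol_P2; apply: (hol_mul Xle); exact: hol_tc.
Qed.

Lemma hol_kappa : hol x0 (fun y => kappa n y.2.1 y.2.2).
Proof.
have [rho [d0 [hr d00 h0]]] := rho_data.
have [p0 q0 p1 q1 t0] := rx.
have hqp b : hol x0 (fun y => qpoch (X (inr b) y)).
  apply: (hol_ext d00 _ (@hol_qp (X (inr b)) b (hol_X X x0 (inr b)))) => y /h0[_ _ [_ _ h1 h2 _]].
  by rewrite qpochE//; case: b.
have hth b : hol x0 (fun y => dth (X (inr b) y) 1 (-1)).
  apply: (hol_ext d00 (f := fun y => (qp (-1) (X (inr b) y) * qp (- X (inr b) y) (X (inr b) y)) ^+ 2)).
    move=> y /h0[_ _ [_ _ h1 h2 _]]; rewrite dthN1; last by case: b.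
    by rewrite /th invrN invr1 mulrN1.
  apply: (hol_exp Xle); apply: (hol_mul Xle); apply: hol_qp; first exact: (hol_cst Xle).
  by apply: (hol_opp Xle); exact: hol_X.
have han : hol x0 (fun y => (addnorm y.2.1 y.2.2)^-1).
  apply: (hol_inv XD XZ Xle); first exact: addnorm_neq0.
  by apply: (hol_mul Xle); [exact: (hth true)|exact: (hth false)].
apply: (hol_mul Xle).
  apply: (hol_mul Xle); last exact: (hol_cst Xle).
  by apply: (hol_mul Xle); apply: (hol_exp Xle); [exact: (hqp true)|exact: (hqp false)].
apply: (hol_mul Xle); last exact: (hol_cst Xle).
by apply: (hol_prod Xle) => i _; apply: (hol_prod Xle) => j _.
Qed.

End At.

Section Kernels.
Variables (x0 : V) (rho r d : R) (K : nat).
Hypotheses (hr : 0 <= rho < 1) (r01 : 0 < r < 1) (d0 : 0 < d).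
Hypothesis uti : forall u, ucl (polyf X) (bal x0 d) (fun y => (tc y u)^-1).
Hypothesis hW : forall y, bal x0 d y -> [/\ cmod y.2.1 <= rho, cmod y.2.2 <= rho, regular y,
     forall u, cmod (tc y u) * rho ^+ K <= r / 2 & valid (tc y) y.2.1 y.2.2 K r].
Let F := polyf_bal Xle x0 d.

Definition hk i k (y : V * C) : C := hker n (tc y.1) y.1.2.1 y.1.2.2 K i k y.2.

Lemma ucl_hk i k : ucl (lpar (polyf X)) (fun y => bal x0 d y.1 /\ ann r r^-1 y.2) (hk i k).
Proof.
apply: (@ucl_hker R V _ _ F n N (fun u y => tc y u) (fun y => y.2.1) (fun y => y.2.2) rho r K hr r01) => //.
- exact: ucl_base (polyf_X X (inr true)).
- by move=> y /hW[].
- exact: ucl_base (polyf_X X (inr false)).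
- by move=> y /hW[].
- by move=> u; exact: ucl_base (polyf_X X (inl u)).
- by move=> u y /hW[].
Qed.

Definition polef (c : nat * nat) u (y : V) := pole (tc y) y.2.1 y.2.2 c u.
Definition polefs s : seq (V -> C) := [seq polef c u | c <- s, u <- enum 'I_N].

Lemma hol_small_polef c u : hol_small (polyf X) (bal x0 d) r (polef c u).
Proof.
split.
  apply: (ucl_mul F); last exact: ucl_base (polyf_X X (inl u)).
  apply: (ucl_mul F); apply: (ucl_exp F); first exact: ucl_base (polyf_X X (inr true)).
  exact: ucl_base (polyf_X X (inr false)).
move=> y /hW[_ _ [_ _ p1 q1 _] _ v]; exact: (pole_small p1 q1 v).
Qed.

Lemma hol_smalls_polefs s : hol_smalls (polyf X) (bal x0 d) r (polefs s).
Proof.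
rewrite /polefs; elim: s => [|c s IH] i; first by rewrite nth_nil; exact: (hol_small0 F).
rewrite /= nth_cat; case: ltnP => // h; rewrite size_map in h.
elim: (enum 'I_N) i h => [|u e IHe] [|i] //= h; first exact: hol_small_polef.
exact: IHe.
Qed.

Lemma evs_polefs s y : evs (polefs s) y = poles (tc y) y.2.1 y.2.2 s.
Proof. by rewrite /evs /polefs /poles map_flatten -map_comp; congr flatten; apply: eq_map => c /=; rewrite -map_comp. Qed.

End Kernels.

(** Near [x0] one truncation serves, and [Lrec_clear] multiplies every entry by the same product of
    factors [lfac]; the determinant collects its n-th power, whence [nseq n ls1]. *)
Lemma local_formula x0 : regular x0 -> exists2 G, hol x0 G & exists ls, exists2 d : R, 0 < d &
  forall y, bal x0 d y -> regular y /\ (pfree y -> Fgen y * \prod_(e <- ls) lfac e y = G y).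
Proof.
move=> rx; have [rho [r [d [K [_ [hr r01 d0 uti hW]]]]]] := local_data rx 0.
have F := polyf_bal Xle x0 d.
have hs := @hol_smalls_polefs x0 rho r d K hW (cells K).
have hP i k := Lrec_clear F r01 (ucl_hk hr r01 uti hW i k) hs hs.
pose P i k := projT1 (cid2 (hP i k)).
have uP i k : ucl (polyf X) (bal x0 d) (P i k) by rewrite /P; case: cid2.
have PE i k y : bal x0 d y -> pfree y -> P i k y = cross (poles (tc y) y.2.1 y.2.2 (cells K)) (poles (tc y) y.2.1 y.2.2 (cells K)) * Lent n (tc y) y.2.1 y.2.2 i k.
  move=> hy fy; rewrite /P; case: cid2 => /= Q _ hQ; have [_ _ [p0 q0 p1 q1 t0] _ v] := hW y hy.
  rewrite hQ// evs_polefs; last exact: nondeg_poles.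
  by rewrite (LentE n p1 q1 i k fy v).
pose idx := [seq (c, u) | c <- cells K, u <- enum 'I_N].
pose ls1 := [seq ((a.1.1 + b.1.1, a.1.2 + b.1.2)%N, (a.2, b.2)) | a <- idx, b <- idx].
have crossE y : cross (poles (tc y) y.2.1 y.2.2 (cells K)) (poles (tc y) y.2.1 y.2.2 (cells K)) = \prod_(e <- ls1) lfac e y.
  have pE : poles (tc y) y.2.1 y.2.2 (cells K) = [seq pole (tc y) y.2.1 y.2.2 a.1 a.2 | a <- idx].
    by rewrite /poles /idx map_allpairs.
  rewrite /cross pE /ls1; move: (idx) => J.
  rewrite big_map big_allpairs_dep /=; apply: eq_bigr => a _; rewrite big_map; apply: eq_bigr => b _.
  by rewrite /lfac /pole /= !exprD; congr (1 - _); ring.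
exists (fun y => BC_prefactor y.1 y.2.1 y.2.2 * (kappa n y.2.1 y.2.2 * \det (\matrix_(i < n, k < n) P i k y))).
  apply: (hol_mul Xle); first exact: hol_prefactor.
  apply: (hol_mul Xle); first exact: hol_kappa.
  by apply: (hol_det Xle) => i k; exists d.
exists (flatten (nseq n ls1)), d => // y hy; split; first by case: (hW y hy).
move=> fy.
have -> : \prod_(e <- flatten (nseq n ls1)) lfac e y = (\prod_(e <- ls1) lfac e y) ^+ n.
  by elim: (n) => [|k IH]; rewrite /= ?big_nil ?expr0// big_cat IH exprS.
rewrite /Fgen -(mulrA (BC_prefactor _ _ _)) -(mulrA (kappa _ _ _)); congr (_ * (_ * _)).
rewrite [LHS]mulrC.
rewrite -detZ; congr (\det _).
by apply/matrixP => i k; rewrite !mxE PE// crossE.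
Qed.

End LocalFormula.

(** Far factors stay away from their zeros: only exponents with a + b < K can produce a
    coincidence. *)
Lemma free_tail (R : realType) (p q t t' : CC R) (rho r : R) (a b K : nat) : 0 <= rho < 1 -> 0 < r < 1 ->
  cmod p <= rho -> cmod q <= rho -> cmod t * rho ^+ K <= r / 2 -> cmod t' * r <= 1 / 2 -> (K <= a + b)%N ->
  cmod (p ^+ a * q ^+ b * t * t') <= 1 / 2.
Proof.
move=> /andP[h0 h1] /andP[r0 r1] hp hq ht ht' Kab; rewrite !cmodM !cmodX.
have e1 : cmod p ^+ a * cmod q ^+ b <= rho ^+ K.
  apply: (@le_trans _ _ (rho ^+ a * rho ^+ b)).
    by apply: ler_pM; rewrite ?exprn_ge0 ?cmod_ge0// lerXn2r// ?nnegrE ?cmod_ge0.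
  by rewrite -exprD; apply: ler_wiXn2l => //; exact: ltW.
have e2 : cmod p ^+ a * cmod q ^+ b * cmod t <= r / 2.
  by apply: le_trans ht; rewrite mulrC ler_wpM2l ?cmod_ge0.
apply: (@le_trans _ _ (r / 2 * cmod t')); first by rewrite ler_wpM2r ?cmod_ge0.
rewrite mulrAC mulrC in ht' *; lra.
Qed.

Lemma residue_cancel (F : fieldType) (A B I1 I2 k m : F) : A * I2 * (B * I1) != 0 ->
  (A * I2 * (B * I1))^-1 * (k * m * (I1 * I2)) = k * (m / (A * B)).
Proof.
rewrite !mulf_eq0 !negb_or => /andP[/andP[h1 h2] /andP[h3 h4]].
by field; rewrite h1 h2 h3 h4.
Qed.

(** * Residues at a generic point of a polar divisor *)

Section GenericPoint.
Variable R : realType.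
Local Notation C := (CC R).
Variables (n N : nat).
Local Notation V := ('rV[C]_N * (C * C))%type.
Local Notation X := (@crd R N).
Local Notation hol := (hol X).
Local Notation XD := (@crdD R N).
Local Notation XZ := (@crdZ R N).
Local Notation Xle := (@crd_le R N).
Local Notation pl y c u := (pole (tc y) y.2.1 y.2.2 c u).

(* The only coincidence among poles and inverse poles is the one expressed by the
   vanishing of [lfac]. With four parameters and [ra != rb] no such point satisfies
   the balancing condition, the two other parameters having then a product in
   p^Z q^Z; this is why [n] is positive in [generic_dense]. *)
Definition generic (ra rb : 'I_N) (ij : nat * nat) (y : V) := [/\ regular y,
  forall a b a' b', y.2.1 ^+ a * y.2.2 ^+ b = y.2.1 ^+ a' * y.2.2 ^+ b' -> a = a' /\ b = b',
  forall c u c' v, pl y c u = pl y c' v -> u = v,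
  forall c u v a b, pl y c u * tc y v = y.2.1 ^+ a * y.2.2 ^+ b -> (u == ra) && (v == rb) || (u == rb) && (v == ra) &
  lfac (ij, (ra, rb)) y = 0].

Variables (ra rb : 'I_N) (ij : nat * nat) (x1 : V).
Hypothesis gx : generic ra rb ij x1.
Let rx : regular x1. Proof. by case: gx. Qed.
Local Notation l := (lfac (ij, (ra, rb))).
Local Notation P c u := (pole (tc x1) x1.2.1 x1.2.2 c u).

Let p0 : x1.2.1 != 0. Proof. by case: rx. Qed.
Let q0 : x1.2.2 != 0. Proof. by case: rx. Qed.
Let p1 : cmod x1.2.1 < 1. Proof. by case: rx. Qed.
Let q1 : cmod x1.2.2 < 1. Proof. by case: rx. Qed.
Let t0 u : tc x1 u != 0. Proof. by case: rx. Qed.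
Let P0 c u : P c u != 0. Proof. exact: pole_neq0. Qed.

Lemma pole_inj c u c' v : P c u = P c' v -> (c, u) = (c', v).
Proof.
move=> e; case: gx => _ g1 g2 _ _; have uv := g2 _ _ _ _ e.
have [h1 h2] : c.1 = c'.1 /\ c.2 = c'.2.
  by apply: g1; apply: (mulIf (t0 u)); move: e; rewrite /pole -uv.
by rewrite uv [c]surjective_pairing h1 h2 -surjective_pairing.
Qed.

Lemma pole_mul (y : V) c u c' v : pl y c u * pl y c' v = pl y (c.1 + c'.1, c.2 + c'.2)%N u * tc y v.
Proof. by rewrite /pole /= !exprD; ring. Qed.

Lemma lfac_eq0 c u v : P c u * tc x1 v = 1 -> ((u == ra) && (v == rb) || (u == rb) && (v == ra)) /\ c = ij.
Proof.
move=> e; case: gx => _ g1 _ g3 g4.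
have e' : P c u * tc x1 v = x1.2.1 ^+ 0 * x1.2.2 ^+ 0 by rewrite !expr0 mulr1.
have h := g3 _ _ _ _ _ e'; split=> //.
have e2 : x1.2.1 ^+ c.1 * x1.2.2 ^+ c.2 * (tc x1 ra * tc x1 rb) = 1.
  by rewrite -e /pole; case/orP: h => /andP[/eqP -> /eqP ->]; ring.
have e3 : x1.2.1 ^+ ij.1 * x1.2.2 ^+ ij.2 * (tc x1 ra * tc x1 rb) = 1.
  by move: g4; rewrite /lfac /= => /eqP; rewrite subr_eq0 => /eqP E; rewrite [RHS]E; ring.
have [h1 h2] : c.1 = ij.1 /\ c.2 = ij.2.
  apply: g1; apply: (mulIf (mulf_neq0 (t0 ra) (t0 rb))).
  by rewrite e2 e3.
by rewrite [c]surjective_pairing h1 h2 -surjective_pairing.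
Qed.

Lemma lfacE (y : V) c u v : (u == ra) && (v == rb) || (u == rb) && (v == ra) -> c = ij -> 1 - pl y c u * tc y v = l y.
Proof.
move=> h ->; rewrite /lfac /pole /=; congr (1 - _).
by case/orP: h => /andP[/eqP -> /eqP ->]; ring.
Qed.

Definition flip (c : nat * nat) := (ij.1 - c.1, ij.2 - c.2)%N.
Definition in_box (c : nat * nat) := (c.1 <= ij.1)%N && (c.2 <= ij.2)%N.
Lemma flipK c : in_box c -> flip (flip c) = c.
Proof. by case: c => a b /andP[/= h1 h2]; rewrite /flip /= !subKn. Qed.
Lemma flip_in c : in_box (flip c).
Proof. by rewrite /in_box /= !leq_subr. Qed.
Lemma flip_add c : in_box c -> ((c.1 + (flip c).1)%N, (c.2 + (flip c).2)%N) = ij.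
Proof. by case: c => a b /andP[/= h1 h2]; rewrite !subnKC// -surjective_pairing. Qed.

(** The pole that is inverse to the pole [e] at [x1], if there is one; the exponents of the two add
    up to [ij]. *)
Definition partner (e : (nat * nat) * 'I_N) : option ((nat * nat) * 'I_N) :=
  if in_box e.1 then if e.2 == ra then Some (flip e.1, rb) else if e.2 == rb then Some (flip e.1, ra) else None
  else None.

Lemma partner_sing e b : P b.1 b.2 * P e.1 e.2 = 1 -> partner e = Some b.
Proof.
case: e b => [c u] [c' v] /= e; rewrite mulrC pole_mul in e.
have [h hc] := lfac_eq0 e.
have cc : in_box c by rewrite /in_box -hc /= !leq_addr.
have -> : c' = flip c by rewrite /flip -hc /= !addKn -surjective_pairing.
rewrite /partner /= cc; case/orP: h => /andP[/eqP -> /eqP ->]; first by rewrite eqxx.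
by case: eqP => [->//|_]; rewrite eqxx.
Qed.

Lemma partnerP e b (y : V) : partner e = Some b -> 1 - pl y b.1 b.2 * pl y e.1 e.2 = l y.
Proof.
case: e => c u; rewrite /partner /=; case: ifP => // cc.
case: eqP => [-> [<-]|_]; last case: eqP => [-> [<-]|//].
- by rewrite mulrC pole_mul flip_add// lfacE// !eqxx.
- by rewrite mulrC pole_mul flip_add// lfacE// !eqxx orbT.
Qed.

Lemma partner_one e b : partner e = Some b -> P b.1 b.2 * P e.1 e.2 = 1.
Proof. move=> h; have := partnerP x1 h; case: gx => _ _ _ _ -> /eqP.
by rewrite subr_eq0 eq_sym => /eqP. Qed.

Section WithData.
Variables (rho r d : R) (K : nat).
Hypotheses (hr : 0 <= rho < 1) (r01 : 0 < r < 1) (d0 : 0 < d).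
Hypothesis Kij : ((ij.1 + ij.2).+1 <= K)%N.
Hypothesis uti : forall u, ucl (polyf X) (bal x1 d) (fun y => (tc y u)^-1).
Hypothesis hW : forall y, bal x1 d y -> [/\ cmod y.2.1 <= rho, cmod y.2.2 <= rho, regular y,
     forall u, cmod (tc y u) * rho ^+ K <= r / 2 & valid (tc y) y.2.1 y.2.2 K r].
Let F := polyf_bal Xle x1 d.
Let r0 : 0 < r. Proof. by case/andP: r01. Qed.

Definition idx := [seq (c, u) | c <- cells K, u <- enum 'I_N].

Lemma idx_uniq : uniq idx.
Proof. by apply: allpairs_uniq; rewrite ?cells_uniq ?enum_uniq//; case=> a b [a' b'] _ _ /= [-> ->]. Qed.

Lemma mem_idx c u : ((c, u) \in idx) = (c \in cells K).
Proof.
apply/allpairsP/idP => [[[c' u'] [/= h _ [-> _]]]//|h]; exists (c, u) => /=.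
by rewrite mem_enum.
Qed.

Lemma polesE (y : V) : poles (tc y) y.2.1 y.2.2 (cells K) = [seq pl y e.1 e.2 | e <- idx].
Proof. by rewrite /poles /idx map_allpairs. Qed.

Lemma in_box_cells c : in_box c -> c \in cells K.
Proof.
case: c => a b /andP[/= h1 h2]; rewrite mem_cells /=; move: Kij h1 h2.
by case: (ij) => i j /=; lia.
Qed.

Lemma partner_idx e b : partner e = Some b -> b \in idx.
Proof.
case: e => c u; rewrite /partner /=; case: ifP => // cc.
by case: eqP => [_ [<-]|_]; last case: eqP => [_ [<-]|//]; rewrite mem_idx in_box_cells// flip_in.
Qed.

(** [free_tail] leaves finitely many factors. Those vanishing at [x1] coincide with [l], the others
    stay nonzero nearby. *)
Lemma free_near : exists2 d' : R, 0 < d' & forall y : V, bal x1 d' y -> l y != 0 -> pfree y.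
Proof.
pose J : finType := (('I_K * 'I_K) * ('I_N * 'I_N))%type.
pose Q (e : J) (y : V) := l y != 0 -> pl y (e.1.1 : nat, e.1.2 : nat) e.2.1 * tc y e.2.2 != 1.
have hQ e : exists2 d' : R, 0 < d' & forall y : V, bal x1 d' y -> Q e y.
  have [/eqP h|h] := boolP (P (e.1.1 : nat, e.1.2 : nat) e.2.1 * tc x1 e.2.2 == 1).
    exists 1 => // y _ ly; have [h1 h2] := lfac_eq0 h.
    by rewrite eq_sym -subr_eq0 (lfacE _ h1 h2).
  have hh : hol x1 (fun y => 1 - pl y (e.1.1 : nat, e.1.2 : nat) e.2.1 * tc y e.2.2).
    apply: (hol_sub Xle); first exact: (hol_cst Xle).
    by apply: (hol_mul Xle); [exact: hol_pole|exact: hol_tc].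
  have [|d' d'0 hd'] := hol_neq0 XD XZ Xle _ hh; first by rewrite subr_eq0 eq_sym.
  by exists d' => // y /hd'; rewrite subr_eq0 eq_sym => a _.
have [d' d'0 hd'] := common_radius hQ.
exists (Order.min d d'); first by rewrite lt_min d0.
move=> y hy ly [a b] u v.
have hy1 : bal x1 d y by apply: bal_le hy; rewrite ge_min lexx.
have hy2 : bal x1 d' y by apply: bal_le hy; rewrite ge_min lexx orbT.
have [hp hq [_ _ yp yq _] hK [_ ht _]] := hW hy1.
have big (a' b' : nat) : (K <= a' + b')%N -> pl y (a', b') u * tc y v != 1.
  move=> hab; apply: contraTneq (free_tail hr r01 hp hq (hK u) (ht v) hab) => e.
  by rewrite -ltNge /pole /= in e *; rewrite e cmod1; lra.
have [ha|ha] := ltnP a K; last by apply: big; rewrite (leq_trans ha)// leq_addr.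
have [hb|hb] := ltnP b K; last by apply: big; rewrite (leq_trans hb)// leq_addl.
exact: (hd' y hy2 ((Ordinal ha, Ordinal hb), (u, v)) ly).
Qed.

(** [alp] at the pole [e], without the factor that vanishes at [x1]. *)
Definition betaf (e : (nat * nat) * 'I_N) eo (y : V) : C :=
  (\prod_(a <- idx | a != e) (1 - pl y a.1 a.2 / pl y e.1 e.2) *
   \prod_(b <- idx | Some b != eo) (1 - pl y b.1 b.2 * pl y e.1 e.2))^-1.

Lemma beta_den e : \prod_(a <- idx | a != e) (1 - P a.1 a.2 / P e.1 e.2) *
   \prod_(b <- idx | Some b != partner e) (1 - P b.1 b.2 * P e.1 e.2) != 0.
Proof.
rewrite mulf_neq0// prodf_seq_neq0; apply/allP => a _; apply/implyP => ae; rewrite subr_eq0 eq_sym.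
  apply: contraNneq ae => /(congr1 ( *%R^~ (P e.1 e.2))); rewrite mulfVK// mul1r => /pole_inj.
  by case: a => a1 a2 /= ->; rewrite -surjective_pairing.
by apply: contraNneq ae => /partner_sing ->.
Qed.

Lemma hol_polei c u : hol x1 (fun y => (pl y c u)^-1).
Proof. by apply: (hol_inv XD XZ Xle) => //; exact: hol_pole. Qed.

Lemma hol_betaf e : hol x1 (betaf e (partner e)).
Proof.
apply: (hol_inv XD XZ Xle); first exact: beta_den.
apply: (hol_mul Xle); apply: (hol_prod Xle) => a _; (apply: (hol_sub Xle); first exact: (hol_cst Xle)).
  by apply: (hol_mul Xle); [exact: hol_pole|exact: hol_polei].
by apply: (hol_mul Xle); exact: hol_pole.
Qed.

Definition chi i k (y : V) (w : C) := psi (fun z => hk n K i k (y, z)) r w + phi (fun z => hk n K i k (y, z)) r w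
  - h0 (fun z => hk n K i k (y, z)) r.

(* Extends [l * Lent] across [l = 0]: in the partial fraction expansion the factor [l]
   cancels the denominator shared by a pole and the inverse of its partner. *)
Definition Mfun i k (y : V) := \sum_(e <- idx) (if partner e is Some e' then 1 else l y) * betaf e (partner e) y * chi i k y (pl y e.1 e.2).

Lemma hol_Mfun i k : hol x1 (Mfun i k).
Proof.
have hs c u := @hol_small_polef _ _ x1 rho r d K hW c u.
have uh := @ucl_hk _ n N x1 rho r d K hr r01 uti hW i k.
apply: (hol_sum Xle) => e _; apply: (hol_mul Xle).
  apply: (hol_mul Xle); last exact: hol_betaf.
  by case: (partner e) => [_|]; [exact: (hol_cst Xle)|exact: hol_lfac].
apply: (hol_sub Xle); first apply: (hol_add Xle).
- by exists d => //; exact: (ucl_psi F r01 uh (hs e.1 e.2)).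
- by exists d => //; exact: (ucl_phi F r01 uh (hs e.1 e.2)).
- by exists d => //; exact: (ucl_h0 F r01 uh).
Qed.

Lemma poles_uniq_near : exists2 d' : R, 0 < d' & forall y : V, bal x1 d' y -> {in idx &, injective (fun e => pl y e.1 e.2)}.
Proof.
pose J : finType := (('I_K * 'I_K) * 'I_N)%type.
pose Q (e : J * J) (y : V) := e.1 != e.2 -> pl y (e.1.1.1 : nat, e.1.1.2 : nat) e.1.2 != pl y (e.2.1.1 : nat, e.2.1.2 : nat) e.2.2.
have hQ e : exists2 d' : R, 0 < d' & forall y : V, bal x1 d' y -> Q e y.
  have [ee|ee] := eqVneq e.1 e.2; first by exists 1 => // y _; rewrite /Q ee eqxx.
  have hh : hol x1 (fun y => pl y (e.1.1.1 : nat, e.1.1.2 : nat) e.1.2 - pl y (e.2.1.1 : nat, e.2.1.2 : nat) e.2.2).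
    by apply: (hol_sub Xle); exact: hol_pole.
  have [|d' d'0 hd'] := hol_neq0 XD XZ Xle _ hh.
    rewrite subr_eq0; apply: contraNneq ee => /pole_inj [/ord_inj h1 /ord_inj h2 h3].
    by apply/eqP; case: e {hh} h1 h2 h3 => [[[a b] u] [[a' b'] u']] /= -> -> ->.
  by exists d' => // y /hd'; rewrite subr_eq0 => h _.
have [d' d'0 hd'] := common_radius hQ.
exists d' => // y hy [[a b] u] [[a' b'] u']; rewrite !mem_idx !mem_cells /= => /andP[aK bK] /andP[a'K b'K] e.
have := hd' y hy (((Ordinal aK, Ordinal bK), u), ((Ordinal a'K, Ordinal b'K), u')); rewrite /Q /= e eqxx.
by case: eqP => [[-> -> ->]//|_ /(_ isT)].
Qed.

Lemma Lent_Mfun : exists2 d' : R, 0 < d' & forall y : V, bal x1 d' y -> l y != 0 ->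
  pfree y /\ forall i k, l y * Lent n (tc y) y.2.1 y.2.2 i k = Mfun i k y.
Proof.
have [d1 d10 h1] := free_near; have [d2 d20 h2] := poles_uniq_near.
exists (Order.min d (Order.min d1 d2)); first by rewrite !lt_min d0 d10.
move=> y hy ly.
have hy0 : bal x1 d y by apply: bal_le hy; rewrite ge_min lexx.
have hy1 : bal x1 d1 y by apply: bal_le hy; rewrite !ge_min lexx ?orbT.
have hy2 : bal x1 d2 y by apply: bal_le hy; rewrite !ge_min lexx ?orbT.
have fy := h1 y hy1 ly; have inj := h2 y hy2; split=> // i k.
have [_ _ [yp0 yq0 yp1 yq1 yt0] _ v] := hW hy0.
rewrite (LentE n yp1 yq1 i k fy v) /Lval Lrec_diag//; first last.
- rewrite polesE; apply/eqP => /(congr1 size); rewrite size_map => /size0nil e.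
  by have := mem_idx (0%N, 0%N) ra; rewrite e mem_cells /= (leq_trans _ Kij).
- exact: nondeg_poles.
- exact: (poles_allsm yp0 yq0 yp1 yq1 yt0 v).
- by rewrite polesE map_inj_in_uniq// idx_uniq.
- exact: hker_lau.
rewrite polesE big_map mulr_sumr big_seq [RHS]big_seq; apply: eq_bigr => e ei.
rewrite mulrA; congr (_ * _).
have e1 : \prod_(a <- [seq pl y e.1 e.2 | e <- idx] | a != pl y e.1 e.2) (1 - a / pl y e.1 e.2) =
   \prod_(a <- idx | a != e) (1 - pl y a.1 a.2 / pl y e.1 e.2).
  rewrite big_map big_seq_cond [RHS]big_seq_cond; apply: eq_bigl => a.
  by case: (boolP (a \in idx)) => //= ai; rewrite (inj_in_eq inj).
rewrite /alp e1 /betaf big_map; case E : (partner e) => [b|].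
  rewrite (bigD1_seq b) ?idx_uniq ?(partner_idx E)//= (partnerP y E) mul1r.
  by rewrite [X in _ / X]mulrCA invfM mulrA mulfV// mul1r.
by [].
Qed.

Definition partner_of e := odflt e (partner e).
Definition paired := [seq e <- idx | partner e].
Lemma partnerK e b : partner e = Some b -> partner b = Some e.
Proof. by move=> /partner_one h; apply: partner_sing; rewrite mulrC. Qed.

Lemma paired_perm : perm_eq paired (map partner_of paired).
Proof.
have hJ e : e \in paired -> exists b, [/\ partner e = Some b, partner_of e = b, partner_of b = e & b \in paired].
  rewrite mem_filter => /andP[]; case E : (partner e) => [b|//] _ ei; exists b; have E' := partnerK E.
  by rewrite /partner_of E E' mem_filter E' (partner_idx E).
have uJ : uniq paired by rewrite filter_uniq ?idx_uniq.
apply: uniq_perm => //.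
  rewrite map_inj_in_uniq// => e e' /hJ[b [_ h1 h2 _]] /hJ[b' [_ h3 h4 _]].
  by rewrite h1 h3 => bb; rewrite -h2 -h4 bb.
move=> e; apply/idP/mapP => [/hJ[b [h1 h2 h3 h4]]|[b /hJ[b' [h1 h2 h3 h4]] ->]]; first by exists b.
by rewrite h2.
Qed.

Lemma pole_ann c u : in_box c -> (u == ra) || (u == rb) -> [/\ small r (P c u), small r (P c u)^-1 & ann r r^-1 (P c u)].
Proof.
move=> cc hu; have xx : bal x1 d x1 by exact: bal_id.
have [_ _ _ _ v] := hW xx.
have [b hb] : exists b, partner (c, u) = Some b.
  rewrite /partner /= cc; case: eqP hu => [_ _|_ /= ->]; by eexists.
have s1 := pole_small p1 q1 v c u; have s2 := pole_small p1 q1 v b.1 b.2.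
have e : (P c u)^-1 = P b.1 b.2 by apply: (mulIf (P0 c u)); rewrite mulVf// (partner_one hb).
rewrite e; split=> //; split.
  move: s2; rewrite -e /small cmodV => s2.
  have c0 : 0 < cmod (P c u) by rewrite cmod_gt0.
  by move: s2; rewrite mulrC ler_pdivrMr//; lra.
move: s1; rewrite /small => s1; rewrite -[leRHS]mul1r ler_pdivlMr//; lra.
Qed.

Lemma hker_sym i k z : z != 0 -> hker n (tc x1) x1.2.1 x1.2.2 K i k z^-1 = hker n (tc x1) x1.2.1 x1.2.2 K i k z.
Proof.
move=> z0; rewrite /hker /pker !ph_inv// mulrNN; congr (_ * _ * _).
  by apply: eq_bigr => u _; rewrite invrK mulrC.
by apply: eq_bigr => u _; rewrite invrK mulrC.
Qed.

(** Replacing a pole by its inverse exchanges the two products. *)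
Lemma beta_sym e b : partner e = Some b -> betaf b (partner b) x1 = betaf e (partner e) x1.
Proof.
move=> h; have h' := partnerK h; rewrite /betaf h h'; congr (_^-1).
have E : P b.1 b.2 = (P e.1 e.2)^-1 by apply: (mulIf (P0 e.1 e.2)); rewrite mulVf// (partner_one h).
rewrite E invrK mulrC; congr (_ * _); apply: eq_bigl => a //=.
Qed.

(** Poles without partner carry the factor l, which is 0 at [x1]. For a pole w with partner 1/w,
    [laurent_split] turns chi(w) + chi(1/w) into h(w) + h(1/w) = 2 h(w), the kernel being invariant
    under inversion; the sum is therefore doubled and symmetrised. *)
Lemma Mfun_at i k : Mfun i k x1 = \sum_(e <- paired) betaf e (partner e) x1 * hker n (tc x1) x1.2.1 x1.2.2 K i k (P e.1 e.2).
Proof.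
have lx : l x1 = 0 by case: gx.
have -> : Mfun i k x1 = \sum_(e <- paired) betaf e (partner e) x1 * chi i k x1 (P e.1 e.2).
  rewrite big_filter [RHS]big_mkcond; apply: eq_bigr => e _.
  by case: (partner e) => [b|] /=; rewrite ?mul1r// lx !mul0r.
have two0 : (2 : C) != 0 by rewrite pnatr_eq0.
apply: (mulfI two0); rewrite [LHS](_ : _ = \sum_(e <- paired) betaf e (partner e) x1 * chi i k x1 (P e.1 e.2)
  + \sum_(e <- paired) betaf e (partner e) x1 * chi i k x1 (P e.1 e.2)); last by rewrite mulr_natl mulr2n.
rewrite {2}(perm_big _ paired_perm) /= big_map -big_split mulr_sumr big_seq [RHS]big_seq; apply: eq_bigr => e /=.
rewrite mem_filter => /andP[]; case E : (partner e) => [b|//] _ ei.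
have Ep : partner_of e = b by rewrite /partner_of E.
rewrite Ep -E (beta_sym E) -mulrDr [RHS]mulrCA; congr (_ * _).
have [cc hu] : in_box e.1 /\ (e.2 == ra) || (e.2 == rb).
  by move: E; rewrite /partner; case: ifP => // _; case: eqP => //= _; case: eqP.
have [s1 s2 _] := pole_ann cc hu.
have Eb : P b.1 b.2 = (P e.1 e.2)^-1 by apply: (mulIf (P0 e.1 e.2)); rewrite mulVf// (partner_one E).
have xx : bal x1 d x1 by exact: bal_id.
have [_ _ _ _ v] := hW xx.
have uh := hker_lau n p1 q1 v i k.
rewrite Eb.
have e1 := laurent_split r01 uh (P0 e.1 e.2) s1 s2.
have e2 : phi (hker n (tc x1) x1.2.1 x1.2.2 K i k) r (P e.1 e.2)^-1 + psi (hker n (tc x1) x1.2.1 x1.2.2 K i k) r (P e.1 e.2) - h0 (hker n (tc x1) x1.2.1 x1.2.2 K i k) r = hker n (tc x1) x1.2.1 x1.2.2 K i k (P e.1 e.2).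
  have := laurent_split r01 uh (x := (P e.1 e.2)^-1); rewrite invr_eq0 invrK hker_sym//.
  by apply.
rewrite /chi mulr_natl mulr2n -{1}e1 -e2 /hk /=.
ring.
Qed.

Definition residue i k e := betaf e (partner e) x1 * hker n (tc x1) x1.2.1 x1.2.2 K i k (P e.1 e.2).

Lemma residue_sym i k e b : partner e = Some b -> residue i k b = residue i k e.
Proof.
move=> h; rewrite /residue (beta_sym h).
have -> : P b.1 b.2 = (P e.1 e.2)^-1 by apply: (mulIf (P0 e.1 e.2)); rewrite mulVf// (partner_one h).
by rewrite hker_sym.
Qed.

Definition box := [seq (a, b) | a <- iota 0 ij.1.+1, b <- iota 0 ij.2.+1].
Lemma mem_box c : (c \in box) = in_box c.
Proof.
case: c => a b; rewrite /box /in_box; apply/allpairsP/andP => [[[a' b'] [h1 h2 [-> ->]]]|[h1 h2]].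
  by move: h1 h2; rewrite !mem_iota !add0n.
by exists (a, b); split=> //; rewrite mem_iota add0n.
Qed.
Lemma box_uniq : uniq box.
Proof. by apply: allpairs_uniq; rewrite ?iota_uniq//; case=> a b [a' b'] _ _ /= [-> ->]. Qed.

Lemma partner_ra c : in_box c -> partner (c, ra) = Some (flip c, rb).
Proof. by move=> h; rewrite /partner /= h eqxx. Qed.

Lemma mem_paired e : (e \in paired) = in_box e.1 && ((e.2 == ra) || (e.2 == rb)).
Proof.
case: e => c u; rewrite mem_filter mem_idx /partner /=; case: (boolP (in_box c)) => //= cc.
by rewrite (in_box_cells cc) andbT; case: (u == ra) => //; case: (u == rb).
Qed.

(** Partners have equal residues. For ra != rb each pair has one member over [ra] and one over [rb],
    hence the factor 2; for ra = rb the poles over [ra] are all the paired ones. *)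
Lemma Mfun_box i k : Mfun i k x1 = (ra != rb).+1%:R * \sum_(c <- box) residue i k (c, ra).
Proof.
have -> : Mfun i k x1 = \sum_(e <- paired) residue i k e by exact: Mfun_at.
 case: eqVneq => /= [e|rab].
  have Jp : perm_eq paired [seq (c, ra) | c <- box].
    apply: uniq_perm; first by rewrite filter_uniq ?idx_uniq.
      by rewrite map_inj_uniq ?box_uniq// => ? ? [].
    move=> [c u]; rewrite mem_paired -e orbb; apply/andP/mapP => [[h /eqP /= ->]|[c' h [-> ->]]].
      by exists c; rewrite ?mem_box.
    by rewrite -mem_box /=.
  by rewrite (perm_big _ Jp) big_map mul1r.
have Jp : perm_eq paired ([seq (c, ra) | c <- box] ++ [seq (flip c, rb) | c <- box]).
  apply: uniq_perm; first by rewrite filter_uniq ?idx_uniq.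
    rewrite cat_uniq !map_inj_in_uniq ?box_uniq//; last by move=> ? ? _ _ [].
      by rewrite andbT andTb; apply/hasPn => _ /mapP[c _ ->]; apply/mapP => -[c' _ [_ /eqP]]; rewrite eq_sym (negPf rab).
    by move=> c c'; rewrite !mem_box => h h' [h1 h2]; rewrite -(flipK h) -(flipK h') /flip /= h1 h2.
  move=> [c u]; rewrite mem_paired mem_cat -[(c, u).1]/c -[(c, u).2]/u; apply/andP/orP => [[h /orP[]/eqP ->]|[]/mapP[c' h [-> ->]]].
  - by left; apply/mapP; exists c; rewrite ?mem_box.
  - by right; apply/mapP; exists (flip c); rewrite ?mem_box ?flip_in ?flipK.
  - by rewrite -mem_box eqxx.
  - by rewrite (flip_in c') eqxx orbT.
rewrite (perm_big _ Jp) big_cat !big_map /= mulr_natl mulr2n; congr (_ + _).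
by rewrite big_seq [RHS]big_seq; apply: eq_bigr => c; rewrite mem_box => h; exact: (residue_sym _ _ (partner_ra h)).
Qed.

(** The two products of [betaf], completed to infinite ones with the vanishing factors left out; [K]
    and [r] no longer appear. *)
Definition Dres c := (\prod_u P2 (if u == ra then Some c else None) (tc x1 u / P c ra) x1.2.1 x1.2.2) *
  \prod_u P2 (if u == rb then Some (flip c) else None) (tc x1 u * P c ra) x1.2.1 x1.2.2.

Lemma prod_dfac c u0 (w : C) : c \in cells K ->
  (forall u, cmod (tc x1 u * w) * Order.max (cmod x1.2.1) (cmod x1.2.2) ^+ K <= 1 / 2) ->
  \prod_(a <- idx | a != (c, u0)) (1 - P a.1 a.2 * w) =
  \prod_u P2 (if u == u0 then Some c else None) (tc x1 u * w) x1.2.1 x1.2.2 *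
  \prod_u itail K (tc x1 u * w) x1.2.1 x1.2.2.
Proof.
move=> cK hw; rewrite -big_split /= big_mkcond /idx big_allpairs_dep /= exchange_big /= big_enum; apply: eq_bigr => u _.
rewrite (P2_split p1 q1 (hw u)); last by case: eqP.
apply: eq_bigr => c' _; rewrite /dfac -surjective_pairing xpair_eqE.
case: (u == u0); rewrite ?andbT ?andbF /=; last by rewrite /pole mulrA.
rewrite (_ : (Some c == Some c') = (c' == c)); last by rewrite eq_sym.
by case: eqP => //= _; rewrite /pole mulrA.
Qed.

Lemma residueE i k c : in_box c ->
  residue i k (c, ra) = pker n i k x1.2.1 x1.2.2 (P c ra) * (nker (tc x1) x1.2.1 x1.2.2 (P c ra) / Dres c).
Proof.
move=> cc; have xx : bal x1 d x1 by exact: bal_id.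
have [_ _ _ _ v] := hW xx.
have [_ _ an] : [/\ small r (P c ra), small r (P c ra)^-1 & ann r r^-1 (P c ra)] by apply: pole_ann; rewrite ?eqxx.
have tl u := tail_ok p1 q1 v u an.
have bd := beta_den (c, ra); move: bd; rewrite /residue /betaf (partner_ra cc) /=.
rewrite (@prod_dfac c ra (P c ra)^-1) ?in_box_cells//; last by move=> u; have [] := tl u.
rewrite (eq_bigl (fun b => b != (flip c, rb)))//.
rewrite (@prod_dfac (flip c) rb (P c ra)) ?in_box_cells ?flip_in//; last by move=> u; have [] := tl u.
rewrite /hker /tker /Dres big_split /=.
by move=> bd; exact: residue_cancel.
Qed.

Lemma Mfun_res i k : Mfun i k x1 = (ra != rb).+1%:R *
  \sum_(c <- box) pker n i k x1.2.1 x1.2.2 (P c ra) * (nker (tc x1) x1.2.1 x1.2.2 (P c ra) / Dres c).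
Proof.
rewrite Mfun_box; congr (_ * _); rewrite big_seq [RHS]big_seq; apply: eq_bigr => c.
by rewrite mem_box => /residueE ->.
Qed.
End WithData.
End GenericPoint.

Lemma ratio_step (F : fieldType) (a1 a2 b1 b2 n1 n2 d1 d2 : F) : a1 != 0 -> b2 != 0 ->
  a2 * n1 * n2 / (b1 * d1 * d2) = a1 * a2 / (b1 * b2) * (n1 * (b2 * n2) / (d1 * (a1 * d2))).
Proof.
move=> h1 h2; rewrite !invfM.
have e1 : a1 * a1^-1 = 1 by rewrite mulfV.
have e2 : b2 * b2^-1 = 1 by rewrite mulfV.
transitivity ((a1 * a1^-1) * (b2 * b2^-1) * (a2 * n1 * n2 * (b1^-1 * d1^-1 * d2^-1))); last by ring.
by rewrite e1 e2 !mul1r.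
Qed.

(** After multiplication by q^(b (j - b)) both sides become p^(ib) q^(2ib) times powers of p^i q^j
    t^2. The identity compares theta multipliers at a pole and at its inverse. *)
Lemma monomial_rev (F : fieldType) (p q t : F) (i j b : nat) : q != 0 -> p ^+ i * q ^+ j * t ^+ 2 = 1 -> (b <= j)%N ->
  q ^+ ((j - b) * (j - b)) * t ^+ (2 * (j - b)) * (p ^+ (i * i) * t ^+ (2 * i)) * (q ^+ b) ^+ (2 * i) * (p * q) ^+ (i * j)
  = ((p * q) ^+ 2) ^+ (i * b) * (q ^+ (b * b) * t ^+ (2 * b)).
Proof.
move=> q0 T hb; set b' := (j - b)%N; have jE : j = (b' + b)%N by rewrite /b' subnK.
apply: (mulIf (expf_neq0 (b * b') q0)).
transitivity ((p ^+ i * q ^+ j * t ^+ 2) ^+ i * (p ^+ i * q ^+ j * t ^+ 2) ^+ b' * p ^+ (i * b) * q ^+ (2 * (i * b))).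
  rewrite jE !exprMn -!exprM !mulnDr !mulnDl !exprD.
  by rewrite (mulnC b' i) (mulnC b i) ?muln0; ring.
rewrite T !expr1n !mul1r.
transitivity ((p ^+ i * q ^+ j * t ^+ 2) ^+ b * p ^+ (i * b) * q ^+ (2 * (i * b))); first by rewrite T expr1n mul1r.
by rewrite jE !exprMn -!exprM !mulnDl !exprD (mulnC b' b); ring.
Qed.

(** * Quasi-periodicity of the residues *)

Section Residues.
Variable R : realType.
Local Notation C := (CC R).
Variables (m n N : nat).
Hypothesis hN : N = (2 * m + 2 * n + 4)%N.
Local Notation V := ('rV[C]_N * (C * C))%type.
Variables (ra rb : 'I_N) (ij : nat * nat) (x1 : V).
Hypothesis gx : generic ra rb ij x1.
Local Notation p := (x1.2.1).
Local Notation q := (x1.2.2).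
Local Notation t := (tc x1).
Local Notation i0 := (ij.1).
Local Notation j0 := (ij.2).
Hypothesis hprod : \prod_u t u = (p * q) ^+ m.+1.
Local Notation P c u := (pole t p q c u).
Let rx : regular x1. Proof. by case: gx. Qed.
Let p0 : p != 0. Proof. by case: rx. Qed.
Let q0 : q != 0. Proof. by case: rx. Qed.
Let p1 : cmod p < 1. Proof. by case: rx. Qed.
Let q1 : cmod q < 1. Proof. by case: rx. Qed.
Let t0 u : t u != 0. Proof. by case: rx. Qed.
Let P0 c u : P c u != 0. Proof. exact: pole_neq0. Qed.

Definition resc c := nker t p q (P c ra) / Dres ra rb ij x1 c.
(** The ratio of the residue factors [resc] at the poles p z and z, by [resc_step]; only theta
    functions of base q remain. *)
Definition eratio (z : C) := \prod_u (th (t u * z) q / th (t u / (p * z)) q).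

Lemma pole_S a b u : P (a.+1, b) u = p * P (a, b) u.
Proof. by rewrite /pole exprS -!mulrA. Qed.
Lemma pole_q a b u : P (a, b) u = q ^+ b * P (a, 0%N) u.
Proof. by rewrite /pole /=; ring. Qed.
Lemma pole_p a b u : P (a, b) u = p ^+ a * P (0%N, b) u.
Proof. by rewrite /pole /=; ring. Qed.

Lemma rescE c : resc c = \prod_u (P2 None (p * q / (t u * P c ra)) p q * P2 None (p * q / (t u / P c ra)) p q /
   (P2 (if u == ra then Some c else None) (t u / P c ra) p q *
    P2 (if u == rb then Some (flip ij c) else None) (t u * P c ra) p q)).
Proof. by rewrite /resc /nker /Dres -big_split prodf_div. Qed.

(** Each double product is moved by one step in p at the cost of a simple product in q, and the
    omitted factor moves along. The simple products that complete the theta functions are nonzero by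
    genericity. *)
Lemma resc_step a b : (a < i0)%N -> resc (a.+1, b) = eratio (P (a, b) ra) * resc (a, b).
Proof.
move=> ai; rewrite !rescE /eratio -big_split /=; apply: eq_bigr => u _.
rewrite pole_S; set x := P (a, b) ra; have x0 : x != 0 by exact: P0.
have u0 := t0 u.
have h1 : P2 None (p * q / (t u * (p * x))) p q = qp (q / (t u * x)) q * P2 None (p * q / (t u * x)) p q.
  have e1 : p * (p * q / (t u * (p * x))) = p * q / (t u * x) by field; rewrite x0 u0 p0.
  have e2 : p * q / (t u * (p * x)) = q / (t u * x) by field; rewrite x0 u0 p0.
  by rewrite (P2_recN p1 q1 (p * q / (t u * (p * x)))) e1 e2.
have h2 : P2 None (p * q / (t u / x)) p q = qp (q / (t u / (p * x))) q * P2 None (p * q / (t u / (p * x))) p q.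
  have e1 : p * (p * q / (t u / x)) = p * q / (t u / (p * x)) by field; rewrite x0 u0 p0.
  have e2 : p * q / (t u / x) = q / (t u / (p * x)) by field; rewrite x0 u0 p0.
  by rewrite (P2_recN p1 q1 (p * q / (t u / x))) e1 e2.
have px : p * (t u / (p * x)) = t u / x by field; rewrite x0 p0.
have h3 : P2 (if u == ra then Some (a.+1, b) else None) (t u / (p * x)) p q =
    qp (t u / (p * x)) q * P2 (if u == ra then Some (a, b) else None) (t u / x) p q.
  by case: (u == ra); [rewrite (P2_recS p1 q1)|rewrite (P2_recN p1 q1)]; rewrite px.
have h4 : P2 (if u == rb then Some (flip ij (a, b)) else None) (t u * x) p q =
    qp (t u * x) q * P2 (if u == rb then Some (flip ij (a.+1, b)) else None) (t u * (p * x)) p q.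
  have -> : t u * (p * x) = p * (t u * x) by ring.
  rewrite /flip /= -(subnSK ai).
  by case: (u == rb); [rewrite (P2_recS p1 q1)|rewrite (P2_recN p1 q1)].
rewrite h1 h2 h3 h4 /th; apply: ratio_step; apply: qp_neq0 => // k.
  apply/eqP => e.
  have e' : P (a, (b + k)%N) ra * t u = 1 by rewrite -e /x /pole /= exprD; ring.
  by have [_ e2] := lfac_eq0 gx e'; move: ai; rewrite -e2 /= ltnn.
apply/eqP => e.
have e' : P (a.+1, (b + k).+1) ra = P (0%N, 0%N) u.
  have -> : P (0%N, 0%N) u = t u * (q ^+ k * (q / (t u / (p * x)))) by rewrite e /pole !expr0; ring.
  by rewrite /pole /= !exprS exprD /x /pole /=; field; rewrite u0 p0 t0 !expf_neq0.
by have := pole_inj gx e'.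
Qed.

(** Each [u] contributes p q / t_u^2, and the balancing condition evaluates the product of these to
    (p q)^(N - 2m - 2). *)
Lemma eratio_q z : z != 0 -> eratio (q * z) = (p * q) ^+ (2 * n + 2) * eratio z.
Proof.
move=> z0.
have -> : (p * q) ^+ (2 * n + 2) = \prod_u ((p * q) * (t u ^+ 2)^-1).
  rewrite big_split /= prodr_const card_ord prodfV prodrXl hprod.
  have -> : (p * q) ^+ N = (p * q) ^+ (2 * n + 2) * ((p * q) ^+ m.+1) ^+ 2.
    by rewrite -exprM -exprD (_ : 2 * n + 2 + m.+1 * 2 = N)%N//; lia.
  by rewrite mulfK// !expf_neq0// mulf_neq0.
rewrite /eratio -big_split; apply: eq_bigr => u _ /=.
have u0 := t0 u.
have -> : t u * (q * z) = q * (t u * z) by ring.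
rewrite (th_shift q0 q1) ?mulf_neq0//.
have -> : th (t u / (p * z)) q = - (t u / (p * (q * z)))^-1 * th (t u / (p * (q * z))) q.
  rewrite -(th_shift q0 q1) ?mulf_neq0 ?invr_eq0 ?mulf_neq0//.
  have e1 : q * (t u / (p * (q * z))) = t u / (p * z) by field; rewrite p0 z0 q0.
  by rewrite e1.
rewrite (invfM (- _)); move: (th (t u * z) q) ((th (t u / (p * (q * z))) q)^-1) => A B.
by field; rewrite p0 z0 q0 u0.
Qed.

Lemma eratio_qn b z : z != 0 -> eratio (q ^+ b * z) = ((p * q) ^+ (2 * n + 2)) ^+ b * eratio z.
Proof.
move=> z0; elim: b => [|b IH]; first by rewrite !expr0 !mul1r.
by rewrite exprS -mulrA eratio_q ?mulf_neq0 ?expf_neq0// IH mulrA -exprS.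
Qed.

(** Iterating [resc_step] down to exponent 0 of p, with [eratio_qn] removing q^b from each ratio:
    the dependence on a and on b separates up to one mixed power of p q. *)
Lemma resc_fact a b : (a <= i0)%N ->
  resc (a, b) = ((p * q) ^+ (2 * n + 2)) ^+ (a * b) * \prod_(c < a) eratio (P (c : nat, 0%N) ra) * resc (0%N, b).
Proof.
elim: a => [|a IH] ha; first by rewrite mul0n expr0 big_ord0 !mul1r.
rewrite resc_step// IH ?(ltnW ha)// pole_q eratio_qn// big_ord_recr /= mulSn.
by rewrite (exprD ((p * q) ^+ (2 * n + 2)) b); ring.
Qed.

Lemma sq_prod (s z : C) a : \prod_(c < a) (s * (s ^+ c * z) ^+ 2) = s ^+ (a * a) * z ^+ (2 * a).
Proof.
elim: a => [|a IH]; first by rewrite big_ord0 !muln0 !expr0 mulr1.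
rewrite big_ord_recr /= IH.
have -> : (a.+1 * a.+1 = a * a + (a + a).+1)%N by lia.
have -> : (2 * a.+1 = 2 * a + 2)%N by lia.
by rewrite !exprD !exprS !exprD expr0; ring.
Qed.

Lemma shift_prod (s v z : C) a : \prod_(c < a) (s * (s ^+ c * (v * z)) ^+ 2)^-1 =
  (s ^+ (a * a) * z ^+ (2 * a))^-1 * (v ^+ (2 * a))^-1.
Proof. by rewrite prodfV sq_prod exprMn -invfM; congr (_^-1); ring. Qed.

Lemma ph_p a b i : (i < n)%N -> ph p n i (P (a, b) ra) =
  ((p ^+ (a * a) * t ra ^+ (2 * a))^-1) ^+ n.+1 * (((q ^+ b) ^+ (2 * a))^-1) ^+ n.+1 * ph p n i (P (0%N, b) ra).
Proof.
move=> hi; rewrite pole_p (ph_shiftn p0 p1)// -exprMn -shift_prod; congr (_ ^+ _ * _); apply: eq_bigr => c _.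
by rewrite /pole expr0 mul1r.
Qed.

Lemma ph_q a b k : (k < n)%N -> ph q n k (P (a, b) ra) =
  ((q ^+ (b * b) * t ra ^+ (2 * b))^-1) ^+ n.+1 * (((p ^+ a) ^+ (2 * b))^-1) ^+ n.+1 * ph q n k (P (a, 0%N) ra).
Proof.
move=> hk; rewrite pole_q (ph_shiftn q0 q1)// -exprMn -shift_prod; congr (_ ^+ _ * _); apply: eq_bigr => c _.
by rewrite /pole expr0 mulr1.
Qed.

Definition resU i b := ((q ^+ (b * b) * t ra ^+ (2 * b))^-1) ^+ n.+1 * ph p n i (P (0%N, b) ra) * resc (0%N, b).
Definition resW k a := - (((p ^+ (a * a) * t ra ^+ (2 * a))^-1) ^+ n.+1 *
  \prod_(c < a) eratio (P (c : nat, 0%N) ra) * ph q n k (P (a, 0%N) ra)).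

(** The mixed factor (p q)^((2n+2)ab) of [resc_fact] cancels against the mixed factors of [ph_p] and
    [ph_q], so the double sum over the box factors. *)
Lemma res_rank1 i k : (i < n)%N -> (k < n)%N ->
  \sum_(c <- box ij) pker n i k p q (P c ra) * resc c = (\sum_(b < j0.+1) resU i b) * (\sum_(a < i0.+1) resW k a).
Proof.
move=> hi hk; rewrite /box big_allpairs_dep mulr_sumr.
rewrite -[iota 0 i0.+1]/(index_iota 0 i0.+1) -[iota 0 j0.+1]/(index_iota 0 j0.+1) big_mkord.
apply: eq_bigr => a _; rewrite mulr_suml big_mkord; apply: eq_bigr => b _.
have ai : (a <= i0)%N by rewrite -ltnS.
rewrite /pker ph_p// ph_q// resc_fact// /resU /resW.
have E : ((q ^+ b) ^+ (2 * a))^-1 ^+ n.+1 * ((p ^+ a) ^+ (2 * b))^-1 ^+ n.+1 * ((p * q) ^+ (2 * n + 2)) ^+ (a * b) = 1.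
  rewrite -!exprVn -!exprM.
  have -> : (b * (2 * a * n.+1) = (2 * n + 2) * (a * b))%N by lia.
  have -> : (a * (2 * b * n.+1) = (2 * n + 2) * (a * b))%N by lia.
  by rewrite -!exprMn (_ : q^-1 * p^-1 * (p * q) = 1) ?expr1n//; field; rewrite p0 q0.
move: E; move: (((q ^+ b) ^+ (2 * a))^-1 ^+ n.+1) (((p ^+ a) ^+ (2 * b))^-1 ^+ n.+1) (((p * q) ^+ (2 * n + 2)) ^+ (a * b)) => e1 e2 e3 E.
rewrite -[RHS]mul1r -E; ring.
Qed.

Section Square.
Hypothesis rab : ra = rb.
Let T : p ^+ i0 * q ^+ j0 * t ra ^+ 2 = 1.
Proof.
case: gx => _ _ _ _; rewrite /lfac /= -rab => /eqP; rewrite subr_eq0 => /eqP ->.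
by rewrite expr2 mulrA.
Qed.

Lemma pole_cinv c : in_box ij c -> P (flip ij c) ra = (P c ra)^-1.
Proof.
move=> hc; apply: (mulIf (P0 c ra)); rewrite mulVf// mulrC pole_mul flip_add//.
by rewrite -T /pole expr2 mulrA.
Qed.

Lemma resc_sym c : in_box ij c -> resc (flip ij c) = resc c.
Proof.
move=> hc; rewrite /resc /Dres (pole_cinv hc) flipK// -rab; congr (_ / _).
  by rewrite /nker; apply: eq_bigr => u _; rewrite invrK mulrC.
by rewrite mulrC invrK.
Qed.

Let th_nz u c : (c < i0)%N -> th (t u * P (c, 0%N) ra) q != 0.
Proof.
move=> hc; apply: th_neq0 => //; first by rewrite mulf_neq0.
  move=> k; apply/eqP => e.
  have e' : P (c, k) ra * t u = 1 by rewrite -e /pole /=; ring.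
  by have [_ e2] := lfac_eq0 gx e'; move: hc; rewrite -e2 /= ltnn.
move=> k; apply/eqP => e.
have e' : P (c, 0%N) ra * t u = p ^+ 0 * q ^+ k.+1 by rewrite expr0 mul1r e mulrC.
case: gx => _ g1 _ g3 _; have := g3 _ _ _ _ _ e'; rewrite -rab orbb => /andP[_ /eqP uu].
have e2 : p ^+ c * q ^+ 0 = p ^+ i0 * q ^+ (j0 + k.+1).
  rewrite exprD; have -> : p ^+ i0 * (q ^+ j0 * q ^+ k.+1) = p ^+ i0 * q ^+ j0 * (P (c, 0%N) ra * t u) by rewrite e'; ring.
  by rewrite -[LHS]mul1r -T /pole /= uu; ring.
by have [_] := g1 _ _ _ _ e2; rewrite addnS.
Qed.

(* Since [1 / (p * P (c, 0) ra) = q ^ j0 * P (i0 - c - 1, 0) ra], the quotients of theta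
   functions telescope. *)
Lemma eratio_prod : (\prod_(c < i0) eratio (P (c : nat, 0%N) ra)) * (p * q) ^+ (n.+1 * (i0 * j0)) = 1.
Proof.
have -> : \prod_(c < i0) eratio (P (c : nat, 0%N) ra) =
    \prod_(c < i0) \prod_u (th (t u * P (c : nat, 0%N) ra) q / th (q ^+ j0 * (t u * P (c : nat, 0%N) ra)) q).
  under eq_bigr do rewrite /eratio prodf_div.
  under [RHS]eq_bigr do rewrite prodf_div.
  rewrite !prodf_div; congr (_ / _); rewrite (reindex_inj rev_ord_inj) /=; apply: eq_bigr => c _.
  apply: eq_bigr => u _; have hc := ltn_ord c.
  have E : q ^+ j0 * P (c : nat, 0%N) ra * (p * P ((i0 - c.+1)%N, 0%N) ra) = 1.
    have e : p ^+ i0 = p ^+ (i0 - c.+1) * p ^+ c * p by rewrite -exprD -exprSr -addnS subnK.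
    by rewrite -T /pole /= e; ring.
  have -> : t u / (p * P ((i0 - c.+1)%N, 0%N) ra) = q ^+ j0 * (t u * P (c : nat, 0%N) ra); last by [].
  by rewrite -[LHS]mulr1 -E; field; rewrite p0 P0.
rewrite (_ : \prod_(c < i0) _ = \prod_(c < i0) \prod_(u < N) \prod_(l < j0) (- (q ^+ l * (t u * P (c : nat, 0%N) ra)))); last first.
  apply: eq_bigr => c _; apply: eq_bigr => u _; have nz := th_nz u (ltn_ord c).
  have e := th_shiftn q0 q1 j0 (mulf_neq0 (t0 u) (P0 (c : nat, 0%N) ra)).
  rewrite e invfM mulrCA mulfV// mulr1 -prodfV; apply: eq_bigr => l _.
  by rewrite invrN invrK.
have hh : N = (2 * (m.+1 + n.+1))%N by rewrite hN; lia.
have E (B : C) : \prod_(u < N) \prod_(l < j0) - (q ^+ l * (t u * B)) =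
    \prod_(l < j0) (((q ^+ l * B) ^+ 2) ^+ (m.+1 + n.+1) * (p * q) ^+ m.+1).
  rewrite exchange_big /=; apply: eq_bigr => l _.
  under eq_bigr => u _ do rewrite mulrCA -mulrN mulrC.
  by rewrite big_split /= hprod prodr_const card_ord -[in RHS]sqrrN -exprM -hh.
under eq_bigr do rewrite E.
have E2 : \prod_(c < i0) \prod_(l < j0) ((p * q) * (q ^+ l * P (c : nat, 0%N) ra) ^+ 2) = 1.
  have E1 (c : 'I_i0) : \prod_(l < j0) ((p * q) * (q ^+ l * P (c : nat, 0%N) ra) ^+ 2) = q ^+ (j0 * j0) * (p * (p ^+ c * t ra) ^+ 2) ^+ j0.
    under eq_bigr => l _ do rewrite -mulrA.
    rewrite big_split /= sq_prod prodr_const card_ord [in RHS]exprMn -exprM.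
    by rewrite (_ : P (c : nat, 0%N) ra = p ^+ c * t ra); [ring|rewrite /pole expr0 mulr1].
  under eq_bigr do rewrite E1.
  rewrite big_split /= prodr_const card_ord prodrXl sq_prod.
  have -> : q ^+ (j0 * j0) ^+ i0 * (p ^+ (i0 * i0) * t ra ^+ (2 * i0)) ^+ j0 = (p ^+ i0 * q ^+ j0 * t ra ^+ 2) ^+ (i0 * j0).
    rewrite !exprMn -!exprM; have -> : (j0 * j0 * i0 = j0 * (i0 * j0))%N by lia.
    have -> : (i0 * i0 * j0 = i0 * (i0 * j0))%N by lia.
    have -> : (2 * i0 * j0 = i0 * j0 + i0 * j0)%N by lia.
    by rewrite (exprD (t ra)); ring.
  by rewrite T expr1n.
have E3 : (p * q) ^+ (n.+1 * (i0 * j0)) = \prod_(c < i0) \prod_(l < j0) (p * q) ^+ n.+1.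
  rewrite !prodr_const !card_ord -!exprM; congr (_ ^+ _); lia.
transitivity ((\prod_(c < i0) \prod_(l < j0) ((p * q) * (q ^+ l * P (c : nat, 0%N) ra) ^+ 2)) ^+ (m.+1 + n.+1)); last by rewrite E2 expr1n.
rewrite E3 -big_split -prodrXl; apply: eq_bigr => c _.
rewrite -big_split -prodrXl /=; apply: eq_bigr => l _.
by rewrite [in RHS]exprMn (exprD (p * q)) -mulrA mulrC.
Qed.

(** Inversion sends the pole with exponents (i0, b) to the one with (0, j0 - b); the residue factor
    is even and [ph] is odd under it. The multipliers picked up in returning from i0 to 0 cancel by
    [eratio_prod] and [monomial_rev]. *)
Lemma resU_rev i b : (i < n)%N -> (b <= j0)%N -> resU i (j0 - b) = - resU i b.
Proof.
move=> hi hb.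
have hc : in_box ij (i0, b) by rewrite /in_box /= leqnn.
have e1 : resc (0%N, (j0 - b)%N) = ((p * q) ^+ (2 * n + 2)) ^+ (i0 * b) * \prod_(c < i0) eratio (P (c : nat, 0%N) ra) * resc (0%N, b).
  by rewrite -resc_fact// -(resc_sym hc) /flip /= subnn.
have e2 : ph p n i (P (0%N, (j0 - b)%N) ra) = - (((p ^+ (i0 * i0) * t ra ^+ (2 * i0))^-1) ^+ n.+1 * (((q ^+ b) ^+ (2 * i0))^-1) ^+ n.+1 * ph p n i (P (0%N, b) ra)).
  rewrite -ph_p// -(ph_inv p1)// -(pole_cinv hc) /flip /= subnn.
  by [].
rewrite /resU e1 e2.
have E := eratio_prod.
have K := monomial_rev q0 T hb.
have -> : \prod_(c < i0) eratio (P (c : nat, 0%N) ra) = ((p * q) ^+ (n.+1 * (i0 * j0)))^-1.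
  apply: (mulIf (expf_neq0 (n.+1 * (i0 * j0)) (mulf_neq0 p0 q0))).
  by rewrite E mulVf// expf_neq0// mulf_neq0.
have K' : ((q ^+ ((j0 - b) * (j0 - b)) * t ra ^+ (2 * (j0 - b)))^-1) ^+ n.+1 * ((p ^+ (i0 * i0) * t ra ^+ (2 * i0))^-1) ^+ n.+1 *
    (((q ^+ b) ^+ (2 * i0))^-1) ^+ n.+1 * ((p * q) ^+ (n.+1 * (i0 * j0)))^-1 * ((p * q) ^+ (2 * n + 2)) ^+ (i0 * b) =
    ((q ^+ (b * b) * t ra ^+ (2 * b))^-1) ^+ n.+1.
  have -> : ((p * q) ^+ (n.+1 * (i0 * j0)))^-1 = ((p * q) ^+ (i0 * j0))^-1 ^+ n.+1 by rewrite mulnC exprM exprVn.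
  have -> : ((p * q) ^+ (2 * n + 2)) ^+ (i0 * b) = (((p * q) ^+ 2) ^+ (i0 * b)) ^+ n.+1 by rewrite -!exprM; congr (_ ^+ _); lia.
  rewrite -!exprMn -!invfM K invfM mulrAC mulVf ?mul1r// !expf_neq0// mulf_neq0//.
rewrite -K'; ring.
Qed.

(** The reversal of b changes the sign of every term, so the sum equals its opposite. *)
Lemma resU_sum0 i : (i < n)%N -> \sum_(b < j0.+1) resU i b = 0.
Proof.
move=> hi; have two0 : (2 : C) != 0 by rewrite pnatr_eq0.
apply: (mulfI two0); rewrite mulr0 mulr_natl mulr2n {2}(reindex_inj rev_ord_inj) -big_split big1// => b _.
by rewrite /= subSS resU_rev// -1?ltnS// subrr.
Qed.
End Square.
End Residues.

(** * Determinants near a matrix of rank at most one *)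

Section RankOne.
Variable R : realType.
Local Notation C := (CC R).

Lemma det_row_bound n (A : 'M[C]_n) (B : 'I_n -> R) : (forall i k, cmod (A i k) <= B i) ->
  cmod (\det A) <= #|{: {perm 'I_n}}|%:R * \prod_i B i.
Proof.
move=> h; rewrite /determinant; apply: (le_trans (cmod_sum _ _ _)).
apply: (@le_trans _ _ (\sum_(s : {perm 'I_n}) \prod_i B i)); last by rewrite sumr_const mulr_natl.
apply: ler_sum => s _; rewrite cmodM cmodX cmodN cmod1 expr1n mul1r cmod_prod.
by apply: ler_prod => i _; rewrite cmod_ge0 h.
Qed.

Variables (V : normedModType C) (I : finType) (X : I -> V -> C).
Hypotheses (XD : forall i u v, X i (u + v) = X i u + X i v) (XZ : forall i a v, X i (a *: v) = a * X i v)
  (Xle : forall i v, cmod (X i v) <= vn v).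
Variable x1 : V.
Local Notation hol := (hol X x1).

Lemma hol_lip_family (J : finType) (f : J -> V -> C) : (forall j, hol (f j)) -> exists L d : R, [/\ 0 <= L, 0 < d &
  forall y, bal x1 d y -> forall j, cmod (f j y - f j x1) <= L * vn (y - x1) /\ cmod (f j y) <= L].
Proof.
move=> hf; have [L_ hL] := choice (fun j => hol_lip XD XZ Xle (hf j)).
have L0 j : 0 <= L_ j by have [d []] := hL j.
have [d0 d00 h0] : exists2 d : R, 0 < d & forall y, bal x1 d y -> forall j, cmod (f j y - f j x1) <= L_ j * vn (y - x1).
  by apply: common_radius => j; have [d [_ d0 h]] := hL j; exists d.
pose S := \sum_j (L_ j + cmod (f j x1)).
have Sj j : L_ j + cmod (f j x1) <= S.
  by rewrite /S (bigD1 j)//= lerDl sumr_ge0// => i _; rewrite addr_ge0 ?cmod_ge0.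
exists S, (Order.min d0 1); split.
- by rewrite /S sumr_ge0// => j _; rewrite addr_ge0 ?cmod_ge0.
- by rewrite lt_min d00 ltr01.
move=> y hy j; have hy0 : bal x1 d0 y by apply: bal_le hy; rewrite ge_min lexx.
have hv : vn (y - x1) <= 1.
  by apply: ltW; have : bal x1 1 y by apply: bal_le hy; rewrite ge_min lexx orbT.
have v0 := vn_ge0 (y - x1).
have hj := h0 y hy0 j; split.
  apply: le_trans hj _; rewrite ler_wpM2r//; apply: le_trans (Sj j); by rewrite lerDl cmod_ge0.
have : cmod (f j y) <= cmod (f j y - f j x1) + cmod (f j x1) by rewrite -{1}(subrK (f j x1) (f j y)) cmodD.
move=> h; apply: le_trans h _; apply: le_trans (Sj j); rewrite lerD2r; apply: le_trans hj _.
by rewrite ler_piMr.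
Qed.

(** A constant invertible matrix [Q] takes the column u to one supported on the first row. All rows
    but the first then vanish at [x1], and each is Lipschitz there. *)
Lemma hol_det_rank1 n' (M : 'I_n'.+1 -> 'I_n'.+1 -> V -> C) u v : (forall i k, hol (M i k)) ->
  (forall i k, M i k x1 = u i * v k) -> exists c d : R, [/\ 0 <= c, 0 < d &
  forall y, bal x1 d y -> cmod (\det (\matrix_(i, k) M i k y)) <= c * vn (y - x1) ^+ n'].
Proof.
move=> hM hx; pose U : 'cV[C]_n'.+1 := \col_i u i.
pose Q := invmx (col_ebase U).
have uQ : Q \in unitmx by rewrite unitmx_inv col_ebase_unit.
have QU : Q *m U = pid_mx (\rank U) *m row_ebase U.
  by rewrite -[X in _ *m X]mulmx_ebase -mulmxA mulKmx ?col_ebase_unit.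
have QU0 i : i != 0 -> (Q *m U) i 0 = 0.
  move=> i0; rewrite QU mxE big1// => k _; rewrite !mxE.
  by rewrite (ord1 k) /= (_ : (i == 0 :> nat) = false) ?mul0r//; apply: negbTE.
pose N (ik : 'I_n'.+1 * 'I_n'.+1) y := \sum_j Q ik.1 j * M j ik.2 y.
have hN ik : hol (N ik).
  by apply: (hol_sum Xle) => j _; apply: (hol_mul Xle) => //; exact: (hol_cst Xle).
have NE y : Q *m (\matrix_(i, k) M i k y) = \matrix_(i, k) N (i, k) y.
  by apply/matrixP => i k; rewrite !mxE; apply: eq_bigr => j _; rewrite mxE.
have N0 i k : i != 0 -> N (i, k) x1 = 0.
  move=> /QU0; rewrite mxE => h; rewrite /N /=.
  have -> : \sum_j Q i j * M j k x1 = (\sum_j Q i j * U j 0) * v k.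
    by rewrite mulr_suml; apply: eq_bigr => j _; rewrite hx mxE mulrA.
  by rewrite h mul0r.
have [L [d [L0 d0 hL]]] := hol_lip_family hN.
have detQ : \det Q != 0 by rewrite -unitfE -unitmxE.
exists ((cmod (\det Q))^-1 * (#|{: {perm 'I_n'.+1}}|%:R * (L * L ^+ n'))), d; split=> //.
  by rewrite mulr_ge0 ?invr_ge0 ?cmod_ge0// mulr_ge0// mulr_ge0// exprn_ge0.
move=> y hy; have v0 := vn_ge0 (y - x1).
have -> : \det (\matrix_(i, k) M i k y) = (\det Q)^-1 * \det (\matrix_(i, k) N (i, k) y).
  by rewrite -NE det_mulmx mulKf.
rewrite cmodM cmodV -mulrA ler_wpM2l ?invr_ge0 ?cmod_ge0//.
pose B (i : 'I_n'.+1) := if i == 0 then L else L * vn (y - x1).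
have hB i k : cmod ((\matrix_(i, k) N (i, k) y) i k) <= B i.
  rewrite mxE /B; have [h1 h2] := hL y hy (i, k); case: eqP => // /eqP i0.
  by rewrite N0// subr0 in h1.
apply: le_trans (det_row_bound hB) _; rewrite big_ord_recl /B eqxx /=.
by rewrite prodr_const card_ord exprMn -!mulrA.
Qed.

Lemma hol_det_zero n' (M : 'I_n' -> 'I_n' -> V -> C) : (forall i k, hol (M i k)) ->
  (forall i k, M i k x1 = 0) -> exists c d : R, [/\ 0 <= c, 0 < d &
  forall y, bal x1 d y -> cmod (\det (\matrix_(i, k) M i k y)) <= c * vn (y - x1) ^+ n'].
Proof.
move=> hM hx; have [L [d [L0 d0 hL]]] := hol_lip_family (fun ik => hM ik.1 ik.2).
exists (#|{: {perm 'I_n'}}|%:R * L ^+ n'), d; split=> //; first by rewrite mulr_ge0 ?exprn_ge0.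
move=> y hy; have hB i k : cmod ((\matrix_(i, k) M i k y) i k) <= L * vn (y - x1).
  by rewrite mxE; have [h1 _] := hL y hy (i, k); rewrite /= hx subr0 in h1.
apply: le_trans (det_row_bound (B := fun=> L * vn (y - x1)) hB) _.
by rewrite prodr_const card_ord exprMn mulrA.
Qed.
End RankOne.

(** * Paths to generic points *)

Section Approach.
Variable R : realType.
Local Notation C := (CC R).
Variables (m n' N : nat).
Local Notation n := n'.+1.
Hypothesis hN : N = (2 * m + 2 * n + 4)%N.
Local Notation V := ('rV[C]_N * (C * C))%type.
Local Notation X := (@crd R N).
Local Notation hol := (hol X).
Local Notation XD := (@crdD R N).
Local Notation XZ := (@crdZ R N).
Local Notation Xle := (@crd_le R N).

Definition dom (y : V) := regular y /\ \prod_u tc y u = (y.2.1 * y.2.2) ^+ m.+1.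

Lemma P2_zero (p q x : C) i j : cmod p < 1 -> cmod q < 1 -> p ^+ i * q ^+ j * x = 1 -> P2 None x p q = 0.
Proof.
move=> p1 q1 h; apply: (ccvg_unique (P2_cells p1 q1 None x)).
apply: ccvg_eq (ccvg_cst 0); exists (i + j).+1 => k hk; apply/esym/eqP; rewrite prodf_seq_eq0; apply/hasP.
exists (i, j); first by rewrite mem_cells /=; lia.
by rewrite /dfac /= h subrr.
Qed.

Lemma prefactor_zero (y : V) (ra rb : 'I_N) ij : regular y -> ra != rb -> lfac (ij, (ra, rb)) y = 0 ->
  BC_prefactor y.1 y.2.1 y.2.2 = 0.
Proof.
move=> ry; wlog lt : ra rb / (ra < rb)%N.
  move=> W rab h; have [lt|lt|/ord_inj e] := ltngtP ra rb.
  - exact: (W _ _ lt rab h).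
  - by apply: (W _ _ lt); rewrite 1?eq_sym// -h /lfac /=; congr (1 - _); ring.
  - by rewrite e eqxx in rab.
move=> _ h; have [_ _ p1 q1 _] := ry.
rewrite /BC_prefactor (bigD1 ra)//= (bigD1 rb)//= qpoch2E (@P2_zero _ _ _ ij.1 ij.2)// ?mul0r//.
by move: h; rewrite /lfac /= => /eqP; rewrite subr_eq0 => /eqP ->; rewrite !mulrA.
Qed.

Section AtGeneric.
Variables (ra rb e : 'I_N) (ij : nat * nat) (x1 : V).
Hypotheses (gx : generic ra rb ij x1) (dx : dom x1) (ea : e != ra) (eb : e != rb).
Local Notation l := (lfac (ij, (ra, rb))).
Let rx : regular x1. Proof. by case: gx. Qed.
Let hprod : \prod_u tc x1 u = (x1.2.1 * x1.2.2) ^+ m.+1. Proof. by case: dx. Qed.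

(* At [x1] the matrix [l * Lent] has rank at most one, so its determinant vanishes to
   order [n - 1]; the missing order comes from the prefactor if [ra != rb], and
   from the vanishing of the whole matrix if [ra = rb]. *)
Lemma pref_det_bound : exists c d : R, [/\ 0 <= c, 0 < d & forall y : V, bal x1 d y -> l y != 0 ->
  [/\ pfree y, regular y & cmod (l y ^+ n * Fgen n y) <= c * vn (y - x1) ^+ n]].
Proof.
have [rho [r [d [K [Kij [hr r01 d0 uti hW]]]]]] := local_data rx (ij.1 + ij.2).+1.
pose M i k := Mfun n ra rb ij r K i k.
have hM (i k : 'I_n) : hol x1 (M i k) by exact: (hol_Mfun n gx hr r01 d0 uti hW).
have Mx (i k : 'I_n) : M i k x1 = ((ra != rb).+1%:R * \sum_(b < ij.2.+1) resU n ra rb ij x1 i b) * \sum_(a < ij.1.+1) resW n ra x1 k a.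
  by rewrite /M (Mfun_res n gx hr r01 d0 Kij hW) -mulrA -(res_rank1 hN gx hprod)//; exact: ltn_ord.
have [d1 d10 h1] := Lent_Mfun n gx hr r01 d0 Kij hW.
have [cB [d2 [cB0 d20 h2]]] : exists c d : R, [/\ 0 <= c, 0 < d & forall y : V, bal x1 d y ->
    cmod (BC_prefactor y.1 y.2.1 y.2.2 * \det (\matrix_(i < n, k < n) M i k y)) <= c * vn (y - x1) ^+ n].
  have hp := hol_prefactor rx.
  have [L [dp [L0 dp0 hL]]] := hol_lip_family XD XZ Xle (fun _ : 'I_1 => hp).
  have [rab|rab] := eqVneq ra rb.
    have Mx0 (i k : 'I_n) : M i k x1 = 0.
      by rewrite Mx (resU_sum0 hN gx hprod rab) ?ltn_ord// mulr0 mul0r.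
    have [c [dd [c0 dd0 hc]]] := hol_det_zero XD XZ Xle hM Mx0.
    exists (L * c), (Order.min dp dd); split; rewrite ?mulr_ge0 ?lt_min ?dp0//.
    move=> y hy; rewrite cmodM -mulrA; apply: ler_pM; rewrite ?cmod_ge0//.
      by have [] := hL y (bal_le _ hy) ord0; rewrite // ge_min lexx.
    by apply: hc; apply: bal_le hy; rewrite ge_min lexx orbT.
  have [c [dd [c0 dd0 hc]]] := hol_det_rank1 XD XZ Xle hM Mx.
  exists (L * c), (Order.min dp dd); split; rewrite ?mulr_ge0 ?lt_min ?dp0//.
  move=> y hy; rewrite cmodM exprS mulrACA; apply: ler_pM; rewrite ?cmod_ge0//.
    have [] := hL y (bal_le _ hy) ord0; first by rewrite ge_min lexx.
    have lx : l x1 = 0 by case: gx.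
    by rewrite (prefactor_zero rx rab lx) subr0.
  by apply: hc; apply: bal_le hy; rewrite ge_min lexx orbT.
have [L [dk [L0 dk0 hL]]] := hol_lip_family XD XZ Xle (fun _ : 'I_1 => hol_kappa n rx).
exists (L * cB), (Order.min (Order.min d d1) (Order.min d2 dk)); split; rewrite ?mulr_ge0 ?lt_min ?d0 ?d10 ?d20//.
move=> y hy ly.
have [fy hl] : pfree y /\ forall i k, l y * Lent n (tc y) y.2.1 y.2.2 i k = M i k y.
  by apply: h1 => //; apply: bal_le hy; rewrite !ge_min lexx ?orbT.
have [_ _ ry _ _] : [/\ cmod y.2.1 <= rho, cmod y.2.2 <= rho, regular y,
     forall u, cmod (tc y u) * rho ^+ K <= r / 2 & valid (tc y) y.2.1 y.2.2 K r].
  by apply: hW; apply: bal_le hy; rewrite !ge_min lexx ?orbT.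
split=> //.
have -> : l y ^+ n * Fgen n y = kappa n y.2.1 y.2.2 * (BC_prefactor y.1 y.2.1 y.2.2 * \det (\matrix_(i < n, k < n) M i k y)).
  have -> : \det (\matrix_(i < n, k < n) M i k y) = l y ^+ n * \det (\matrix_(i < n, k < n) Lent n (tc y) y.2.1 y.2.2 i k).
    by rewrite -detZ; congr (\det _); apply/matrixP => i k; rewrite !mxE hl.
  rewrite /Fgen; move: (\det _) (BC_prefactor _ _ _) (kappa _ _ _) (l y ^+ n) => A B D E; ring.
rewrite cmodM -mulrA; apply: ler_pM; rewrite ?cmod_ge0//.
  by have [] := hL y (bal_le _ hy) ord0; rewrite // !ge_min lexx ?orbT.
by apply: h2; apply: bal_le hy; rewrite !ge_min lexx ?orbT.
Qed.

(** The path multiplies t_ra by 1 + s and compensates in t_e, with e different from ra and rb: the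
    balancing condition is kept while l = 0 is left. *)
Definition gfac (s : R) u : C := if u == ra then (1 + s)%:C else if u == e then ((1 + s)^-1)%:C else 1.
Definition escape (s : R) : V := (\row_u (tc x1 u * gfac s u), x1.2).

Lemma escapeE s u : tc (escape s) u = tc x1 u * gfac s u.
Proof. by rewrite /tc mxE. Qed.

Lemma escape_prod s : 0 < s -> \prod_u tc (escape s) u = (x1.2.1 * x1.2.2) ^+ m.+1.
Proof.
move=> s0; under eq_bigr do rewrite escapeE.
rewrite big_split /= hprod (bigD1 ra)//= (bigD1 e)//= big1 ?mulr1 => [|u /andP[u1 u2]]; last first.
  by rewrite /gfac (negPf u1) (negPf u2).
rewrite /gfac !eqxx (negPf ea) -rmorphM mulfV ?mulr1//; lra.
Qed.

(** On the path l is 1 - (1 + s)^2 if ra = rb and 1 - (1 + s) otherwise. *)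
Lemma lfac_escape s : 0 < s -> s <= cmod (l (escape s)).
Proof.
move=> s0; have l0 : x1.2.1 ^+ ij.1 * x1.2.2 ^+ ij.2 * tc x1 ra * tc x1 rb = 1.
  by case: gx => _ _ _ _ /eqP; rewrite /lfac /= subr_eq0 => /eqP <-.
have -> : l (escape s) = 1 - gfac s ra * gfac s rb.
  by rewrite /lfac /= !escapeE -[X in _ = X - _]l0 -[X in _ = _ - X]mul1r -l0; ring.
rewrite /gfac eqxx [rb == e]eq_sym (negPf eb); case: eqP => _.
  have -> : 1 - (1 + s)%:C * (1 + s)%:C = (- (s * (2 + s)))%:C :> C.
    rewrite -rmorphM -(rmorph1 (real_complex R)) -rmorphB; congr (_%:C); ring.
  rewrite cmodC normrN ger0_norm; first by nra.
  by nra.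
have -> : 1 - (1 + s)%:C * 1 = (- s)%:C :> C.
  rewrite mulr1 -(rmorph1 (real_complex R)) -rmorphB; congr (_%:C); ring.
by rewrite cmodC normrN ger0_norm// ltW.
Qed.

Lemma vn_escape s : 0 < s -> vn (escape s - x1) <= (\sum_u cmod (tc x1 u)) * s.
Proof.
move=> s0; have S0 u : cmod (tc x1 u) <= \sum_u cmod (tc x1 u).
  by rewrite (bigD1 u)//= lerDl sumr_ge0// => v _; exact: cmod_ge0.
have SS : 0 <= (\sum_u cmod (tc x1 u)) * s.
  by rewrite mulr_ge0 ?(ltW s0)// sumr_ge0// => v _; exact: cmod_ge0.
apply: crd_ge => // -[u|b] /=; last by case: b; rewrite subrr cmod0.
rewrite !mxE -/(tc x1 u) (_ : _ - _ = tc x1 u * (gfac s u - 1)); last by rewrite mulrBr mulr1.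
rewrite cmodM; apply: ler_pM; rewrite ?cmod_ge0//.
rewrite /gfac; case: eqP => _; last case: eqP => _; last by rewrite subrr cmod0 ltW.
  have -> : (1 + s)%:C - 1 = s%:C :> C.
    rewrite -(rmorph1 (real_complex R)) -rmorphB; congr (_%:C); ring.
  by rewrite cmodC ger0_norm// ltW.
have s1 : 0 < 1 + s by lra.
have -> : ((1 + s)^-1)%:C - 1 = (- (s / (1 + s)))%:C :> C.
  rewrite -(rmorph1 (real_complex R)) -rmorphB; congr (_%:C); field; exact: lt0r_neq0.
rewrite cmodC normrN ger0_norm ?divr_ge0 ?ltW//.
by rewrite ltr_pdivrMr//; nra.
Qed.

(** On the path |y - x1| <= T s while |l| >= s, so the bound c |y - x1|^n / |l|^(n-1) of l F is
    O(s). *)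
Lemma small_near_generic (eps : R) : 0 < eps -> exists y : V, [/\ bal x1 eps y, dom y, pfree y & cmod (l y * Fgen n y) <= eps].
Proof.
move=> e0; have [c [d [c0 d0 hc]]] := pref_det_bound.
pose T := \sum_u cmod (tc x1 u) + 1.
have T0 : 0 < T by rewrite /T ltr_wpDl// sumr_ge0// => u _; exact: cmod_ge0.
pose D := c * T ^+ n + 1.
have D0 : 0 < D by rewrite /D ltr_wpDl// mulr_ge0// exprn_ge0// ltW.
pose s := Order.min (eps / T) (Order.min (d / T) (eps / D)) / 2.
have s0 : 0 < s by rewrite divr_gt0// !lt_min !divr_gt0.
have hs x : Order.min (eps / T) (Order.min (d / T) (eps / D)) <= x -> s < x.
  by move=> h; apply: lt_le_trans h; rewrite /s ltr_pdivrMr// ltr_pMr ?ltr1n// !lt_min !divr_gt0.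
have h1 : T * s < eps by rewrite -ltr_pdivlMl// mulrC; apply: hs; rewrite ge_min lexx.
have h2 : T * s < d by rewrite -ltr_pdivlMl// mulrC; apply: hs; rewrite !ge_min lexx ?orbT.
have h3 : D * s <= eps by rewrite -ler_pdivlMl// mulrC ltW//; apply: hs; rewrite !ge_min lexx ?orbT.
have vT : vn (escape s - x1) <= T * s.
  by apply: le_trans (vn_escape s0) _; rewrite ler_wpM2r ?(ltW s0)// /T lerDl.
have ls := lfac_escape s0.
have lc : 0 < cmod (l (escape s)) by exact: lt_le_trans ls.
have ly : l (escape s) != 0 by rewrite -cmod_gt0.
have [fy ry hy] : [/\ pfree (escape s), regular (escape s) & cmod (l (escape s) ^+ n * Fgen n (escape s)) <= c * vn (escape s - x1) ^+ n].
  by apply: hc => //; exact: le_lt_trans vT h2.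
exists (escape s); split=> //.
- exact: le_lt_trans vT h1.
- by split=> //; exact: escape_prod.
apply: le_trans h3; rewrite exprSr -mulrA cmodM cmodX in hy.
have ln : 0 < cmod (l (escape s)) ^+ n' by rewrite exprn_gt0.
rewrite -(ler_pM2l ln); apply: le_trans hy _.
apply: (@le_trans _ _ (c * (T * s) ^+ n)).
  by rewrite ler_wpM2l// lerXn2r ?nnegrE ?vn_ge0// mulr_ge0// ltW.
apply: (@le_trans _ _ (s ^+ n' * (D * s))).
  rewrite exprMn [s ^+ n]exprSr (_ : c * _ = s ^+ n' * ((c * T ^+ n) * s)); last by ring.
  by rewrite ler_wpM2l ?exprn_ge0 ?(ltW s0)// ler_wpM2r ?(ltW s0)// /D lerDl.
have Ds : 0 <= D * s by rewrite mulr_ge0// ltW.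
apply: (ler_wpM2r Ds); rewrite lerXn2r// nnegrE; [exact: ltW s0|exact: ltW lc].
Qed.

End AtGeneric.
End Approach.

(** * Density of generic points *)

Section Avoid.
Variable R : realType.

Lemma countable_roots (P : {poly R}) : P != 0 -> countable [set s : R | root P s].
Proof.
move=> P0; apply: finite_set_countable; apply: contrapT => inf.
have [B hB sB] := infinite_set_fset (size P) inf.
have := max_poly_roots P0 (rs := finmap.enum_fset B); rewrite finmap.fset_uniq.
have -> : all (root P) (finmap.enum_fset B) by apply/allP => s sB'; exact: (hB s).
by move=> /(_ isT isT); rewrite ltnNge sB.
Qed.

(** Countably many finite sets cannot cover an interval, which has positive measure. *)
Lemma avoid_roots (K : countType) (P : K -> {poly R}) (d : R) : (forall k, P k != 0) -> 0 < d ->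
  exists s, 0 < s < d /\ forall k, (P k).[s] != 0.
Proof.
move=> P0 d0; apply: contrapT => no.
have sub : `]0, d[%classic `<=` \bigcup_(k in [set: K]) [set s : R | root (P k) s].
  move=> s /=; rewrite in_itv /= => hs; apply: contrapT => hs'; apply: no; exists s; split=> // k.
  by apply/negP => h; apply: hs'; exists k.
have c : countable (`]0, d[%classic : set R).
  apply: countable_sub sub _; apply: bigcup_countable; first exact: countableP.
  by move=> k _; exact: countable_roots.
have := countable_lebesgue_measure0 c; rewrite lebesgue_measure_itv /= lte_fin d0 => /eqP.
by rewrite sube0 eqe gt_eqF.
Qed.

Lemma expR_poly_small (c : {poly R}) (e : R) : c.[0] = 0 -> 0 < e -> exists2 d : R, 0 < d &
  forall s, 0 < s < d -> `|expR c.[s] - 1| <= e.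
Proof.
move=> c0 e0.
have cc : {for 0, continuous (fun s : R => expR c.[s])}.
  apply: continuous_comp; [exact: continuous_horner|exact: continuous_expR].
move/cvgrPdist_le: cc => /(_ e e0); rewrite c0 expR0 => /nbhs_ballP[d d0 hd].
exists d => // s /andP[s0 sd]; rewrite distrC; apply: hd; rewrite /ball /= sub0r normrN gtr0_norm//.
Qed.
End Avoid.

Section Density.
Variable R : realType.
Local Notation C := (CC R).
Variables (m N : nat).
Hypothesis N6 : (6 <= N)%N.
Local Notation V := ('rV[C]_N * (C * C))%type.
Variables (ra rb e : 'I_N) (ij : nat * nat).
Hypotheses (ea : e != ra) (eb : e != rb).
Local Notation l := (lfac (ij, (ra, rb))).

Definition others : pred 'I_N := fun w => [&& w != e, w != ra & w != rb].
Definition plin : {poly R} := 'X *+ ij.1 + 'X^2 *+ ij.2.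
(* The logarithms of the parameters are moved along polynomials in [s] that preserve
   the balancing condition and the vanishing factor and are otherwise as
   independent as possible: each unwanted coincidence then becomes a nonzero
   polynomial equation in [s]. *)
Definition cpol u : {poly R} :=
  if u == e then ('X + 'X^2) *+ m.+1 + (if ra == rb then 2^-1 else 1) *: plin - \sum_(w | others w) 'X^(3 + w)
  else if u == ra then if ra == rb then - (2^-1 *: plin) else 'X^(3 + ra)
  else if u == rb then - plin - 'X^(3 + ra)
  else 'X^(3 + u).

Lemma sum_others (f : 'I_N -> {poly R}) :
  \sum_u f u = f e + (f ra + (if ra == rb then 0 else f rb)) + \sum_(w | others w) f w.
Proof.
rewrite (bigD1 e)//= (bigD1 ra)/=; last by rewrite eq_sym.
rewrite -!addrA; congr (_ + (_ + _)); case: (eqVneq ra rb) => [ab|ab].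
  by rewrite add0r; apply: eq_bigl => w; rewrite /others -ab andbb.
rewrite (bigD1 rb)/=; last by rewrite eq_sym eb eq_sym ab.
by congr (_ + _); apply: eq_bigl => w; rewrite /others andbA.
Qed.

Lemma cpol_other w : others w -> cpol w = 'X^(3 + w).
Proof. by rewrite /cpol => /and3P[/negPf -> /negPf -> /negPf ->]. Qed.

Lemma cpol_sum : \sum_u cpol u = ('X + 'X^2) *+ m.+1.
Proof.
rewrite sum_others (eq_bigr (fun w : 'I_N => 'X^(3 + w))) => [|w]; last exact: cpol_other.
rewrite /cpol !eqxx ![_ == e]eq_sym (negPf ea) (negPf eb) [rb == ra]eq_sym.
by case: eqVneq => [_|_]; [rewrite addr0|rewrite scale1r]; ring.
Qed.

Lemma cpol_pair : plin + (cpol ra + cpol rb) = 0.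
Proof.
rewrite /cpol !eqxx ![_ == e]eq_sym (negPf ea) (negPf eb) [rb == ra]eq_sym; case: (eqVneq ra rb) => _ /=; last by ring.
rewrite -opprD -scalerDl (_ : 2^-1 + 2^-1 = 1) ?scale1r ?subrr//; lra.
Qed.

Lemma cpol0 u : (cpol u).[0] = 0.
Proof.
have pl0 : plin.[0] = 0 by rewrite /plin hornerD !hornerMn hornerX hornerXn expr0n /= !mul0rn addr0.
have x0 (k : nat) : ('X^(3 + k) : {poly R}).[0] = 0 by rewrite hornerXn expr0n.
rewrite /cpol; case: ifP => _; last case: ifP => _; last case: ifP => _; last by rewrite x0.
- rewrite hornerD hornerN hornerD hornerMn hornerD hornerX hornerXn hornerZ pl0 horner_sum big1 => [|w _]; last by rewrite x0.
  by rewrite expr0n /= mulr0 oppr0 !addr0 mul0rn.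
- by case: ifP => _; rewrite ?x0// hornerN hornerZ pl0 mulr0 oppr0.
- by rewrite hornerD !hornerN pl0 x0 oppr0 addr0.
Qed.

(** The coefficient of X^(3 + w) in [cpol u]; the exponents 1 and 2 belong to the logarithms of p
    and q. *)
Definition mcoef (w u : 'I_N) : R :=
  if u == e then - (others w)%:R
  else if u == ra then (if ra == rb then 0 else (w == ra)%:R)
  else if u == rb then - (w == ra)%:R
  else (w == u)%:R.

Lemma coef_cpol (w u : 'I_N) : (cpol u)`_(3 + w) = mcoef w u.
Proof.
have hX (v : 'I_N) : ('X^(3 + v) : {poly R})`_(3 + w) = (w == v)%:R.
  by rewrite coefXn eqn_add2l.
have pl0 : plin`_(3 + w) = 0 by rewrite /plin coefD !coefMn coefX coefXn /= !mul0rn addr0.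
rewrite /cpol /mcoef; case: ifP => _; last case: ifP => _; last case: ifP => _; last by rewrite hX.
- rewrite coefB coefD coefZ pl0 mulr0 coefMn coefD coefX coefXn /= !addr0 mul0rn sub0r coef_sum; congr (- _).
  under eq_bigr do rewrite hX.
  rewrite big_mkcond (bigD1 w)//= big1 => [|v vw]; first by rewrite eqxx addr0; case: (others w).
  by rewrite eq_sym (negPf vw); case: ifP.
- by case: ifP => _; rewrite ?hX// coefN coefZ pl0 mulr0 oppr0.
- by rewrite coefB coefN pl0 oppr0 sub0r hX.
Qed.

Lemma others_two u : exists2 w, others w & w != u.
Proof.
have : (0 < #|[set: 'I_N] :\ e :\ ra :\ rb :\ u|)%N.
  rewrite -(leq_add2l (u \in [set: 'I_N] :\ e :\ ra :\ rb)) -cardsD1 addn1.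
  have h1 := cardsD1 e [set: 'I_N]; have h2 := cardsD1 ra ([set: 'I_N] :\ e); have h3 := cardsD1 rb ([set: 'I_N] :\ e :\ ra).
  rewrite cardsT card_ord in h1.
  move: h1 h2 h3; move: (e \in _) (ra \in _) (rb \in _) (u \in _) => b1 b2 b3 b4.
  have := leq_b1 b1; have := leq_b1 b2; have := leq_b1 b3; have := leq_b1 b4.
  move: (nat_of_bool b1) (nat_of_bool b2) (nat_of_bool b3) (nat_of_bool b4) => a1 a2 a3 a4.
  move: #|_ :\ rb| #|_ :\ ra| #|_ :\ e| => k1 k2 k3 h4 h3 h2 h1 e1 e2 e3.
  by move: N6; rewrite e1 e2 e3; lia.
case/card_gt0P => w; rewrite !inE => /and4P[h1 h2 h3 /andP[h4 _]].
by exists w => //; rewrite /others h4 h3 h2.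
Qed.

Lemma mcoef_e w : others w -> mcoef w e = -1.
Proof. by move=> h; rewrite /mcoef eqxx h. Qed.
Lemma mcoef_other w u : others u -> mcoef w u = (w == u)%:R.
Proof. by rewrite /mcoef => /and3P[/negPf -> /negPf -> /negPf ->]. Qed.
Lemma mcoef_ab w u : (u == ra) || (u == rb) -> others w -> mcoef w u = 0.
Proof.
rewrite /mcoef => h /and3P[w1 w2 w3]; rewrite (negPf w2).
have -> : (u == e) = false by apply: contraTF h => /eqP ->; rewrite (negPf ea) (negPf eb).
by case: ifP h => [_ _|_ /= ->]; [case: ifP|rewrite oppr0].
Qed.
Lemma mcoef_ra : ra != rb -> mcoef ra ra = 1.
Proof. by move=> h; rewrite /mcoef eq_sym (negPf ea) eqxx (negPf h). Qed.
Lemma mcoef_rb : ra != rb -> mcoef ra rb = -1.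
Proof. by move=> h; rewrite /mcoef [rb == e]eq_sym (negPf eb) [rb == ra]eq_sym (negPf h) !eqxx. Qed.

Variant kind u : Prop := KE of u = e | KA of (u == ra) || (u == rb) & others u = false | KO of others u.
Lemma kindP u : kind u.
Proof.
case: (boolP (others u)) => [h|]; first exact: KO.
rewrite /others !negb_and !negbK => /or3P[/eqP h|h|h]; first exact: KE.
  by apply: KA; rewrite ?h// /others h /= andbF.
by apply: KA; rewrite ?h ?orbT// /others h /= !andbF.
Qed.

(** The monomials X^(3 + w) tell any two parameters apart, so t_u / t_v cannot stay in p^Z q^Z along
    the perturbation. The same holds in [mcoef_add] for t_u t_v, except for the pair ra, rb, whose
    product is tied to p and q. *)
Lemma mcoef_sub u v : u != v -> exists w, mcoef w u - mcoef w v != 0.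
Proof.
wlog wl : u v / (u = e) \/ (v <> e /\ (((u == ra) || (u == rb)) \/ others u /\ others v)).
  move=> W uv; have sw : (exists w, mcoef w v - mcoef w u != 0) -> exists w, mcoef w u - mcoef w v != 0.
    by move=> [w h]; exists w; rewrite -opprB oppr_eq0.
  have vu : v != u by rewrite eq_sym.
  case: (kindP u) => [hu|hu1 hu2|hu]; first by apply: W => //; left.
    by case: (eqVneq v e) => [ve|/eqP ve]; [apply/sw/W => //; left|apply: W => //; right; split=> //; left].
  case: (kindP v) => [hv|hv1 hv2|hv]; first by apply/sw/W => //; left.
    by apply/sw/W => //; right; split; [move=> ue; move: hu; rewrite /others ue eqxx|left].
  by apply: W => //; right; split; [move=> ve; move: hv; rewrite /others ve eqxx|right].
move=> uv; have [f hf _] := others_two e.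
case: wl => [ue|[ve [hu|[hu hv]]]].
- case: (kindP v) => [ve|hv _|hv]; first by rewrite ue ve eqxx in uv.
    by exists f; rewrite ue mcoef_e// mcoef_ab// subr0 oppr_eq0 oner_eq0.
  by exists v; rewrite ue mcoef_e// mcoef_other// eqxx; apply/eqP; lra.
- case: (kindP v) => [//|hv _|hv]; last by exists v; rewrite (mcoef_ab hu hv) mcoef_other// eqxx sub0r oppr_eq0 oner_eq0.
  have rab : ra != rb.
    by apply: contraNneq uv => ab; move: hu hv; rewrite -ab !orbb => /eqP -> /eqP ->.
  exists ra; move: uv; case/orP: hu => /eqP ->; case/orP: hv => /eqP ->; rewrite ?eqxx// mcoef_ra// mcoef_rb//; move=> _; apply/eqP; lra.
- by exists u; rewrite mcoef_other// mcoef_other// eqxx (negPf uv) subr0 oner_eq0.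
Qed.

Lemma mcoef_add u v : ~~ ((u == ra) && (v == rb) || (u == rb) && (v == ra)) -> exists w, mcoef w u + mcoef w v != 0.
Proof.
wlog wl : u v / (u = e) \/ (v <> e /\ (((u == ra) || (u == rb)) \/ others u /\ others v)).
  move=> W uv; have sw : (exists w, mcoef w v + mcoef w u != 0) -> exists w, mcoef w u + mcoef w v != 0.
    by move=> [w h]; exists w; rewrite addrC.
  have vu : ~~ ((v == ra) && (u == rb) || (v == rb) && (u == ra)) by rewrite orbC andbC [X in _ || X]andbC.
  case: (kindP u) => [hu|hu1 hu2|hu]; first by apply: W => //; left.
    by case: (eqVneq v e) => [ve|/eqP ve]; [apply/sw/W => //; left|apply: W => //; right; split=> //; left].
  case: (kindP v) => [hv|hv1 hv2|hv]; first by apply/sw/W => //; left.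
    by apply/sw/W => //; right; split; [move=> ue; move: hu; rewrite /others ue eqxx|left].
  by apply: W => //; right; split; [move=> ve; move: hv; rewrite /others ve eqxx|right].
move=> uv; have [f hf fv] := others_two v.
case: wl => [ue|[ve [hu|[hu hv]]]].
- exists f; rewrite ue mcoef_e//; case: (kindP v) => [->|hv _|hv].
  + by rewrite mcoef_e//; apply/eqP; lra.
  + by rewrite mcoef_ab// addr0 oppr_eq0 oner_eq0.
  + by rewrite mcoef_other// (negPf fv) addr0 oppr_eq0 oner_eq0.
- case: (kindP v) => [//|hv _|hv]; last by exists v; rewrite (mcoef_ab hu hv) mcoef_other// eqxx add0r oner_eq0.
  have rab : ra != rb.
    by apply: contraNneq uv => ab; move: hu hv; rewrite -ab !orbb => /eqP -> /eqP ->; rewrite eqxx.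
  exists ra; move: uv; case/orP: hu => /eqP ->; case/orP: hv => /eqP ->; rewrite ?eqxx ?orbT// => _; rewrite ?mcoef_ra// ?mcoef_rb//; apply/eqP; lra.
- exists u; rewrite mcoef_other// mcoef_other// eqxx; case: (u == v) => /=; apply/eqP; lra.
Qed.

Variable x0 : V.
Hypotheses (dx : dom m x0) (lx : l x0 = 0).
Let rx : regular x0. Proof. by case: dx. Qed.
Let p0 : x0.2.1 != 0. Proof. by case: rx. Qed.
Let q0 : x0.2.2 != 0. Proof. by case: rx. Qed.
Let t0 u : tc x0 u != 0. Proof. by case: rx. Qed.

Definition ccpol (k : 'I_N + bool) : {poly R} := match k with inl u => cpol u | inr true => 'X | inr false => 'X^2 end.
(** All parameters move by positive real factors; coincidences are then refuted on logarithms of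
    moduli, which are real polynomials in s. *)
Definition perturb (s : R) : V := (\row_u (tc x0 u * (expR (cpol u).[s])%:C),
  (x0.2.1 * (expR ('X : {poly R}).[s])%:C, x0.2.2 * (expR ('X^2 : {poly R}).[s])%:C)).

Lemma tc_perturb s u : tc (perturb s) u = tc x0 u * (expR (cpol u).[s])%:C.
Proof. by rewrite /tc mxE. Qed.

Lemma expRC_exp (P : {poly R}) s k : (expR P.[s])%:C ^+ k = (expR (P *+ k).[s])%:C :> C.
Proof. by rewrite -rmorphXn -expRM_natl mulr_natl hornerMn. Qed.

Lemma expRC_mul (P Q : {poly R}) s : (expR P.[s])%:C * (expR Q.[s])%:C = (expR (P + Q).[s])%:C :> C.
Proof. by rewrite -rmorphM -expRD hornerD. Qed.

Lemma perturb_prod s : \prod_u tc (perturb s) u = ((perturb s).2.1 * (perturb s).2.2) ^+ m.+1.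
Proof.
have [_ hp] := dx.
under eq_bigr do rewrite tc_perturb.
rewrite big_split /= hp [RHS](_ : _ = ((x0.2.1 * x0.2.2) * ((expR ('X : {poly R}).[s])%:C * (expR ('X^2 : {poly R}).[s])%:C)) ^+ m.+1); last by congr (_ ^+ _); ring.
rewrite [RHS]exprMn; congr (_ * _); rewrite expRC_mul expRC_exp -cpol_sum -rmorph_prod horner_sum expR_sum.
by [].
Qed.

Lemma lfac_perturb s : l (perturb s) = 0.
Proof.
have h1 : x0.2.1 ^+ ij.1 * x0.2.2 ^+ ij.2 * tc x0 ra * tc x0 rb = 1.
  by have /eqP := lx; rewrite /lfac /= subr_eq0 => /eqP <-.
rewrite /lfac /= !tc_perturb.
rewrite [X in 1 - X](_ : _ = (x0.2.1 ^+ ij.1 * x0.2.2 ^+ ij.2 * tc x0 ra * tc x0 rb) *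
  ((expR ('X : {poly R}).[s])%:C ^+ ij.1 * (expR ('X^2 : {poly R}).[s])%:C ^+ ij.2 * ((expR (cpol ra).[s])%:C * (expR (cpol rb).[s])%:C))).
  by rewrite h1 mul1r !expRC_exp !expRC_mul cpol_pair horner0 expR0 subrr.
by rewrite !exprMn; ring.
Qed.

Definition lnp (x : C) : {poly R} := (ln (cmod x))%:P.
Lemma cmod_lnp (x : C) (P : {poly R}) s : x != 0 -> cmod (x * (expR P.[s])%:C) = expR (lnp x + P).[s].
Proof.
move=> xn; rewrite cmodM cmodC ger0_norm ?expR_ge0// hornerD hornerC expRD lnK// posrE.
by rewrite cmod_gt0.
Qed.

Definition lp := lnp x0.2.1 + 'X.
Definition lq := lnp x0.2.2 + 'X^2.
Definition lt_ u := lnp (tc x0 u) + cpol u.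

Lemma cmod_mon s a b : cmod ((perturb s).2.1 ^+ a * (perturb s).2.2 ^+ b) = expR (lp *+ a + lq *+ b).[s].
Proof.
by rewrite cmodM !cmodX !cmod_lnp// -!expRM_natl -expRD (hornerD (lp *+ a)) (hornerMn _ lp) (hornerMn _ lq) !mulr_natl.
Qed.

Lemma cmod_tmov s u : cmod (tc (perturb s) u) = expR (lt_ u).[s].
Proof. by rewrite tc_perturb cmod_lnp. Qed.

(** The three values of the first index stand for coincidences of monomials in p and q, of a
    quotient and of a product of parameters with such monomials, in the order of the clauses of
    [generic]. *)
Definition badidx := (('I_3 * ('I_N * 'I_N)) * ((nat * nat) * (nat * nat)))%type.
Definition badpol (k : badidx) : {poly R} :=
  lp *+ k.2.1.1 + lq *+ k.2.1.2 - (lp *+ k.2.2.1 + lq *+ k.2.2.2) +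
  match k.1.1 : nat with 0%N => 0 | 1%N => lt_ k.1.2.1 - lt_ k.1.2.2 | _ => lt_ k.1.2.1 + lt_ k.1.2.2 end.

Lemma coef_lpq (w : 'I_N) a b : (lp *+ a + lq *+ b)`_(3 + w) = 0.
Proof. by rewrite coefD !coefMn !coefD !coefC coefX coefXn /= !addr0 !mul0rn addr0. Qed.

Lemma coef_lt (w : 'I_N) u : (lt_ u)`_(3 + w) = mcoef w u.
Proof. by rewrite coefD coefC /= add0r coef_cpol. Qed.

Lemma perturb_near (eps : R) : 0 < eps -> exists2 d : R, 0 < d & forall s, 0 < s < d -> bal x0 eps (perturb s).
Proof.
move=> e0.
pose eta k := eps / 2 / (cmod (crd k x0) + 1).
have c1 k : 0 < cmod (crd k x0) + 1 by rewrite ltr_wpDl ?cmod_ge0.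
have eta0 k : 0 < eta k by rewrite !divr_gt0.
have cc0 k : (ccpol k).[0] = 0.
  by case: k => [u|[]] /=; [exact: cpol0|rewrite hornerX|rewrite hornerXn expr0n].
have hk k : exists d : R, 0 < d /\ forall s, 0 < s < d -> `|expR (ccpol k).[s] - 1| <= eta k.
  by have [d d0 h] := expR_poly_small (cc0 k) (eta0 k); exists d.
have [d_ hd] := choice hk.
exists (\big[Order.min/1]_k d_ k); first by apply: lt_bigmin => // k _; have [] := hd k.
move=> s /andP[s0 sd]; apply: (@le_lt_trans _ _ (eps / 2)); last by rewrite ltr_pdivrMr// ltr_pMr// ltr1n.
apply: crd_ge; first by rewrite ltW// divr_gt0.
move=> k; rewrite (_ : crd k (perturb s - x0) = crd k x0 * ((expR (ccpol k).[s])%:C - 1)); last first.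
  by case: k => [u|[]] /=; rewrite ?mxE mulrBr mulr1.
rewrite cmodM -(rmorph1 (real_complex R)) -rmorphB cmodC.
have [_ h] := hd k; have := h s; rewrite s0 (lt_le_trans sd (bigmin_le _ _ _)) => /(_ isT) hs.
apply: (@le_trans _ _ ((cmod (crd k x0) + 1) * eta k)).
  by apply: ler_pM; rewrite ?cmod_ge0// lerDl.
by rewrite /eta mulrC mulfVK// gt_eqF.
Qed.

Lemma generic_dense (eps : R) : 0 < eps -> exists x1 : V, [/\ bal x0 eps x1, dom m x1 & generic ra rb ij x1].
Proof.
move=> e0; have [rho [d1 [hr d10 hreg]]] := rho_data rx.
have [|d d0 hd] := @perturb_near (Order.min eps d1); first by rewrite lt_min e0.
(* Identically zero polynomials cannot be avoided and are replaced by 1. A [badpol k] vanishing at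
   the chosen [s] thus vanishes identically, and its coefficients decide. *)
pose Q k := if badpol k == 0 then 1 else badpol k.
have Q0 k : Q k != 0 by rewrite /Q; case: ifP => [_|/negbT//]; exact: oner_neq0.
have [s [sd hs]] := avoid_roots Q0 d0.
have Qz k : (badpol k).[s] = 0 -> badpol k = 0.
  move=> h; apply/eqP/negP => /negP nz; have := hs k.
  by rewrite /Q (negPf nz) => /eqP nn; case: (nn h).
have hb := hd s sd; exists (perturb s).
have b1 : bal x0 eps (perturb s) by apply: bal_le hb; rewrite ge_min lexx.
have [_ _ rs] : [/\ cmod (perturb s).2.1 <= rho, cmod (perturb s).2.2 <= rho & regular (perturb s)].
  by apply: hreg; apply: bal_le hb; rewrite ge_min lexx orbT.
split=> //; first by split=> //; exact: perturb_prod.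
have lin (P P' : {poly R}) : expR P.[s] = expR P'.[s] -> (P - P').[s] = 0.
  by move=> /expR_inj h; rewrite hornerD hornerN h subrr.
split=> //; last exact: lfac_perturb.
- move=> a b a' b' /(congr1 (@cmod R)); rewrite !cmod_mon => /lin h.
  have /Qz : (badpol ((ord0, (e, e)), ((a, b), (a', b')))).[s] = 0 by rewrite /badpol /= addr0.
  rewrite /badpol /= addr0 => E; split; apply/eqP; rewrite -(eqr_nat R) -subr_eq0; apply/eqP.
    (* The coefficient of X sees only the exponents of p, that of X^2 only those of q. *)
    have := congr1 (fun P : {poly R} => P`_1) E.
    by rewrite coefB !coefD !coefMn !coefD !coefC coefX coefXn ?coef0 /= !addr0 !add0r !mul0rn !addr0.
  have := congr1 (fun P : {poly R} => P`_2) E.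
  by rewrite coefB !coefD !coefMn !coefD !coefC coefX coefXn ?coef0 /= !addr0 !add0r !mul0rn !add0r.
- move=> c u c' v /(congr1 (@cmod R)); rewrite /pole cmodM [in RHS]cmodM !cmod_mon !cmod_tmov -!expRD -!hornerD => /lin h.
  have /Qz : (badpol ((inord 1, (u, v)), (c, c'))).[s] = 0.
    by rewrite /badpol /= inordK//= -h; congr (_.[_]); ring.
  rewrite /badpol /= inordK//= => E; apply/eqP/negP => /negP /mcoef_sub[w].
  have := congr1 (fun P : {poly R} => P`_(3 + w)) E.
  by rewrite coefD coefB !coef_lpq coefB !coef_lt coef0 subrr add0r => ->; rewrite eqxx.
- move=> c u v a b /(congr1 (@cmod R)); rewrite /pole cmodM cmodM !cmod_mon !cmod_tmov -!expRD -!hornerD => /lin h.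
  have /Qz : (badpol ((inord 2, (u, v)), (c, (a, b)))).[s] = 0.
    by rewrite /badpol /= inordK//= -h; congr (_.[_]); ring.
  rewrite /badpol /= inordK//= => E; apply/negPn/negP => /mcoef_add[w].
  have := congr1 (fun P : {poly R} => P`_(3 + w)) E.
  by rewrite coefD coefB !coef_lpq coefD !coef_lt coef0 subrr add0r => ->; rewrite eqxx.
Qed.
End Density.

(** * The holomorphic extension *)

Section Extension.
Variable R : realType.
Local Notation C := (CC R).
Variables (m n' N : nat).
Local Notation n := n'.+1.
Hypothesis hN : N = (2 * m + 2 * n + 4)%N.
Local Notation V := ('rV[C]_N * (C * C))%type.
Local Notation X := (@crd R N).
Local Notation hol := (hol X).
Local Notation XD := (@crdD R N).
Local Notation XZ := (@crdZ R N).
Local Notation Xle := (@crd_le R N).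
Local Notation Xge := (@crd_ge R N).
Local Notation dom := (@dom R m N).
Local Notation F := (@Fgen R n N).

Let N6 : (6 <= N)%N. Proof. by rewrite hN; lia. Qed.

Lemma other_index (ra rb : 'I_N) : exists2 e, e != ra & e != rb.
Proof.
have : (0 < #|[set: 'I_N] :\ ra :\ rb|)%N.
  have h1 := cardsD1 ra [set: 'I_N]; have h2 := cardsD1 rb ([set: 'I_N] :\ ra).
  rewrite cardsT card_ord in h1.
  move: h1 h2; move: (ra \in _) (rb \in _) => b1 b2; have := leq_b1 b1; have := leq_b1 b2.
  move: (nat_of_bool b1) (nat_of_bool b2) #|_ :\ rb| #|_ :\ ra| => a1 a2 k2 k1 h2 h1 e1 e2.
  by move: N6; rewrite e1 e2; lia.
by case/card_gt0P => w; rewrite !inE => /and3P[h1 h2 _]; exists w.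
Qed.

Lemma cmod_small (z : C) (B : R) : 0 <= B -> (forall e, 0 < e -> cmod z <= B * e) -> z = 0.
Proof.
move=> B0 h; apply/eqP; rewrite -cmod_eq0; apply/eqP/le_anti; rewrite cmod_ge0 andbT.
apply/ler_addgt0Pr => e e0; rewrite add0r.
have B1 : 0 < B + 1 by rewrite ltr_wpDl.
apply: le_trans (h (e / (B + 1)) _) _; first by rewrite divr_gt0.
by rewrite mulrA ler_pdivrMr// mulrDr mulr1 [B * e]mulrC lerDl ltW.
Qed.

(** Arbitrarily close to [x1] there are points where l F is small while Q is bounded, so G = (l F) Q
    is small there, and G is continuous. *)
Lemma generic_zero (ra rb e : 'I_N) ij (x1 : V) (G Q : V -> C) (d : R) : generic ra rb ij x1 -> dom x1 -> e != ra -> e != rb ->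
  hol x1 G -> hol x1 Q -> 0 < d ->
  (forall y : V, bal x1 d y -> dom y -> pfree y -> F y * (lfac (ij, (ra, rb)) y * Q y) = G y) -> G x1 = 0.
Proof.
move=> gx dx ea eb hG hQ d0 hd.
have hS : cmod (Q x1) < cmod (Q x1) + 1 by rewrite ltrDl.
have [d1 d10 h1] := hol_bound XD XZ Xle hQ hS.
set B := cmod (Q x1) + 1 in h1.
have B0 : 0 <= B by rewrite addr_ge0 ?cmod_ge0.
apply: (@cmod_small _ (1 + B)) => [|eps e0]; first by rewrite addr_ge0.
have [d2 d20 h2] := hol_cont XD XZ Xle hG e0.
have [|y [hy dy fy ly]] := small_near_generic hN gx dx ea eb (eps := Order.min (Order.min eps d) (Order.min d1 d2)).
  by rewrite !lt_min e0 d0 d10.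
have hb x : Order.min (Order.min eps d) (Order.min d1 d2) <= x -> bal x1 x y by move=> h; exact: bal_le hy.
have b1 : bal x1 d1 y by apply: hb; rewrite !ge_min lexx ?orbT.
have b2 : bal x1 d2 y by apply: hb; rewrite !ge_min lexx ?orbT.
have b3 : bal x1 d y by apply: hb; rewrite !ge_min lexx ?orbT.
have le : cmod (lfac (ij, (ra, rb)) y * F y) <= eps by apply: le_trans ly _; rewrite !ge_min lexx.
have hGy : cmod (G y) <= eps * B.
  rewrite -hd// mulrA [F y * _]mulrC cmodM; apply: ler_pM; rewrite ?cmod_ge0//; exact: h1.
have := h2 y b2; rewrite cmodBC => h3.
have h4 : cmod (G x1) <= cmod (G x1 - G y) + cmod (G y) by rewrite -{1}(subrK (G y) (G x1)) cmodD.
by rewrite mulrDl mul1r [B * eps]mulrC; apply: le_trans h4 _; exact: lerD.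
Qed.

(** Generic points are dense in the part of l = 0 inside the domain, and G is continuous. *)
Lemma vanish_on_factor (x0 : V) (G Q : V -> C) (d : R) (e : 'I_N) ij ra rb : hol x0 G -> hol x0 Q -> 0 < d ->
  e != ra -> e != rb ->
  (forall y : V, bal x0 d y -> dom y -> pfree y -> F y * (lfac (ij, (ra, rb)) y * Q y) = G y) ->
  exists2 d' : R, 0 < d' & forall y : V, bal x0 d' y -> dom y -> lfac (ij, (ra, rb)) y = 0 -> G y = 0.
Proof.
move=> hG hQ d0 ea eb hd.
have [d1 d10 h1] := hol_near hG; have [d2 d20 h2] := hol_near hQ.
exists (Order.min d (Order.min d1 d2)); first by rewrite !lt_min d0 d10.
move=> y hy dy ly.
have hy1 : bal x0 d1 y by apply: bal_le hy; rewrite !ge_min lexx ?orbT.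
have [r r0 hr] := bal_in hy.
apply: (@cmod_small _ 1) => // eps e0; rewrite mul1r.
have [d3 d30 h3] := hol_cont XD XZ Xle (h1 y hy1) e0.
have [|x1 [hx dx gx]] := generic_dense N6 ea eb dy ly (eps := Order.min r d3); first by rewrite lt_min r0.
have hx0 : bal x0 (Order.min d (Order.min d1 d2)) x1 by apply: hr; apply: bal_le hx; rewrite ge_min lexx.
have hxd : bal x0 d x1 by apply: bal_le hx0; rewrite ge_min lexx.
have [r' r'0 hr'] := bal_in hxd.
have G0 : G x1 = 0.
  apply: (generic_zero gx dx ea eb _ _ r'0 (Q := Q)).
  - by apply: h1; apply: bal_le hx0; rewrite !ge_min lexx ?orbT.
  - by apply: h2; apply: bal_le hx0; rewrite !ge_min lexx ?orbT.
  - by move=> z hz; apply: hd; exact: hr'.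
have := h3 x1; rewrite G0 sub0r cmodN; apply; apply: bal_le hx; rewrite ge_min lexx orbT//.
Qed.

(** The retraction onto the balancing hypersurface that solves for t_e. The numerator is known to
    vanish on l = 0 only inside the domain; composed with [proj] it vanishes near the point on all
    of l = 0, as the division requires, because e does not occur in l. *)
Definition proj (e : 'I_N) (y : V) : V :=
  (\row_u (if u == e then (y.2.1 * y.2.2) ^+ m.+1 / \prod_(w | w != e) tc y w else tc y u), y.2).

Lemma proj_tc e y u : tc (proj e y) u = if u == e then (y.2.1 * y.2.2) ^+ m.+1 / \prod_(w | w != e) tc y w else tc y u.
Proof. by rewrite /tc mxE. Qed.

Lemma proj_id e y : dom y -> proj e y = y.
Proof.
move=> [[_ _ _ _ t0] hp]; rewrite [RHS]surjective_pairing; congr pair; apply/rowP => u; rewrite mxE.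
case: eqP => // ->; rewrite -hp (bigD1 e)//= mulfK// prodf_seq_neq0; apply/allP => w _; apply/implyP => _; exact: t0.
Qed.

Lemma proj_dom e y : regular y -> dom (proj e y).
Proof.
move=> [p0 q0 p1 q1 t0].
have nz : \prod_(w | w != e) tc y w != 0.
  by rewrite prodf_seq_neq0; apply/allP => w _; apply/implyP => _; exact: t0.
split.
  split=> // u; rewrite proj_tc; case: (u == e) => //.
  by apply: mulf_neq0; [apply/expf_neq0/mulf_neq0|rewrite invr_eq0].
have E : \prod_(w | w != e) tc (proj e y) w = \prod_(w | w != e) tc y w.
  by apply: eq_bigr => u /negPf ue; rewrite proj_tc ue.
by rewrite (bigD1 e)//= E proj_tc eqxx mulfVK.
Qed.

Lemma proj_lfac e ij ra rb y : e != ra -> e != rb -> lfac (ij, (ra, rb)) (proj e y) = lfac (ij, (ra, rb)) y.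
Proof. by move=> ea eb; rewrite /lfac /= !proj_tc ![_ == e]eq_sym (negPf ea) (negPf eb). Qed.

Lemma hol_proj e x0 : regular x0 -> forall i, hol x0 (fun y => X i (proj e y)).
Proof.
move=> [p0 q0 p1 q1 t0] [u|b]; last exact: (hol_X X x0 (inr b)).
have [->|ue] := eqVneq u e; last first.
  suff -> : (fun y => X (inl u) (proj e y)) = X (inl u) by exact: (hol_X X x0 (inl u)).
  by apply/funext => y; rewrite /= mxE (negPf ue).
suff -> : (fun y => X (inl e) (proj e y)) = fun y : V => (y.2.1 * y.2.2) ^+ m.+1 * (\prod_(w | w != e) tc y w)^-1.
  apply: (hol_mul Xle).
    by apply: (hol_exp Xle); apply: (hol_mul Xle); [exact: hol_p|exact: hol_q].
  apply: (hol_inv XD XZ Xle); first by rewrite prodf_seq_neq0; apply/allP => w _; apply/implyP => _; exact: t0.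
  by apply: (hol_prod Xle) => w _; exact: hol_tc.
by apply/funext => y; rewrite /= mxE eqxx.
Qed.

Lemma divide_factor (x0 : V) (G Q : V -> C) (d : R) ij ra rb : dom x0 -> hol x0 G -> hol x0 Q -> 0 < d ->
  (forall y : V, bal x0 d y -> dom y -> pfree y -> F y * (lfac (ij, (ra, rb)) y * Q y) = G y) ->
  exists2 H, hol x0 H & exists2 d' : R, 0 < d' & forall y : V, bal x0 d' y -> dom y -> pfree y -> F y * Q y = H y.
Proof.
move=> dx hG hQ d0 hd; have rx : regular x0 by case: dx.
have [p0 q0 p1 q1 t0] := rx.
have fin (H : V -> C) (d' : R) : 0 < d' -> (forall y : V, bal x0 d' y -> dom y -> pfree y -> H y * lfac (ij, (ra, rb)) y = G y) ->
    exists2 d' : R, 0 < d' & forall y : V, bal x0 d' y -> dom y -> pfree y -> F y * Q y = H y.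
  move=> d'0 h; exists (Order.min d d'); first by rewrite lt_min d0.
  move=> y hy dy fy; have ly := pfreeP (ij, (ra, rb)) fy; apply: (mulIf ly).
  rewrite h//; last by apply: bal_le hy; rewrite ge_min lexx orbT.
  by rewrite -hd//; [ring|apply: bal_le hy; rewrite ge_min lexx].
have [lx|lx] := eqVneq (lfac (ij, (ra, rb)) x0) 0; last first.
  exists (fun y => G y * (lfac (ij, (ra, rb)) y)^-1).
    by apply: (hol_mul Xle) => //; apply: (hol_inv XD XZ Xle) => //; exact: hol_lfac.
  by apply: (fin _ 1) => // y _ _ /(pfreeP (ij, (ra, rb))) ly; rewrite mulfVK.
have [e ea eb] := other_index ra rb.
have [d1 d10 h1] := vanish_on_factor hG hQ d0 ea eb hd.
have hG1 : hol x0 (fun y => G (proj e y)).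
  by apply: (hol_comp XD XZ Xle Xge) => [i|]; [exact: hol_proj|rewrite proj_id].
have [d2 d20 h2] := map_cont XD XZ Xle Xge (hol_proj e rx) d10; rewrite (proj_id e dx) in h2.
have [rho [d3 [_ d30 h3]]] := rho_data rx.
pose pq (y : V) := y.2.1 ^+ ij.1 * y.2.2 ^+ ij.2.
have hpq : hol x0 pq by apply: (hol_mul Xle); apply: (hol_exp Xle); [exact: hol_p|exact: hol_q].
(* Along t_ra, the direction [v], the factor l is linear if ra != rb and quadratic if ra = rb; [a]
   and [b] are its coefficients up to sign. *)
pose a (y : V) := if ra == rb then 2 * (pq y * tc y ra) else pq y * tc y rb.
pose b (y : V) := if ra == rb then pq y else 0.
pose v : V := (\row_u (u == ra)%:R, (0, 0)).
have pq0 : pq x0 != 0 by rewrite mulf_neq0 ?expf_neq0.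
have [||||y z||Hq hHq [d4 d40 h4]] := @divide _ _ _ _ XD XZ Xle x0 (fun y => G (proj e y)) (lfac (ij, (ra, rb))) a b v hG1 _ _ _ lx.
- exact: hol_lfac.
- rewrite /a; case: eqP => _; [apply: (hol_mul Xle); first exact: (hol_cst Xle)|]; apply: (hol_mul Xle) => //; exact: hol_tc.
- by rewrite /b; case: eqP => _ //; exact: (hol_cst Xle).
- rewrite /a; case: (ra == rb); last exact: mulf_neq0.
  by apply: mulf_neq0; [rewrite pnatr_eq0|exact: mulf_neq0].
- have tv u : tc (y + z *: v) u = tc y u + z * (u == ra)%:R by rewrite /tc !mxE.
  have pv : (y + z *: v).2 = y.2 by rewrite /= scaler0 addr0.
  rewrite /lfac pv !tv /= eqxx /a /b /pq [rb == ra]eq_sym; case: eqVneq => [->|_] /=; ring.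
- exists (Order.min d2 d3); first by rewrite lt_min d20.
  move=> y hy ly; apply: h1; last by rewrite proj_lfac.
    by apply: h2; apply: bal_le hy; rewrite ge_min lexx.
  apply: proj_dom; have [] := h3 y; last by [].
  by apply: bal_le hy; rewrite ge_min lexx orbT.
- exists Hq => //; apply: (fin _ d4) => // y hy dy _.
  by rewrite h4// proj_id.
Qed.

Lemma local_extension (x0 : V) : dom x0 -> exists2 H, hol x0 H & exists2 d : R, 0 < d &
  forall y : V, bal x0 d y -> dom y -> pfree y -> F y = H y.
Proof.
move=> dx; have [rx _] := dx; have [G hG [ls [d d0 hd]]] := local_formula n rx.
have : forall y : V, bal x0 d y -> dom y -> pfree y -> F y * \prod_(e <- ls) lfac e y = G y.
  by move=> y /hd[_ h] _; exact: h.
move: G hG d d0 {hd}; elim: ls => [|[ij [ra rb]] ls IH] G hG d d0 hd.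
  by exists G => //; exists d => // y hy dy fy; rewrite -hd// big_nil mulr1.
have hQ : hol x0 (fun y => \prod_(e <- ls) lfac e y) by apply: (hol_prod Xle) => e _; exact: hol_lfac.
have [|H hH [d' d'0 hd']] := divide_factor dx hG hQ d0 (ij := ij) (ra := ra) (rb := rb).
  by move=> y hy dy fy; rewrite -hd// big_cons.
exact: IH hH d' d'0 hd'.
Qed.

(** Where poles coincide with inverse poles some factor l vanishes. A generic point of l = 0 is
    close by, and the path of [small_near_generic] leads from it to points without coincidences. *)
Lemma pfree_dense (x0 : V) (eps : R) : dom x0 -> 0 < eps -> exists y : V, [/\ bal x0 eps y, dom y & pfree y].
Proof.
move=> dx e0; have [fx|] := pselect (pfree x0); first by exists x0; split=> //; exact: bal_id.
move=> /existsNP[c /existsNP[ra /existsNP[rb /negP]]]; rewrite negbK => /eqP h.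
have lx : lfac (c, (ra, rb)) x0 = 0 by rewrite /lfac; move: h; rewrite /pole => ->; rewrite subrr.
have [e ea eb] := other_index ra rb.
have e2 : 0 < eps / 2 by rewrite divr_gt0.
have [x1 [b1 d1 g1]] := generic_dense N6 ea eb dx lx e2.
have [y [b2 d2 f2 _]] := small_near_generic hN g1 d1 ea eb e2.
exists y; split=> //; apply: bal_le (bal_sub b1 b2); lra.
Qed.

Definition ext_at (x : V) (H : V -> C) := hol x H /\ exists2 d : R, 0 < d &
  forall y : V, bal x d y -> dom y -> pfree y -> F y = H y.
(* Well defined because points without coinciding poles are dense in the domain. *)
Definition Fext (x : V) : C := xget 0 [set v | exists2 H, ext_at x H & H x = v].

Lemma ext_at_unique x H H' : dom x -> ext_at x H -> ext_at x H' -> H x = H' x.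
Proof.
move=> dx [hH [d d0 h]] [hH' [d' d'0 h']].
apply/eqP; rewrite -subr_eq0; apply/eqP; apply: (@cmod_small _ 2) => // e e0.
have [d1 d10 h1] := hol_cont XD XZ Xle hH e0; have [d2 d20 h2] := hol_cont XD XZ Xle hH' e0.
have [|y [hy dy fy]] := pfree_dense dx (eps := Order.min (Order.min d d') (Order.min d1 d2)).
  by rewrite !lt_min d0 d'0 d10.
have hb r : Order.min (Order.min d d') (Order.min d1 d2) <= r -> bal x r y by move=> hh; exact: bal_le hy.
have e1 : H y = H' y.
  by rewrite -h// ?h'//; apply: hb; rewrite !ge_min lexx ?orbT.
have c1 : cmod (H y - H x) <= e by apply/h1/hb; rewrite !ge_min lexx ?orbT.
have c2 : cmod (H' y - H' x) <= e by apply/h2/hb; rewrite !ge_min lexx ?orbT.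
rewrite (_ : H x - H' x = (H' y - H' x) - (H y - H x)); last by rewrite e1; ring.
by apply: le_trans (cmodB _ _) _; rewrite mulr_natl mulr2n lerD.
Qed.

Lemma FextE x H : dom x -> ext_at x H -> Fext x = H x.
Proof.
move=> dx hH; have : [set v | exists2 H, ext_at x H & H x = v] (Fext x).
  by apply: xgetPex; exists (H x), H.
by move=> [H' hH' <-]; exact: ext_at_unique.
Qed.

Lemma Fext_local x : dom x -> exists2 H, hol x H & exists2 d : R, 0 < d & forall y : V, bal x d y -> dom y -> Fext y = H y.
Proof.
move=> dx; have [H hH [d d0 h]] := local_extension dx; have [d' d'0 h'] := hol_near hH.
exists H => //; exists (Order.min d d'); first by rewrite lt_min d0.
move=> y hy dy; apply: (FextE dy).
have hy2 : bal x d' y by apply: bal_le hy; rewrite ge_min lexx orbT.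
split; first exact: h'.
have hy1 : bal x d y by apply: bal_le hy; rewrite ge_min lexx.
by have [r r0 hr] := bal_in hy1; exists r => // z hz; apply: h; exact: hr.
Qed.

Lemma Fext_free x : dom x -> pfree x -> Fext x = F x.
Proof.
move=> dx fx; have [H hH [d d0 h]] := local_extension dx.
by rewrite (FextE dx (H := H)) ?h//; [exact: bal_id|split=> //; exists d].
Qed.

End Extension.

Section Main.
Variable R : realType.
Local Notation C := (CC R).

Lemma BC_domain_dom m n x : BC_domain R m n x -> dom m x.
Proof.
move=> [hp /andP[p0 p1] /andP[q0 q1]].
have pn : x.2.1 != 0 by rewrite -normr_gt0.
have qn : x.2.2 != 0 by rewrite -normr_gt0.
split=> //; split=> //.
- by move: p1; rewrite cmodE ltcR.
- by move: q1; rewrite cmodE ltcR.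
move=> u; have : \prod_r x.1 0 r != 0 by rewrite hp expf_neq0// mulf_neq0.
by rewrite (bigD1 u)//= mulf_eq0 negb_or => /andP[].
Qed.

Lemma Fgen_contour m n (t : 'rV[C]_(2 * m + 2 * n + 4)) (p q : C) (g : R -> C) : dom m (t, (p, q)) ->
  admissible_contour t p q g -> pfree (t, (p, q)) /\ Fgen n (t, (p, q)) = BC_prefactor t p q * I_BC n g t p q.
Proof.
move=> [[p0 q0 p1 q1 t0] _] adm; split; first exact: (adm_poles_free t0 adm).
have u0 : 'I_(2 * m + 2 * n + 4) by apply: (@Ordinal _ 0); lia.
by rewrite (contour_formula n p0 q0 p1 q1 t0 adm u0).
Qed.

Lemma holomorphic_ext m n (F : 'rV[C]_(2 * m + 2 * n + 4) * (C * C) -> C) :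
  (forall x, dom m x -> exists2 H, hol (@crd R _) x H & exists2 d : R, 0 < d & forall y, bal x d y -> dom m y -> F y = H y) ->
  (forall x, dom m x -> pfree x -> F x = Fgen n x) ->
  holomorphic_on (BC_domain R m n) F /\
    (forall (t : 'rV[CC R]_(2 * m + 2 * n + 4)) (p q : CC R),
       BC_domain R m n (t, (p, q)) ->
       (forall r, `|t 0 r| < 1) ->
       F (t, (p, q)) = BC_prefactor t p q * I_BC n unit_circle t p q) /\
    (forall (t : 'rV[CC R]_(2 * m + 2 * n + 4)) (p q : CC R) (g : R -> CC R),
       BC_domain R m n (t, (p, q)) ->
       admissible_contour t p q g ->
       F (t, (p, q)) = BC_prefactor t p q * I_BC n g t p q).
Proof.
move=> hF hfree.
have adm_case (t : 'rV[CC R]_(2 * m + 2 * n + 4)) (p q : CC R) (g : R -> CC R) :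
    BC_domain R m n (t, (p, q)) -> admissible_contour t p q g -> F (t, (p, q)) = BC_prefactor t p q * I_BC n g t p q.
  by move=> /BC_domain_dom dx /(Fgen_contour dx)[fx <-]; exact: hfree.
split; last split=> //.
  move=> x /BC_domain_dom dx; have [H hH [d d0 h]] := hF x dx; exists H; split.
    exact: (hol_differentiable (@crdD R _) (@crdZ R _) (@crd_le R _) hH).
  by apply/nearV; exists d => // y hy /BC_domain_dom dy; exact: h.
move=> t p q dx ht; apply: adm_case => //.
have [[p0 q0 p1 q1 t0] _] := BC_domain_dom dx.
apply: unit_admissible => // u; by have := ht u; rewrite cmodE ltcR.
Qed.
End Main.

Theorem theorem10p6 (R : realType) (m n : nat) :
  exists F : 'rV[CC R]_(2 * m + 2 * n + 4) * (CC R * CC R) -> CC R,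
    holomorphic_on (BC_domain R m n) F /\
    (forall (t : 'rV[CC R]_(2 * m + 2 * n + 4)) (p q : CC R),
       BC_domain R m n (t, (p, q)) ->
       (forall r, `|t 0 r| < 1) ->
       F (t, (p, q)) = BC_prefactor t p q * I_BC n unit_circle t p q) /\
    (forall (t : 'rV[CC R]_(2 * m + 2 * n + 4)) (p q : CC R) (g : R -> CC R),
       BC_domain R m n (t, (p, q)) ->
       admissible_contour t p q g ->
       F (t, (p, q)) = BC_prefactor t p q * I_BC n g t p q).
Proof.
(* For n = 0 the determinant is empty and [Fgen] is holomorphic as it stands; for n > 0 there are at
   least six parameters, as the density of generic points requires. *)
case: n => [|n'].
  exists (@Fgen R 0 _); apply: holomorphic_ext => // x [rx _].
  exists (fun y => BC_prefactor y.1 y.2.1 y.2.2 * kappa 0 y.2.1 y.2.2).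
    by apply: (hol_mul (@crd_le R _)); [exact: hol_prefactor|exact: hol_kappa].
  by exists 1 => // y _ _; rewrite /Fgen det_mx00 mulr1.
exists (@Fext R m n' _); apply: holomorphic_ext => x dx.
  exact: (Fext_local erefl dx).
by move=> fx; exact: (Fext_free erefl dx fx).
Qed.
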